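(* Let $\mathfrak g=\mathfrak{gl}(m|n)$ and let $\lambda\in\mathbb P^+$ be a piecewise disconnected weight. Then $$e^{\rho}R\cdot \mathrm{ch}\,L(\lambda)=\frac{(-1)^{|(\lambda^{\rho})^{\Uparrow}-\lambda^{\rho}|_{S_\lambda}}}{t_\lambda}\sum_{w\in W}(-1)^{l(w)}\,w\!\left(\frac{e^{(\lambda^{\rho})^{\Uparrow}}}{\prod_{\beta\in S_\lambda}(1+e^{-\beta})}\right),$$ where $t_\lambda=t_1!\,t_2!\cdots t_N!$ and $S_\lambda$ is the (unique) $\lambda^\rho$-maximal isotropic set of roots.
   Context: Lie superalgebra. $\mathfrak g=\mathfrak{gl}(m|n)$ over $\mathbb C$, with Cartan subalgebra $\mathfrak h$ of diagonal matrices; $\{\varepsilon_1,\dots,\varepsilon_m,\delta_1,\dots,\delta_n\}$ is the basis of $\mathfrak h^*$ dual to $\{E_{1,1},\dots,E_{m+n,m+n}\}$. The bilinear form on $\mathfrak h^*$ is $(\varepsilon_i,\varepsilon_j)=\delta_{ij}$, $(\delta_i,\delta_j)=-\delta_{ij}$ (Kronecker delta on the right), $(\varepsilon_i,\delta_j)=0$. Positive roots (standard choice of simple roots): even $\Delta_{\bar0}^+=\{\varepsilon_i-\varepsilon_j\}_{i<j}\cup\{\delta_k-\delta_l\}_{k<l}$, odd $\Delta_{\bar1}^+=\{\varepsilon_i-\delta_k\}_{1\le i\le m,\,1\le k\le n}$. $\rho=\frac12\sum_{\alpha\in\Delta_{\bar0}^+}\alpha-\frac12\sum_{\alpha\in\Delta_{\bar1}^+}\alpha$,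 and $\lambda^\rho:=\lambda+\rho$. The Weyl group $W=\mathrm{Sym}(m)\times\mathrm{Sym}(n)$ permutes the indices of the $\varepsilon$'s and of the $\delta$'s; $l(w)$ is the length. $L(\lambda)$ is the simple $\mathfrak g$-module of highest weight $\lambda$ with respect to this choice of positive roots. Weights. $\mathbb P^+$ is the set of dominant integral weights $\lambda$ with $(\lambda^\rho,\varepsilon_i),(\lambda^\rho,\delta_j)\in\mathbb Z$ for all $i,j$; equivalently $\lambda^\rho=\sum_{i=1}^m a_i\varepsilon_i-\sum_{j=1}^n b_j\delta_j$ with $a_i,b_j\in\mathbb Z$, $a_1>\dots>a_m$ and $b_1<\dots<b_n$. We call $a_i$ (resp. $b_j$) the $\varepsilon_i$-entry (resp. $\delta_j$-entry). Isotropic set. $S_\lambda=\{\beta_1,\dots,\beta_r\}$ is the set of all $\beta=\varepsilon_p-\delta_q\in\Delta_{\bar1}^+$ with $(\lambda^\rho,\beta)=0$, i.e. $a_p=b_q$; it is the unique maximal set of mutually orthogonal positive odd roots orthogonal to $\lambda^\rho$. If $\varepsilon_p-\delta_q\in S_\lambda$, the $\varepsilon_p$- and $\delta_q$-entries are called atypical; other entries are typical. Weight diagram $D_\lambda$. Over each integer $t$ put $\vee$ if $t\in\{a_i\}\cap\{b_j\}$, $\times$ if $t\in\{a_i\}\setminus\{b_j\}$, $\circ$ if $t\in\{b_j\}\setminus\{a_i\}$, and $\wedge$ if $t\notin\{a_i\}\cup\{b_j\}$. Piecewise disconnected. An atypical component of $D_\lambda$ is a nonempty set of consecutive integer positions that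 contains a $\vee$, contains no $\wedge$, and is maximal with these properties. Enumerate the atypical components from left to right $T_1,\dots,T_N$, let $t_i$ be the number of $\vee$'s in $T_i$, and $t_\lambda=t_1!\cdots t_N!$. Let $s_i$ be the number of $\wedge$'s between $T_i$ and $T_{i+1}$. The weight $\lambda$ is piecewise disconnected if $t_i\le s_i$ for $i=1,\dots,N-1$. $(\lambda^\rho)^{\Uparrow}$ is the element obtained from $\lambda^\rho$ by replacing each atypical entry (the $\varepsilon$-entries and the $\delta$-entries) by the maximal atypical entry in the atypical component to which it belongs. If $\nu=\sum_{\alpha\in S_\lambda}k_\alpha\alpha$, then $|\nu|_{S_\lambda}:=\sum_{\alpha\in S_\lambda}k_\alpha$. Characters. $\mathrm{ch}\,L(\lambda)=\sum_{\mu}\dim L(\lambda)_\mu\,e^\mu$, and $$R=\frac{\prod_{\alpha\in\Delta_{\bar0}^+}(1-e^{-\alpha})}{\prod_{\alpha\in\Delta_{\bar1}^+}(1+e^{-\alpha})}.$$ The identity is in the algebra $\mathbb Q(e^\nu,\ \nu\in\mathfrak h^* )$ of rational functions, on which $W$ acts by $w(e^\nu)=e^{w(\nu)}$ (equivalently, expand each $1/(1+e^{-\beta})$, $\beta\in\Delta_{\bar1}^+$, as a geometric series in $e^{-\beta}$; since $W$ fixes $\Delta_{\bar 1}^+$, expansion commutes with $W$). *)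

(* Defs.v *)
(* The field of complex numbers is R[i] for R : realType. *)
From HB Require Import structures.
From mathcomp Require Import all_boot all_order all_algebra all_fingroup.
From mathcomp Require Import boolp classical_sets functions cardinality fsbigop.
From mathcomp Require Import finmap reals complex.

Set Implicit Arguments.
Unset Strict Implicit.
Unset Printing Implicit Defensive.

Import Order.TTheory GRing.Theory Num.Theory.
Local Open Scope classical_set_scope.
Local Open Scope ring_scope.


(* Weights are written in the basis eps_1, ..., eps_m, del_1, ..., del_n of h^*
   dual to the E_ii: the i-th coordinate of mu is mu(E_ii). *)
Section Weights.
Variables (R : realType) (m n : nat).
Local Notation wt := 'rV[R[i]]_(m + n).

Definition eps (i : 'I_m) : wt := delta_mx 0 (lshift n i).
Definition del (j : 'I_n) : wt := delta_mx 0 (rshift m j).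

Definition form (mu nu : wt) : R[i] :=
  \sum_(i < m) mu 0 (lshift n i) * nu 0 (lshift n i)
  - \sum_(j < n) mu 0 (rshift m j) * nu 0 (rshift m j).

Definition odd_root (p : 'I_m * 'I_n) : wt := eps p.1 - del p.2.

Definition even_pos_roots : seq wt :=
  [seq eps p.1 - eps p.2 | p : 'I_m * 'I_m <- enum {: 'I_m * 'I_m}
     & (p.1 < p.2)%N]
  ++ [seq del p.1 - del p.2 | p : 'I_n * 'I_n <- enum {: 'I_n * 'I_n}
     & (p.1 < p.2)%N].
Definition odd_pos_roots : seq wt := [seq odd_root p | p <- enum {: 'I_m * 'I_n}].

Definition rho : wt :=
  2^-1 *: (\sum_(alpha <- even_pos_roots) alpha)
  - 2^-1 *: (\sum_(alpha <- odd_pos_roots) alpha).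

(* sum_i a_i eps_i - sum_j b_j del_j *)
Definition weight_of (a : 'I_m -> int) (b : 'I_n -> int) : wt :=
  \sum_(i < m) (a i)%:~R *: eps i - \sum_(j < n) (b j)%:~R *: del j.

(* lambda belongs to P^+, and a, b are the entries of lambda + rho *)
Definition dominant_with_entries (lam : wt) (a : 'I_m -> int) (b : 'I_n -> int)
  : Prop :=
  [/\ lam + rho = weight_of a b,
      forall i k : 'I_m, (i < k)%N -> a k < a i
    & forall j l : 'I_n, (j < l)%N -> b j < b l].

(* S_lambda; the pair (p, q) stands for the root eps_p - del_q *)
Definition isotropic_set (lam : wt) : {set 'I_m * 'I_n} :=
  [set p | form (lam + rho) (odd_root p) == 0].

(* |nu|_S for nu in the integral span of the (linearly independent) roots of S *)
Definition S_norm (S : {set 'I_m * 'I_n}) (nu : wt) : int :=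
  \sum_(p in S) xget ([ffun=> 0] : {ffun 'I_m * 'I_n -> int})
    [set k : {ffun 'I_m * 'I_n -> int} |
       nu = \sum_(q in S) (k q)%:~R *: odd_root q] p.

End Weights.

Section WeightDiagram.
Variables (m n : nat) (a : 'I_m -> int) (b : 'I_n -> int).

Definition is_vee (t : int) : bool :=
  [exists i, a i == t] && [exists j, b j == t].
Definition is_wedge (t : int) : bool :=
  ~~ [exists i, a i == t] && ~~ [exists j, b j == t].

Definition consecutive (T : set int) : Prop :=
  forall x y z : int, T x -> T z -> x <= y <= z -> T y.

Definition vee_block (T : set int) : Prop :=
  [/\ consecutive T, (exists2 t, T t & is_vee t)
    & forall t, T t -> ~~ is_wedge t].

Definition atypical_component (T : set int) : Prop :=
  vee_block T /\ forall T', vee_block T' -> T `<=` T' -> T' = T.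

Definition left_of (T T' : set int) : Prop :=
  forall x y : int, T x -> T' y -> x < y.

(* T = [:: T_1; ...; T_N], the atypical components listed from left to right *)
Definition components_enumeration (T : seq (set int)) : Prop :=
  (forall A, atypical_component A <->
     exists2 i, (i < size T)%N & nth set0 T i = A)
  /\ (forall i j, (i < j)%N -> (j < size T)%N ->
     left_of (nth set0 T i) (nth set0 T j)).

Definition num_vees (A : set int) : nat :=
  #|` fset_set [set t | A t /\ is_vee t] |.

Definition num_wedges_between (A B : set int) : nat :=
  #|` fset_set [set t | [/\ is_wedge t, forall x, A x -> x < t
                        & forall y, B y -> t < y]] |.

Definition piecewise_disconnected (T : seq (set int)) : Prop :=
  forall i, (i.+1 < size T)%N ->
  (num_vees (nth set0 T i)
     <= num_wedges_between (nth set0 T i) (nth set0 T i.+1))%N.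

Definition t_factorial (T : seq (set int)) : nat :=
  (\prod_(A <- T) (num_vees A)`!)%N.

Definition same_component (s t : int) : Prop :=
  exists A, [/\ atypical_component A, A s & A t].

(* For an atypical entry t, the maximal atypical entry of its component: every
   atypical entry occurs among the a_i, so it suffices to let i range there. *)
Definition max_atypical (t : int) : int :=
  \big[Num.max/t]_(i < m | is_vee (a i) && `[< same_component t (a i) >]) a i.

End WeightDiagram.

Section Uparrow.
Variables (R : realType) (m n : nat) (lam : 'rV[R[i]]_(m + n)).
Variables (a : 'I_m -> int) (b : 'I_n -> int).

Definition uparrow : 'rV[R[i]]_(m + n) :=
  weight_of R
    (fun p => if [exists q, (p, q) \in isotropic_set lam]
              then max_atypical a b (a p) else a p)
    (fun q => if [exists p, (p, q) \in isotropic_set lam]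
              then max_atypical a b (b q) else b q).

End Uparrow.

Section WeylGroup.
Variables (m n : nat).
Local Notation W := ('S_m * 'S_n)%type.

Definition simple_reflection : pred W := fun s =>
  [exists i : 'I_m, exists k : 'I_m, (k == i.+1 :> nat) && (s == (tperm i k, 1%g))]
  || [exists j : 'I_n, exists l : 'I_n, (l == j.+1 :> nat) && (s == (1%g, tperm j l))].

(* Length of a shortest expression of w as a product of simple reflections;
   that length is less than #|W|, which bounds the search. *)
Definition weyl_length (w : W) : nat :=
  find (fun k => [exists s : k.-tuple W,
                    all simple_reflection s && ((\prod_(x <- s) x)%g == w)])
       (iota 0 #|{: W}|).

Definition weyl_act (R : realType) (w : W) (mu : 'rV[R[i]]_(m + n)) :
  'rV[R[i]]_(m + n) :=
  \sum_(i < m) mu 0 (lshift n i) *: eps R n (w.1 i)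
  + \sum_(j < n) mu 0 (rshift m j) *: del R m (w.2 j).

End WeylGroup.

(* Formal series sum_mu f(mu) e^mu, mu in h^*, with rational coefficients.  The
   series multiplied below are supported in finite unions of cones
   nu - (nonnegative integral span of the positive roots), so that the
   finitely supported sums in [conv] and [inv_one_plus] are genuine ones. *)
Section FormalSeries.
Variables (R : realType) (m n : nat).
Local Notation wt := 'rV[R[i]]_(m + n).

Definition series : Type := wt -> rat.

Definition fexp (nu : wt) : series := fun mu => (mu == nu)%:R.

Definition conv (f g : series) : series :=
  fun mu => \sum_(nu \in [set: wt]) f nu * g (mu - nu).

(* 1 / (1 + e^-beta) = sum_k (-1)^k e^(- k beta) *)
Definition inv_one_plus (beta : wt) : series :=
  fun mu => \sum_(k \in [set: nat]) (-1) ^+ k * fexp (- (beta *+ k)) mu.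

(* w(e^nu) = e^(w nu) *)
Definition weyl_act_series (w : 'S_m * 'S_n) (f : series) : series :=
  fun mu => f (weyl_act w^-1%g mu).

Definition superdenominator : series :=
  conv
    (\big[conv/fexp 0]_(alpha <- even_pos_roots R m n)
       (fun mu => fexp 0 mu - fexp (- alpha) mu))
    (\big[conv/fexp 0]_(beta <- odd_pos_roots R m n) inv_one_plus beta).

End FormalSeries.

Arguments superdenominator R m n : clear implicits.

Section Modules.
Variables (R : realType) (m n : nat) (V : lmodType R[i]).
Local Notation C := R[i].
Local Notation gl := 'M[C]_(m + n).

Definition index_parity (i : 'I_(m + n)) : bool := (m <= i)%N.

Definition gl_homogeneous (p : bool) (X : gl) : Prop :=
  forall i j, X i j != 0 -> index_parity i (+) index_parity j = p.

(* Superbracket of X of parity p and Y of parity q *)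
Definition gl_bracket (p q : bool) (X Y : gl) : gl :=
  X *m Y - (-1) ^+ (p && q) *: (Y *m X).

Definition subspace (U : set V) : Prop :=
  U 0 /\ forall (c : C) u v, U u -> U v -> U (c *: u + v).

(* Vp false and Vp true are the even and odd parts of V *)
Record is_supermodule (Vp : bool -> set V) (act : gl -> V -> V) : Prop := {
  sm_part_subspace : forall p, subspace (Vp p);
  sm_part_span : forall v, exists u0 u1,
    [/\ Vp false u0, Vp true u1 & v = u0 + u1];
  sm_part_disjoint : forall v, Vp false v -> Vp true v -> v = 0;
  sm_act_linear_l : forall c X Y v, act (c *: X + Y) v = c *: act X v + act Y v;
  sm_act_linear_r : forall X c u v, act X (c *: u + v) = c *: act X u + act X v;
  sm_act_parity : forall p q X v,
    gl_homogeneous p X -> Vp q v -> Vp (p (+) q) (act X v);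
  sm_act_bracket : forall p q X Y v, gl_homogeneous p X -> gl_homogeneous q Y ->
    act (gl_bracket p q X Y) v
      = act X (act Y v) - (-1) ^+ (p && q) *: act Y (act X v)
}.

Definition is_subsupermodule (Vp : bool -> set V) (act : gl -> V -> V)
    (U : set V) : Prop :=
  [/\ subspace U,
      forall X u, U u -> U (act X u)
    & forall u0 u1, Vp false u0 -> Vp true u1 -> U (u0 + u1) -> U u0 /\ U u1].

Definition is_simple (Vp : bool -> set V) (act : gl -> V -> V) : Prop :=
  (exists v : V, v != 0)
  /\ forall U, is_subsupermodule Vp act U -> U = [set 0] \/ U = [set: V].

Definition weight_space (act : gl -> V -> V) (mu : 'rV[C]_(m + n)) : set V :=
  [set v | forall i, act (delta_mx i i) v = mu 0 i *: v].

(* The root vectors of the positive roots are the E_ij with i < j. *)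
Definition has_highest_weight (Vp : bool -> set V) (act : gl -> V -> V)
    (lam : 'rV[C]_(m + n)) : Prop :=
  exists v : V, [/\ v != 0, (exists p, Vp p v), weight_space act lam v
    & forall i j : 'I_(m + n), (i < j)%N -> act (delta_mx i j) v = 0].

(* V, with this grading and action, is L(lambda) (up to parity change) *)
Definition is_L (Vp : bool -> set V) (act : gl -> V -> V)
    (lam : 'rV[C]_(m + n)) : Prop :=
  [/\ is_supermodule Vp act, is_simple Vp act & has_highest_weight Vp act lam].

Definition is_basis (U : set V) (d : nat) (e : 'I_d -> V) : Prop :=
  forall v, U v <-> exists! c : 'rV[C]_d, v = \sum_(i < d) c 0 i *: e i.

(* Dimension of a finite-dimensional subspace (the weight spaces of a highest
   weight module are finite-dimensional) *)
Definition dimension (U : set V) : nat :=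
  xget 0%N [set d | exists e : 'I_d -> V, is_basis U e].

Definition character (act : gl -> V -> V) : series R m n :=
  fun mu => (dimension (weight_space act mu))%:R.

End Modules.

(* Submission.v *)
(* The statement is proved without Kazhdan-Lusztig theory, by translation functors.  Write weights shifted by rho, and let
   D_z = e^rho R ch L(z).  Since e^rho R intertwines the radial part of the Casimir element with the quadratic form
   Q(y) = sum_k (-1)^(par k) y_k^2, the series D_z lives on the quadric Q = Q(z); tensoring with the standard module and
   projecting to a generalized Casimir eigenspace therefore acts on D_z by moving one entry of the weight diagram by one
   step, and the result is again some D_z' as soon as only one dominant weight can occur.  Moving all entries far apart
   shows that D_z is supported on weights with the same typical entries (linkage).

   The right hand side X_z is an alternating sum of an explicit template and obeys the same translation rules: a typical
   entry moves past its neighbours, and a vee next to a wedge is split into a cross and a circle, which lowers the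
   atypicality.  Comparing X_z with D_z at a weight of their difference with maximal sum of epsilon-entries, and
   splitting its rightmost vee, the equality X_z = D_z follows by induction on the number of vees.  Piecewise
   disconnectedness is what keeps the factor 1/t_lambda consistent under the splitting.  W-antisymmetry of D_z comes from sl_2 theory, and finite
   dimensionality of L(z) from bounding its weights with it. *)
From HB Require Import structures.
Require Import Defs.
From mathcomp Require Import all_boot all_order all_algebra all_fingroup.
From mathcomp Require Import boolp classical_sets functions mxtens.
From mathcomp Require Import zify ring lra.
Set Implicit Arguments.
Unset Strict Implicit.
Unset Printing Implicit Defensive.
Import Order.TTheory GRing.Theory Num.Theory.
Local Open Scope ring_scope.

(** Adding [eps k] to a shifted weight changes the quadratic form by an odd number that records the
    diagram position of entry [k]; prescribing the Casimir eigenvalue of a tensor summand thus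
    prescribes the position at which an entry moves. The quadric does not separate the sets of
    typical entries, which is why linkage is a step of its own. A translated module is an idempotent
    matrix [Pi] commuting with the action on a tensor product, so its character is a trace, and
    [hwm] records simplicity in a form that survives such a cut: [v] generates, and every singular
    weight vector is a multiple of [v]. That a projection is nonzero is read off a nonzero
    coefficient of the translated series. That it is zero usually follows because no dominant weight
    is available; the exception is a vee immediately to the right of a wedge, where a singular
    vector has to be constructed. In the basis dual to the [E_ii] the shifted weight has coordinates
    [a_i] and [- b_j]; [xc] removes the sign, so that entries of both kinds live on one integer
    line. *)

(* A reflexive decision procedure for equalities in abelian groups; [ring]
   does not apply to the noncommutative rings below. *)
Inductive zexp := ZVar of nat | ZAdd of zexp & zexp | ZOpp of zexp | ZZero.

Fixpoint zeval (V : zmodType) (env : seq V) (e : zexp) : V :=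
  match e with
  | ZVar i => env`_i
  | ZAdd a b => zeval env a + zeval env b
  | ZOpp a => - zeval env a
  | ZZero => 0
  end.

Fixpoint zcoef (e : zexp) (i : nat) : int :=
  match e with
  | ZVar j => (i == j)%:R
  | ZAdd a b => zcoef a i + zcoef b i
  | ZOpp a => - zcoef a i
  | ZZero => 0
  end.

Lemma zevalE (V : zmodType) (env : seq V) e :
  zeval env e = \sum_(i < size env) env`_i *~ zcoef e i.
Proof.
elim: e => [j|a ha b hb|a ha|] /=.
- have [lt|le] := ltnP j (size env).
    rewrite (bigD1 (Ordinal lt)) //= eqxx mulr1z big1 ?addr0 // => i hi.
    by rewrite (_ : (i == j :> nat) = false) ?mulr0z //; apply/negbTE.
  rewrite nth_default // big1 // => i _.
  by rewrite ltn_eqF ?mulr0z // (leq_trans (ltn_ord i) le).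
- by rewrite ha hb -big_split; apply: eq_bigr => i _; rewrite mulrzDr.
- by rewrite ha -sumrN; apply: eq_bigr => i _; rewrite mulrNz.
- by rewrite big1.
Qed.

Lemma zeval_eq (V : zmodType) (env : seq V) e1 e2 :
  all (fun i => zcoef e1 i == zcoef e2 i) (iota 0 (size env)) ->
  zeval env e1 = zeval env e2.
Proof.
move=> /allP h; rewrite !zevalE; apply: eq_bigr => i _; congr (_ *~ _).
by apply/eqP/h; rewrite mem_iota add0n ltn_ord.
Qed.

Ltac zsame x y := match goal with _ => let _ := match goal with _ => unify x y end in constr:(true) | _ => constr:(false) end.
Ltac zmem x l := lazymatch l with
  | nil => constr:(false)
  | cons ?y ?t => let b := zsame x y in
      lazymatch b with true => constr:(true) | false => zmem x t end end.
Ltac zadd x l := lazymatch zmem x l with true => l | false => constr:(cons x l) end.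
Ltac zvars l t := lazymatch t with
  | ?a + ?b => let l1 := zvars l a in zvars l1 b
  | - ?a => zvars l a
  | 0 => l
  | ?a => zadd a l end.
Ltac zidx x l := lazymatch l with
  | cons ?y ?t => let b := zsame x y in
      lazymatch b with true => constr:(O) | false => let n := zidx x t in constr:(S n) end end.
Ltac zreify l t := lazymatch t with
  | ?a + ?b => let x := zreify l a in let y := zreify l b in constr:(ZAdd x y)
  | - ?a => let x := zreify l a in constr:(ZOpp x)
  | 0 => constr:(ZZero)
  | ?a => let i := zidx a l in constr:(ZVar i) end.
Ltac abel := lazymatch goal with
  |- @eq ?T ?x ?y =>
   let l0 := zvars (@nil T) x in let l := zvars l0 y in
   let a := zreify l x in let b := zreify l y in
   change (zeval l a = zeval l b); apply: zeval_eq; vm_compute; reflexivity end.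

(** * The radial part of the Casimir element *)

Section RadialPart.
Variables (E : pzRingType) (N : nat) (par : 'I_N -> bool).
(** Read [z i] as multiplication by the [i]-th coordinate on series, [S i j] as multiplication by
    the exponential of minus the root [eps i - eps j], [n] as a denominator factor, [I] as its
    inverse and [G] as the geometric series [S I]. The section is a computation from these
    commutation rules. *)
Variables (z : 'I_N -> E) (S I n G : 'I_N -> 'I_N -> E).
Let sg (i : 'I_N) : E := (-1) ^+ par i.
Let s i j : E := (-1) ^+ (par i (+) par j).
Let d (i j : 'I_N) : E := (i == j)%:R.
Hypothesis nE : forall i j, n i j = 1 - s i j * S i j.
Hypothesis GE : forall i j, G i j = S i j * I i j.
Hypothesis SS : forall i j k l, S i j * S k l = S k l * S i j.
Hypothesis Sm : forall i j k, S i k * S k j = S i j.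
Hypothesis nI : forall i j : 'I_N, (i < j)%N -> n i j * I i j = 1.
Hypothesis In : forall i j : 'I_N, (i < j)%N -> I i j * n i j = 1.
Hypothesis zS : forall i j k, z i * S j k = S j k * (z i - (d i j - d i k)).

Let sgC b (x : E) : (-1) ^+ b * x = x * (-1) ^+ b.
Proof. exact: commr_sym (commr_sign _ _). Qed.

Let sC i j (x : E) : s i j * x = x * s i j. Proof. exact: sgC. Qed.

Let nC i j k l : n i j * S k l = S k l * n i j.
Proof. by rewrite nE mulrBl mulrBr mul1r mulr1 -mulrA SS mulrA sC -!mulrA sC. Qed.

Let IC (x : E) (i j : 'I_N) : (i < j)%N -> n i j * x = x * n i j ->
  I i j * x = x * I i j.
Proof.
move=> ij h; rewrite -[LHS]mulr1 -(nI ij) mulrA -(mulrA (I i j)) -h.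
by rewrite mulrA In // mul1r.
Qed.

Let IS (i j : 'I_N) k l : (i < j)%N -> I i j * S k l = S k l * I i j.
Proof. by move=> ij; apply: IC => //; apply: nC. Qed.

Let nn i j k l : n i j * n k l = n k l * n i j.
Proof.
rewrite (nE k l) mulrBr mulrBl mul1r mulr1; congr (_ - _).
by rewrite mulrA -sC -mulrA nC mulrA.
Qed.

Let nIC i j (k l : 'I_N) : (k < l)%N -> n i j * I k l = I k l * n i j.
Proof. by move=> kl; apply/esym/IC => //; apply: nn. Qed.

Let II (i j k l : 'I_N) : (i < j)%N -> (k < l)%N -> I i j * I k l = I k l * I i j.
Proof. by move=> ij kl; apply: IC => //; apply: nIC. Qed.

Let GI (i j k l : 'I_N) : (i < j)%N -> (k < l)%N -> G i j * I k l = I k l * G i j.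
Proof. by move=> ij kl; rewrite GE -mulrA II // mulrA -IS // -mulrA. Qed.

Let nG (k l i j : 'I_N) : (i < j)%N -> n k l * G i j = G i j * n k l.
Proof. by move=> ij; rewrite GE mulrA nC -!mulrA nIC. Qed.

Let GG (i j k l : 'I_N) : (i < j)%N -> (k < l)%N -> G i j * G k l = G k l * G i j.
Proof.
move=> ij kl; rewrite (GE k l) mulrA.
by rewrite {1}GE -(mulrA (S i j)) IS // mulrA SS -(mulrA (S k l)) -GE -!mulrA GI.
Qed.

Let Ge (i j : 'I_N) : (i < j)%N -> I i j = 1 + s i j * G i j.
Proof. by move=> ij; rewrite -(nI ij) nE GE mulrBl mul1r mulrA subrK. Qed.

Let ss i j k : s i k * s k j = s i j.
Proof. by rewrite -signr_addb addbA -(addbA (par i)) addbb addbF. Qed.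

(** The addition formula of the cotangent in disguise: multiplying both sides by the invertible
    factors [n i k] and [n k j] leaves [S i j] on each. This relation makes the potential of the
    radial part collapse. *)
Lemma radial_triple (i k j : 'I_N) : (i < k)%N -> (k < j)%N ->
  G i k * G k j = G i j * (1 + s i k * G i k + s k j * G k j).
Proof.
move=> ik kj; have ij := ltn_trans ik kj.
rewrite -Ge //.
have -> : I i k + s k j * G k j = I i k + I k j - 1 by rewrite (Ge kj); abel.
have inj : injective (fun x => n i k * (n k j * x)).
  move=> x y /(congr1 (fun u => I k j * (I i k * u))).
  by rewrite 2!(mulrA (I i k)) !In // !mul1r !mulrA !In // !mul1r.
apply: inj.
have -> : n i k * (n k j * (G i k * G k j)) = S i j.
  have -> : G i k * G k j = S i j * (I i k * I k j).
    by rewrite !GE -mulrA (mulrA (I i k)) IS // -mulrA mulrA Sm.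
  rewrite (mulrA (n k j)) nC -mulrA (mulrA (n k j)) nIC // -mulrA nI // mulr1.
  by rewrite mulrA nC -mulrA nI // mulr1.
have -> : n i k * (n k j * (G i j * (I i k + I k j - 1))) =
          G i j * (n k j + n i k - n i k * n k j).
  rewrite (mulrA (n k j)) nG // -(mulrA (G i j)) mulrA nG // -(mulrA (G i j)).
  congr (_ * _); rewrite (mulrBr (n k j)) (mulrBr (n i k)) !(mulrDr (n k j)).
  rewrite !(mulrDr (n i k)) mulr1 nI // mulr1 nIC // (mulrA (n i k)) nI //.
  by rewrite mul1r.
have -> : n k j + n i k - n i k * n k j = n i j.
  have -> : n i k * n k j = n k j - s i k * S i k + s i j * S i j.
    rewrite {1}nE (mulrBl (n k j)) mul1r -addrA; congr (_ + _).
    rewrite nE mulrBr mulr1 opprB addrC; congr (_ + _).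
    by rewrite -mulrA (mulrA (S i k)) -sC -!mulrA Sm mulrA ss.
  by rewrite (nE i j) (nE i k); abel.
by rewrite GE -mulrA In // mulr1.
Qed.

(** Multiply the commutation rule of [z i] with [n j k] by [I j k] on both sides. *)
Let zI (i j k : 'I_N) : (j < k)%N ->
  z i * I j k = I j k * (z i - s j k * (d i j - d i k) * G j k).
Proof.
move=> jk.
set e := d i j - d i k.
have eC x : e * x = x * e.
  by rewrite /e mulrBl mulrBr /d !mulr_natl !mulr_natr.
have zn : z i * n j k = n j k * z i + s j k * e * S j k.
  rewrite nE (mulrBr (z i)) (mulrBl (z i)) mulr1 mul1r (mulrA (z i)) -sC -(mulrA _ (z i)) zS.
  rewrite (mulrBr (S j k)) (mulrBr (s j k)) -/e -(eC (S j k)) !mulrA; abel.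
have {zn} /(congr1 (fun x => I j k * x * I j k)) := zn.
rewrite -[LHS]mulrA -(mulrA (z i)) nI // mulr1 (mulrDr (I j k)) (mulrA (I j k) (n j k)).
rewrite In // mul1r (mulrDl _ _ (I j k)) => h; have {h} -> := canRL (addrK _) (esym h).
rewrite (mulrBr (I j k)); congr (_ - _); rewrite GE !mulrA; congr (_ * _ * _).
Qed.

Let zG (i j k : 'I_N) : (j < k)%N ->
  z i * G j k = G j k * z i - (d i j - d i k) * (G j k * (1 + s j k * G j k)).
Proof.
move=> jk; set e := d i j - d i k.
have eC x : e * x = x * e.
  by rewrite /e mulrBl mulrBr /d !mulr_natl !mulr_natr.
have -> : z i * G j k = S j k * (z i * I j k) - S j k * (e * I j k).
  by rewrite GE mulrA zS -/e -mulrA mulrBl mulrBr.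
rewrite zI // -/e (mulrA (S j k)) -GE (mulrBr (G j k)) -addrA; congr (_ + _).
rewrite -opprD; congr (- _); rewrite (eC (G j k * _)) (mulrDr (G j k)) mulr1.
rewrite (mulrDl (G j k)) addrC (eC (I j k)) (mulrA (S j k)) -GE; congr (_ + _).
by rewrite -!mulrA; congr (_ * (_ * _)).
Qed.

(** [phi i] is the logarithmic derivative, in direction [i], of the product of the factors of all
    positive roots. A factor sees [i] and [j] with opposite signs, hence the antisymmetry of [H]. *)
Let H (i j : 'I_N) := if (i < j)%N then G i j else if (j < i)%N then - G j i else 0.
Let phi i := \sum_j H i j.
(** This is twice the form of rho with the root [eps i - eps j], after telescoping. *)
Let e (i j : 'I_N) := sg i + sg j + (\sum_(k < N | (i < k < j)%N) sg k) *+ 2.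

Let HC i j k l : H i j * H k l = H k l * H i j.
Proof.
rewrite /H; case: ltnP => ?; case: ltnP => ?; try case: ltnP => ?; try case: ltnP => ?;
by rewrite ?mulNr ?mulrN ?(mulr0, mul0r) // ?mulNr ?mulrN GG.
Qed.

Let zH i j : z i * H i j = H i j * z i -
  (if (i < j)%N then G i j * (1 + s i j * G i j)
   else if (j < i)%N then G j i * (1 + s i j * G j i) else 0).
Proof.
have d1 : d i i = 1 by rewrite /d eqxx.
rewrite /H; case: ltnP => ij.
  by rewrite zG // d1 /d -val_eqE /= (ltn_eqF ij) subr0 mul1r.
case: ltnP => ji; last by rewrite mulr0 mul0r subr0.
rewrite mulrN zG // d1 /d -val_eqE /= (gtn_eqF ji) sub0r mulN1r !opprK mulNr.
by rewrite opprD /s addbC.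
Qed.

Let phi2 i : phi i * phi i =
  \sum_j H i j * H i j + (\sum_(j < N) \sum_(k < N | (j < k)%N) H i j * H i k) *+ 2.
Proof.
rewrite /phi mulr_suml.
under eq_bigr => j _ do rewrite mulr_sumr (bigD1 j) //=.
rewrite big_split /=; congr (_ + _).
have -> : \sum_i0 \sum_(i1 | i1 != i0) H i i0 * H i i1 =
  \sum_(j < N) \sum_(k < N | (j < k)%N) H i j * H i k + \sum_(j < N) \sum_(k < N | (k < j)%N) H i j * H i k.
  rewrite -big_split /=; apply: eq_bigr => j _.
  rewrite (bigID (fun k : 'I_N => (j < k)%N)) /=; congr (_ + _); apply: eq_bigl => k.
    by rewrite -val_eqE /=; case: ltngtP.
  by rewrite -val_eqE /=; case: ltngtP.
rewrite mulr2n; congr (_ + _).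
rewrite (exchange_big_dep xpredT) //=; apply: eq_bigr => k _; apply: eq_bigr => j _.
exact: HC.
Qed.

(** The potential is of first order in [G]: squares cancel against the derivative terms, and
    products over three distinct indices collapse by [radial_triple]. *)
Lemma radial_scalar :
  \sum_i sg i * (phi i * phi i + (z i * phi i - phi i * z i)) =
  - \sum_(i < N) \sum_(j < N | (i < j)%N) e i j * G i j.
Proof.
pose P i j := G i j * (1 + s i j * G i j).
have -> : \sum_i sg i * (phi i * phi i + (z i * phi i - phi i * z i)) =
  \sum_(i < N) \sum_(j < N | (i < j)%N) (sg i + sg j) * (G i j * G i j - P i j) +
  (\sum_i \sum_(j < N) \sum_(k < N | (j < k)%N) sg i * (H i j * H i k)) *+ 2.
  have -> : \sum_i sg i * (phi i * phi i + (z i * phi i - phi i * z i)) =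
    \sum_(i < N) \sum_(j < N) sg i * (H i j * H i j -
      (if (i < j)%N then P i j else if (j < i)%N then P j i else 0)) +
    (\sum_i \sum_(j < N) \sum_(k < N | (j < k)%N) sg i * (H i j * H i k)) *+ 2.
    rewrite -sumrMnl -big_split /=; apply: eq_bigr => i _.
    have -> : z i * phi i - phi i * z i =
      - \sum_(j < N) (if (i < j)%N then P i j else if (j < i)%N then P j i else 0).
      rewrite /phi mulr_sumr mulr_suml -sumrB -sumrN; apply: eq_bigr => j _.
      rewrite zH addrAC addrN add0r. congr (- _); case: ifP => // _; case: ifP => // _; by rewrite /P /s addbC.
    rewrite phi2 addrAC mulrDr; congr (_ + _); first by rewrite -sumrB mulr_sumr.
    rewrite mulrnAr mulr_sumr; congr (_ *+ 2); apply: eq_bigr => j _.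
    by rewrite mulr_sumr.
  congr (_ + _).
  under eq_bigr => i _ do rewrite (bigID (fun j : 'I_N => (i < j)%N)) /=.
  rewrite big_split /= addrC.
  have -> : \sum_(i < N) \sum_(j < N | ~~ (i < j)%N) sg i * (H i j * H i j -
      (if (i < j)%N then P i j else if (j < i)%N then P j i else 0)) =
    \sum_(i < N) \sum_(j < N | (i < j)%N) sg j * (G i j * G i j - P i j).
    rewrite [RHS](exchange_big_dep xpredT) //=; apply: eq_bigr => i _.
    rewrite (bigD1 i) ?ltnn //= /H ltnn mulr0 subr0 mulr0 add0r.
    apply: eq_big => j; first by rewrite -leqNgt -val_eqE ltn_neqAle andbC.
    rewrite -leqNgt -val_eqE /= => /andP[h1 h2].
    have ji : (j < i)%N by rewrite ltn_neqAle h2.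
    by rewrite ltnNge h1 /= ji mulrNN.
  rewrite -big_split; apply: eq_bigr => i _; rewrite -big_split; apply: eq_bigr => j ij.
  by rewrite /= /H ij mulrDl addrC.
(* For opposite parities [sg i + sg j] vanishes, and for equal parities [s i j] is 1, so the squares
   cancel in both cases. *)
have sPG (i j : 'I_N) : (i < j)%N ->
  (sg i + sg j) * (G i j * G i j - P i j) = - ((sg i + sg j) * G i j).
  move=> ij; rewrite /P (mulrDr (G i j)) mulr1 mulrBr mulrDr.
  have -> : (sg i + sg j) * (G i j * G i j) = (sg i + sg j) * (G i j * (s i j * G i j)).
    rewrite /sg /s; case: (par i) (par j) => [] [] /=;
      by rewrite ?expr0 ?expr1 ?mul1r ?addNr ?addrN ?mul0r.
  by abel.
pose T (i j k : 'I_N) := sg i * (H i j * H i k).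
have -> : \sum_i \sum_(j < N) \sum_(k < N | (j < k)%N) sg i * (H i j * H i k) =
  - \sum_(i < N) \sum_(j < N | (i < j)%N) \sum_(k : 'I_N | (i < k < j)%N) sg k * G i j.
  have -> : \sum_i \sum_(j < N) \sum_(k < N | (j < k)%N) T i j k =
    \sum_(i < N) \sum_(j < N | (i < j)%N) \sum_(k : 'I_N | (i < k < j)%N) (T i k j + T k i j + T j i k).
    (* Sort the triples by the place of the distinguished index relative to [j < k], then rename so
       that the outer indices are always [i < j] with [k] between them. *)
    pose U (i j k : 'I_N) := T i j k *+ (i < j < k)%N + T i j k *+ (j < i < k)%N + T i j k *+ (j < k < i)%N.
    have -> : \sum_i \sum_(j < N) \sum_(k < N | (j < k)%N) T i j k = \sum_(i < N) \sum_(j < N) \sum_k U i j k.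
      apply: eq_bigr => i _; apply: eq_bigr => j _; rewrite big_mkcond; apply: eq_bigr => k _.
      rewrite /U /T /H; case: (ltngtP j k) => jk; last 2 first.
      + have -> : (j < i < k)%N = false by lia.
        by rewrite !andbF !mulr0n !addr0.
      + have -> : (j < i < k)%N = false by lia.
        by rewrite !andbF !mulr0n !addr0.
      rewrite !andbT; case: (ltngtP i j) => ij.
      + by rewrite (ltn_trans ij jk) (leq_gtF (ltnW (ltn_trans ij jk))) mulr1n !mulr0n !addr0.
      + by case: (ltngtP i k) => ik; rewrite ?mulr0n ?addr0 ?add0r // !mulr0.
      + by rewrite ij jk (leq_gtF (ltnW jk)) mul0r mulr0 !mulr0n !addr0.
    have -> : \sum_(i < N) \sum_(j < N) \sum_k U i j k = \sum_(i < N) \sum_(j < N) \sum_k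
       (T i k j + T k i j + T j i k) *+ (i < k < j)%N.
      rewrite /U.
      under eq_bigr => i _ do under eq_bigr => j _ do rewrite !big_split.
      under eq_bigr => i _ do rewrite !big_split.
      rewrite !big_split /=.
      under [RHS]eq_bigr => i _ do under eq_bigr => j _ do under eq_bigr => k _ do rewrite !mulrnDl.
      under [RHS]eq_bigr => i _ do under eq_bigr => j _ do rewrite !big_split.
      under [RHS]eq_bigr => i _ do rewrite !big_split.
      rewrite !big_split /=; congr (_ + _ + _).
      + by apply: eq_bigr => i _; rewrite exchange_big.
      + by rewrite exchange_big /=; apply: eq_bigr => i _; rewrite exchange_big.
      + by rewrite [RHS]exchange_big.
    apply: eq_bigr => i _; rewrite [RHS]big_mkcond; apply: eq_bigr => j _.
    case: ifP => ij; last by rewrite big1 // => k _; have -> : (i < k < j)%N = false by lia.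
    by rewrite [RHS]big_mkcond; apply: eq_bigr => k _; case: ifP.
  rewrite -sumrN; apply: eq_bigr => i _; rewrite -sumrN; apply: eq_bigr => j ij.
  rewrite -sumrN; apply: eq_bigr => k /andP[ik kj].
  have ki : (k < i)%N = false by lia.
  have jk : (j < k)%N = false by lia.
  have ji : (j < i)%N = false by lia.
  rewrite /T /H ij ik kj ki jk ji !(mulNr, mulrN) opprK.
  have sgs a b x : sg a * (s a b * x) = sg b * x.
    by rewrite mulrA /sg /s -signr_addb addKb.
  have sgs' a b x : sg b * (s a b * x) = sg a * x.
    by rewrite mulrA /sg /s -signr_addb addbC addbK.
  rewrite radial_triple // !(mulrDr (G i j)) mulr1 !(mulrDr (sg k)).
  rewrite (mulrA (G i j)) -sC -(mulrA (s i k)) sgs' (mulrA (G i j)) -sC -(mulrA (s k j)) sgs.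
  by rewrite (GG ik ij); abel.
rewrite mulNrn -sumrMnl -sumrB -sumrN; apply: eq_bigr => i _.
rewrite -sumrMnl -sumrB -sumrN; apply: eq_bigr => j ij.
by rewrite sPG // /e (mulrDl (sg i + sg j)) (opprD ((sg i + sg j) * _)) mulrnAl mulr_suml.
Qed.

Lemma radial_conj (R : E) : (forall i, z i * R = R * (z i + phi i)) ->
  (\sum_i sg i * (z i * z i)) * R =
  R * (\sum_i sg i * (z i * z i) + \sum_(i < N) \sum_(j < N | (i < j)%N)
         G i j * ((sg i * z i - sg j * z j) *+ 2 - e i j)).
Proof.
move=> zR; have zzR i : z i * z i * R = R * ((z i + phi i) * (z i + phi i)).
  by rewrite -mulrA zR mulrA zR -mulrA.
have sgR i x : sg i * x = x * sg i by exact: sgC.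
rewrite mulr_suml; under eq_bigr => i _ do rewrite -mulrA zzR mulrA sgR -mulrA.
rewrite -mulr_sumr; congr (R * _).
have -> : \sum_i sg i * ((z i + phi i) * (z i + phi i)) = \sum_i sg i * (z i * z i) +
  (\sum_i sg i * (phi i * phi i + (z i * phi i - phi i * z i)) + \sum_i (sg i * (phi i * z i)) *+ 2).
  rewrite -!big_split; apply: eq_bigr => i _ /=.
  rewrite -mulrnAr -!mulrDr; congr (_ * _).
  by rewrite mulrDr !mulrDl mulr2n; abel.
rewrite radial_scalar; congr (_ + _).
have -> : \sum_i (sg i * (phi i * z i)) *+ 2 =
  \sum_(i < N) \sum_(j < N | (i < j)%N) G i j * ((sg i * z i - sg j * z j) *+ 2).
  have -> : \sum_i (sg i * (phi i * z i)) *+ 2 = \sum_(i < N) \sum_(j < N) sg i * (H i j * z i) *+ 2.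
    by apply: eq_bigr => i _; rewrite /phi mulr_suml mulr_sumr sumrMnl.
  under eq_bigr => i _ do rewrite (bigID (fun j : 'I_N => (i < j)%N)) /=.
  rewrite big_split /= addrC.
  have -> : \sum_(i < N) \sum_(j < N | ~~ (i < j)%N) (sg i * (H i j * z i)) *+ 2 =
    \sum_(i < N) \sum_(j < N | (i < j)%N) - (sg j * (G i j * z j)) *+ 2.
    rewrite [RHS](exchange_big_dep xpredT) //=; apply: eq_bigr => i _.
    rewrite (bigD1 i) ?ltnn //= /H ltnn mul0r mulr0 mul0rn add0r.
    apply: eq_big => j; first by rewrite -leqNgt -val_eqE ltn_neqAle andbC.
    rewrite -leqNgt -val_eqE /= => /andP[h1 h2].
    have ji : (j < i)%N by rewrite ltn_neqAle h2.
    by rewrite ltnNge h1 /= ji mulNr mulrN.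
  rewrite -big_split; apply: eq_bigr => i _; rewrite -big_split; apply: eq_bigr => j ij.
  rewrite /= /H ij mulrnAr mulrBr !mulrA -!sgR -!mulrA mulrnBl addrC.
  by rewrite mulNrn.
rewrite -sumrN -big_split; apply: eq_bigr => i _ /=.
rewrite -sumrN -big_split; apply: eq_bigr => j ij /=.
rewrite mulrBr addrC; congr (_ - _).
rewrite /e mulrDl mulrDr mulrnAl mulrnAr mulr_suml mulr_sumr.
congr (_ + _ *+ 2); first by rewrite mulrDl mulrDr !sgR.
by apply: eq_bigr => k _; rewrite sgR.
Qed.

Let F (p : 'I_N * 'I_N) := if par p.1 (+) par p.2 then I p.1 p.2 else n p.1 p.2.

Let zF i (p : 'I_N * 'I_N) : (p.1 < p.2)%N ->
  z i * F p = F p * (z i + (d i p.1 - d i p.2) * G p.1 p.2).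
Proof.
move=> hp; set e' := d i p.1 - d i p.2.
have eC x : e' * x = x * e' by rewrite /e' mulrBl mulrBr /d !mulr_natl !mulr_natr.
rewrite /F; case: ifP => hpar.
  rewrite zI // -/e'; congr (_ * (_ + _)).
  by rewrite /s hpar expr1 !mulNr mul1r opprK.
have s1 : s p.1 p.2 = 1 by rewrite /s hpar.
have nGS : n p.1 p.2 * G p.1 p.2 = S p.1 p.2.
  by rewrite nG // GE -mulrA In // mulr1.
rewrite (mulrDr (n p.1 p.2)) eC (mulrA (n p.1 p.2)) nGS nE s1 mul1r.
rewrite (mulrBr (z i)) mulr1 (mulrBl (z i)) mul1r zS -/e' (mulrBr (S p.1 p.2)).
by abel.
Qed.

Lemma radial_comm (p q : 'I_N * 'I_N) : (p.1 < p.2)%N -> (q.1 < q.2)%N ->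
  F p * F q = F q * F p.
Proof.
move=> hp hq; rewrite /F; case: ifP => _; case: ifP => _.
- by rewrite II.
- by rewrite nIC.
- by rewrite nIC.
- by rewrite nn.
Qed.

Lemma radial_factors (l : seq ('I_N * 'I_N)) :
  all (fun p : 'I_N * 'I_N => (p.1 < p.2)%N) l -> forall i,
  z i * \prod_(p <- l) F p =
  \prod_(p <- l) F p * (z i + \sum_(p <- l) (d i p.1 - d i p.2) * G p.1 p.2).
Proof.
elim: l => [_ i|p l IH] /=; first by rewrite !big_nil mulr1 mul1r addr0.
move=> /andP[hp hl] i; rewrite !big_cons mulrA zF // -!mulrA; congr (_ * _).
rewrite mulrDl IH // !mulrDr -!addrA; congr (_ + _); rewrite addrC; congr (_ + _).
have GF : G p.1 p.2 * \prod_(q <- l) F q = \prod_(q <- l) F q * G p.1 p.2.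
  elim: l hl {IH} => [|q l IHl] /=; first by rewrite big_nil mulr1 mul1r.
  move=> /andP[hq hl]; rewrite big_cons mulrA.
  have -> : G p.1 p.2 * F q = F q * G p.1 p.2.
    by rewrite /F; case: ifP => _; rewrite ?GI // nG.
  by rewrite -!mulrA IHl.
have eC x : (d i p.1 - d i p.2) * x = x * (d i p.1 - d i p.2).
  by rewrite mulrBl mulrBr /d !mulr_natl !mulr_natr.
by rewrite -mulrA GF mulrA eC -mulrA.
Qed.

Definition pospairs : seq ('I_N * 'I_N) :=
  [seq p : 'I_N * 'I_N <- enum {: 'I_N * 'I_N} | (p.1 < p.2)%N].

(** Harish-Chandra's radial part: conjugation by the superdenominator reproduces the quadratic form
    plus exactly the first order terms that the off-diagonal part of the Casimir element contributes
    to a trace. *)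
Lemma radial_part (R := \prod_(p <- pospairs) F p) :
  (\sum_i sg i * (z i * z i)) * R =
  R * (\sum_i sg i * (z i * z i) + \sum_(i < N) \sum_(j < N | (i < j)%N)
         G i j * ((sg i * z i - sg j * z j) *+ 2 - e i j)).
Proof.
apply: radial_conj => i; rewrite radial_factors; last first.
  by apply/allP => p; rewrite mem_filter => /andP[].
congr (_ * (_ + _)); rewrite big_filter big_enum_cond /=.
rewrite -(pair_big_dep xpredT (fun i j : 'I_N => (i < j)%N)
  (fun j k => (d i j - d i k) * G j k)) /=.
have dE a b (x : E) : d a b * x = if a == b then x else 0.
  by rewrite /d; case: eqP; rewrite ?mul1r ?mul0r.
rewrite /phi /H.
under eq_bigr => j _.
  under eq_bigr => k _ do rewrite mulrBl !dE.
  rewrite sumrB; over.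
rewrite sumrB.
rewrite (bigD1 i) //= [X in _ + X - _]big1 ?addr0; last first.
  by move=> j ji; rewrite big1 // => k _; rewrite eq_sym (negbTE ji).
rewrite eqxx [X in _ - X](exchange_big_dep xpredT) //= [X in _ - X](bigD1 i) //= [X in _ - (_ + X)]big1 ?addr0; last first.
  by move=> j ji; rewrite big1 // => k _; rewrite eq_sym (negbTE ji).
rewrite eqxx [RHS](bigID (fun j : 'I_N => (i < j)%N)) /=; congr (_ + _).
  by apply: eq_bigr => j ->.
rewrite -sumrN [RHS](bigID (fun j : 'I_N => (j < i)%N)) /= [X in _ = _ + X]big1 ?addr0.
  apply: eq_big => [j|j ji]; first by case: ltngtP.
  by rewrite ji (leq_gtF (ltnW ji)).
by move=> j /andP[/negbTE-> /negbTE->].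
Qed.
End RadialPart.

(** * Formal characters and their difference operators *)

Section Endo.
Variable V : zmodType.
(** Additive maps on series form a ring, which is the setting in which [radial_part] is applied. *)
Record endo := Endo { efun :> V -> V; efunD : forall x y, efun (x + y) = efun x + efun y }.

Lemma endoP (f g : endo) : (forall x, f x = g x) -> f = g.
Proof.
case: f g => [f hf] [g hg] /= fg; have e : f = g by apply: funext.
by case: _ / e in hg *; congr Endo; apply: Prop_irrelevance.
Qed.

Lemma endo0 (f : endo) : f 0 = 0.
Proof. by apply: (addrI (f 0)); rewrite -efunD !addr0. Qed.
Lemma endoN (f : endo) x : f (- x) = - f x.
Proof. by apply: (addrI (f x)); rewrite -efunD !subrr endo0. Qed.

HB.instance Definition _ := gen_eqMixin endo.
HB.instance Definition _ := gen_choiceMixin endo.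

Lemma endo_addD (f g : endo) x y : f (x + y) + g (x + y) = f x + g x + (f y + g y).
Proof. by rewrite !efunD addrACA. Qed.
Definition endo_add (f g : endo) := Endo (endo_addD f g).
Lemma endo_zeroD (x y : V) : 0 = 0 + 0 :> V. Proof. by rewrite addr0. Qed.
Definition endo_zero := @Endo (fun=> 0) endo_zeroD.
Lemma endo_oppD (f : endo) x y : - f (x + y) = - f x + - f y.
Proof. by rewrite efunD opprD. Qed.
Definition endo_opp (f : endo) := Endo (endo_oppD f).
Definition endo_one := @Endo id (fun _ _ => erefl).
Lemma endo_mulD (f g : endo) x y : f (g (x + y)) = f (g x) + f (g y).
Proof. by rewrite !efunD. Qed.
Definition endo_mul (f g : endo) := Endo (endo_mulD f g).

Lemma endo_addA : associative endo_add.
Proof. by move=> f g h; apply: endoP => x /=; rewrite addrA. Qed.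
Lemma endo_addC : commutative endo_add.
Proof. by move=> f g; apply: endoP => x /=; rewrite addrC. Qed.
Lemma endo_add0 : left_id endo_zero endo_add.
Proof. by move=> f; apply: endoP => x /=; rewrite add0r. Qed.
Lemma endo_addN : left_inverse endo_zero endo_opp endo_add.
Proof. by move=> f; apply: endoP => x /=; rewrite addNr. Qed.
HB.instance Definition _ :=
  GRing.isZmodule.Build endo endo_addA endo_addC endo_add0 endo_addN.
Lemma endo_mulA : associative endo_mul. Proof. by move=> f g h; apply: endoP. Qed.
Lemma endo_mul1 : left_id endo_one endo_mul. Proof. by move=> f; apply: endoP. Qed.
Lemma endo_1mul : right_id endo_one endo_mul. Proof. by move=> f; apply: endoP. Qed.
Lemma endo_mulDl : left_distributive endo_mul endo_add.
Proof. by move=> f g h; apply: endoP. Qed.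
Lemma endo_mulDr : right_distributive endo_mul endo_add.
Proof. by move=> f g h; apply: endoP => x /=; rewrite efunD. Qed.
HB.instance Definition _ := GRing.Zmodule_isPzRing.Build endo
  endo_mulA endo_mul1 endo_1mul endo_mulDl endo_mulDr.

Lemma endo_sumE I (r : seq I) (P : pred I) (F : I -> endo) x :
  (\sum_(i <- r | P i) F i) x = \sum_(i <- r | P i) F i x.
Proof. by elim/big_rec2: _ => // i y f _ <-. Qed.
End Endo.

Section Series.
Variables (K : numFieldType) (N : nat).
Definition wt := {ffun 'I_N -> int}.
HB.instance Definition _ := GRing.Zmodule.on wt.
Definition eps (i : 'I_N) : wt := [ffun k => (k == i)%:R].
Definition root (i j : 'I_N) : wt := eps i - eps j.
Definition psum (k : nat) (y : wt) : int := \sum_(i < N | (i < k)%N) y i.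

Lemma psumD k y z : psum k (y + z) = psum k y + psum k z.
Proof. by rewrite /psum -big_split; apply: eq_bigr => i _; rewrite ffunE. Qed.
Lemma psumN k y : psum k (- y) = - psum k y.
Proof. by rewrite /psum -sumrN; apply: eq_bigr => i _; rewrite ffunE. Qed.
Lemma psumMn k y n : psum k (y *+ n) = psum k y *+ n.
Proof. by rewrite /psum -sumrMnl; apply: eq_bigr => i _; rewrite ffunMnE. Qed.
Lemma psum_eps k i : psum k (eps i) = (i < k)%N%:R.
Proof.
rewrite /psum; have [ik|ki] := ltnP i k.
  rewrite (bigD1 i) //= ffunE eqxx big1 ?addr0 // => j /andP[_ /negbTE ji].
  by rewrite ffunE ji.
by rewrite big1 // => j jk; rewrite ffunE; case: eqP jk => // ->; rewrite ltnNge ki.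
Qed.
Lemma psum_root k (i j : 'I_N) : (i < j)%N -> psum k (root i j) = (i < k <= j)%N%:R.
Proof. by move=> ij; rewrite /root psumD psumN !psum_eps; lia. Qed.

(** Weaker than support in a finite union of cones, but preserved by every operator below. A
    positive root raises some [psum], so a geometric series in the exponentials of negative roots
    has finitely many nonzero terms at each weight. *)
Definition bounded (f : wt -> K) :=
  exists B : int, forall y, f y != 0 -> forall k, psum k y <= B.

Record bser := Bser { bval :> wt -> K; bserP : bounded bval }.
Lemma bserE (f g : bser) : (forall x, f x = g x) -> f = g.
Proof.
case: f g => [f hf] [g hg] /= fg; have e : f = g by apply: funext.
by case: _ / e in hg *; congr Bser; apply: Prop_irrelevance.
Qed.
HB.instance Definition _ := gen_eqMixin bser.
HB.instance Definition _ := gen_choiceMixin bser.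

Lemma bounded0 : bounded (fun=> 0). Proof. by exists 0 => y; rewrite eqxx. Qed.
Lemma boundedD f g : bounded f -> bounded g -> bounded (fun y => f y + g y).
Proof.
move=> [B hB] [B' hB']; exists (`|B| + `|B'|) => y h k.
have [f0|/hB/(_ k)] := eqVneq (f y) 0; last by lia.
have [g0|/hB'/(_ k)] := eqVneq (g y) 0; last by lia.
by rewrite f0 g0 addr0 eqxx in h.
Qed.
Lemma boundedM (c : wt -> K) f : bounded f -> bounded (fun y => c y * f y).
Proof.
move=> [B hB]; exists B => y; have [->|/hB//] := eqVneq (f y) 0.
by rewrite mulr0 eqxx.
Qed.
Lemma boundedN f : bounded f -> bounded (fun y => - f y).
Proof. by move=> [B hB]; exists B => y; rewrite oppr_eq0; apply: hB. Qed.

Definition bser_add (f g : bser) := Bser (boundedD (bserP f) (bserP g)).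
Definition bser_opp (f : bser) := Bser (boundedN (bserP f)).
Lemma bser_addA : associative bser_add.
Proof. by move=> f g h; apply: bserE => x /=; rewrite addrA. Qed.
Lemma bser_addC : commutative bser_add.
Proof. by move=> f g; apply: bserE => x /=; rewrite addrC. Qed.
Lemma bser_add0 : left_id (Bser bounded0) bser_add.
Proof. by move=> f; apply: bserE => x /=; rewrite add0r. Qed.
Lemma bser_addN : left_inverse (Bser bounded0) bser_opp bser_add.
Proof. by move=> f; apply: bserE => x /=; rewrite addNr. Qed.
HB.instance Definition _ :=
  GRing.isZmodule.Build bser bser_addA bser_addC bser_add0 bser_addN.

Lemma bser_sumE I (r : seq I) (P : pred I) (F : I -> bser) y :
  (\sum_(i <- r | P i) F i) y = \sum_(i <- r | P i) F i y.
Proof. by elim/big_rec2: _ => // i u f _ <-. Qed.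
Lemma bser_mulrnE (f : bser) n y : (f *+ n) y = f y *+ n.
Proof. by elim: n => // n IH; rewrite !mulrS -IH. Qed.

Notation E := (endo bser).

Lemma opz_subproof i (f g : bser) : Bser (boundedM (fun y => (y i)%:~R) (bserP (f + g))) =
  Bser (boundedM (fun y => (y i)%:~R) (bserP f)) + Bser (boundedM (fun y => (y i)%:~R) (bserP g)).
Proof. by apply: bserE => y /=; rewrite mulrDr. Qed.
Definition opz i : E := Endo (opz_subproof i).

Lemma boundedS a f : bounded f -> bounded (fun y => f (y + a)).
Proof.
move=> [B hB]; exists (B + \sum_i `|a i|) => y /hB h k; have := h k; rewrite psumD.
suff : - psum k a <= \sum_i `|a i| by lia.
rewrite /psum -sumrN big_mkcond; apply: ler_sum => i _; case: ifP => _; lia.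
Qed.
Lemma opS_subproof a (f g : bser) : Bser (boundedS a (bserP (f + g))) =
  Bser (boundedS a (bserP f)) + Bser (boundedS a (bserP g)).
Proof. exact: bserE. Qed.
Definition opS a : E := Endo (opS_subproof a).

Lemma bsum_stable (g : nat -> K) M M' : (forall k, (M <= k)%N -> g k = 0) ->
  (forall k, (M' <= k)%N -> g k = 0) -> \sum_(k < M) g k = \sum_(k < M') g k.
Proof.
wlog le : M M' / (M <= M')%N => [hw h h'|h _].
  by case/orP: (leq_total M M') => le; [|symmetry]; apply: hw.
rewrite -(subnKC le) big_split_ord /= [X in _ = _ + X]big1 ?addr0 // => i _.
by rewrite h // leq_addr.
Qed.

Section Inverse.
Variables (i j : 'I_N) (ij : (i < j)%N) (c : K).
Let al := root i j.

Lemma bser_vanish (f : bser) y : exists M, forall k, (M <= k)%N -> f (y + al *+ k) = 0.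
Proof.
have [B hB] := bserP f; exists `|B - psum i.+1 y|%N.+1 => k hk.
apply/eqP/negPn/negP => /hB/(_ i.+1).
rewrite psumD psumMn psum_root // ltnSn ij /=; lia.
Qed.

(** The cut-off is chosen; [binvE] shows that every sufficiently large one gives the same value. *)
Definition binv_fun (f : bser) y :=
  \sum_(k < projT1 (cid (bser_vanish f y))) c ^+ k * f (y + al *+ k).

Lemma binvE (f : bser) y M : (forall k, (M <= k)%N -> f (y + al *+ k) = 0) ->
  binv_fun f y = \sum_(k < M) c ^+ k * f (y + al *+ k).
Proof.
move=> h; rewrite /binv_fun; case: cid => M' /= h'.
apply: (@bsum_stable (fun k => c ^+ k * f (y + al *+ k))) => k hk.
  by rewrite h' // mulr0.
by rewrite h // mulr0.
Qed.

Lemma binv_supp (f : bser) y : binv_fun f y != 0 -> exists k, f (y + al *+ k) != 0.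
Proof.
rewrite /binv_fun => h; apply: contrapT => h'; case/eqP: h; apply: big1 => k _.
have [->|h] := eqVneq (f (y + al *+ k)) 0; first by rewrite mulr0.
by case: h'; exists k.
Qed.

Lemma binv_bounded f : bounded (binv_fun f).
Proof.
have [B hB] := bserP f; exists B => y /binv_supp[k] /hB h l.
have := h l; rewrite psumD psumMn psum_root //; case: (_ <= _)%N; lia.
Qed.

Lemma opI_subproof (f g : bser) :
  Bser (binv_bounded (f + g)) = Bser (binv_bounded f) + Bser (binv_bounded g).
Proof.
apply: bserE => y /=; have [M hf] := bser_vanish f y; have [M' hg] := bser_vanish g y.
have hf' k : (M + M' <= k)%N -> f (y + al *+ k) = 0.
  by move=> hk; rewrite hf // (leq_trans _ hk) // leq_addr.
have hg' k : (M + M' <= k)%N -> g (y + al *+ k) = 0.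
  by move=> hk; rewrite hg // (leq_trans _ hk) // leq_addl.
rewrite (binvE hf') (binvE hg') (@binvE _ _ (M + M')).
  by rewrite -big_split; apply: eq_bigr => k _; rewrite /= mulrDr.
by move=> k hk /=; rewrite hf' // hg' // addr0.
Qed.
Definition opI : E := Endo opI_subproof.

Lemma opI_rec (f : bser) y : opI f y - c * opI f (y + al) = f y.
Proof.
rewrite /=; have [M h] := bser_vanish f y.
rewrite (@binvE f y M.+1); last by move=> k hk; rewrite h // ltnW.
rewrite (@binvE f (y + al) M); last first.
  by move=> k hk; rewrite -addrA -mulrS h // ltnW.
rewrite big_ord_recl expr0 mul1r addr0 mulr_sumr -addrA -[RHS]addr0.
congr (_ + _); rewrite -sumrB big1 // => k _ /=.
by rewrite /bump /= add1n exprS -mulrA -addrA -mulrS subrr.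
Qed.

(** Iterating the equation walks along the root until the bounded support is left. *)
Lemma bser_inj (f : bser) : (forall y, f y = c * f (y + al)) -> f = 0.
Proof.
move=> h; apply: bserE => y; have [M hM] := bser_vanish f y.
suff -> : f y = c ^+ M * f (y + al *+ M) by rewrite hM // mulr0.
elim: {hM} M => [|M IH]; first by rewrite expr0 mul1r addr0.
by rewrite IH h exprSr mulrA -addrA -mulrSr.
Qed.

End Inverse.

Variable par : 'I_N -> bool.
Let s i j : bool := par i (+) par j.
Definition opn i j : E := 1 - (-1) ^+ s i j * opS (root i j).
(** The dependent conditional hands [opI] its proof of [i < j], so that the operator is defined for
    all pairs as [radial_part] expects. *)
Definition opinv (i j : 'I_N) : E :=
  (if (i < j)%N as b return (i < j)%N = b -> E then fun h => opI h ((-1) ^+ s i j)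
   else fun=> 0) erefl.
Definition opG i j : E := opS (root i j) * opinv i j.

Lemma endo_signE (b : bool) (u : E) (f : bser) y : ((-1) ^+ b * u) f y = (-1) ^+ b * u f y.
Proof. by case: b; rewrite ?expr1 ?expr0 ?mulN1r ?mul1r. Qed.

Lemma endo_sgnE (b : bool) (f : bser) y : ((-1) ^+ b : E) f y = (-1) ^+ b * f y.
Proof. by case: b; rewrite ?mulN1r ?mul1r. Qed.

Lemma opinvE (i j : 'I_N) (h : (i < j)%N) : opinv i j = opI h ((-1) ^+ s i j).
Proof.
rewrite /opinv; move: erefl; case: {2 3}(i < j)%N => [h'|]; last by rewrite h.
by rewrite (Prop_irrelevance h' h).
Qed.

Lemma opnE i j f y : opn i j f y = f y - (-1) ^+ s i j * f (y + root i j).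
Proof. by rewrite -[LHS]/(f y - ((-1) ^+ s i j * opS (root i j) : E) f y) endo_signE. Qed.

Lemma opnK (i j : 'I_N) : (i < j)%N -> opn i j * opinv i j = 1.
Proof.
move=> h; apply: endoP => f; apply: bserE => y.
by rewrite [LHS]opnE (opinvE h) opI_rec.
Qed.

Lemma opn_inj (i j : 'I_N) (f g : bser) : (i < j)%N -> opn i j f = opn i j g -> f = g.
Proof.
move=> h e; apply/eqP; rewrite -subr_eq0; apply/eqP.
apply: (@bser_inj i j h ((-1) ^+ s i j)) => y.
have : opn i j (f - g) y = 0 by rewrite efunD endoN e subrr.
by rewrite opnE => /eqP; rewrite subr_eq0 => /eqP.
Qed.

Lemma opinvK (i j : 'I_N) : (i < j)%N -> opinv i j * opn i j = 1.
Proof.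
move=> h; apply: endoP => f; apply: (opn_inj h).
by rewrite -[LHS]/((opn i j * (opinv i j * opn i j)) f) mulrA opnK // mul1r.
Qed.

Lemma rootD i k j : root i k + root k j = root i j.
Proof. by rewrite /root addrA subrK. Qed.

Lemma opSM a b : opS a * opS b = opS (a + b).
Proof. by apply: endoP => f; apply: bserE => y /=; rewrite addrA. Qed.

Lemma opzS i j k : opz i * opS (root j k) =
  opS (root j k) * (opz i - ((i == j)%:R - (i == k)%:R)).
Proof.
apply: endoP => f; apply: bserE => y /=.
have natE n (g : bser) : (n%:R : E) g = g *+ n.
  by elim: n => // n IH; rewrite !mulrS /= IH.
rewrite !natE.
have -> : (y i)%:~R = (((y + root j k) i)%:~R - ((i == j)%:R - (i == k)%:R)) :> K.
  by rewrite !ffunE; case: (i == j); case: (i == k); rewrite !rmorphD !rmorphN /=; ring.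
rewrite mulrBl mulrBl !mulr_natl !bser_mulrnE; congr (_ - _).
Qed.

(** Multiplication by the superdenominator: for an odd root the sign in [opI] is -1, so [opinv] is
    the expansion of [1 / (1 + e^-beta)]. *)
Definition opR : E := \prod_(p <- pospairs N) (if s p.1 p.2 then opinv p.1 p.2 else opn p.1 p.2).

Let sg i : int := (-1) ^+ par i.
Definition casdiff (i j : 'I_N) : int :=
  sg i + sg j + (\sum_(k < N | (i < k < j)%N) sg k) *+ 2.
Definition Qform (y : wt) : int := \sum_i sg i * (y i * y i).

(** [U i j] is given by a recursion along the root instead of as [opG i j] applied to a series,
    because the recursion is what cyclicity of the trace delivers; [opn_inj] makes the two
    descriptions agree. *)
Lemma opR_radial (f : bser) (U : 'I_N -> 'I_N -> bser) :
  (forall i j : 'I_N, (i < j)%N -> forall y, U i j y - (-1) ^+ s i j * U i j (y + root i j) =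
     (((sg i * (y + root i j) i - sg j * (y + root i j) j) *+ 2 - casdiff i j)%:~R
     * f (y + root i j))) ->
  forall y, (Qform y)%:~R * opR f y =
    opR (Bser (boundedM (fun y => (Qform y)%:~R) (bserP f)) +
      \sum_(i < N) \sum_(j < N | (i < j)%N) U i j) y.
Proof.
move=> hU y.
have SS i j k l : opS (root i j) * opS (root k l) = opS (root k l) * opS (root i j).
  by rewrite !opSM addrC.
have Sm i j k : opS (root i k) * opS (root k j) = opS (root i j) by rewrite opSM rootD.
have nE i j : opn i j = 1 - (-1) ^+ (par i (+) par j) * opS (root i j) by [].
have GE i j : opG i j = opS (root i j) * opinv i j by [].
have hR : (\sum_i (-1) ^+ par i * (opz i * opz i)) * opR =
    opR * (\sum_i (-1) ^+ par i * (opz i * opz i) +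
    \sum_(i < N) \sum_(j < N | (i < j)%N) opG i j *
      (((-1) ^+ par i * opz i - (-1) ^+ par j * opz j) *+ 2 -
       ((-1) ^+ par i + (-1) ^+ par j + (\sum_(k < N | (i < k < j)%N) (-1) ^+ par k) *+ 2))).
  exact: (radial_part nE GE SS Sm opnK opinvK opzS).
have sgE (b : bool) (g : E) : ((-1) ^+ b * g : E) = g *~ (-1) ^+ (b : bool).
  by case: b; rewrite ?expr1 ?mulN1r ?mulrN1z ?expr0 ?mul1r ?mulr1z.
have mulzE (g : E) (c : int) (h : bser) x : (g *~ c) h x = c%:~R * g h x.
  have mulnE (n : nat) : (g *+ n) h x = n%:R * g h x.
    by elim: n => [|n IH]; rewrite ?mulr0n ?mul0r // !mulrS mulrDl mul1r -IH.
  case: c => n; first exact: mulnE.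
  by rewrite NegzE !mulrNz mulNr -[LHS]/(- ((g *+ n.+1) h x)) mulnE.
have QE (h : bser) x : (\sum_i (-1) ^+ par i * (opz i * opz i) : E) h x = (Qform x)%:~R * h x.
  rewrite endo_sumE bser_sumE /Qform rmorph_sum /= mulr_suml; apply: eq_bigr => i _.
  by rewrite endo_sgnE /= !rmorphM /= rmorph_sign; ring.
have /(congr1 (fun e : E => e f y)) := hR.
rewrite -[LHS]/((\sum_i (-1) ^+ par i * (opz i * opz i) : E) (opR f) y) QE => ->.
congr (opR _ y); apply: bserE => x; rewrite -[LHS]/(_ + _); congr (_ + _).
  by rewrite QE.
rewrite endo_sumE; congr (bval _ x); apply: eq_bigr => i _.
rewrite endo_sumE; apply: eq_bigr => j ij.
apply: (opn_inj ij).
set X : E := (_ - _) in |- *.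
have -> : opn i j ((opG i j * X) f) = (opS (root i j) * X) f.
  rewrite -[LHS]/((opn i j * (opG i j * X)) f) mulrA; congr ((_ * X) f).
  rewrite /opG mulrA.
  have -> : opn i j * opS (root i j) = opS (root i j) * opn i j.
    rewrite /opn mulrBl mulrBr mul1r mulr1; congr (_ - _).
    by rewrite -mulrA mulrA [RHS]mulrA (commr_sign (opS (root i j))).
  by rewrite -mulrA opnK // mulr1.
apply: bserE => w; rewrite opnE hU // -[LHS]/(X f (w + root i j)).
move: (w + root i j) => v; rewrite /X.
have s1 (b : bool) (h : bser) u : ((-1) ^+ b : E) h u = ((-1) ^+ b : int)%:~R * h u.
  by rewrite endo_sgnE rmorph_sign.
pose SS' := \sum_(k < N | (i < k < j)%N) ((-1) ^+ par k : E).
have -> : X f v = (((-1) ^+ par i * opz i : E) f v - ((-1) ^+ par j * opz j : E) f v) +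
   (((-1) ^+ par i * opz i : E) f v - ((-1) ^+ par j * opz j : E) f v) -
   (((-1) ^+ par i : E) f v + ((-1) ^+ par j : E) f v + (SS' f v + SS' f v)) by [].
rewrite !endo_signE !s1 /SS' endo_sumE bser_sumE.
under eq_bigr => k _ do rewrite s1.
rewrite -mulr_suml /= /casdiff.
rewrite !(rmorphB, rmorphD, rmorphMn, rmorphM, rmorph_sign, rmorph_sum) /=.
ring.
Qed.

Notation Ffac := (fun p : 'I_N * 'I_N => if s p.1 p.2 then opinv p.1 p.2 else opn p.1 p.2).

Lemma Ffac_comm (p q : 'I_N * 'I_N) : (p.1 < p.2)%N -> (q.1 < q.2)%N ->
  Ffac p * Ffac q = Ffac q * Ffac p.
Proof.
have nE i j : opn i j = 1 - (-1) ^+ (par i (+) par j) * opS (root i j) by [].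
have SS i j k l : opS (root i j) * opS (root k l) = opS (root k l) * opS (root i j).
  by rewrite !opSM addrC.
move=> hp hq; exact: (radial_comm nE SS opnK opinvK hp hq).
Qed.

Lemma comm_perm (I : eqType) (F : I -> E) (l t : seq I) :
  (forall x y, x \in l -> y \in l -> F x * F y = F y * F x) -> perm_eq l t ->
  \prod_(x <- l) F x = \prod_(x <- t) F x.
Proof.
elim: l t => [|x l IH] t hc; first by rewrite perm_sym => /perm_nilP->.
move=> hp; have xt : x \in t by rewrite -(perm_mem hp) mem_head.
move: hp; case/splitPr: xt => t1 t2 hp.
have hl : perm_eq l (t1 ++ t2) by rewrite -(perm_cons x) (perm_trans hp) // perm_catC /= perm_cons perm_catC.
rewrite big_cons (IH (t1 ++ t2)) // => [|y w hy hw]; last by apply: hc; rewrite inE ?hy ?hw orbT.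
have -> : \prod_(w <- t1 ++ x :: t2) F w = \prod_(w <- t1) F w * F x * \prod_(w <- t2) F w.
  by rewrite big_cat big_cons /= mulrA.
have -> : \prod_(w <- t1 ++ t2) F w = \prod_(w <- t1) F w * \prod_(w <- t2) F w.
  by rewrite big_cat.
rewrite mulrA; congr (_ * _).
have : {subset t1 <= l} by move=> y hy; rewrite (perm_mem hl) mem_cat hy.
elim: t1 {hp hl} => [_|y t1 IHt h1]; first by rewrite big_nil mulr1 mul1r.
rewrite !big_cons mulrA (hc x y) ?mem_head ?inE ?h1 ?mem_head ?orbT //.
by rewrite -!mulrA IHt // => w hw; apply: h1; rewrite inE hw orbT.
Qed.

Lemma mem_pospairs (p : 'I_N * 'I_N) : (p \in pospairs N) = (p.1 < p.2)%N.
Proof. by rewrite mem_filter mem_enum andbT. Qed.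

Lemma Ffac_support (P : wt -> Prop) (f : bser) (p : 'I_N * 'I_N) : (p.1 < p.2)%N ->
  (forall y, P (y + root p.1 p.2) -> P y) -> (forall y, f y != 0 -> P y) ->
  forall y, Ffac p f y != 0 -> P y.
Proof.
move=> hp dP hf y /=; case: ifP => _.
  rewrite opinvE => /binv_supp[k]; move/hf; elim: k => [|k IH]; first by rewrite addr0.
  by rewrite mulrSr addrA => /dP.
rewrite opnE; have [->|/hf//] := eqVneq (f y) 0.
by rewrite sub0r oppr_eq0 mulf_eq0 signr_eq0 => /hf/dP.
Qed.

Lemma opR_support (P : wt -> Prop) (f : bser) :
  (forall i j : 'I_N, (i < j)%N -> forall y, P (y + root i j) -> P y) ->
  (forall y, f y != 0 -> P y) -> forall y, opR f y != 0 -> P y.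
Proof.
move=> dP hf; rewrite /opR; have : {subset pospairs N <= pospairs N} by [].
elim: {1 3}(pospairs N) => [|p l IH] hl; first by rewrite big_nil.
rewrite big_cons => y; have hp : (p.1 < p.2)%N by rewrite -mem_pospairs hl ?mem_head.
apply: (Ffac_support hp) => [w|w]; first exact: dP.
by apply: IH => q hq; apply: hl; rewrite inE hq orbT.
Qed.

(** Besides the leading term, a factor reads its argument at [z] plus positive multiples of a root,
    where the support has ended. *)
Lemma opR_top (P : wt -> Prop) (f : bser) z :
  (forall i j : 'I_N, (i < j)%N -> forall y, P (y + root i j) -> P y) ->
  (forall y, f y != 0 -> P y) ->
  (forall (i j : 'I_N) k, (i < j)%N -> ~ P (z + root i j *+ k.+1)) -> opR f z = f z.
Proof.
move=> dP hf hz; rewrite /opR; have : {subset pospairs N <= pospairs N} by [].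
elim: {1 3}(pospairs N) => [|p l IH] hl; first by rewrite big_nil.
have hl' : {subset l <= pospairs N} by move=> q hq; apply: hl; rewrite inE hq orbT.
rewrite big_cons -(IH hl'); have hp : (p.1 < p.2)%N by rewrite -mem_pospairs hl ?mem_head.
set g := (\prod_(q <- l) Ffac q) f; have hg y : g y != 0 -> P y.
  move: y; rewrite /g; elim: l hl' {IH hl g} => [|q l IH] hl; first by rewrite big_nil.
  rewrite big_cons => y; have hq : (q.1 < q.2)%N by rewrite -mem_pospairs hl ?mem_head.
  apply: (Ffac_support hq) => [w|w]; first exact: dP.
  by apply: IH => q' hq'; apply: hl; rewrite inE hq' orbT.
have g0 k : g (z + root p.1 p.2 *+ k.+1) = 0.
  by apply/eqP/negPn/negP => /hg; apply: hz.
rewrite -[LHS]/(Ffac p g z) /=; case: ifP => _.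
  rewrite (opinvE hp) /= (@binvE _ _ _ _ g _ 1); last by case=> // k _; exact: g0.
  by rewrite big_ord1 expr0 mul1r addr0.
by rewrite opnE -[root _ _]/(root _ _ *+ 1) g0 mulr0 subr0.
Qed.

Lemma opR_commute (u : E) : (forall i j, opn i j * u = u * opn i j) -> opR * u = u * opR.
Proof.
move=> nS; rewrite /opR; have : {subset pospairs N <= pospairs N} by [].
elim: {1 3 4}(pospairs N) => [|p l IH] hl; first by rewrite big_nil mul1r mulr1.
have hp : (p.1 < p.2)%N by rewrite -mem_pospairs hl ?mem_head.
have FS : Ffac p * u = u * Ffac p.
  rewrite /=; case: ifP => _; last exact: nS.
  rewrite -[LHS]mulr1 -(opnK hp) mulrA -(mulrA (opinv _ _)).
  by rewrite -nS mulrA opinvK // mul1r.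
rewrite !big_cons -mulrA IH; last by move=> q hq; apply: hl; rewrite inE hq orbT.
by rewrite !mulrA -FS.
Qed.

Lemma opR_shift a (f : bser) y : opR (opS a f) y = opR f (y + a).
Proof.
rewrite -[LHS]/((opR * opS a) f y) opR_commute // => i j.
apply: endoP => g; apply: bserE => w; rewrite -[LHS]/(opn i j (opS a g) w).
by rewrite -[RHS]/(opn i j g (w + a)) !opnE /= addrAC.
Qed.

Lemma bscale_subproof c (f g : bser) : Bser (boundedM (fun=> c) (bserP (f + g))) =
  Bser (boundedM (fun=> c) (bserP f)) + Bser (boundedM (fun=> c) (bserP g)).
Proof. by apply: bserE => y /=; rewrite mulrDr. Qed.
Definition bscale c : E := Endo (bscale_subproof c).

Lemma opR_scale c (f : bser) y : opR (bscale c f) y = c * opR f y.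
Proof.
rewrite -[LHS]/((opR * bscale c) f y) opR_commute // => i j.
apply: endoP => g; apply: bserE => w; rewrite -[LHS]/(opn i j (bscale c g) w).
by rewrite -[RHS]/(c * opn i j g w) !opnE /= mulrBr mulrCA.
Qed.

Section Swap.
Variables (i j : 'I_N).
Hypothesis (ij : (j = i.+1 :> nat)) (pij : par i = par j).
Definition swap (y : wt) : wt := [ffun k => y (tperm i j k)].

Lemma swapK : involutive swap.
Proof. by move=> y; apply/ffunP => k; rewrite !ffunE tpermK. Qed.
Lemma swapD x y : swap (x + y) = swap x + swap y.
Proof. by apply/ffunP => k; rewrite !ffunE. Qed.
Lemma swapMn x k : swap (x *+ k) = swap x *+ k.
Proof. by apply/ffunP => l; rewrite !(ffunE, ffunMnE). Qed.
Lemma swap_root a b : swap (root a b) = root (tperm i j a) (tperm i j b).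
Proof.
by apply/ffunP => k; rewrite !ffunE !(can2_eq (tpermK _ _) (tpermK _ _)).
Qed.
Lemma par_tperm a : par (tperm i j a) = par a.
Proof. by case: tpermP => // ->. Qed.
Lemma tperm_lt (a b : 'I_N) : (a < b)%N -> (a, b) != (i, j) -> (tperm i j a < tperm i j b)%N.
Proof.
rewrite xpair_eqE -!val_eqE /= => ab h; rewrite /tperm !permE /= -!val_eqE /=.
by do 4?[case: ifP => /eqP] => /=; move: ab h ij; lia.
Qed.

Lemma swap_Ffac (f g : bser) (p : 'I_N * 'I_N) : (p.1 < p.2)%N -> p != (i, j) ->
  (forall y, f (swap y) = g y) ->
  forall y, Ffac p f (swap y) = Ffac (tperm i j p.1, tperm i j p.2) g y.
Proof.
case: p => a b /= ab nab fg y.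
have fgk c : f (swap y + c) = g (y + swap c) by rewrite -fg swapD swapK.
rewrite /s !par_tperm; case: ifP => hpar.
  rewrite !(opinvE ab) (opinvE (tperm_lt ab nab)) /=.
  have [M hM] := bser_vanish (tperm_lt ab nab) g y.
  rewrite (binvE _ _ hM) (@binvE _ _ _ _ f _ M); last first.
    by move=> k hk; rewrite fgk swapMn swap_root hM.
  by apply: eq_bigr => k _; rewrite fgk swapMn swap_root /s !par_tperm.
by rewrite !opnE fgk swap_root fg /s !par_tperm.
Qed.

(** A simple reflection permutes the other positive roots and keeps their parity, and its own factor
    [1 - e^-alpha] supplies the sign. In rho-shifted labels invariance of a character reads
    [f (swap y) = f (y + root i j)]. *)
Lemma opR_antisym (f : bser) : (forall y, f (swap y) = f (y + root i j)) ->
  forall y, opR f (swap y) = - opR f y.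
Proof.
move=> hf y; pose l := rem (i, j) (pospairs N).
have iltj : (i < j)%N by rewrite ij.
have up : uniq (pospairs N) by rewrite filter_uniq // enum_uniq.
have hp : perm_eq (pospairs N) (rcons l (i, j)).
  by rewrite perm_sym perm_rcons perm_sym perm_to_rem // mem_pospairs.
have ll p : p \in l -> (p.1 < p.2)%N && (p != (i, j)).
  by rewrite mem_rem_uniq // inE mem_pospairs andbC.
have -> : opR = \prod_(p <- l) Ffac p * opn i j.
  rewrite /opR (comm_perm _ hp); last first.
    by move=> p q; rewrite !mem_pospairs => *; apply: Ffac_comm.
  by rewrite -cats1 big_cat big_seq1 /= /s pij addbb.
rewrite -[LHS]/((\prod_(p <- l) Ffac p) (opn i j f) (swap y)).
rewrite -[in RHS]/((\prod_(p <- l) Ffac p) (opn i j f) y).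
set u := opn i j f.
have su w : u (swap w) = (- u) w.
  rewrite -[RHS]/(- u w) /u !opnE /s pij addbb expr0 !mul1r hf opprB; congr (_ - _).
  have -> : swap w + root i j = swap (w + root j i).
    by rewrite swapD swap_root tpermL tpermR.
  by rewrite hf -addrA rootD /root subrr addr0.
have lE : \prod_(p <- l) Ffac p = \prod_(p <- [seq (tperm i j p.1, tperm i j p.2) | p : 'I_N * 'I_N <- l]) Ffac p.
  apply: comm_perm => [p q /ll/andP[hp1 _] /ll/andP[hq _]|]; first exact: Ffac_comm.
  have inj2 : injective (fun p : 'I_N * 'I_N => (tperm i j p.1, tperm i j p.2)).
    by move=> [a b] [c d] /= [/perm_inj-> /perm_inj->].
  apply: uniq_perm; rewrite ?(map_inj_uniq inj2) ?rem_uniq //.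
  move=> [a b]; rewrite -{2}(tpermK i j a) -{2}(tpermK i j b).
  rewrite (mem_map inj2 _ (tperm i j a, tperm i j b)) !mem_rem_uniq // !inE !mem_pospairs /=.
  have aux (c d : 'I_N) : ((c, d) != (i, j)) && (c < d)%N ->
      ((tperm i j c, tperm i j d) != (i, j)) && (tperm i j c < tperm i j d)%N.
    move=> /andP[h1 h2]; rewrite tperm_lt // andbT.
    apply: contraTneq h2 => -[/(canRL (tpermK i j)) -> /(canRL (tpermK i j)) ->].
    by rewrite tpermL tpermR -leqNgt ltnW.
  by apply/idP/idP => /aux; rewrite ?tpermK.
have gen (l' : seq ('I_N * 'I_N)) (v g : bser) : {subset l' <= l} ->
   (forall w, v (swap w) = g w) -> forall w, (\prod_(p <- l') Ffac p) v (swap w) =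
   (\prod_(p <- [seq (tperm i j p.1, tperm i j p.2) | p : 'I_N * 'I_N <- l']) Ffac p) g w.
  elim: l' => [|p l' IH] hl hv w; first by rewrite !big_nil.
  rewrite !big_cons; have /andP[hp1 hp2] := ll p (hl p (mem_head _ _)).
  apply: (swap_Ffac hp1 hp2) => x; apply: IH => // q hq.
  by apply: hl; rewrite inE hq orbT.
by rewrite (gen l u (- u)) // -lE endoN.
Qed.
End Swap.
End Series.

(** * Casimir eigenvalues and characters *)

Section Rep.
Variables (K : numFieldType) (N : nat) (par : 'I_N -> bool).
Local Notation sg i := ((-1) ^+ par i : K).
Local Notation wt := (wt N).

(** The coordinate of rho on [E_ii], as [rhoE] confirms. *)
Definition rr (i : 'I_N) : K :=
  sg i * ((\sum_(j < N | (i < j)%N) sg j) - (\sum_(j < N | (j < i)%N) sg j)) / 2.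

Definition sgn4 (i j k l : 'I_N) : K := (-1) ^+ ((par i (+) par j) && (par k (+) par l)).

(** The transposed indices of [Ym] absorb the reversal of products on row vectors, so these look
    like the relations of the matrix units themselves. *)
Definition bracket_rel d (Y : 'I_N -> 'I_N -> 'M[K]_d) := forall i j k l,
  Y i j *m Y k l = sgn4 i j k l *: (Y k l *m Y i j)
    + ((j == k)%:R *: Y i l - sgn4 i j k l *: ((i == l)%:R *: Y k j)).

(* [Ym i j] is the matrix, acting on row vectors, of the matrix unit E_ji;
   [lab] lists the weights of the basis, shifted by rho. *)
Record srep := SRep {
  dim : nat;
  lab : 'I_dim -> wt;
  Ym : 'I_N -> 'I_N -> 'M[K]_dim;
  Ym_rel : bracket_rel Ym;
  Ym_diag : forall i, Ym i i = diag_mx (\row_b ((lab b i)%:~R - rr i)) }.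

Variable M : srep.
Local Notation Y := (@Ym M).
Local Notation lb := (@lab M).
Local Notation d := (dim M).

Lemma Ym_entry i j b c : Y i j b c != 0 -> lb c = lb b + (eps j - eps i).
Proof.
move=> nz; apply/ffunP => k; have := Ym_rel M k k i j.
have -> : sgn4 k k i j = 1 by rewrite /sgn4 addbb.
rewrite !scale1r Ym_diag => /matrixP/(_ b c).
rewrite mul_diag_mx mul_mx_diag !mxE => h.
have {}h : ((lb b k)%:~R - (lb c k)%:~R : K) * Y i j b c =
   ((k == i)%:R - (k == j)%:R) * Y i j b c.
  transitivity ((k == i)%:R * Y k j b c - (k == j)%:R * Y i k b c).
    by rewrite mulrBl [X in X - _](_ : _ = Y i j b c * ((lb c k)%:~R - rr k) + ((k == i)%:R * Y k j b c - (k == j)%:R * Y i k b c) + rr k * Y i j b c); [ring|rewrite -h; ring].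
  by rewrite mulrBl; congr (_ - _); case: eqP => [->|_]; rewrite ?mul0r.
have := mulIf nz h; rewrite !ffunE.
have -> : ((k == i)%:R - (k == j)%:R : K) = ((k == i)%:R - (k == j)%:R : int)%:~R.
  by rewrite rmorphB !rmorph_nat.
by rewrite -rmorphB => /intr_inj; case: (k == i); case: (k == j) => /=; lia.
Qed.

Definition Pm (y : wt) : 'M[K]_d := diag_mx (\row_b (lb b == y)%:R).

Lemma mulPm m (A : 'M_(m, d)) y : A *m Pm y = \matrix_(b, c) (A b c * (lb c == y)%:R).
Proof. by apply/matrixP => b c; rewrite mul_mx_diag !mxE. Qed.

Lemma Pm_shift y i j : Pm y *m Y i j = Y i j *m Pm (y + (eps j - eps i)).
Proof.
apply/matrixP => b c; rewrite mul_mx_diag mul_diag_mx !mxE.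
have [->|/Ym_entry->] := eqVneq (Y i j b c) 0; first by rewrite mul0r mulr0.
by rewrite (inj_eq (addIr _)) mulrC.
Qed.

Lemma Pm_diag y i : Y i i *m Pm y = ((y i)%:~R - rr i) *: Pm y.
Proof.
rewrite Ym_diag; apply/matrixP => b c; rewrite mul_diag_mx !mxE.
by case: (b == c); rewrite ?mulr0 //; case: eqP => [->|_]; rewrite ?mulr0.
Qed.

Lemma PmP y y' : Pm y *m Pm y' = (y == y')%:R *: Pm y.
Proof.
apply/matrixP => b c; rewrite mul_diag_mx !mxE; case: (b == c); rewrite ?mulr0 //=.
by case: (eqVneq (lb b) y) => [->|]; case: eqP => //= _; rewrite ?mulr1 ?mulr0 ?mul0r.
Qed.

Definition Cas : 'M[K]_d := \sum_i \sum_j sg j *: (Y i j *m Y j i).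

Lemma Cas_comm k l : Cas *m Y k l = Y k l *m Cas.
Proof.
rewrite /Cas mulmx_suml mulmx_sumr.
under eq_bigr => i _ do rewrite mulmx_suml.
under [RHS]eq_bigr => i _ do rewrite mulmx_sumr.
pose s i j : K := (-1) ^+ ((par i (+) par j) && (par k (+) par l)).
have step i j : sg j *: (Y i j *m Y j i) *m Y k l = Y k l *m (sg j *: (Y i j *m Y j i)) +
   (((j == k)%:R * (sg j * s i j)) *: (Y i l *m Y j i) - ((i == l)%:R * sg j) *: (Y k j *m Y j i)
   + ((i == k)%:R * sg j) *: (Y i j *m Y j l) - ((j == l)%:R * (sg j * s i j)) *: (Y i j *m Y k i)).
  have s4 : sgn4 j i k l = s i j by rewrite /sgn4 /s addbC.
  have s4' : sgn4 i j k l = s i j by [].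
  have ss : s i j * s i j = 1 by rewrite /s -signr_addb addbb.
  rewrite -scalemxAl -mulmxA (Ym_rel _ j i k l) s4 !mulmxDr mulmxN -!scalemxAr.
  rewrite mulmxA (Ym_rel _ i j k l) s4' !mulmxDl mulNmx -!scalemxAl !mulmxA.
  rewrite !(scalerDr, scalerN, scalerA, opprK).
  have -> : sg j * s i j * s i j = sg j by rewrite -mulrA ss mulr1.
  have -> : sg j * s i j * (s i j * (i == l)%:R) = (i == l)%:R * sg j.
    by rewrite mulrA -(mulrA (sg j)) ss mulr1 mulrC.
  rewrite (mulrC (sg j * s i j) (j == k)%:R) (mulrC (sg j) (i == k)%:R).
  have -> : sg j * (s i j * (j == l)%:R) = (j == l)%:R * (sg j * s i j) by ring.
  by rewrite !addrA.
under eq_bigr => i _ do under eq_bigr => j _ do rewrite step.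
under eq_bigr => i _ do rewrite big_split.
rewrite big_split /= -[RHS]addr0; congr (_ + _).
have pick (F : 'I_N -> 'M[K]_d) (c : 'I_N -> K) k' :
   \sum_i ((i == k')%:R * c i) *: F i = c k' *: F k'.
  rewrite (bigD1 k') //= eqxx mul1r big1 ?addr0 // => i /negbTE->.
  by rewrite mul0r scale0r.
under eq_bigr => i _ do rewrite !big_split /= !sumrN !pick.
rewrite !big_split /= !sumrN.
have -> : \sum_i \sum_i0 ((i == l)%:R * sg i0) *: (Y k i0 *m Y i0 i) =
  \sum_j sg j *: (Y k j *m Y j l).
  rewrite exchange_big; apply: eq_bigr => j _.
  by rewrite (pick (fun i => Y k j *m Y j i) (fun=> sg j) l).
have -> : \sum_i \sum_i0 ((i == k)%:R * sg i0) *: (Y i i0 *m Y i0 l) =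
  \sum_j sg j *: (Y k j *m Y j l).
  rewrite exchange_big; apply: eq_bigr => j _.
  by rewrite (pick (fun i => Y i j *m Y j l) (fun=> sg j) k).
rewrite subrK; apply/eqP; rewrite subr_eq0; apply/eqP; apply: eq_bigr => i _.
congr (_ *: _); rewrite /s.
by case: (par i); case: (par k); case: (par l); rewrite //= ?expr0 ?expr1; ring.
Qed.

Lemma rrE i : 2 * sg i * rr i = (\sum_(j < N | (i < j)%N) sg j) - \sum_(j < N | (j < i)%N) sg j.
Proof.
rewrite /rr; set x := _ - _; have : sg i * sg i = 1 by rewrite -signr_addb addbb.
have : (2 : K) != 0 by rewrite pnatr_eq0.
move: (sg i) => e h2 he; rewrite [LHS](_ : _ = (e * e) * x); last by field.
by rewrite he mul1r.
Qed.

Definition q0 : K := \sum_i sg i * (rr i * rr i).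

(** With [i < j], in [Y j i *m Y i j] the raising operator acts first on a row vector, so the double
    sum dies on singular vectors. The reordering produces the linear terms in [rr], that is, the
    rho-shift. *)
Lemma CasE : Cas = \sum_i sg i *: (Y i i *m Y i i + (2 * rr i) *: Y i i)
   + \sum_(i < N) \sum_(j < N | (i < j)%N) (2 * sg i) *: (Y j i *m Y i j).
Proof.
rewrite /Cas.
have -> : \sum_i \sum_j sg j *: (Y i j *m Y j i) =
  \sum_i sg i *: (Y i i *m Y i i) + (\sum_(i < N) \sum_(j < N | (i < j)%N) sg j *: (Y i j *m Y j i)
   + \sum_(i < N) \sum_(j < N | (i < j)%N) sg i *: (Y j i *m Y i j)).
  have -> : \sum_(i < N) \sum_(j < N | (i < j)%N) sg i *: (Y j i *m Y i j) =
     \sum_(i < N) \sum_(j < N | (j < i)%N) sg j *: (Y i j *m Y j i).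
    by rewrite (exchange_big_dep xpredT).
  rewrite -!big_split; apply: eq_bigr => i _ /=; rewrite (bigD1 i) //=; congr (_ + _).
  rewrite (bigID (fun j : 'I_N => (i < j)%N)) /=; congr (_ + _); apply: eq_bigl => j.
    by rewrite -val_eqE /=; case: ltngtP.
  by rewrite -val_eqE /=; case: ltngtP.
have sgij i j : sg j * sgn4 i j j i = sg i :> K.
  by rewrite /sgn4 (addbC (par j)) andbb; case: (par i); case: (par j); rewrite //= ?expr0 ?expr1; ring.
have -> : \sum_(i < N) \sum_(j < N | (i < j)%N) sg j *: (Y i j *m Y j i) =
  \sum_(i < N) \sum_(j < N | (i < j)%N) sg i *: (Y j i *m Y i j) +
  \sum_(i < N) \sum_(j < N | (i < j)%N) (sg j *: Y i i - sg i *: Y j j).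
  rewrite -big_split; apply: eq_bigr => i _; rewrite -big_split; apply: eq_bigr => j _ /=.
  by rewrite Ym_rel !eqxx !scale1r scalerDr scalerBr !scalerA sgij.
rewrite [in RHS](eq_bigr (fun i => sg i *: (Y i i *m Y i i) + (2 * sg i * rr i) *: Y i i)); last first.
  by move=> i _; rewrite scalerDr scalerA; congr (_ + _ *: _); ring.
rewrite big_split /= -!addrA; congr (_ + _).
have -> : \sum_i (2 * sg i * rr i) *: Y i i =
  \sum_(i < N) \sum_(j < N | (i < j)%N) (sg j *: Y i i - sg i *: Y j j).
  under eq_bigr => i _ do rewrite rrE scalerBl !scaler_suml.
  rewrite sumrB; under [RHS]eq_bigr => i _ do rewrite sumrB.
  rewrite sumrB; congr (_ - _); rewrite (exchange_big_dep xpredT) //=.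
rewrite addrCA; congr (_ + _); rewrite -big_split; apply: eq_bigr => i _.
by rewrite -big_split; apply: eq_bigr => j _ /=; rewrite -scalerDl; congr (_ *: _); ring.
Qed.

Lemma chi_bounded (A : 'M[K]_d) : bounded (fun y => \tr (A *m Pm y)).
Proof.
exists (\sum_b \sum_k `|lb b k|) => y nz k.
have [b eb] : exists b, lb b = y.
  apply: contrapT => h; case/eqP: nz; rewrite /mxtrace big1 // => b _.
  rewrite mulPm mxE; case: eqP => [e|]; last by rewrite mulr0.
  by case: h; exists b.
rewrite -eb /psum (bigD1 b) //= -[leLHS]addr0 lerD //; last first.
  by apply: sumr_ge0 => c _; apply: sumr_ge0.
by rewrite big_mkcond; apply: ler_sum => i _; case: ifP => _ //; apply: ler_norm.
Qed.
(** For an idempotent [A] commuting with the action this is the character of its image in shifted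
    labels. A trace also allows [A] to contain a polynomial in the Casimir element. *)
Definition chi (A : 'M[K]_d) : bser K N := Bser (chi_bounded A).

Lemma chiE A y : chi A y = \tr (A *m Pm y). Proof. by []. Qed.

Definition commutant (A : 'M[K]_d) := forall i j, A *m Y i j = Y i j *m A.

Definition Dser (A : 'M[K]_d) : bser K N := opR K par (chi A).

(** Freudenthal's argument: cyclicity of the trace relates [Y j i Y i j] at a weight to
    [Y i j Y j i] at that weight plus the root, and the bracket relation between the two products is
    the recursion required by [opR_radial]. *)
Lemma Dser_Cas A : commutant A ->
  forall y, Dser (A *m Cas) y = ((Qform par y)%:~R - q0) * Dser A y.
Proof.
move=> cA y; pose U (i j : 'I_N) := chi ((2 * sg i) *: (A *m (Y j i *m Y i j))).
have hU (i j : 'I_N) : (i < j)%N -> forall y, U i j y - (-1) ^+ (par i (+) par j) * U i j (y + root i j) =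
     ((((-1) ^+ par i * (y + root i j) i - (-1) ^+ par j * (y + root i j) j) *+ 2 - casdiff par i j)%:~R
     * chi A (y + root i j)).
  move=> ij z; rewrite /U !chiE -!scalemxAl !mxtraceZ.
  have -> : \tr (A *m (Y j i *m Y i j) *m Pm z) = \tr (A *m (Y i j *m Y j i) *m Pm (z + root i j)).
    have -> : A *m (Y j i *m Y i j) *m Pm z = (Y j i *m A) *m (Y i j *m Pm z).
      by rewrite mulmxA cA !mulmxA.
    rewrite mxtrace_mulC.
    have -> : Y i j *m Pm z *m (Y j i *m A) = (Y i j *m Y j i *m Pm (z + root i j)) *m A.
      by rewrite mulmxA -(mulmxA _ (Pm z)) Pm_shift !mulmxA.
    by rewrite mxtrace_mulC !mulmxA.
  rewrite Ym_rel !eqxx !scale1r.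
  have s4 : sgn4 i j j i = (-1) ^+ (par i (+) par j) by rewrite /sgn4 (addbC (par j)) andbb.
  rewrite s4 !(mulmxDr, mulmxDl, mulmxN, mulNmx) -!scalemxAr -!scalemxAl -!mulmxA !Pm_diag.
  rewrite !mxtraceD raddfN /= -!scalemxAr !mxtraceZ !mulmxA.
  set t := \tr _; set x := \tr _; set v := z + root i j.
  have e2 : 2 * sg i * rr i - 2 * sg j * rr j = (casdiff par i j)%:~R.
    have -> : (casdiff par i j)%:~R = sg i + sg j + (\sum_(k < N | (i < k < j)%N) sg k) *+ 2.
      rewrite /casdiff !(rmorphD, rmorphMn, rmorph_sum, rmorph_sign) mulr2n /=.
      by congr (_ + _ + (_ + _)); apply: eq_bigr => k _; rewrite rmorph_sign.
    rewrite !rrE.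
    rewrite [X in X - _](_ : _ = \sum_(k < N) ((i < k)%N%:R * sg k - (k < i)%N%:R * sg k)); last first.
      by rewrite sumrB; congr (_ - _); rewrite big_mkcond; apply: eq_bigr => k _; case: ifP; rewrite ?mul1r ?mul0r.
    rewrite [X in _ - X](_ : _ = \sum_(k < N) ((j < k)%N%:R * sg k - (k < j)%N%:R * sg k)); last first.
      by rewrite sumrB; congr (_ - _); rewrite big_mkcond; apply: eq_bigr => k _; case: ifP; rewrite ?mul1r ?mul0r.
    rewrite -sumrB (bigD1 i) //= (bigD1 j) /=; last by rewrite -val_eqE /= gtn_eqF.
    rewrite !ltnn ij (leq_gtF (ltnW ij)) addrA; congr (_ + _); first by rewrite /=; ring.
    rewrite -sumrMnl [RHS]big_mkcond [RHS](bigD1 i) //= ltnn add0r [RHS](bigD1 j) /=; last first.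
      by rewrite -val_eqE /= gtn_eqF.
    rewrite ltnn andbF add0r; apply: eq_bigr => k /andP[]; rewrite -!val_eqE /= => ki kj.
    move: (sg k) => e; case: (ltngtP i k) ki => // ik _; case: (ltngtP k j) kj => // kj _ /=; try ring.
    by move: (ltn_trans kj (ltn_trans ik ij)); rewrite ltnn.
  rewrite !(rmorphB, rmorphMn, rmorphM, rmorph_sign) /= -e2.
  have : sg i * (-1) ^+ (par i (+) par j) = sg j by rewrite -signr_addb addKb.
  move: ((-1) ^+ (par i (+) par j)) => s hs; rewrite -hs; ring.
have hF : chi (A *m Cas) = Bser (boundedM (fun y => (Qform par y)%:~R) (bserP (chi A))) +
      \sum_(i < N) \sum_(j < N | (i < j)%N) U i j - Bser (boundedM (fun=> q0) (bserP (chi A))).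
  apply: bserE => z; rewrite -[RHS]/(_ + (\sum_(i < N) \sum_(j < N | (i < j)%N) U i j) z - q0 * chi A z) /=.
  rewrite bser_sumE CasE mulmxDr mulmxDl mxtraceD addrAC; congr (_ + _).
    rewrite mulmx_sumr mulmx_suml raddf_sum /= -mulrBl /Qform /q0 rmorph_sum -sumrB mulr_suml.
    apply: eq_bigr => i _; rewrite -mulmxA -scalemxAl -scalemxAr mxtraceZ mulmxDl -mulmxA.
    rewrite -scalemxAl !Pm_diag -scalemxAr Pm_diag !scalerA -scalerDl -scalemxAr mxtraceZ.
    by rewrite !rmorphM rmorph_sign /=; ring.
  rewrite mulmx_sumr mulmx_suml raddf_sum; apply: eq_bigr => i _.
  rewrite mulmx_sumr mulmx_suml raddf_sum bser_sumE; apply: eq_bigr => j _ /=.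
  by rewrite -!scalemxAr.
rewrite /Dser hF efunD endoN -[LHS]/(_ + _) -(opR_radial hU) mulrBl; congr (_ - _).
exact: opR_scale.
Qed.

(** Powers and polynomial evaluation for square matrices whose size may be zero. *)
Fixpoint mpow (A : 'M[K]_d) n := if n is n'.+1 then A *m mpow A n' else 1%:M.
Definition mhorner (p : {poly K}) (A : 'M[K]_d) := \sum_(i < size p) p`_i *: mpow A i.

Lemma comm_Cas_mpow n : commutant (mpow Cas n).
Proof.
elim: n => [|n IH] i j /=; first by rewrite mul1mx mulmx1.
by rewrite -mulmxA IH mulmxA Cas_comm mulmxA.
Qed.

Lemma commutantM A B : commutant A -> commutant B -> commutant (A *m B).
Proof. by move=> hA hB i j; rewrite -mulmxA hB mulmxA hA mulmxA. Qed.

Lemma commutant_sum I (r : seq I) (P : pred I) F :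
  (forall i, P i -> commutant (F i)) -> commutant (\sum_(i <- r | P i) F i).
Proof.
move=> h; elim/big_rec: _ => [|i x Pi hx] k l; first by rewrite mul0mx mulmx0.
by rewrite mulmxDl mulmxDr hx h.
Qed.

Lemma comm_mhorner p : commutant (mhorner p Cas).
Proof.
apply: commutant_sum => i _ k l.
by rewrite -scalemxAl -scalemxAr comm_Cas_mpow.
Qed.

Lemma chi_sum I (r : seq I) (P : pred I) F : chi (\sum_(i <- r | P i) F i) = \sum_(i <- r | P i) chi (F i).
Proof.
apply: bserE => y; rewrite bser_sumE chiE mulmx_suml raddf_sum; apply: eq_bigr => //.
Qed.

Lemma chi_scale (c : K) (A : 'M[K]_d) : chi (c *: A) = bscale N c (chi A).
Proof. by apply: bserE => y; rewrite /= -scalemxAl mxtraceZ. Qed.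

Lemma endo_sum (V : zmodType) (e : endo V) I (r : seq I) (P : pred I) F :
  e (\sum_(i <- r | P i) F i) = \sum_(i <- r | P i) e (F i).
Proof. by elim/big_rec2: _ => [|i x y _ <-]; rewrite ?endo0 ?efunD. Qed.

Lemma Dser_horner A p y : commutant A ->
  Dser (A *m mhorner p Cas) y = p.[(Qform par y)%:~R - q0] * Dser A y.
Proof.
move=> cA; rewrite horner_coef mulr_suml /mhorner mulmx_sumr /Dser chi_sum endo_sum bser_sumE.
apply: eq_bigr => i _; rewrite -scalemxAr chi_scale opR_scale -mulrA; congr (_ * _).
rewrite -[LHS]/(Dser (A *m mpow Cas i) y) -[X in _ * X]/(Dser A y).
elim: (i : nat) A cA => [|n IH] A cA /=; first by rewrite mulmx1 expr0 mul1r.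
rewrite mulmxA IH; last by apply: commutantM => // k l; exact: Cas_comm.
by rewrite Dser_Cas // exprSr mulrA.
Qed.

Lemma mhornerM p q : mhorner (p * q) Cas = mhorner p Cas *m mhorner q Cas.
Proof.
have mE e (A : 'M[K]_e.+1) (r : {poly K}) : \sum_(i < size r) r`_i *: iter i (mulmx A) 1%:M = horner_mx A r.
  rewrite -[in RHS](coefK r) poly_def rmorph_sum; apply: eq_bigr => i _ /=.
  rewrite linearZ /= rmorphXn /= horner_mx_X; congr (_ *: _).
  by elim: (i : nat) => // n IH; rewrite iterS IH exprS.
have mE2 (r : {poly K}) : mhorner r Cas = \sum_(i < size r) r`_i *: iter i (mulmx Cas) 1%:M.
  apply: eq_bigr => i _; congr (_ *: _).
  by elim: (i : nat) => // n IH /=; rewrite IH.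
rewrite !mE2; move: (Cas); case: (d) => [|e] A; last by rewrite !mE rmorphM.
by apply/matrixP => -[].
Qed.

Lemma mhorner_id e (c : K) (A : 'M[K]_(e, d)) : A *m Cas = c *: A -> forall p, A *m mhorner p Cas = p.[c] *: A.
Proof.
move=> h p; rewrite horner_coef /mhorner mulmx_sumr scaler_suml; apply: eq_bigr => i _.
rewrite -scalemxAr -scalerA; congr (_ *: _).
elim: (i : nat) => [|n IH] /=; first by rewrite mulmx1 expr0 scale1r.
by rewrite mulmxA h -scalemxAl IH scalerA -exprS.
Qed.

End Rep.

(** * Highest weight modules and translation functors *)

Section HighestWeight.
Variables (K : numFieldType) (N : nat) (par : 'I_N -> bool).
Local Notation wt := (wt N).
Local Notation srep := (srep K par).

Definition dominant (y : wt) := forall i j : 'I_N,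
  j = i.+1 :> nat -> par i = par j -> y j < y i.

Lemma rr_adj (i j : 'I_N) : j = i.+1 :> nat -> par i = par j ->
  rr K par i - rr K par j = 1.
Proof.
move=> ij pij; have := rrE K par i; have := rrE K par j; rewrite -pij.
set e : K := (-1) ^+ par i => hj hi.
have he : e * e = 1 by rewrite /e -signr_addb addbb.
suff h : 2 * e * rr K par i - 2 * e * rr K par j = 2 * e.
  have h2 : (2 : K) != 0 by rewrite pnatr_eq0.
  apply: (mulfI h2); rewrite mulr1 mulrBr.
  have -> : 2 * rr K par i - 2 * rr K par j = e * (2 * e * rr K par i - 2 * e * rr K par j).
    rewrite -[in LHS](mul1r (2 * rr K par i)) -[in LHS](mul1r (2 * rr K par j)) -he; ring.
  by rewrite h mulrCA he mulr1.
rewrite hi hj.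
have e1 : \sum_(k < N | (i < k)%N) (-1) ^+ par k = e + \sum_(k < N | (j < k)%N) (-1) ^+ par k :> K.
  rewrite (bigD1 j) /= ?ij // -pij; congr (_ + _); apply: eq_bigl => k.
  by rewrite -val_eqE /=; lia.
have e2 : \sum_(k < N | (k < j)%N) (-1) ^+ par k = e + \sum_(k < N | (k < i)%N) (-1) ^+ par k :> K.
  rewrite (bigD1 i) /= ?ij //; congr (_ + _); apply: eq_bigl => k.
  by rewrite -val_eqE /=; lia.
by rewrite e1 e2; ring.
Qed.

Section Module.
Variable M : srep.
Local Notation Y := (@Ym _ _ _ M).
Local Notation lb := (@lab _ _ _ M).
Local Notation d := (dim M).
Implicit Types (x u : 'rV[K]_d) (P : 'rV[K]_d -> Prop).

Record submod P : Prop := Submod {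
  submod0 : P 0;
  submodL : forall a x y, P x -> P y -> P (a *: x + y);
  submodY : forall i j x, P x -> P (x *m Y i j) }.

(** For [P = zerop] this is singularity. Arguing modulo an arbitrary submodule lets the same lemmas
    prove vanishing and generation. *)
Definition raises P x := forall i j : 'I_N, (j < i)%N -> P (x *m Y i j).
Definition zerop x := x = 0.

Lemma submod_zero : submod zerop.
Proof.
split=> [//|a x y -> ->|i j x ->]; first by rewrite /zerop scaler0 addr0.
by rewrite /zerop mul0mx.
Qed.

Section SubmodTheory.
Variable (P : 'rV[K]_d -> Prop) (hP : submod P).
Lemma submodD x y : P x -> P y -> P (x + y).
Proof. by move=> hx hy; rewrite -(scale1r x); apply: submodL. Qed.
Lemma submodZ a x : P x -> P (a *: x).
Proof. by move=> hx; rewrite -[_ *: _]addr0; apply: submodL => //; apply: submod0. Qed.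
Lemma submodB x y : P x -> P y -> P (x - y).
Proof. by move=> hx hy; rewrite addrC -scaleN1r; apply: submodL. Qed.
Lemma submodZI a x : a != 0 -> P (a *: x) -> P x.
Proof. by move=> a0 /(submodZ a^-1); rewrite scalerA mulVf // scale1r. Qed.
Lemma submod_sum I (r : seq I) (C : pred I) F :
  (forall i, C i -> P (F i)) -> P (\sum_(i <- r | C i) F i).
Proof.
move=> h; elim/big_rec: _ => [|i x Ci hx]; first exact: submod0.
by apply: submodD => //; apply: h.
Qed.

Lemma Cas_singular x y : x *m Pm M y = x -> raises P x ->
  P (x *m Cas M - ((Qform par y)%:~R - q0 K par) *: x).
Proof.
move=> hx hr; rewrite CasE mulmxDr addrAC; apply: submodD; last first.
  rewrite mulmx_sumr; apply: submod_sum => i _; rewrite mulmx_sumr.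
  apply: submod_sum => j ij; rewrite -scalemxAr; apply: submodZ.
  by rewrite mulmxA; apply: submodY => //; apply: hr.
have hY i : x *m Y i i = ((y i)%:~R - rr K par i) *: x.
  rewrite -{1}hx -mulmxA.
  have -> : Pm M y *m Y i i = Y i i *m Pm M y.
    by rewrite Pm_shift subrr addr0.
  by rewrite Pm_diag -scalemxAr hx.
have -> : x *m \sum_i (-1) ^+ par i *: (Y i i *m Y i i + (2 * rr K par i) *: Y i i) =
   ((Qform par y)%:~R - q0 K par) *: x.
  rewrite mulmx_sumr /Qform /q0 rmorph_sum -sumrB scaler_suml; apply: eq_bigr => i _.
  rewrite -scalemxAr mulmxDr mulmxA hY -!(scalemxAl, scalemxAr) hY !scalerA -scalerDl scalerA.
  by congr (_ *: _); rewrite !rmorphM rmorph_sign /=; ring.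
by rewrite subrr; apply: submod0.
Qed.

Lemma horner_mod c x : P (x *m Cas M - c *: x) -> forall p, P (x *m mhorner p (Cas M) - p.[c] *: x).
Proof.
move=> h p; rewrite horner_coef /mhorner mulmx_sumr scaler_suml -sumrB.
apply: submod_sum => i _; rewrite -scalemxAr -scalerA -scalerBr; apply: submodZ.
elim: (i : nat) => [|n IH] /=; first by rewrite mulmx1 expr0 scale1r subrr; apply: submod0.
have -> : x *m (Cas M *m mpow (Cas M) n) - c ^+ n.+1 *: x =
    (x *m mpow (Cas M) n - c ^+ n *: x) *m Cas M + c ^+ n *: (x *m Cas M - c *: x).
  rewrite mulmxBl -scalemxAl scalerBr scalerA -exprSr addrA subrK; congr (_ - _).
  by rewrite -[RHS]mulmxA; congr (_ *m _); elim: n {IH} => /= [|n IH]; rewrite ?mulmx1 ?mul1mx // -mulmxA -IH.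
apply: submodD; last exact: submodZ.
rewrite /Cas mulmx_sumr; apply: submod_sum => k _; rewrite mulmx_sumr; apply: submod_sum => l _.
by rewrite -scalemxAr; apply: submodZ; rewrite mulmxA; do 2!apply: submodY => //.
Qed.

(** The Casimir element minus [c] is nilpotent on the image of [Pi] but acts on [x] modulo [P] as
    the nonzero scalar [a - c]. *)
Lemma nilp_mod (Pi : 'M[K]_d) n c a x : Pi *m mhorner (('X - c%:P) ^+ n) (Cas M) = 0 ->
  x *m Pi = x -> P (x *m Cas M - a *: x) -> a != c -> P x.
Proof.
move=> hn hx h ac; have := horner_mod h (('X - c%:P) ^+ n).
rewrite -{1}hx -mulmxA hn mulmx0 sub0r -scaleNr horner_exp hornerXsubC.
by apply: submodZI; rewrite oppr_eq0 expf_neq0 // subr_eq0.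
Qed.

(** sl_2 theory modulo [P]: in shifted labels the weight of [x] is [k = y i - y j - 1], which is
    negative here, so the coefficients [(n + 1) (k - n)] never vanish and membership in [P] descends
    from a power of the lowering operator that kills [x] to [x] itself. *)
Lemma nondominant_mod (i j : 'I_N) x y : j = i.+1 :> nat -> par i = par j ->
  x *m Pm M y = x -> P (x *m Y j i) -> ~~ (y j < y i) -> P x.
Proof.
move=> ij pij hx hr nd; pose xn n := iter n (fun u => u *m Y i j) x.
have wxn n : xn n *m Pm M (y + (eps j - eps i) *+ n) = xn n.
  elim: n => [|n IH]; first by rewrite addr0.
  rewrite -[xn n.+1]/(xn n *m Y i j) mulrSr addrA -[RHS](congr1 (mulmx^~ (Y i j)) IH).
  by rewrite -[RHS]mulmxA Pm_shift mulmxA.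
have hdiag n k : xn n *m Y k k = (((y + (eps j - eps i) *+ n) k)%:~R - rr K par k) *: xn n.
  rewrite -{1}wxn -mulmxA.
  have -> : Pm M (y + (eps j - eps i) *+ n) *m Y k k = Y k k *m Pm M (y + (eps j - eps i) *+ n).
    by rewrite Pm_shift subrr addr0.
  by rewrite Pm_diag -scalemxAr wxn.
pose k : K := (y i)%:~R - (y j)%:~R - 1.
have nij : (i == j) = false by apply/negbTE; rewrite -val_eqE /= ij; lia.
have nji : (j == i) = false by rewrite eq_sym.
have rel n : P (xn n.+1 *m Y j i - (n.+1%:R * (k - n%:R)) *: xn n).
  elim: n => [|n IH].
    rewrite /= -mulmxA Ym_rel; have -> : sgn4 K par i j j i = 1 by rewrite /sgn4 pij addbb.
    rewrite !eqxx !scale1r mulmxDr mulmxA mulmxBr -[X in _ + (X - _)]/(xn 0%N *m Y i i) -[X in _ + (_ - X)]/(xn 0%N *m Y j j).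
    rewrite !hdiag /= !addr0 -scalerBl.
    rewrite [X in _ + X - _](_ : _ = (1%:R * (k - 0%:R)) *: x); first by rewrite addrK; apply: submodY.
    congr (_ *: _); rewrite subr0 mul1r /k -(rr_adj ij pij); ring.
  have -> : xn n.+2 *m Y j i = xn n.+1 *m Y j i *m Y i j + (xn n.+1 *m Y i i - xn n.+1 *m Y j j).
    rewrite [xn n.+2]/= -/(xn n.+1) -mulmxA Ym_rel; have -> : sgn4 K par i j j i = 1 by rewrite /sgn4 pij addbb.
    by rewrite !eqxx !scale1r mulmxDr mulmxA mulmxBr.
  rewrite !hdiag -scalerBl.
  have -> : (((y + (eps j - eps i) *+ n.+1) i)%:~R - rr K par i - (((y + (eps j - eps i) *+ n.+1) j)%:~R - rr K par j)) = k - (n.+1)%:R *+ 2.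
    rewrite !(ffunE, ffunMnE) !eqxx nij nji /= sub0r subr0 mulNrn.
    have e1 : (1 *+ n.+1 : int)%:~R = n.+1%:R :> K by rewrite rmorphMn.
    rewrite rmorphB rmorphD /= e1 mulr2n /k -(rr_adj ij pij); move: (n.+1%:R : K) => t; ring.
  have -> : xn n.+1 *m Y j i *m Y i j + (k - n.+1%:R *+ 2) *: xn n.+1 - (n.+2%:R * (k - n.+1%:R)) *: xn n.+1 =
     (xn n.+1 *m Y j i - (n.+1%:R * (k - n%:R)) *: xn n) *m Y i j.
    rewrite mulmxBl -scalemxAl -[xn n *m Y i j]/(xn n.+1) -addrA; congr (_ + _).
    rewrite -scalerBl -scaleNr; congr (_ *: _); rewrite -[n.+2]addn1 -[n.+1]addn1 !natrD; ring.
  exact: submodY.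
have [n hn] : exists n, xn n = 0.
  (* Each application of [Y i j] raises the [j]-th label by one, so beyond [B] no label is left. *)
  pose B := \sum_b `|lb b j|; exists (`|B - y j|%N.+1).
  set n := _.+1; apply/rowP => b; rewrite -wxn mulPm !mxE.
  case: eqP => [e|]; last by rewrite mulr0.
  have : lb b j <= B.
    by rewrite /B (bigD1 b) //= -[leLHS]addr0 lerD ?ler_norm // sumr_ge0.
  rewrite e !(ffunE, ffunMnE) eqxx nji /= subr0.
  have -> : (1 *+ n : int) = n%:Z by rewrite natz.
  by rewrite /n => h; suff: False by []; lia.
have hxn m : P (xn (n - m)%N).
  elim: m => [|m IH]; first by rewrite subn0 hn; apply: submod0.
  have [le|lt] := leqP n m.
    by have -> : (n - m.+1 = n - m)%N by lia.
  have e : (n - m = (n - m.+1).+1)%N by lia.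
  rewrite e in IH; move: {e lt} (n - m.+1)%N IH => l IH.
  have := submodB (submodY hP j i IH) (rel l); rewrite opprB addrCA subrr addr0.
  apply: submodZI; rewrite mulf_neq0 ?pnatr_eq0 //.
  have -> : k - l%:R = (y i - y j - 1 - l%:Z)%:~R by rewrite /k !rmorphB.
  by rewrite intr_eq0; move: nd; lia.
by have := hxn n; rewrite subnn.
Qed.
End SubmodTheory.

(** [hw_socle] and [hw_gen] together express that the image of [Pi] is simple: a nonzero submodule
    contains a singular weight vector, hence [v]. Both can be tested on leading terms in a tensor
    product. *)
Record hwm (Pi : 'M[K]_d) (v : 'rV[K]_d) (z : wt) : Prop := Hwm {
  hw_comm : commutant Pi;
  hw_idem : Pi *m Pi = Pi;
  hw_neq0 : v != 0;
  hw_vPi : v *m Pi = v;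
  hw_wt : v *m Pm M z = v;
  hw_sing : raises zerop v;
  hw_socle : forall x y, x *m Pi = x -> x *m Pm M y = x -> raises zerop x ->
    exists c, x = c *: v;
  hw_gen : forall P, submod P -> P v -> forall u, P (u *m Pi) }.

End Module.
End HighestWeight.

Section Tensor.
Variables (K : numFieldType) (N : nat) (par : 'I_N -> bool).
Local Notation wt := (wt N).
Local Notation srep := (srep K par).

Section HwmTheory.
Variables (M : srep) (Pi : 'M[K]_(dim M)) (v : 'rV[K]_(dim M)) (z : wt).
Hypothesis hM : hwm Pi v z.
Local Notation Y := (@Ym _ _ _ M).

Lemma Pm_comm (A : 'M_(dim M)) y : commutant A -> A *m Pm M y = Pm M y *m A.
Proof.
move=> cA; apply/matrixP => b c; rewrite mul_mx_diag mul_diag_mx !mxE mulrC.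
have [->|nz] := eqVneq (A b c) 0; first by rewrite !mulr0.
congr (_%:R * _); congr (_ == y : nat); apply/ffunP => k.
have := cA k k; rewrite Ym_diag => /matrixP/(_ b c).
rewrite mul_mx_diag mul_diag_mx !mxE [RHS]mulrC => /(mulfI nz) /addIr /intr_inj.
by [].
Qed.

Lemma hwm_top_eq y (x : 'rV_(dim M)) : x *m Pi = x -> x *m Pm M y = x -> x != 0 -> raises (@zerop _ _ _ M) x ->
  y = z.
Proof.
move=> h1 h2 h3 h4; have [c xc] := hw_socle hM h1 h2 h4.
have c0 : c != 0 by apply: contraNneq h3 => c0; rewrite xc c0 scale0r.
have vy : v *m Pm M y = v.
  by apply: (scalerI c0); rewrite scalemxAl -xc h2 xc.
apply/eqP/negPn/negP => ne; move: (hw_neq0 hM).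
have -> : v = 0 by rewrite -vy -[X in X *m _](hw_wt hM) -mulmxA PmP eq_sym (negbTE ne) scale0r mulmx0.
by rewrite eqxx.
Qed.

(** A weight vector that maximizes [psum k] and then the height [h] is singular, hence of weight
    [z]. *)
Lemma hwm_psum (x : 'rV_(dim M)) y k : x *m Pi = x -> x *m Pm M y = x -> x != 0 -> psum k y <= psum k z.
Proof.
move=> hx1 hx2 hx0.
pose isw (b : 'I_(dim M)) : bool := `[< exists u : 'rV[K]_(dim M), [/\ u *m Pi = u, u *m Pm M (@lab _ _ _ M b) = u & u != 0] >].
have lab_ex (u : 'rV_(dim M)) w : u *m Pm M w = u -> u != 0 -> exists b, @lab _ _ _ M b = w.
  move=> hu u0; apply: contrapT => h; case/eqP: u0; rewrite -hu mulPm.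
  apply/matrixP => i b; rewrite !mxE; case: eqP => [e|]; last by rewrite mulr0.
  by case: h; exists b.
have [b0 eb0] := lab_ex _ _ hx2 hx0.
pose h (w : wt) : int := \sum_(i < N) ((N - i)%N%:Z) * w i.
pose A : int := \sum_(b < dim M) `|h (@lab _ _ _ M b)|.
(* A raising operator never lowers [psum k] and strictly raises [h]. The factor [2 A + 1] exceeds
   every difference of values of [h], so [L] is a lexicographic order. *)
pose L (b : 'I_(dim M)) : int := psum k (@lab _ _ _ M b) * (A *+ 2 + 1) + h (@lab _ _ _ M b).
have hAb b : `|h (@lab _ _ _ M b)| <= A.
  by rewrite /A (bigD1 b) //= -[leLHS]addr0 lerD // sumr_ge0.
have hb0 : isw b0 by apply/asboolP; exists x; rewrite eb0.
case: (@arg_maxP _ _ _ b0 isw L hb0) => b /asboolP[u [u1 u2 u0]] bmax.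
have bz : lab b = z.
  apply: (hwm_top_eq u1 u2 u0) => i j ji; apply/eqP/negPn/negP => nz.
  have uw : u *m Y i j *m Pm M (lab b + (eps j - eps i)) = u *m Y i j.
    by rewrite -mulmxA -Pm_shift mulmxA u2.
  have [c ec] := lab_ex _ _ uw nz.
  have : isw c.
    by apply/asboolP; exists (u *m Y i j); rewrite ec -mulmxA -(hw_comm hM) mulmxA u1.
  move/bmax; rewrite /L ec -/(root j i) psumD psum_root //.
  have -> : h (lab b + root j i) = h (lab b) + (i - j)%N.
    have hD a c' : h (a + c') = h a + h c'.
      by rewrite /h -big_split; apply: eq_bigr => l _; rewrite ffunE mulrDr.
    have he a : h (eps a) = (N - a)%N.
      rewrite /h (bigD1 a) //= ffunE eqxx mulr1 big1 ?addr0 // => l /negbTE la.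
      by rewrite ffunE la mulr0.
    have hN a : h (- a) = - h a by rewrite /h -sumrN; apply: eq_bigr => l _; rewrite ffunE mulrN.
    rewrite hD /root hD hN !he; congr (_ + _); have := ltn_ord i; lia.
  have : 0 <= A by apply: sumr_ge0.
  by rewrite /A => A0; case: (_ <= _)%N; rewrite ?mulr1n ?mulr0n; nia.
have := bmax b0 hb0; rewrite /L eb0 bz.
have := hAb b; have := hAb b0; rewrite eb0 bz.
have : 0 <= A by apply: sumr_ge0.
move: (A) (h z) (h y) (psum k z) (psum k y) => a hz hy pz py ? ? ? ?.
by rewrite leNgt; apply/negP => ?; nia.
Qed.

Lemma chi_hwm_supp y k : chi Pi y != 0 -> psum k y <= psum k z.
Proof.
rewrite chiE => nz.
have [b hb] : exists b, row b (Pi *m Pm M y) != 0.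
  apply: contrapT => h; case/eqP: nz; rewrite /mxtrace big1 // => b _.
  have : row b (Pi *m Pm M y) == 0 by apply/negPn/negP => hb; apply: h; exists b.
  by move=> /eqP/rowP/(_ b); rewrite !mxE.
apply: (hwm_psum k _ _ hb).
  by rewrite -row_mul -mulmxA -Pm_comm ?mulmxA ?(hw_idem hM) //; apply: hw_comm hM.
by rewrite -row_mul -mulmxA PmP eqxx scale1r.
Qed.

Lemma root_cone (i j : 'I_N) (y : wt) : (i < j)%N ->
  (forall k, psum k (y + root i j) <= psum k z) -> forall k, psum k y <= psum k z.
Proof. by move=> ij h k; have := h k; rewrite psumD psum_root //; case: (_ <= _)%N => /=; lia. Qed.

Lemma D_hwm_supp y k : Dser Pi y != 0 -> psum k y <= psum k z.
Proof.
move: k y; suff h y : Dser Pi y != 0 -> forall k, psum k y <= psum k z by move=> k y /h.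
apply: (opR_support (P := fun y => forall k, psum k y <= psum k z)).
  by move=> i j ij w; apply: root_cone.
by move=> w hw k; apply: chi_hwm_supp.
Qed.

Lemma hwm_wtspace (x : 'rV_(dim M)) : x *m Pi = x -> x *m Pm M z = x -> exists c, x = c *: v.
Proof.
move=> h1 h2; apply: (hw_socle hM h1 h2) => i j ji; apply/eqP/negPn/negP => nz.
have w1 : x *m Y i j *m Pi = x *m Y i j by rewrite -mulmxA -(hw_comm hM) mulmxA h1.
have w2 : x *m Y i j *m Pm M (z + root j i) = x *m Y i j.
  by rewrite -mulmxA -Pm_shift mulmxA h2.
by have := hwm_psum j.+1 w1 w2 nz; rewrite psumD psum_root // ltnSn ji /=; lia.
Qed.

(** The top weight space of the image is the line of [v], so the trace there is that of a rank one
    idempotent, and [opR] does not alter a top coefficient. *)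
Lemma D_hwm_top : Dser Pi z = 1.
Proof.
rewrite /Dser (@opR_top _ _ _ (fun y => forall k, psum k y <= psum k z)); last 3 first.
- by move=> i j ij w; apply: root_cone.
- by move=> w hw k; apply: chi_hwm_supp.
- move=> i j k ij /(_ i.+1); rewrite psumD psumMn psum_root // ltnSn ij /=; lia.
rewrite chiE; set E := Pi *m Pm M z.
have hE b : exists c, row b E = c *: v.
  apply: hwm_wtspace; rewrite -row_mul -mulmxA ?PmP ?eqxx ?scale1r //.
  by rewrite -Pm_comm ?mulmxA ?(hw_idem hM) //; apply: hw_comm hM.
pose a : 'cV[K]_(dim M) := \col_b projT1 (cid (hE b)).
have eE : E = a *m v.
  apply/row_matrixP => b; rewrite row_mul (projT2 (cid (hE b))).
  by apply/rowP => i; rewrite !mxE big_ord1 !mxE.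
have : v *m E = v by rewrite /E mulmxA (hw_vPi hM) (hw_wt hM).
rewrite eE mulmxA [v *m a]mx11_scalar mul_scalar_mx; set t := (v *m a) 0 0 => /eqP.
rewrite -subr_eq0 -{2}(scale1r v) -scalerBl scaler_eq0 (negbTE (hw_neq0 hM)) orbF subr_eq0 => /eqP h.
by rewrite mxtrace_mulC [v *m a]mx11_scalar -/t mxtrace_scalar h.
Qed.

Lemma Cas_hwm : Pi *m Cas M = ((Qform par z)%:~R - q0 K par) *: Pi.
Proof.
set c := _ - _; have sub : submod (fun u => u *m Cas M = c *: u).
  split=> [|a x y hx hy|i j x hx]; first by rewrite mul0mx scaler0.
    by rewrite mulmxDl -scalemxAl hx hy scalerDr !scalerA mulrC.
  by rewrite -mulmxA -Cas_comm mulmxA hx -scalemxAl.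
have hv : v *m Cas M = c *: v.
  apply/eqP; rewrite -subr_eq0; apply/eqP.
  exact: (Cas_singular (@submod_zero _ _ _ M) (hw_wt hM) (hw_sing hM)).
apply/row_matrixP => b; rewrite row_mul linearZ /= rowE.
exact: (hw_gen hM sub hv).
Qed.

Lemma hwm_dominant : dominant par z.
Proof.
move=> i j ij pij; apply/negPn/negP => h.
have ji : (i < j)%N by rewrite ij.
have := nondominant_mod (@submod_zero _ _ _ M) ij pij (hw_wt hM) (hw_sing hM ji) h.
by move/eqP; rewrite (negbTE (hw_neq0 hM)).
Qed.

End HwmTheory.

(** The spectral projection is [h] at the Casimir element, [h = w g] coming from a Bezout relation.
    On series it multiplies by the value of [h] at the local eigenvalue; the series is supported
    where that eigenvalue is a root of the characteristic polynomial, and there [h] is 1 at [c] and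
    0 elsewhere. *)
Lemma projector (M : srep) (Pi0 : 'M[K]_(dim M)) (c : K) :
  commutant Pi0 -> Pi0 *m Pi0 = Pi0 -> exists Pi : 'M[K]_(dim M),
  [/\ commutant Pi, Pi *m Pi = Pi, Pi *m Pi0 = Pi & Pi0 *m Pi = Pi] /\
  (exists n, Pi *m mhorner (('X - c%:P) ^+ n) (Cas M) = 0) /\
  (forall y, Dser Pi y = ((Qform par y)%:~R - q0 K par == c)%:R * Dser Pi0 y).
Proof.
move=> c0 i0; pose f := char_poly (Cas M).
have f0 : mhorner f (Cas M) = 0.
  have mE e (A : 'M[K]_e.+1) : \sum_(i < size (char_poly A)) (char_poly A)`_i *: iter i (mulmx A) 1%:M = 0.
    rewrite -[RHS](Cayley_Hamilton A) -[in RHS](coefK (char_poly A)) poly_def rmorph_sum.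
    apply: eq_bigr => i _ /=; rewrite linearZ /= rmorphXn /= horner_mx_X; congr (_ *: _).
    by elim: (i : nat) => // n IH; rewrite iterS IH exprS.
  have -> : mhorner f (Cas M) = \sum_(i < size f) f`_i *: iter i (mulmx (Cas M)) 1%:M.
    by apply: eq_bigr => i _; congr (_ *: _); elim: (i : nat) => // n IH /=; rewrite IH.
  rewrite /f; move: (Cas M); case: (dim M) => [|e] A; first by apply/matrixP => -[].
  exact: mE.
have fn0 : f != 0 by apply: monic_neq0; apply: char_poly_monic.
have [n [g gc fE]] := multiplicity_XsubC f c; rewrite fn0 /= in gc.
have cop : coprimep (('X - c%:P) ^+ n) g.
  by rewrite coprimep_expl // coprimep_sym coprimep_XsubC.
have /Bezout_eq1_coprimepP[[u w] /= huw] := cop.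
pose h := w * g; have h1 : u * ('X - c%:P) ^+ n + h = 1 by [].
have hf : exists q, h * h = h + q * f.
  exists (- w * u); rewrite fE -{3}[h]mulr1 -h1 /h; ring.
pose Pi := Pi0 *m mhorner h (Cas M).
have mD p q : Pi0 *m mhorner (p + q) (Cas M) = Pi0 *m mhorner p (Cas M) + Pi0 *m mhorner q (Cas M).
  have ext (s : {poly K}) m : (size s <= m)%N -> mhorner s (Cas M) = \sum_(i < m) s`_i *: mpow (Cas M) i.
    move=> le; rewrite /mhorner (big_ord_widen m (fun i => s`_i *: mpow (Cas M) i) le) big_mkcond.
    by apply: eq_bigr => i _; case: ltnP => // ?; rewrite nth_default ?scale0r.
  pose m := maxn (size p) (size q).
  rewrite (ext p m) ?leq_maxl // (ext q m) ?leq_maxr // (ext (p + q) m) ?size_polyD //.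
  by rewrite -mulmxDr -big_split; congr (_ *m _); apply: eq_bigr => i _; rewrite coefD scalerDl.
have cP : Pi0 *m mhorner h (Cas M) = mhorner h (Cas M) *m Pi0.
  have cm p : Pi0 *m mhorner p (Cas M) = mhorner p (Cas M) *m Pi0.
    rewrite /mhorner mulmx_sumr mulmx_suml; apply: eq_bigr => i _.
    rewrite -scalemxAr -scalemxAl; congr (_ *: _).
    elim: (i : nat) => [|k IH] /=; first by rewrite mulmx1 mul1mx.
    rewrite mulmxA -[RHS]mulmxA -IH !mulmxA; congr (_ *m _).
    rewrite /Cas mulmx_sumr mulmx_suml; apply: eq_bigr => j _; rewrite mulmx_sumr mulmx_suml.
    by apply: eq_bigr => l _; rewrite -scalemxAr -scalemxAl mulmxA c0 -!mulmxA c0.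
  exact: cm.
exists Pi; split; [split|split].
- by apply: commutantM => //; apply: comm_mhorner.
- rewrite /Pi {2}cP mulmxA -(mulmxA Pi0) -mhornerM; have [q ->] := hf.
  by rewrite mD (mhornerM M q f) f0 mulmx0 mulmx0 addr0 cP -mulmxA i0.
- by rewrite /Pi cP -mulmxA i0.
- by rewrite /Pi mulmxA i0.
- exists n; rewrite /Pi -mulmxA -mhornerM.
  have -> : h * ('X - c%:P) ^+ n = w * f by rewrite fE /h; ring.
  by rewrite mhornerM f0 !mulmx0.
- move=> y; rewrite Dser_horner //; set x := _ - _.
  have [-> | D0] := eqVneq (Dser Pi0 y) 0; first by rewrite !mulr0.
  have fx : f.[x] = 0.
    have := Dser_horner f y c0; rewrite f0 mulmx0 -/x.
    have -> : Dser (0 : 'M[K]_(dim M)) y = 0.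
      rewrite /Dser; have -> : chi (0 : 'M[K]_(dim M)) = 0 :> bser K N.
        by apply: bserE => w'; rewrite chiE mul0mx mxtrace0.
      by rewrite endo0.
    by move=> /esym/eqP; rewrite mulf_eq0 (negbTE D0) orbF => /eqP.
  congr (_ * _); have := congr1 (horner^~ x) h1; rewrite hornerD hornerM horner_exp hornerXsubC hornerC.
  have [xc | xc] := eqVneq x c.
    rewrite xc subrr; case: n fE {cop huw h1} => [|n] fE.
      by move: fx gc; rewrite xc fE expr0 mulr1 /poly.root => ->; rewrite eqxx.
    by rewrite expr0n mulr0 add0r.
  move: fx; rewrite fE hornerM horner_exp hornerXsubC => /eqP.
  rewrite mulf_eq0 expf_eq0 subr_eq0 (negbTE xc) andbF orbF => /eqP gx _.
  by rewrite /h hornerM gx mulr0.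
Qed.

End Tensor.

Local Notation "A *t B" := (tensmx A B) (at level 40, left associativity).

(** * Tensor product of a highest weight module with a small module *)

Section TensorProduct.
Variables (K : numFieldType) (N : nat) (par : 'I_N -> bool).
Local Notation wt := (wt N).
Local Notation srep := (srep K par).

Lemma tensDl m n p q (A A' : 'M[K]_(m, n)) (B : 'M[K]_(p, q)) : (A + A') *t B = A *t B + A' *t B.
Proof. by apply/matrixP => i j; rewrite !mxE mulrDl. Qed.
Lemma tensDr m n p q (A : 'M[K]_(m, n)) (B B' : 'M[K]_(p, q)) : A *t (B + B') = A *t B + A *t B'.
Proof. by apply/matrixP => i j; rewrite !mxE mulrDr. Qed.
Lemma tensZl m n p q c (A : 'M[K]_(m, n)) (B : 'M[K]_(p, q)) : (c *: A) *t B = c *: (A *t B).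
Proof. by apply/matrixP => i j; rewrite !mxE mulrA. Qed.
Lemma tensZr m n p q c (A : 'M[K]_(m, n)) (B : 'M[K]_(p, q)) : A *t (c *: B) = c *: (A *t B).
Proof. by apply/matrixP => i j; rewrite !mxE mulrCA. Qed.
Lemma tensNr m n p q (A : 'M[K]_(m, n)) (B : 'M[K]_(p, q)) : A *t (- B) = - (A *t B).
Proof. by rewrite -scaleN1r tensZr scaleN1r. Qed.

(** The order [bord] triangularizes tensor products: a raising operator sends a basis vector of the
    small factor to vectors of strictly smaller [bord]. *)
Record small := Small {
  bd : nat;
  om : 'I_bd -> wt;
  bp : 'I_bd -> bool;
  Zm : 'I_N -> 'I_N -> 'M[K]_bd;
  Zrel : bracket_rel par Zm;
  Zdiag : forall i, Zm i i = diag_mx (\row_k (om k i)%:~R);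
  Zpar : forall i j k l, Zm i j k l != 0 -> bp k (+) bp l = par i (+) par j;
  om_inj : injective om;
  bord : 'I_bd -> nat;
  bord_inj : injective bord;
  Zraise : forall (i j : 'I_N) k l, (j < i)%N -> Zm i j k l != 0 -> (bord l < bord k)%N }.

Variables (B : small) (M : srep).
Local Notation Z := (@Zm B).
Local Notation Y := (@Ym _ _ _ M).
Local Notation b := (bd B).
Local Notation d := (dim M).

(** Koszul sign of a matrix unit passing the [k]-th basis vector. *)
Definition sgB (i j : 'I_N) (k : 'I_b) : K := (-1) ^+ ((par i (+) par j) && bp k).
Definition Sg i j : 'M[K]_b := diag_mx (\row_k sgB i j k).
Definition tY i j : 'M[K]_(b * d) := Z i j *t 1%:M + Sg i j *t Y i j.
Definition tlab (s : 'I_(b * d)) : wt :=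
  om (mxtens_unindex s).1 + @lab _ _ _ M (mxtens_unindex s).2.

Lemma SgM i j k l : Sg i j *m Sg k l = Sg k l *m Sg i j.
Proof. by rewrite !mulmx_diag; congr diag_mx; apply/rowP => s; rewrite !mxE mulrC. Qed.

Lemma SgMM i j l : Sg i j *m Sg j l = Sg i l.
Proof.
rewrite mulmx_diag; congr diag_mx; apply/rowP => s; rewrite !mxE /sgB.
by case: (bp s); rewrite ?andbF ?mulr1 // !andbT -signr_addb addbA -(addbA (par i)) addbb addbF.
Qed.

Lemma ZSg i j k l : Z i j *m Sg k l = sgn4 K par i j k l *: (Sg k l *m Z i j).
Proof.
apply/matrixP => s t; rewrite mul_mx_diag mxE mul_diag_mx !mxE.
have [->|/Zpar h] := eqVneq (Z i j s t) 0; first by rewrite mul0r !mulr0.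
rewrite /sgB /sgn4 -h mulrC mulrA; congr (_ * _).
by rewrite -signr_addb; congr ((-1) ^+ _); case: (par k (+) par l); case: (bp s); case: (bp t).
Qed.

Lemma tY_rel : bracket_rel par tY.
Proof.
move=> i j k l; rewrite /tY; set s := sgn4 K par i j k l.
have ss : s * s = 1 by rewrite /s /sgn4 -signr_addb addbb.
have sC : sgn4 K par k l i j = s by rewrite /s /sgn4 andbC.
rewrite !(mulmxDl, mulmxDr) !tensmx_mul !mul1mx !mulmx1.
rewrite !ZSg sC -/s (Zrel B i j k l) (Ym_rel M i j k l) -/s (SgM k l i j).
rewrite !(tensDl, tensDr, tensZl, tensZr, tensNr, scalerDr, scalerN, scalerA, ss, scale1r).
have -> : (- ((s * (i == l)%:R) *: Z k j)) *t (1%:M : 'M_d) = - ((s * (i == l)%:R) *: (Z k j *t 1%:M)).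
  by rewrite -scaleNr tensZl scaleNr.
have -> : (j == k)%:R *: ((Sg i j *m Sg k l) *t Y i l) = (j == k)%:R *: (Sg i l *t Y i l).
  by case: eqP => [->|]; rewrite ?scale0r // SgMM.
have -> : (s * (i == l)%:R) *: ((Sg i j *m Sg k l) *t Y k j) = (s * (i == l)%:R) *: (Sg k j *t Y k j).
  by case: eqP => [->|]; rewrite ?mulr0 ?scale0r // SgM SgMM.
by abel.
Qed.

Lemma tY_diag i : tY i i = diag_mx (\row_s ((tlab s i)%:~R - rr K par i)).
Proof.
have -> : tY i i = Z i i *t 1%:M + 1%:M *t Y i i.
  congr (_ + _ *t _); apply/matrixP => s t; rewrite !mxE /sgB addbb /=.
  by case: (s == t).
rewrite Zdiag Ym_diag; apply/matrixP => s t; rewrite !mxE /tlab ffunE.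
case: (mxtens_indexP s) => k u; case: (mxtens_indexP t) => l w.
rewrite !mxtens_indexK /= (can_eq (@mxtens_indexK _ _)) xpair_eqE.
case: (k == l); case: (u == w); rewrite /= ?mulr0 ?mul0r ?mulr1 ?mul1r ?addr0 ?rmorphD //=.
by rewrite addrA.
Qed.

Definition tens : srep := SRep tY_rel tY_diag.

Definition tv (k : 'I_b) (u : 'rV[K]_d) : 'rV[K]_(b * d) :=
  \row_s (((mxtens_unindex s).1 == k)%:R * u 0 (mxtens_unindex s).2).
Definition cmp (k : 'I_b) (x : 'rV[K]_(b * d)) : 'rV[K]_d := \row_c x 0 (mxtens_index (k, c)).

Lemma sum_tens (F : 'I_(b * d) -> K) :
  \sum_s F s = \sum_k \sum_c F (mxtens_index (k, c)).
Proof.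
rewrite (reindex (@mxtens_index b d)) /=; last first.
  by exists (@mxtens_unindex b d) => s _; rewrite ?mxtens_indexK ?mxtens_unindexK.
by rewrite pair_bigA; apply: eq_bigr => -[].
Qed.

Lemma tvE k u l c : tv k u 0 (mxtens_index (l, c)) = (l == k)%:R * u 0 c.
Proof. by rewrite mxE mxtens_indexK. Qed.

Lemma rowT_eq (x y : 'rV[K]_(b * d)) : (forall k, cmp k x = cmp k y) -> x = y.
Proof.
move=> h; apply/rowP => s; case: (mxtens_indexP s) => k c.
by have /rowP/(_ c) := h k; rewrite !mxE.
Qed.

Lemma cmp_tv l k u : cmp l (tv k u) = (l == k)%:R *: u.
Proof. by apply/rowP => c; rewrite !mxE mxtens_indexK. Qed.
Lemma cmpD k x y : cmp k (x + y) = cmp k x + cmp k y.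
Proof. by apply/rowP => c; rewrite !mxE. Qed.
Lemma cmpZ k a x : cmp k (a *: x) = a *: cmp k x.
Proof. by apply/rowP => c; rewrite !mxE. Qed.
Lemma cmp0 k : cmp k 0 = 0.
Proof. by apply/rowP => c; rewrite !mxE. Qed.
Lemma cmp_sum k I (r : seq I) (P : pred I) F :
  cmp k (\sum_(i <- r | P i) F i) = \sum_(i <- r | P i) cmp k (F i).
Proof. by elim/big_rec2: _ => [|i x y _ <-]; rewrite ?cmp0 ?cmpD. Qed.

Lemma tv_sum x : x = \sum_k tv k (cmp k x).
Proof.
apply: rowT_eq => l; rewrite cmp_sum (bigD1 l) //= cmp_tv eqxx scale1r big1 ?addr0 // => k kl.
by rewrite cmp_tv eq_sym (negbTE kl) scale0r.
Qed.

Lemma cmp_mul k x (A : 'M[K]_b) (C : 'M[K]_d) :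
  cmp k (x *m (A *t C)) = \sum_l A l k *: (cmp l x *m C).
Proof.
apply/rowP => c; rewrite !mxE sum_tens summxE; apply: eq_bigr => l _.
rewrite !mxE mulr_sumr; apply: eq_bigr => e _.
by rewrite !mxE !mxtens_indexK /= mulrCA.
Qed.

Lemma tv_mul k u (A : 'M[K]_b) (C : 'M[K]_d) :
  tv k u *m (A *t C) = \sum_l A k l *: tv l (u *m C).
Proof.
apply: rowT_eq => m; rewrite cmp_mul cmp_sum (bigD1 k) //= cmp_tv eqxx scale1r big1 ?addr0; last first.
  by move=> l lk; rewrite cmp_tv (negbTE lk) scale0r mul0mx scaler0.
rewrite (bigD1 m) //= cmpZ cmp_tv eqxx scale1r big1 ?addr0 // => l lm.
by rewrite cmpZ cmp_tv eq_sym (negbTE lm) scale0r scaler0.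
Qed.

Lemma tvD k a u w : tv k (a *: u + w) = a *: tv k u + tv k w.
Proof. by apply/rowP => s; rewrite !mxE mulrDr mulrCA. Qed.
Lemma tv0 k : tv k 0 = 0.
Proof. by apply/rowP => s; rewrite !mxE mulr0. Qed.

Lemma sgB_neq0 i j k : sgB i j k != 0. Proof. by rewrite signr_eq0. Qed.

Lemma tv_act k u i j :
  tv k u *m @Ym _ _ _ tens i j = \sum_l Z i j k l *: tv l u + sgB i j k *: tv k (u *m Y i j).
Proof.
rewrite /= /tY mulmxDr !tv_mul; congr (_ + _).
  by apply: eq_bigr => l _; rewrite mulmx1.
rewrite (bigD1 k) //= !mxE eqxx mulr1n big1 ?addr0 // => l /negbTE lk.
by rewrite !mxE eq_sym lk mulr0n scale0r.
Qed.

Lemma cmp_act k x i j :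
  cmp k (x *m @Ym _ _ _ tens i j) = \sum_l Z i j l k *: cmp l x + sgB i j k *: (cmp k x *m Y i j).
Proof.
rewrite /= /tY mulmxDr cmpD !cmp_mul; congr (_ + _).
  by apply: eq_bigr => l _; rewrite mulmx1.
rewrite (bigD1 k) //= !mxE eqxx mulr1n big1 ?addr0 // => l /negbTE lk.
by rewrite !mxE lk mulr0n scale0r.
Qed.

Lemma mulPmE y (x : 'rV[K]_(b * d)) k c :
  (x *m Pm tens y) 0 (mxtens_index (k, c)) = x 0 (mxtens_index (k, c)) * (lab c == y - om k)%:R.
Proof.
have -> : (lab c == y - om k) = (@lab _ _ _ tens (mxtens_index (k, c)) == y).
  by rewrite /= /tlab !mxtens_indexK /= (addrC (om k)) eq_sym subr_eq eq_sym.
by rewrite /Pm mul_mx_diag !mxE.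
Qed.

Lemma tv_Pm k u y : tv k u *m Pm tens y = tv k (u *m Pm M (y - om k)).
Proof.
apply: rowT_eq => l; apply/rowP => c.
rewrite mxE mulPmE [RHS]mxE !tvE mulPm mxE.
by case: eqP => [->|_]; rewrite ?mul0r ?mul1r.
Qed.

Lemma cmp_Pm k x y : cmp k (x *m Pm tens y) = cmp k x *m Pm M (y - om k).
Proof. by apply/rowP => c; rewrite mxE mulPmE mulPm !mxE. Qed.

Definition tPi (A : 'M[K]_d) : 'M[K]_(dim tens) := 1%:M *t A.

Lemma tPi_comm A : commutant A -> @commutant _ _ _ tens (tPi A).
Proof.
move=> cA i j; rewrite /= /tY /tPi mulmxDr mulmxDl !tensmx_mul !mul1mx !mulmx1.
by rewrite cA.
Qed.
Lemma tPiM A A' : tPi A *m tPi A' = tPi (A *m A').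
Proof. by rewrite /tPi tensmx_mul mul1mx. Qed.

Lemma cmp_tPi k x A : cmp k (x *m tPi A) = cmp k x *m A.
Proof.
rewrite cmp_mul (bigD1 k) //= mxE eqxx scale1r big1 ?addr0 // => l /negbTE lk.
by rewrite mxE lk scale0r.
Qed.

Lemma D_tens A y : Dser (tPi A) y = \sum_(k < b) Dser A (y - om k).
Proof.
rewrite {1}/Dser; have -> : chi (tPi A) = \sum_(k < b) opS K (- om k) (chi A).
  apply: bserE => w; rewrite bser_sumE chiE /mxtrace sum_tens; apply: eq_bigr => k _.
  rewrite -[RHS]/(chi A (w + - om k)) chiE /mxtrace; apply: eq_bigr => c _.
  rewrite mulPm mxE /tPi mxE mxtens_indexK mulPm mxE /= /tlab !mxtens_indexK /= mxE eqxx mul1r.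
  by rewrite (addrC (om k)) [in RHS]eq_sym subr_eq eq_sym.
by rewrite endo_sum bser_sumE; apply: eq_bigr => k _; rewrite opR_shift.
Qed.

Section Hwm.
Variables (Pi0 : 'M[K]_d) (v : 'rV[K]_d) (z : wt).
Hypothesis hM : hwm Pi0 v z.
Variables (c : K) (Pi : 'M[K]_(dim tens)) (nn : nat).
Hypothesis hcomm : commutant Pi.
Hypothesis hidem : Pi *m Pi = Pi.
Hypothesis hPi0l : Pi *m tPi Pi0 = Pi.
Hypothesis hPi0r : tPi Pi0 *m Pi = Pi.
Hypothesis hnil : Pi *m mhorner (('X - c%:P) ^+ nn) (Cas tens) = 0.

Let cas (y : wt) : K := (Qform par y)%:~R - q0 K par.

Lemma tv_wt k : tv k v *m Pi *m Pm tens (z + om k) = tv k v *m Pi.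
Proof.
by rewrite -mulmxA (Pm_comm _ hcomm) mulmxA tv_Pm addrK (hw_wt hM).
Qed.

Lemma tv_raise P k (i j : 'I_N) : submod P -> (j < i)%N ->
  (forall l, (bord l < bord k)%N -> P (tv l v *m Pi)) -> P (tv k v *m Pi *m Ym tens i j).
Proof.
move=> hP ji h; rewrite -mulmxA hcomm mulmxA tv_act (hw_sing hM ji) tv0 scaler0 addr0.
rewrite mulmx_suml; apply: submod_sum => // l _; rewrite -scalemxAl.
have [->|nz] := eqVneq (Z i j k l) 0; first by rewrite scale0r; apply: submod0.
by apply: submodZ => //; apply: h; apply: Zraise nz.
Qed.

(** Modulo the vectors of smaller [bord] the projection of [e_k (x) v] is singular of weight
    [z + om k], so a wrong Casimir eigenvalue or a non-dominant weight puts it into [P]. *)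
Lemma tv_step P k : submod P ->
  (forall l, (bord l < bord k)%N -> P (tv l v *m Pi)) ->
  cas (z + om k) != c \/ ~ dominant par (z + om k) -> P (tv k v *m Pi).
Proof.
move=> hP h [hc|hd].
  apply: (nilp_mod hP hnil _ _ hc); first by rewrite -mulmxA hidem.
  by apply: (Cas_singular hP (tv_wt k)) => i j ji; apply: tv_raise.
have [i [j [ij pij nd]]] : exists i j : 'I_N, [/\ j = i.+1 :> nat, par i = par j & ~~ ((z + om k) j < (z + om k) i)].
  apply: contrapT => h'; apply: hd => i j ij pij; apply: contrapT => /negP h2.
  by apply: h'; exists i, j.
apply: (nondominant_mod hP ij pij (tv_wt k) _ nd); apply: tv_raise => //.
by rewrite ij.
Qed.

(** The vectors [w] such that every [e_k (x) w] projects into [P] form a submodule of [M]: up to a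
    sign, [e_k (x) (w Y)] is [(e_k (x) w) Y] minus a combination of vectors [e_m (x) w]. *)
Lemma tens_gen P : submod P -> (forall k, P (tv k v *m Pi)) -> forall u, P (u *m Pi).
Proof.
move=> hP h u.
have sub k : forall w, P (tv k (w *m Pi0) *m Pi).
  have sQ : submod (fun w => forall k, P (tv k w *m Pi)).
    split=> [l|a x y hx hy l|i j x hx l].
    - by rewrite tv0 mul0mx; apply: submod0.
    - by rewrite tvD mulmxDl -scalemxAl; apply: submodL.
    apply: (submodZI hP (sgB_neq0 i j l)); rewrite scalemxAl.
    have -> : sgB i j l *: tv l (x *m Y i j) = tv l x *m Ym tens i j - \sum_m Z i j l m *: tv m x.
      by rewrite tv_act addrAC subrr add0r.
    rewrite mulmxBl; apply: submodB => //.
      by rewrite -mulmxA -hcomm mulmxA; apply: submodY.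
    rewrite mulmx_suml; apply: submod_sum => // m _; rewrite -scalemxAl.
    exact: submodZ.
  by move=> w; exact: (hw_gen hM sQ h w k).
rewrite -hPi0r mulmxA [u *m tPi Pi0]tv_sum mulmx_suml; apply: submod_sum => // k _.
by rewrite cmp_tPi.
Qed.

(** The component of a singular vector at its largest [bord] is singular in [M], so it has weight
    [z]. *)
Lemma tens_leading x y : x *m Pi = x -> x *m Pm tens y = x -> x != 0 -> raises (@zerop _ _ _ tens) x ->
  exists k, [/\ y = z + om k, cmp k x != 0, cas (z + om k) = c & dominant par (z + om k)].
Proof.
move=> h1 h2 h3 h4.
have [k0 hk0] : exists k, cmp k x != 0.
  apply: contrapT => h; case/eqP: h3; apply: rowT_eq => k; rewrite cmp0; apply/eqP/negPn/negP => hk.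
  by apply: h; exists k.
case: (@arg_maxnP _ k0 (fun k => cmp k x != 0) (@bord B) hk0) => k hk kmax.
have cz l : (bord k < bord l)%N -> cmp l x = 0.
  by move=> kl; apply/eqP/negPn/negP => /kmax; rewrite /= leqNgt kl.
have xP : x *m tPi Pi0 = x by rewrite -h1 -mulmxA hPi0l.
have yk : y - om k = z.
  apply: (hwm_top_eq hM (x := cmp k x)) => //.
  - by rewrite -cmp_tPi xP.
  - by rewrite -cmp_Pm h2.
  move=> i j ji; have := h4 i j ji; rewrite /zerop => /(congr1 (cmp k)); rewrite cmp_act cmp0 big1 ?add0r.
    by move/eqP; rewrite scaler_eq0 (negbTE (sgB_neq0 _ _ _)) /= => /eqP.
  move=> l _; have [->|nz] := eqVneq (Z i j l k) 0; first by rewrite scale0r.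
  by rewrite cz ?scaler0 //; apply: Zraise nz.
have ey : y = z + om k by rewrite -yk subrK.
have sz := @submod_zero _ _ _ tens.
exists k; split=> //; rewrite -ey.
  apply/eqP/negPn/negP => ne; move: h3.
  by rewrite (nilp_mod sz hnil h1 (Cas_singular sz h2 h4) ne) eqxx.
move=> i j ij pij; apply/negPn/negP => nd; move: h3.
by rewrite (nondominant_mod sz ij pij h2 (h4 j i _) nd) ?eqxx ?ij.
Qed.

Lemma tens_zero : (forall k : 'I_b, cas (z + om k) != c \/ ~ dominant par (z + om k)) -> Pi = 0.
Proof.
move=> h; have sz := @submod_zero _ _ _ tens.
have h0 n : forall k : 'I_b, (bord k < n)%N -> tv k v *m Pi = 0.
  elim: n => // n IH k hk; apply: (tv_step sz _ (h k)) => l hl; apply: IH.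
  exact: leq_trans hl hk.
apply/row_matrixP => s; rewrite rowE row0; apply: (tens_gen sz) => k.
exact: (h0 (bord k).+1).
Qed.

Lemma tens_zero1 k0 : (forall k : 'I_b, k != k0 -> cas (z + om k) != c \/ ~ dominant par (z + om k)) ->
  tv k0 v *m Pi = 0 -> Pi = 0.
Proof.
move=> h hk0; have sz := @submod_zero _ _ _ tens.
have h0 n : forall k : 'I_b, (bord k < n)%N -> tv k v *m Pi = 0.
  elim: n => // n IH k hk; have [->//|kk0] := eqVneq k k0.
  apply: (tv_step sz _ (h k kk0)) => l hl; apply: IH; exact: leq_trans hl hk.
apply/row_matrixP => s; rewrite rowE row0; apply: (tens_gen sz) => k.
exact: (h0 (bord k).+1).
Qed.

(** When [k0] is the only admissible index, a singular vector is determined by its component at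
    [k0], and [tv_step] absorbs the other generators. *)
Lemma tens_hwm k0 : (forall k : 'I_b, k != k0 -> cas (z + om k) != c \/ ~ dominant par (z + om k)) ->
  Pi != 0 -> hwm Pi (tv k0 v *m Pi) (z + om k0).
Proof.
move=> h nz; set w := tv k0 v *m Pi; have sz := @submod_zero _ _ _ tens.
have w0 : w != 0 by apply: contraNneq nz => /(tens_zero1 h) ->.
have lt0 n : forall l : 'I_b, (bord l < n)%N -> (bord l < bord k0)%N -> tv l v *m Pi = 0.
  elim: n => // n IH l ln lk0; apply: (tv_step sz).
    by move=> m ml; apply: IH; [exact: leq_trans ml ln | exact: ltn_trans ml lk0].
  by apply: h; apply: contraTneq lk0 => ->; rewrite ltnn.
have ws : raises (@zerop _ _ _ tens) w.
  by move=> i j ji; apply: tv_raise => // l hl; apply: (lt0 (bord l).+1).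
have wPi : w *m Pi = w by rewrite /w -mulmxA hidem.
have prop x y : x *m Pi = x -> x *m Pm tens y = x -> x != 0 -> raises (@zerop _ _ _ tens) x ->
    y = z + om k0 /\ cmp k0 x != 0.
  move=> h1 h2 h3 h4; have [k [-> hk hc hd]] := tens_leading h1 h2 h3 h4.
  have [<-//|kk] := eqVneq k k0.
  by case: (h k kk) => [/eqP|].
have [_ cw] := prop _ _ wPi (tv_wt k0) w0 ws.
have cmpv x : x *m Pi = x -> x *m Pm tens (z + om k0) = x -> raises (@zerop _ _ _ tens) x ->
    exists a, cmp k0 x = a *: v.
  move=> h1 h2 h4; have xP : x *m tPi Pi0 = x by rewrite -h1 -mulmxA hPi0l.
  apply: (hwm_wtspace hM); first by rewrite -cmp_tPi xP.
  by rewrite -[in Pm M _](addrK (om k0) z) -cmp_Pm h2.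
split=> //; first exact: tv_wt.
- move=> x y h1 h2 h4; have [->|x0] := eqVneq x 0; first by exists 0; rewrite scale0r.
  have [ey cx] := prop _ _ h1 h2 x0 h4; rewrite ey in h2.
  have [a ha] := cmpv _ h1 h2 h4; have [a' ha'] := cmpv _ wPi (tv_wt k0) ws.
  have a0 : a' != 0 by apply: contraNneq cw => e; rewrite ha' e scale0r.
  exists (a / a'); apply/eqP; rewrite -subr_eq0; apply/negPn/negP => ne.
  have [|||_] := prop (x - (a / a') *: w) (z + om k0) _ _ ne.
  + by rewrite mulmxBl h1 -scalemxAl wPi.
  + by rewrite mulmxBl h2 -scalemxAl tv_wt.
  + move=> i j ji; rewrite /zerop mulmxBl -scalemxAl.
    by rewrite (h4 i j ji) (ws i j ji) scaler0 subrr.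
  by rewrite cmpD -scaleN1r !cmpZ ha ha' !scalerA -!mulrA mulVf // mulr1 mulN1r scaleNr subrr eqxx.
- move=> P hP hw; apply: tens_gen => // k.
  have hk n : forall l : 'I_b, (bord l < n)%N -> P (tv l v *m Pi).
    elim: n => // n IH l ln; have [->//|lk0] := eqVneq l k0.
    by apply: tv_step => //; [move=> m ml; apply: IH; exact: leq_trans ml ln | exact: h].
  exact: (hk (bord k).+1).
Qed.
End Hwm.
End TensorProduct.

(** * Translation by the standard module and its dual *)

Section Translation.
Variables (K : numFieldType) (N : nat) (par : 'I_N -> bool).
Local Notation wt := (wt N).
Local Notation srep := (srep K par).

Definition se (s : bool) (k : 'I_N) : wt := if s then - eps k else eps k.
(** Sign of minus the supertranspose, which defines the dual module. *)
Definition dualsg (i j : 'I_N) : K := - (-1) ^+ (par i && (par i (+) par j)).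
Definition Zs (s : bool) (i j : 'I_N) : 'M[K]_N :=
  if s then dualsg i j *: delta_mx j i else delta_mx i j.

Lemma Zs_rel s : bracket_rel par (Zs s).
Proof.
case: s => i j k l; rewrite /Zs; last first.
  by rewrite !mul_delta_mx_cond -!scaler_nat [l == i]eq_sym [RHS]addrC subrK.
rewrite -!(scalemxAl, scalemxAr) !mul_delta_mx_cond [k == j]eq_sym -!scaler_nat !scalerA addrA -scalerDl.
set x := (X in X *: delta_mx l i); set y := (X in _ - X *: _); set w := (X in X *: _ = _).
have x0 : x = 0.
  rewrite /x /dualsg /sgn4; case: (eqVneq j k) => [->|_]; last by rewrite !mulr0 mul0r addr0.
  by case: (par l); case: (par k); case: (par i) => /=; rewrite ?expr1 ?expr0; ring.
have wy : w = - y.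
  rewrite /w /y /dualsg /sgn4; case: (eqVneq i l) => [->|_]; last by rewrite !mulr0 mul0r oppr0.
  by case: (par l); case: (par k); case: (par j) => /=; rewrite ?expr1 ?expr0; ring.
by rewrite x0 wy scale0r add0r scaleNr.
Qed.

Lemma Zs_diag s i : Zs s i i = diag_mx (\row_k (se s k i)%:~R).
Proof.
apply/matrixP => k l; rewrite /Zs /se /dualsg addbb andbF.
have [<-|kl] := eqVneq k l.
  by case: s; rewrite !mxE !ffunE !eqxx mulr1n andbb [k == i]eq_sym; case: (i == k); rewrite /= ?mulr0 ?mulr1.
have ki : (k == i) && (l == i) = false.
  by apply: contraNF kl => /andP[/eqP-> /eqP->].
by case: s; rewrite !mxE ?ki ?[(l == i) && _]andbC ?ki (negbTE kl) mulr0n ?mulr0.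
Qed.

Lemma Zs_neq0 s i j k l : Zs s i j k l != 0 -> if s then k = j /\ l = i else k = i /\ l = j.
Proof.
rewrite /Zs; case: s; rewrite !mxE.
  by case: (k =P j) => [->|_]; case: (l =P i) => [->|_] //=; rewrite mulr0 eqxx.
by case: (k =P i) => [->|_]; case: (l =P j) => [->|_] //=; rewrite eqxx.
Qed.

Lemma Zs_par s i j k l : Zs s i j k l != 0 -> par k (+) par l = par i (+) par j.
Proof. by move/Zs_neq0; case: s => -[-> ->]; rewrite // addbC. Qed.

Lemma se_inj s : injective (se s).
Proof.
have ei : injective (@eps N).
  by move=> i j /ffunP/(_ i); rewrite !ffunE eqxx; case: eqP.
by rewrite /se; case: s => i j; [move/oppr_inj|]; apply: ei.
Qed.

Definition vord (s : bool) (k : 'I_N) : nat := if s then (N - k)%N else k.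

Lemma vord_inj s : injective (vord s).
Proof.
rewrite /vord; case: s => i j; last exact: val_inj.
by move=> h; apply: val_inj => /=; have := ltn_ord i; have := ltn_ord j; lia.
Qed.

Lemma vord_raise s (i j : 'I_N) k l : (j < i)%N -> Zs s i j k l != 0 -> (vord s l < vord s k)%N.
Proof.
move=> ji /Zs_neq0; rewrite /vord; case: s => -[-> ->] //.
by have := ltn_ord i; lia.
Qed.

Definition sv (s : bool) : small K par :=
  @Small K N par N (se s) par (Zs s) (Zs_rel s) (Zs_diag s) (@Zs_par s) (@se_inj s) (vord s)
    (@vord_inj s) (@vord_raise s).

Definition xc (k : 'I_N) (y : wt) : int := (-1) ^+ par k * y k.
(** For [s = false], the standard module, epsilon-entries go from position [i] to [i + 1] and
    delta-entries from [i + 1] to [i]; for [s = true], the dual, the two kinds exchange roles. All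
    these moves change the quadratic form by the same amount. *)
Definition Fop (s : bool) (i : int) (f : wt -> K) (y : wt) : K :=
  \sum_(k < N | xc k y == i + (par k == s : nat)%:Z) f (y - se s k).

Lemma xc_se s k l y : xc l (y + se s k) = xc l y + (l == k)%:R * (-1) ^+ (par k (+) s).
Proof.
rewrite /xc /se ffunE; case: s; rewrite !ffunE; case: (eqVneq l k) => [->|_]; case: (par _) => //=; ring.
Qed.

Lemma xc_seB s k l y : xc l (y - se s k) = xc l y - (l == k)%:R * (-1) ^+ (par k (+) s).
Proof. by rewrite -{2}(subrK (se s k) y) xc_se addrK. Qed.

Lemma Qform_se s k y :
  Qform par (y + se s k) = Qform par y + (-1) ^+ s * (2 * (xc k y - (par k != s : nat)%:Z) + 1).
Proof.
rewrite /Qform (bigD1 k) //= [\sum_i _](bigD1 k) //=.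
rewrite (eq_bigr (fun i => (-1) ^+ par i * (y i * y i))); last first.
  by move=> i /negbTE ik; rewrite /se; case: s; rewrite !ffunE ik ?subr0 ?addr0.
rewrite /xc /se; case: s; rewrite !ffunE eqxx; case: (par k) => /=; ring.
Qed.

Lemma Qform_se_eq s k y i q : Qform par y = q ->
  (Qform par (y + se s k) == q + (-1) ^+ s * (2 * i + 1)) = (xc k y == i + (par k != s : nat)%:Z).
Proof.
move=> <-; rewrite Qform_se (inj_eq (addrI _)); move: (_ != s : nat)%:Z (xc k y) => a x.
by case: s => /=; apply/eqP/eqP; lia.
Qed.

Lemma Fop_contents s k y i : (xc k y == i + (par k == s : nat)%:Z) =
  (xc k (y - se s k) == i + (par k != s : nat)%:Z).
Proof.
rewrite xc_seB eqxx mul1r; case: (par k); case: s; rewrite /= ?expr0 ?expr1; apply/eqP/eqP; lia.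
Qed.

(** On a series living on one quadric, selecting the moved entry by its position is the same as
    selecting the result by its value of [Qform]. *)
Lemma Fop_level s i q (f : wt -> K) y : (forall w, f w != 0 -> Qform par w = q) ->
  Fop s i f y = (Qform par y == q + (-1) ^+ s * (2 * i + 1))%:R * \sum_k f (y - se s k).
Proof.
move=> hf; rewrite /Fop big_mkcond mulr_sumr; apply: eq_bigr => k _.
have [->|/hf hq] := eqVneq (f (y - se s k)) 0; first by rewrite mulr0 if_same.
by rewrite Fop_contents -(Qform_se_eq _ _ _ hq) subrK; case: (_ == _); rewrite ?mul1r ?mul0r.
Qed.

(* [D] is e^rho R times the character of the simple quotient-submodule carried
   by a highest weight vector of rho-shifted weight [z]. *)
Definition hwd (D : wt -> K) (z : wt) : Prop :=
  exists (M : srep) (Pi : 'M[K]_(dim M)) (v : 'rV[K]_(dim M)), hwm Pi v z /\ forall y, Dser Pi y = D y.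

Lemma hwd_level D z y : hwd D z -> D y != 0 -> Qform par y = Qform par z.
Proof.
move=> [M [Pi [v [hM hD]]]]; rewrite -hD => Dy.
have := Dser_horner ('X : {poly K}) y (hw_comm hM).
rewrite (mhorner_id (Cas_hwm hM)) !hornerX /Dser chi_scale opR_scale /= => /(mulIf Dy) /addIr /intr_inj.
by [].
Qed.

Section Step.
Variables (D : wt -> K) (z : wt).
Hypothesis hD : hwd D z.
Variables (s : bool) (i : int).

Definition matching k := xc k z == i + (par k != s : nat)%:Z.

Lemma step_data : exists (M : srep) (Pi0 : 'M[K]_(dim M)) v (Pi : 'M[K]_(dim (tens (sv s) M))) nn,
  let c := (Qform par z + (-1) ^+ s * (2 * i + 1))%:~R - q0 K par in
  [/\ hwm Pi0 v z, [/\ commutant Pi, Pi *m Pi = Pi, Pi *m tPi (sv s) Pi0 = Pi & tPi (sv s) Pi0 *m Pi = Pi],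
    Pi *m mhorner (('X - c%:P) ^+ nn) (Cas _) = 0,
    (forall k, (Qform par (z + se s k))%:~R - q0 K par != c \/ ~ dominant par (z + se s k) <->
       ~~ matching k \/ ~ dominant par (z + se s k))
    & forall y, Dser Pi y = Fop s i D y].
Proof.
have [M [Pi0 [v [hM hy]]]] := hD.
pose c : K := (Qform par z + (-1) ^+ s * (2 * i + 1))%:~R - q0 K par.
have [|Pi [h1 [[nn h2] h3]]] := @projector _ _ _ (tens (sv s) M) (tPi (sv s) Pi0) c (tPi_comm _ (hw_comm hM)).
  by rewrite tPiM (hw_idem hM).
exists M, Pi0, v, Pi, nn; split=> //.
  by move=> k; rewrite (inj_eq (addIr _)) eqr_int (Qform_se_eq _ _ _ erefl).
move=> y; rewrite h3 (inj_eq (addIr _)) eqr_int D_tens (@Fop_level _ _ (Qform par z)); last first.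
  by move=> w; apply: hwd_level hD.
by congr (_ * _); apply: eq_bigr => k _; rewrite hy.
Qed.

Lemma Dser0 (M : srep) y : Dser (0 : 'M[K]_(dim M)) y = 0.
Proof.
rewrite /Dser; have -> : chi (0 : 'M[K]_(dim M)) = 0 :> bser K N.
  by apply: bserE => w'; rewrite chiE mul0mx mxtrace0.
by rewrite endo0.
Qed.

Lemma hwd_zero : (forall k, ~~ matching k \/ ~ dominant par (z + se s k)) -> forall y, Fop s i D y = 0.
Proof.
have [M [Pi0 [v [Pi [nn [hM [h1 h2 h3 h4] h5 h6 h7]]]]]] := step_data.
move=> h y; rewrite -h7 (_ : Pi = 0) ?Dser0 //.
by apply: (tens_zero hM h1 h2 h4 h5) => k; apply/h6.
Qed.

Lemma hwd_step k0 : (forall k, k != k0 -> ~~ matching k \/ ~ dominant par (z + se s k)) ->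
  (exists y, Fop s i D y != 0) -> hwd (Fop s i D) (z + se s k0).
Proof.
have [M [Pi0 [v [Pi [nn [hM [h1 h2 h3 h4] h5 h6 h7]]]]]] := step_data.
move=> h [y hy]; exists (tens (sv s) M), Pi, (tv (B := sv s) k0 v *m Pi); split=> //.
apply: (tens_hwm hM h1 h2 h3 h4 h5) => [k kk|]; first by apply/h6; apply: h.
by apply: contraNneq hy => p0; rewrite -h7 p0 Dser0.
Qed.
End Step.

Lemma hwd_dominant D z : hwd D z -> dominant par z.
Proof. by move=> [M [Pi [v [hM _]]]]; apply: hwm_dominant hM. Qed.
Lemma hwd_top D z : hwd D z -> D z = 1.
Proof. by move=> [M [Pi [v [hM hy]]]]; rewrite -hy (D_hwm_top hM). Qed.
Lemma hwd_psum D z y k : hwd D z -> D y != 0 -> psum k y <= psum k z.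
Proof. by move=> [M [Pi [v [hM hy]]]]; rewrite -hy; apply: (D_hwm_supp hM). Qed.

End Translation.

(** * A vanishing translation detected by an explicit singular vector *)

Section AtypicalStep.
Variables (K : numFieldType) (N : nat) (par : 'I_N -> bool).
Local Notation wt := (wt N).
Local Notation srep := (srep K par).
Variables (M : srep) (Pi0 : 'M[K]_(dim M)) (v : 'rV[K]_(dim M)) (z : wt).
Hypothesis hM : hwm Pi0 v z.
Local Notation V := (sv K par false).
Local Notation VM := (tens V M).
Local Notation Y := (@Ym _ _ _ M).
Local Notation Y' := (@Ym _ _ _ VM).
Local Notation tv := (@tv K N par V M).
Local Notation sgV := (@sgB K N par V).
Local Notation cmp := (@cmp K N par V M).
Variables (p q : 'I_N).
Hypotheses (pq : (p < q)%N) (pp : par p = false).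

Let J (k : 'I_N) := (p < k <= q)%N.
Let sg (k l : 'I_N) : K := (-1) ^+ (par k && par l).

Lemma cmp_actV k x i j : cmp k (x *m Y' i j) =
  (k == j)%:R *: cmp i x + sgV i j k *: (cmp k x *m Y i j).
Proof.
rewrite cmp_act /=; congr (_ + _); rewrite (bigD1 i) //= mxE eqxx big1 ?addr0 //.
by move=> l /negbTE li; rewrite mxE li scale0r.
Qed.

Lemma tv_actV k u i j : tv k u *m Y' i j =
  (k == i)%:R *: tv j u + sgV i j k *: tv k (u *m Y i j).
Proof.
rewrite tv_act /=; congr (_ + _); rewrite (bigD1 j) //= mxE eqxx andbT big1 ?addr0 //.
by move=> l /negbTE li; rewrite mxE li andbF scale0r.
Qed.

Lemma tvZ k c u : tv k (c *: u) = c *: tv k u.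
Proof. by apply/rowP => s; rewrite !mxE mulrCA. Qed.

Lemma tvDD k u w : tv k (u + w) = tv k u + tv k w.
Proof. by rewrite -[u]scale1r tvD !scale1r. Qed.

(** The mixed part of the Casimir element of the Levi subalgebra on the indices [J], acting on the
    tensor product; hence [Top_comm]. *)
Definition Top (x : 'rV[K]_(dim VM)) : 'rV[K]_(dim VM) :=
  \sum_(l | J l) tv l (\sum_(k | J k) sg k l *: (cmp k x *m Y l k)).

Lemma cmp_Top l x : cmp l (Top x) = if J l then \sum_(k | J k) sg k l *: (cmp k x *m Y l k) else 0.
Proof.
rewrite /Top cmp_sum; case: ifP => Jl.
  rewrite (bigD1 l) //= cmp_tv eqxx scale1r [X in _ + X]big1 ?addr0 // => k /andP[_ /negbTE kl].
  by rewrite cmp_tv eq_sym kl scale0r.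
rewrite big1 // => k Jk; rewrite cmp_tv; case: eqP => [e|]; last by rewrite scale0r.
by rewrite e Jk in Jl.
Qed.

Lemma TopL c x y : Top (c *: x + y) = c *: Top x + Top y.
Proof.
apply: rowT_eq => l; rewrite cmpD cmpZ !cmp_Top; case: ifP => _; last by rewrite scaler0 addr0.
rewrite scaler_sumr -big_split; apply: eq_bigr => k _.
by rewrite cmpD cmpZ mulmxDl -scalemxAl scalerDr !scalerA mulrC.
Qed.

Lemma Top_comm x a b : J a -> J b -> Top (x *m Y' a b) = Top x *m Y' a b.
Proof.
move=> Ja Jb; apply: rowT_eq => l; rewrite cmp_actV !cmp_Top Ja.
case: ifP => Jl; last first.
  rewrite mul0mx scaler0 addr0; case: eqP => [e|]; last by rewrite scale0r.
  by rewrite e Jb in Jl.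
pose s k : K := (-1) ^+ ((par a (+) par b) && par k).
have sB k : sgV a b k = s k by [].
have ss k : s k * s k = 1 by rewrite /s -signr_addb addbb.
have s4 k : sgn4 K par l k a b = s l * s k.
  by rewrite /sgn4 /s; case: (par a); case: (par b); case: (par l); case: (par k); rewrite /= ?expr0 ?expr1; ring.
transitivity (\sum_(k | J k) (sg k l * s k) *: (cmp k x *m Y a b *m Y l k) + sg b l *: (cmp a x *m Y l b)).
  rewrite -[X in _ + X](_ : \sum_(k | J k) (sg k l * (k == b)%:R) *: (cmp a x *m Y l k) = _); last first.
    rewrite (bigD1 b) //= eqxx mulr1 big1 ?addr0 // => k /andP[_ /negbTE->].
    by rewrite mulr0 scale0r.
  rewrite -big_split; apply: eq_bigr => k _ /=.
  by rewrite cmp_actV sB mulmxDl -!scalemxAl scalerDr !scalerA addrC.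
rewrite sB.
have -> : s l *: ((\sum_(k | J k) sg k l *: (cmp k x *m Y l k)) *m Y a b) =
   \sum_(k | J k) (sg k l * s k) *: (cmp k x *m Y a b *m Y l k) +
   (s l * sg a l) *: (cmp a x *m Y l b) - (l == b)%:R *: \sum_(k | J k) (sg k l * s k) *: (cmp k x *m Y a k).
  rewrite -[X in _ + X - _](_ : \sum_(k | J k) (s l * sg k l * (k == a)%:R) *: (cmp k x *m Y l b) = _); last first.
    rewrite (bigD1 a) //= eqxx mulr1 big1 ?addr0 // => k /andP[_ /negbTE->].
    by rewrite mulr0 scale0r.
  rewrite mulmx_suml [LHS]scaler_sumr [in RHS]scaler_sumr -sumrN -!big_split; apply: eq_bigr => k _ /=.
  rewrite -scalemxAl -mulmxA Ym_rel s4 !mulmxDr mulmxN -!scalemxAr !scalerDr !scalerN !scalerA -!mulmxA addrA.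
  have e : s l * sg k l * (s l * s k) = sg k l * s k by rewrite mulrACA ss mul1r.
  rewrite e; congr (_ + _ - _); congr (_ *: _).
  by rewrite (mulrA (s l * sg k l)) e mulrC.
case: eqP => [lb|_]; last first.
  rewrite !scale0r subr0 add0r; congr (_ + _ *: _).
  by rewrite /sg /s; case: (par a); case: (par b); case: (par l); rewrite /= ?expr0 ?expr1; ring.
rewrite !scale1r addrC; set A := \sum_(k | J k) _; set B := \sum_(k | J k) sg k a *: _.
have -> : \sum_(k | J k) (sg k l * s k) *: (cmp k x *m Y a k) = B.
  apply: eq_bigr => k _; congr (_ *: _); rewrite lb /sg /s.
  by case: (par a); case: (par b); case: (par k); rewrite /= ?expr0 ?expr1; ring.
rewrite subrKC addrC; congr (_ + _ *: _).
by rewrite lb /sg /s; case: (par a); case: (par b); rewrite /= ?expr0 ?expr1; ring.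
Qed.

(** The eigenvalue of [Top] on [e_k (x) v] modulo the part generated by smaller indices, see
    [Top_vF]. *)
Definition eigT (k : 'I_N) : K := (-1) ^+ par k * ((z k)%:~R - rr K par k) -
  \sum_(l < N | (p < l < k)%N) (-1) ^+ par l.

Lemma vYdiag k : v *m Y k k = ((z k)%:~R - rr K par k) *: v.
Proof.
rewrite -{1}(hw_wt hM) -mulmxA; have -> : Pm M z *m Y k k = Y k k *m Pm M z.
  by rewrite Pm_shift subrr addr0.
by rewrite Pm_diag -scalemxAr (hw_wt hM).
Qed.

Lemma Top_v k : J k -> Top (tv k v) = eigT k *: tv k v +
  \sum_(l < N | (p < l < k)%N) (-1) ^+ par l *: (tv l v *m Y' l k).
Proof.
move=> Jk; have -> : Top (tv k v) = \sum_(l | J l) sg k l *: tv l (v *m Y l k).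
  apply: eq_bigr => l Jl; rewrite (bigD1 k) //= cmp_tv eqxx scale1r big1 ?addr0.
    by rewrite tvZ.
  by move=> i /andP[_ /negbTE ik]; rewrite cmp_tv ik scale0r mul0mx scaler0.
rewrite (bigD1 k) //= (bigID (fun l : 'I_N => (l < k)%N)) /= [X in _ + (_ + X)]big1 ?addr0; last first.
  move=> l /andP[/andP[_ lk] kl]; rewrite (hw_sing hM) ?tv0 ?scaler0 //.
  by rewrite ltn_neqAle leqNgt kl andbT eq_sym; exact: lk.
rewrite (eq_bigl (fun l : 'I_N => (p < l < k)%N)); last first.
  by move=> l; move: Jk; rewrite /J -val_eqE /=; lia.
have -> : tv k (v *m Y k k) = ((z k)%:~R - rr K par k) *: tv k v.
  by rewrite vYdiag tvZ.
rewrite /eigT [in RHS]scalerBl -[RHS]addrA scalerA; congr (_ *: _ + _).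
  by rewrite /sg andbb.
rewrite scaler_suml -sumrN -big_split; apply: eq_bigr => l _ /=.
rewrite tv_actV eqxx scale1r scalerDr scalerA addKr; congr (_ *: _).
by rewrite /sg /sgB /=; case: (par l); case: (par k); rewrite /= ?expr0 ?expr1; ring.
Qed.

(* Span of the vectors obtained from e_l (x) v, l < j, by the Levi subalgebra of J. *)
Definition Fil (j : nat) (x : 'rV[K]_(dim VM)) : Prop := forall P : 'rV[K]_(dim VM) -> Prop,
  P 0 -> (forall c y w, P y -> P w -> P (c *: y + w)) ->
  (forall a b y, J a -> J b -> P y -> P (y *m Y' a b)) ->
  (forall l : 'I_N, J l -> (l < j)%N -> P (tv l v)) -> P x.

Lemma Fil0 j : Fil j 0. Proof. by move=> P. Qed.
Lemma FilL j c x y : Fil j x -> Fil j y -> Fil j (c *: x + y).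
Proof. by move=> hx hy P h1 h2 h3 h4; apply: (h2); [apply: hx|apply: hy]. Qed.
Lemma FilY j a b x : J a -> J b -> Fil j x -> Fil j (x *m Y' a b).
Proof. by move=> Ja Jb hx P h1 h2 h3 h4; apply: (h3) => //; apply: hx. Qed.
Lemma FilG j l : J l -> (l < j)%N -> Fil j (tv l v).
Proof. by move=> Jl lj P h1 h2 h3 h4; apply: h4. Qed.
Lemma FilZ j c x : Fil j x -> Fil j (c *: x).
Proof. by move=> hx; rewrite -[_ *: _]addr0; apply: FilL => //; apply: Fil0. Qed.
Lemma FilD j x y : Fil j x -> Fil j y -> Fil j (x + y).
Proof. by move=> hx hy; rewrite -[x]scale1r; apply: FilL. Qed.
Lemma Fil_sum j I (r : seq I) (C : pred I) F :
  (forall i, C i -> Fil j (F i)) -> Fil j (\sum_(i <- r | C i) F i).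
Proof.
by move=> h; elim/big_rec: _ => [|i x Ci hx]; [apply: Fil0|apply: FilD => //; apply: h].
Qed.
Lemma Fil_le j j' x : (j <= j')%N -> Fil j x -> Fil j' x.
Proof.
move=> le hx P h1 h2 h3 h4; apply: hx => // l Jl lj; apply: h4 => //; exact: leq_trans le.
Qed.

Lemma Top_vF k : J k -> Fil k (Top (tv k v) - eigT k *: tv k v).
Proof.
move=> Jk; rewrite Top_v // addrAC subrr add0r; apply: Fil_sum => l /andP[pl lk].
have Jl : J l by move: Jk; rewrite /J; lia.
by apply: FilZ; apply: FilY => //; apply: FilG.
Qed.

Lemma Top0 : Top 0 = 0.
Proof. by have := TopL (-1) 0 0; rewrite scaler0 addr0 scaleN1r addNr. Qed.

Lemma Fil_Top j x : Fil j x -> Fil j (Top x).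
Proof.
move=> h; apply: (h (fun x => Fil j (Top x))) => [|c y w hy hw|a b y Ja Jb hy|l Jl lj].
- by rewrite Top0; apply: Fil0.
- by rewrite TopL; apply: FilL.
- by rewrite Top_comm //; apply: FilY.
rewrite -(subrK (eigT l *: tv l v) (Top _)); apply: FilD; last by apply: FilZ; apply: FilG.
by apply: (Fil_le (ltnW lj)); apply: Top_vF.
Qed.

Definition Tc k x := Top x - eigT k *: x.
Lemma TcL k c x y : Tc k (c *: x + y) = c *: Tc k x + Tc k y.
Proof.
rewrite /Tc TopL scalerBr scalerDr opprD addrACA; congr (_ - _ + _).
by rewrite !scalerA mulrC.
Qed.
Lemma Tc0 k : Tc k 0 = 0. Proof. by rewrite /Tc Top0 scaler0 subrr. Qed.
Lemma Tc_comm k x a b : J a -> J b -> Tc k (x *m Y' a b) = Tc k x *m Y' a b.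
Proof. by move=> Ja Jb; rewrite /Tc Top_comm // mulmxBl scalemxAl. Qed.
Lemma TcC k l x : Tc k (Tc l x) = Tc l (Tc k x).
Proof.
have hB c y w : Top (y - c *: w) = Top y - c *: Top w.
  by rewrite addrC -scaleNr TopL scaleNr addrC.
rewrite /Tc !hB !scalerBr !scalerA [eigT l * _]mulrC !opprB.
move: (Top (Top x)) (_ *: Top x) (_ *: Top x) (_ *: x) => A B C D; by abel.
Qed.

Lemma Fil_Tc (k : 'I_N) x : J k -> Fil k.+1 x -> Fil k (Tc k x).
Proof.
move=> Jk h; apply: (h (fun x => Fil k (Tc k x))) => [|c y w hy hw|a b y Ja Jb hy|l Jl lk].
- by rewrite Tc0; apply: Fil0.
- by rewrite TcL; apply: FilL.
- by rewrite Tc_comm //; apply: FilY.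
have [->|ne] := eqVneq l k; first exact: Top_vF.
have lk' : (l < k)%N by rewrite ltn_neqAle -(inj_eq val_inj) in ne *; rewrite ne -ltnS.
rewrite /Tc -scaleNr; apply: FilD; first by apply: Fil_Top; apply: FilG.
by apply: FilZ; apply: FilG.
Qed.

Definition Gs (s : seq 'I_N) x := foldr Tc x s.
Lemma Gs_Tc s k x : Gs s (Tc k x) = Tc k (Gs s x).
Proof. by elim: s => //= a s ->; apply: TcC. Qed.
Lemma Gs_rem s k x : k \in s -> Gs s x = Gs (rem k s) (Tc k x).
Proof.
elim: s => //= a s IH; rewrite inE eq_sym; case: eqP => [-> _|_ /= ks]; last by rewrite IH.
by rewrite Gs_Tc.
Qed.
Lemma Gs0 s : Gs s 0 = 0. Proof. by elim: s => //= a s ->; apply: Tc0. Qed.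
Lemma Gs_comm s x a b : J a -> J b -> Gs s (x *m Y' a b) = Gs s x *m Y' a b.
Proof. by move=> Ja Jb; elim: s => //= k s ->; apply: Tc_comm. Qed.

Lemma Gs_kill j s x : (forall k : 'I_N, J k -> (k < j)%N -> k \in s) -> Fil j x -> Gs s x = 0.
Proof.
elim: j s x => [|j IH] s x hs hx.
  suff -> : x = 0 by apply: Gs0.
  by apply: (hx (fun x => x = 0)) => //= [c y w -> ->|a b y _ _ ->]; rewrite ?scaler0 ?addr0 ?mul0mx.
have [jN|Nj] := ltnP j N; last first.
  apply: IH; last by move=> P h1 h2 h3 h4; apply: hx => // l Jl _; apply: h4 => //; apply: leq_trans Nj.
  by move=> k Jk kj; apply: hs => //; apply: ltnW.
pose k := Ordinal jN; have [Jk|nJk] := boolP (J k); last first.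
  apply: IH => [l Jl lj|P h1 h2 h3 h4]; first by apply: hs => //; apply: ltnW.
  apply: hx => // l Jl lj; apply: h4 => //; rewrite ltn_neqAle -ltnS lj andbT.
  by apply: contraNneq nJk => e; have -> : k = l by apply: val_inj.
rewrite (@Gs_rem _ k); last by apply: hs => //=.
apply: IH; last exact: (@Fil_Tc k).
move=> l Jl lj; have := hs l Jl (ltnW lj); have lk : l != k by rewrite -val_eqE /= neq_ltn lj.
by have /perm_mem-> := perm_to_rem (hs k Jk (ltnSn j)); rewrite inE (negbTE lk).
Qed.

Variable Pi : 'M[K]_(dim VM).
Hypothesis hcomm : commutant Pi.
Hypothesis low0 : forall l : 'I_N, (l < q)%N -> tv l v *m Pi = 0.
Hypothesis eq_eig : eigT q = (z p)%:~R - rr K par p.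
Hypothesis neq_eig : forall k, J k -> (k < q)%N -> eigT k != eigT q.

Let s0 := [seq k <- enum 'I_N | J k && (k < q)%N].
(** Removing the eigenvalues [eigT k], [k < q], turns [e_q (x) v] into a true eigenvector of [Top],
    singular for the Levi subalgebra and still congruent to a nonzero multiple of [e_q (x) v] modulo
    [Fil q]. *)
Let x0 := Gs s0 (tv q v).
Let mem_s0 (k : 'I_N) : J k -> (k < q)%N -> k \in s0.
Proof. by move=> Jk kq; rewrite mem_filter Jk kq mem_enum. Qed.
Let Jq : J q. Proof. by rewrite /J pq leqnn. Qed.

Lemma x0_eig : Top x0 = eigT q *: x0.
Proof.
apply/eqP; rewrite -subr_eq0 -/(Tc q x0) /x0 -Gs_Tc; apply/eqP.
by apply: (@Gs_kill q) => //; apply: Top_vF.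
Qed.

Lemma x0_sing (a b : 'I_N) : J a -> J b -> (b < a)%N -> x0 *m Y' a b = 0.
Proof.
move=> Ja Jb ba; rewrite /x0 -Gs_comm // tv_actV (hw_sing hM) // tv0 scaler0 addr0.
case: eqP => [e|_]; last by rewrite scale0r Gs0.
rewrite scale1r; apply: (@Gs_kill q) => //; apply: FilG => //.
by rewrite e.
Qed.

Lemma Fil_Pi x : Fil q x -> x *m Pi = 0.
Proof.
move=> h; apply: (h (fun x => x *m Pi = 0)) => [|c y w hy hw|a b y Ja Jb hy|l Jl lj]; rewrite ?mul0mx //.
- by rewrite mulmxDl -scalemxAl hy hw scaler0 addr0.
- by rewrite -mulmxA -hcomm mulmxA hy mul0mx.
exact: low0.
Qed.

Lemma x0_Pi : exists2 c, c != 0 & Fil q (x0 - c *: tv q v).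
Proof.
have : all (fun k => J k && (k < q)%N) s0 by apply: filter_all.
rewrite /x0; elim: s0 => [_|k s IH /= /andP[/andP[Jk kq] /IH{IH} [c c0 hc]]].
  by exists 1; rewrite ?oner_neq0 // scale1r subrr; apply: Fil0.
exists (c * (eigT q - eigT k)); first by rewrite mulf_neq0 // subr_eq0 eq_sym neq_eig.
set y := Gs s _ in hc *; set w := tv q v in hc *.
have -> : Tc k y - (c * (eigT q - eigT k)) *: w = Tc k (y - c *: w) + c *: (Top w - eigT q *: w).
  have -> : y - c *: w = (- c) *: w + y by rewrite addrC scaleNr.
  rewrite TcL /Tc !(scalerBr, scaleNr, scalerA, mulrBr, scalerBl, mulNr).
  by move: (c *: Top w) (Top y) (eigT k *: y) (_ *: w) (_ *: w) => A B C D E; abel.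
apply: FilD; last by apply: FilZ; apply: Top_vF.
rewrite /Tc -[- (eigT k *: _)]scaleNr.
exact: FilD (Fil_Top hc) (FilZ _ hc).
Qed.

(** What the components of [x0] inherit from [v]; the conditions are chosen so that the Levi
    subalgebra preserves them. *)
Record good (k : 'I_N) (u : 'rV[K]_(dim M)) : Prop := Good {
  gd_Pi0 : u *m Pi0 = u;
  gd_wt : u *m Pm M (z + eps q - eps k) = u;
  gd_p : forall l, J l -> u *m Y l p = 0;
  gd_e : tv p u *m Pi = 0 }.

Lemma good0 k : good k 0.
Proof. by split; rewrite ?mul0mx ?tv0 ?mul0mx // => l _; rewrite mul0mx. Qed.
Lemma goodL k c u w : good k u -> good k w -> good k (c *: u + w).
Proof.
move=> [a1 a2 a3 a4] [b1 b2 b3 b4]; split.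
- by rewrite mulmxDl -scalemxAl a1 b1.
- by rewrite mulmxDl -scalemxAl a2 b2.
- by move=> l Jl; rewrite mulmxDl -scalemxAl a3 // b3 // scaler0 addr0.
- by rewrite tvD mulmxDl -scalemxAl a4 b4 scaler0 addr0.
Qed.
Lemma good_sum k (C : pred 'I_N) F : (forall i, C i -> good k (F i)) -> good k (\sum_(i | C i) F i).
Proof.
move=> h; elim/big_rec: _ => [|i x Ci hx]; first exact: good0.
by rewrite -[F i]scale1r; apply: goodL => //; apply: h.
Qed.

Lemma good_act k l u : J k -> J l -> good k u -> good l (u *m Y l k).
Proof.
move=> Jk Jl [a1 a2 a3 a4]; have lp : l == p = false.
  by apply/negbTE; move: Jl; rewrite /J -val_eqE /=; lia.
split.
- by rewrite -mulmxA -(hw_comm hM) mulmxA a1.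
- rewrite -[in RHS]a2 -[in RHS]mulmxA Pm_shift mulmxA; congr (_ *m Pm M _); abel.
- move=> m Jm; rewrite -mulmxA Ym_rel lp scale0r scaler0 subr0 mulmxDr -!scalemxAr mulmxA.
  by rewrite a3 // mul0mx scaler0 add0r a3 // scaler0.
have /(congr1 (mulmx^~ (Y' l k))) := a4; rewrite mul0mx -mulmxA hcomm mulmxA tv_actV eq_sym lp scale0r add0r.
rewrite -scalemxAl => /eqP; rewrite scaler_eq0 (negbTE (sgB_neq0 _ _ _)) /=.
by move/eqP.
Qed.

Lemma x0_good k : (J k \/ cmp k x0 = 0) /\ good k (cmp k x0).
Proof.
rewrite /x0; elim: s0 k => [|j s IH] k /=.
  have [->|kq] := eqVneq k q; last first.
    by rewrite cmp_tv (negbTE kq) scale0r; split; [right|apply: good0].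
  split; [by left|rewrite cmp_tv eqxx scale1r; split].
  - exact: hw_vPi hM.
  - by rewrite addrK (hw_wt hM).
  - by move=> l /andP[pl _]; rewrite (hw_sing hM).
  - exact: low0.
rewrite /Tc; set y := Gs s _ in IH *.
have e : cmp k (Top y - eigT j *: y) = (- eigT j) *: cmp k y + cmp k (Top y).
  by rewrite addrC -scaleNr cmpD cmpZ.
rewrite e cmp_Top; case: ifP => Jk; last first.
  have yk0 : cmp k y = 0.
    by case: (IH k) => [[hJ|//] _]; move: Jk; rewrite /J in hJ *; rewrite hJ.
  by rewrite yk0 scaler0 addr0; split; [right|apply: good0].
split; [by left|apply: goodL; first by have [] := IH k].
apply: good_sum => l Jl; rewrite -[_ *: _]addr0; apply: goodL; last exact: good0.
by apply: good_act => //; have [] := IH l.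
Qed.

(** Applying [Y' p k] to the vanishing projection of [e_p (x) x0_k] trades [e_k (x) x0_k] for minus
    [e_p (x) (x0_k Y p k)]. Summed over [k], the projection of [x0] is minus that of [e_p (x) psi],
    so it suffices to kill [psi]. *)
Let psi := \sum_(k | J k) cmp k x0 *m Y p k.
Let y0 := z + eps q - eps p.

Lemma psi_Pi0 : psi *m Pi0 = psi.
Proof.
rewrite /psi mulmx_suml; apply: eq_bigr => k _; have [_ g] := x0_good k.
by rewrite -mulmxA -(hw_comm hM) mulmxA (gd_Pi0 g).
Qed.
Lemma psi_wt : psi *m Pm M y0 = psi.
Proof.
rewrite /psi mulmx_suml; apply: eq_bigr => k _; have [_ g] := x0_good k.
have -> : y0 = z + eps q - eps k + (eps k - eps p) by rewrite /y0; abel.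
by rewrite -mulmxA -Pm_shift mulmxA (gd_wt g).
Qed.

(** A raising operator leaving the interval from [p] to [q] would exceed the highest weight; inside
    [J] the vector [x0] is singular; and for an operator that involves [p] and [J] the claim is the
    coincidence of eigenvalues [eq_eig]. *)
Lemma psi_raise : raises (@zerop _ _ _ M) psi.
Proof.
move=> a b ba; rewrite /zerop.
have [out|] := boolP ((b < p) || (q < a))%N.
  apply/eqP/negPn/negP => nz.
  have w1 : psi *m Y a b *m Pi0 = psi *m Y a b by rewrite -mulmxA -(hw_comm hM) mulmxA psi_Pi0.
  have w2 : psi *m Y a b *m Pm M (y0 + root b a) = psi *m Y a b.
    by rewrite -mulmxA -Pm_shift mulmxA psi_wt.
  have h k := hwm_psum hM k w1 w2 nz.
  have := h (if (b < p)%N then b.+1 else a).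
  have -> : y0 + root b a = z - root p q + root b a by rewrite /y0 /root; abel.
  rewrite (psumD _ (z - root p q)) (psum_root _ ba) (psumD _ z) psumN (psum_root _ pq).
  case: ifP out => bp /= out.
    have -> : (p < b.+1 <= q)%N = false by lia.
    by rewrite ltnSn ba; lia.
  have -> : (p < a <= q)%N = false by lia.
  by rewrite ba leqnn; lia.
rewrite negb_or -!leqNgt => /andP[pb aq].
have Ja : J a by rewrite /J; lia.
have [bp|bp] := eqVneq b p.
  rewrite bp /psi mulmx_suml.
  transitivity (((z p)%:~R - rr K par p) *: cmp a x0 - cmp a (Top x0)); last first.
    by rewrite x0_eig cmpZ eq_eig subrr.
  rewrite cmp_Top Ja.
  rewrite -[X in X - _](_ : \sum_(k | J k) (k == a)%:R *: (cmp k x0 *m Y p p) = _); last first.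
    rewrite (bigD1 a) //= eqxx scale1r big1 ?addr0; last by move=> k /andP[_ /negbTE->]; rewrite scale0r.
    have [_ g] := x0_good a; rewrite -{1}(gd_wt g) -mulmxA.
    have -> : Pm M (z + eps q - eps a) *m Y p p = Y p p *m Pm M (z + eps q - eps a).
      by rewrite Pm_shift subrr addr0.
    rewrite Pm_diag -scalemxAr (gd_wt g) !ffunE.
    have -> : (p == q) = false by apply/negbTE; rewrite -val_eqE /= neq_ltn pq.
    have -> : (p == a) = false by apply/negbTE; rewrite -val_eqE /= neq_ltn -{1}bp ba.
    by rewrite subr0 addr0.
  rewrite -sumrB; apply: eq_bigr => k Jk; have [_ g] := x0_good k.
  rewrite -mulmxA Ym_rel eqxx scale1r !mulmxDr mulmxN -!scalemxAr mulmxA (gd_p g Ja) mul0mx scaler0 add0r.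
  congr (_ - _ *: _); rewrite /sgn4 /sg pp /=.
  by rewrite addbF.
have Jb : J b by move: bp; rewrite -val_eqE /= /J; lia.
have bp' : (p == b) = false by rewrite eq_sym; apply/negbTE.
transitivity (\sum_(k | J k) cmp k (x0 *m Y' a b) *m Y p k); last first.
  by rewrite x0_sing // big1 // => k _; rewrite cmp0 mul0mx.
rewrite /psi mulmx_suml.
have -> : \sum_(k | J k) cmp k (x0 *m Y' a b) *m Y p k =
  \sum_(k | J k) (k == b)%:R *: (cmp a x0 *m Y p k) + \sum_(k | J k) sgV a b k *: (cmp k x0 *m Y a b *m Y p k).
  by rewrite -big_split; apply: eq_bigr => k _; rewrite cmp_actV mulmxDl -!scalemxAl.
have -> : \sum_(k | J k) (k == b)%:R *: (cmp a x0 *m Y p k) = \sum_(k | J k) (k == a)%:R *: (cmp k x0 *m Y p b).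
  rewrite (bigD1 b) //= [RHS](bigD1 a) //= !eqxx !scale1r !big1 //.
    by move=> k /andP[_ /negbTE->]; rewrite scale0r.
  by move=> k /andP[_ /negbTE->]; rewrite scale0r.
rewrite -big_split; apply: eq_bigr => k Jk /=.
rewrite -mulmxA Ym_rel bp' scale0r scaler0 subr0 mulmxDr -!scalemxAr addrC mulmxA; congr (_ + _ *: _).
by rewrite /sgn4 /sgB /= pp addFb andbC.
Qed.

(** Singular vectors have weight [z], whereas [psi] has weight [z + eps q - eps p]. *)
Lemma psi0 : psi = 0.
Proof.
apply/eqP/negPn/negP => nz.
have /(congr1 (fun y : wt => y p)) := hwm_top_eq hM psi_Pi0 psi_wt nz psi_raise.
rewrite /y0 !ffunE eqxx.
have -> : (p == q) = false by apply/negbTE; rewrite -val_eqE /= neq_ltn pq.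
by rewrite mulr0n mulr1n addr0; move: (z p) => t; lia.
Qed.

Lemma tv_q_Pi : tv q v *m Pi = 0.
Proof.
have [c c0 /Fil_Pi] := x0_Pi; rewrite mulmxBl -scalemxAl.
have -> : x0 *m Pi = 0.
  rewrite [x0](@tv_sum K N par V M) mulmx_suml.
  have e k : tv k (cmp k x0) *m Pi = - (tv p (if J k then cmp k x0 *m Y p k else 0) *m Pi).
    have [[Jk|k0] g] := x0_good k; last by rewrite k0 mul0mx if_same !tv0 mul0mx oppr0.
    have /(congr1 (mulmx^~ (Y' p k))) := gd_e g; rewrite mul0mx -mulmxA hcomm mulmxA tv_actV eqxx scale1r Jk.
    by rewrite /sgB /= pp andbF scale1r mulmxDl => /eqP; rewrite addr_eq0 => /eqP.
  under eq_bigr => k _ do rewrite e.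
  rewrite sumrN -mulmx_suml.
  rewrite [X in X *m Pi](_ : _ = tv p psi); last first.
    rewrite /psi (big_morph _ (tvDD p) (@tv0 K N par V M p)) [RHS]big_mkcond.
    by apply: eq_bigr => k _; case: ifP => // _; rewrite tv0.
  by rewrite psi0 tv0 mul0mx oppr0.
by rewrite sub0r => /eqP; rewrite oppr_eq0 scaler_eq0 (negbTE c0) => /eqP.
Qed.

End AtypicalStep.

(** * Linkage *)

Section Linkage.
Variables (K : numFieldType) (N : nat) (par : 'I_N -> bool).
Local Notation wt := (wt N).
Local Notation srep := (srep K par).
Local Notation xc := (xc par).
Local Notation Fop := (@Fop K N par).
Local Notation tvV := (@tv K N par (sv K par false) _).
Local Notation hwd := (@hwd K N par).

(** A vee at [i + 1] with nothing else able to move: the remaining candidate is its delta-entry [q],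
    whose target may well be dominant, so the vanishing rests on [tv_q_Pi]. *)
Lemma hwd_nested D z (p q : 'I_N) i : hwd D z -> (p < q)%N -> par p = false -> par q = true ->
  xc p z = i + 1 -> xc q z = i + 1 -> (forall k, k != q -> ~~ matching par z false i k) ->
  forall y, Fop false i D y = 0.
Proof.
move=> hD pq pp parq xp xq hk y.
have [M [Pi0 [v [Pi [nn [hM [h1 h2 h3 h4] h5 h6 h7]]]]]] := step_data hD false i.
have hk' k : k != q -> ~~ matching par z false i k \/ ~ dominant par (z + se false k).
  by move=> kq; left; apply: hk.
rewrite -h7 (_ : Pi = 0) ?Dser0 //.
apply: (tens_zero1 hM h1 h2 h4 h5 (k0 := q)) => [k kq|]; first by apply/h6; apply: hk'.
have sz := @submod_zero _ _ _ (tens (sv K par false) M).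
have low0 (l : 'I_N) : (l < q)%N -> tvV l v *m Pi = 0.
  suff H n : forall l : 'I_N, (l < n)%N -> (l < q)%N -> tvV l v *m Pi = 0.
    by apply: (H l.+1).
  elim: n => // n IH {}l ln lq; apply: (tv_step hM h1 h2 h5 sz).
    by move=> m ml; apply: IH; [exact: leq_trans ml ln|exact: ltn_trans ml lq].
  by apply/h6; apply: hk'; rewrite -val_eqE /= neq_ltn lq.
(* Hence the eigenvalues of [k] and [q] agree exactly when [xc k z] is [i + 1] for odd [k], or [i]
   for even [k]. This is [matching], excluded for [k != q]. *)
have key (k : 'I_N) : (p < k)%N -> 2 * (eigT K par z p k - ((z p)%:~R - rr K par p)) =
    2 * ((xc k z)%:~R - (xc p z)%:~R) + 1 + (-1) ^+ par k.
  move=> pk; rewrite /eigT /xc pp expr0 mul1r rmorphM rmorph_sign /=.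
  have ek := rrE K par k; have ep := rrE K par p; rewrite pp expr0 mulr1 in ep.
  have e1 : \sum_(l < N | (l < k)%N) (-1) ^+ par l = \sum_(l < N | (l < p)%N) (-1) ^+ par l + 1
      + \sum_(l < N | (p < l < k)%N) (-1) ^+ par l :> K.
    rewrite (bigID (fun l : 'I_N => (p < l)%N)) /= addrC; congr (_ + _).
      rewrite (bigD1 p) /=; last by rewrite pk ltnn.
      rewrite pp expr0 addrC; congr (_ + _); apply: eq_bigl => l; rewrite -val_eqE /=; lia.
    by apply: eq_bigl => l; rewrite andbC.
  have e2 : \sum_(l < N | (p < l)%N) (-1) ^+ par l = \sum_(l < N | (p < l < k)%N) (-1) ^+ par l
      + (-1) ^+ par k + \sum_(l < N | (k < l)%N) (-1) ^+ par l :> K.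
    rewrite (bigID (fun l : 'I_N => (l < k)%N)) /= -addrA; congr (_ + _).
    rewrite (bigD1 k) /=; last by rewrite pk ltnn.
    by congr (_ + _); apply: eq_bigl => l; rewrite -val_eqE /=; lia.
  rewrite e1 in ek; rewrite e2 in ep; move: ek ep.
  move: (\sum_(l < N | (p < l < k)%N) _) (\sum_(l < N | (k < l)%N) _) (\sum_(l < N | (l < p)%N) _) => B C E.
  move: ((-1) ^+ par k) (rr K par k) (rr K par p) (z k)%:~R (z p)%:~R => e r rp zk zp ek ep.
  rewrite [LHS](_ : _ = 2 * (e * zk) - 2 * e * r - 2 * B - 2 * zp + 2 * rp); last by ring.
  by rewrite ek ep; ring.
have n2 : (2 : K) != 0 by rewrite pnatr_eq0.
have eq_eig : eigT K par z p q = (z p)%:~R - rr K par p.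
  apply/eqP; rewrite -subr_eq0 -(mulrI_eq0 _ (mulfI n2)) key // xp xq parq subrr mulr0 add0r expr1 subrr.
  by [].
apply: (tv_q_Pi hM pq pp h1 low0 eq_eig) => k /andP[pk _] kq.
have kq' : k != q by rewrite -val_eqE /= neq_ltn kq.
have := hk k kq'; rewrite /matching; apply: contraNneq => e.
have := key k pk; rewrite e eq_eig subrr mulr0 xp.
move: (xc k z) => x h; rewrite -subr_eq0 -(intr_eq0 K) -(mulrI_eq0 _ (mulfI n2)) [X in _ == X]h !(rmorphB, rmorphD) /=.
by apply/eqP; case: (par k) => /=; rewrite ?expr0 ?expr1; ring.
Qed.

(** The image of [Pi] is exhausted by vectors that are singular modulo a submodule and have weights
    in [L]: a filtration by highest weight modules, without choosing one. *)
Definition Sec (M : srep) (Pi : 'M[K]_(dim M)) (L : wt -> Prop) := forall P, submod P ->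
  (forall w x, L w -> x *m Pi = x -> x *m Pm M w = x -> raises P x -> P x) -> forall u, P (u *m Pi).

Definition stepL (i : int) (L : wt -> Prop) (w : wt) : Prop :=
  exists k, L (w - eps k) /\ xc k w = i + (par k == false : nat)%:Z.

Record secd (D : wt -> K) (L : wt -> Prop) (q : int) : Prop := Secd {
  sd_M : exists (M : srep) (Pi : 'M[K]_(dim M)),
    [/\ commutant Pi, Pi *m Pi = Pi, forall y, Dser Pi y = D y & Sec Pi L];
  sd_q : forall w, D w != 0 -> Qform par w = q;
  sd_L : forall w, L w -> Qform par w = q }.

Lemma secd_step D L q i : secd D L q -> secd (Fop false i D) (stepL i L) (q + (2 * i + 1)).
Proof.
move=> [[M [Pi0 [c0 i0 hD hS]]] hq hL].
pose c : K := (q + (2 * i + 1))%:~R - q0 K par.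
pose T := tens (sv K par false) M.
have [|Pi [[h1 h2 h3 h4] [[nn h5] h6]]] := @projector _ _ _ T (tPi (sv K par false) Pi0) c (tPi_comm _ c0).
  by rewrite tPiM i0.
have FE y : Fop false i D y = (Qform par y == q + (2 * i + 1))%:R * \sum_k D (y - se false k).
  by rewrite (Fop_level _ _ _ hq) expr0 mul1r.
split; first exists T, Pi.
- split=> //.
    move=> y; rewrite h6 (inj_eq (addIr _)) eqr_int D_tens FE.
    by congr (_ * _); apply: eq_bigr => k _; rewrite hD.
  move=> P hP hx u.
  pose U (y : 'rV[K]_(dim M)) := forall k, P (tvV k y *m Pi).
  have sU : submod U.
    split=> [l|a x y ha hy l|a j x hy l].
    - by rewrite tv0 mul0mx; apply: submod0.
    - by rewrite tvD mulmxDl -scalemxAl; apply: submodL.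
    apply: (submodZI hP (sgB_neq0 (B := sv K par false) a j l)); rewrite scalemxAl.
    have -> : sgB (B := sv K par false) a j l *: tvV l (x *m Ym M a j) =
       tvV l x *m Ym T a j - \sum_m Zs K par false a j l m *: tvV m x.
      by rewrite tv_act addrAC subrr add0r.
    rewrite mulmxBl; apply: submodB => //.
      by rewrite -mulmxA -h1 mulmxA; apply: submodY.
    rewrite mulmx_suml; apply: submod_sum => // m _; rewrite -scalemxAl.
    exact: submodZ.
  have hU y : U (y *m Pi0).
    apply: (hS U sU) => w x Lw xP xw hr k.
    suff H n : forall k : 'I_N, (k < n)%N -> P (tvV k x *m Pi) by apply: (H k.+1).
    elim: n => // n IH {}k kn.
    have wk : tvV k x *m Pi *m Pm T (w + se false k) = tvV k x *m Pi.
      by rewrite -mulmxA (Pm_comm _ h1) mulmxA tv_Pm addrK xw.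
    have rk : raises P (tvV k x *m Pi).
      move=> a j ja; rewrite -mulmxA h1 mulmxA tv_act mulmxDl; apply: submodD => //.
        rewrite mulmx_suml; apply: submod_sum => // l _; rewrite -scalemxAl.
        have [->|nz] := eqVneq (Zs K par false a j k l) 0; first by rewrite scale0r; apply: submod0.
        apply: submodZ => //; apply: IH.
        exact: leq_trans (vord_raise ja nz) kn.
      by rewrite -scalemxAl; apply: submodZ => //; apply: hr.
    have [e|ne] := eqVneq (Qform par (w + se false k)) (q + (2 * i + 1)).
      apply: (hx (w + se false k)) => //; last by rewrite -mulmxA h2.
      exists k; split; first by rewrite addrK.
      apply/eqP; rewrite Fop_contents addrK -(Qform_se_eq _ _ _ (hL _ Lw)) e expr0 mul1r.
      by [].
    apply: (nilp_mod hP h5 _ (Cas_singular hP wk rk)); first by rewrite -mulmxA h2.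
    by rewrite (inj_eq (addIr _)) eqr_int.
  rewrite -h4 mulmxA [u *m tPi _ Pi0](tv_sum (B := sv K par false) (M := M)) mulmx_suml.
  apply: submod_sum => // k _; rewrite cmp_tPi; exact: hU.
- by move=> w; rewrite FE; case: (Qform par w =P _) => [//|_]; rewrite mul0r eqxx.
move=> w [k [Lw hk]]; apply/eqP; have := Qform_se_eq false k i (hL _ Lw).
by rewrite -[eps k]/(se false k) subrK expr0 mul1r => ->; rewrite -Fop_contents hk.
Qed.

Lemma hwd_secd D z : hwd D z -> secd D (eq z) (Qform par z).
Proof.
move=> hD; have [M [Pi [v [hM hy]]]] := hD; split=> [|w|w <-//]; last exact: hwd_level.
exists M, Pi; split=> //; [exact: hw_comm hM|exact: hw_idem hM|].
move=> P hP h u; apply: (hw_gen hM) => //; apply: (h z) => //.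
- exact: hw_vPi hM.
- exact: hw_wt hM.
by move=> i j ji; rewrite (hw_sing hM ji); apply: submod0.
Qed.

Lemma secd_ex D L q y : secd D L q -> D y != 0 -> exists w, L w.
Proof.
move=> [[M [Pi [h1 h2 hD hS]]] _ _] Dy; apply: contrapT => h.
have Pi0 : Pi = 0.
  apply/row_matrixP => b; rewrite rowE row0.
  apply: (hS _ (@submod_zero _ _ _ M)) => w x Lw; case: h; by exists w.
by move: Dy; rewrite -hD Pi0 Dser0 eqxx.
Qed.

(** Epsilon-entries minus delta-entries at [t]. A vee cancels, so for a regular weight this function
    records the typical entries, its core. *)
Definition mc (y : wt) (t : int) : int := \sum_k (-1) ^+ par k * (xc k y == t)%:R.
Definition shiftc (I : seq int) (t : int) : int := \sum_(i <- I) ((t == i + 1)%:R - (t == i)%:R).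

(** An epsilon-entry moving right and a delta-entry moving left have the same effect on the core, so
    one translation shifts all cores uniformly. *)
Lemma mc_step y k i t : xc k y = i + (par k == false : nat)%:Z ->
  mc y t = mc (y - eps k) t + ((t == i + 1)%:R - (t == i)%:R).
Proof.
move=> hk; rewrite /mc (bigD1 k) //= [\sum_k _ in RHS](bigD1 k) //=.
rewrite [in RHS](eq_bigr (fun l => (-1) ^+ par l * (xc l y == t)%:R)); last first.
  by move=> l /negbTE lk; rewrite -[eps k]/(se false k) xc_seB lk mul0r subr0.
rewrite -[eps k]/(se false k) xc_seB eqxx hk addbF mul1r; move: (\sum_(_ | _) _) => S.
case: (par k) => /=; rewrite ?expr0 ?expr1 ?mul1r ?mulN1r ?addr0 ?addrK ?opprK.
  by rewrite [i + 1 == t]eq_sym [i == t]eq_sym; ring.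
by rewrite [i + 1 == t]eq_sym [i == t]eq_sym; ring.
Qed.

Fixpoint FI (I : seq int) (D : wt -> K) := if I is i :: I' then FI I' (Fop false i D) else D.
Fixpoint LI (I : seq int) (L : wt -> Prop) := if I is i :: I' then LI I' (stepL i L) else L.

Lemma secd_FI I D L q : secd D L q -> exists q', secd (FI I D) (LI I L) q'.
Proof.
elim: I D L q => [|i I IH] D L q h /=; first by exists q.
exact: IH (secd_step i h).
Qed.

Lemma shiftc_cons i I t : shiftc (i :: I) t = ((t == i + 1)%:R - (t == i)%:R) + shiftc I t.
Proof. by rewrite /shiftc big_cons. Qed.

Lemma LI_mc I L w : LI I L w -> exists2 u, L u & forall t, mc w t = mc u t + shiftc I t.
Proof.
elim: I L => [|i I IH] L /=; first by exists w => // t; rewrite /shiftc big_nil addr0.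
move=> /IH[u [k [Lk hk]] hu]; exists (u - eps k) => // t.
by rewrite hu (mc_step t hk) shiftc_cons -[LHS]addrA.
Qed.

Lemma FI_cat I I' D : FI (I ++ I') D = FI I' (FI I D).
Proof. by elim: I D => //= i I IH D. Qed.

Definition restr (mu : int -> int) (D : wt -> K) (w : wt) : K := if `[< mc w =1 mu >] then D w else 0.

(** Because cores shift uniformly, translations respect the decomposition of a series by cores. *)
Lemma FI_restr I D mu y : FI I (restr mu D) y = restr (fun t => mu t + shiftc I t) (FI I D) y.
Proof.
elim: I D mu => [|i I IH] D mu /=.
  by rewrite /restr; congr (if _ then _ else _); apply/asbool_equiv_eq; split=> h t; rewrite h /shiftc big_nil addr0.
have -> : Fop false i (restr mu D) = restr (fun t => mu t + ((t == i + 1)%:R - (t == i)%:R)) (Fop false i D).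
  apply: funext => w; rewrite {2}/restr; case: asboolP => h.
    apply: eq_bigr => k /eqP hk; rewrite /restr asboolT // => t.
    by apply: (addIr ((t == i + 1)%:R - (t == i)%:R)); rewrite -h -mc_step.
  rewrite /Fop big1 // => k /eqP hk; rewrite /restr asboolF // => h'; apply: h => t.
  by rewrite (mc_step t hk) -[eps k]/(se false k) h'.
rewrite IH /restr; congr (if _ then _ else _); apply/asbool_equiv_eq.
by split=> h t; rewrite h shiftc_cons; ring.
Qed.

Lemma int_max (P : int -> Prop) B : (exists x, P x) -> (forall x, P x -> x <= B) ->
  exists2 x, P x & forall y, P y -> y <= x.
Proof.
move=> [x0 Px0] hB.
have ex : exists n, `[< P (B - n%:Z) >].
  exists `|B - x0|%N; apply/asboolP; have := hB _ Px0 => h.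
  by have -> : B - (`|B - x0|%N)%:Z = x0 by lia.
case: (ex_minnP ex) => n /asboolP Pn hn; exists (B - n%:Z) => // y Py.
have := hB _ Py => h; have := hn `|B - y|%N.
have -> : B - (`|B - y|%N)%:Z = y by lia.
by move=> /(_ (asboolT Py)); lia.
Qed.

Lemma psum_succ (k : 'I_N) y : psum k.+1 y = psum k y + y k.
Proof.
rewrite /psum (bigD1 k) //= addrC; congr (_ + _); apply: eq_bigl => l; rewrite -val_eqE /=; lia.
Qed.

Lemma lex_max (D : wt -> K) (b : nat -> int) nu0 : (forall y k, D y != 0 -> psum k y <= b k) -> D nu0 != 0 ->
  exists nu, D nu != 0 /\ forall w (k : 'I_N), D w != 0 -> (forall j : 'I_N, (j < k)%N -> w j = nu j) -> w k <= nu k.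
Proof.
move=> hb h0.
suff H n : exists nu, D nu != 0 /\ forall w (k : 'I_N), (k < n)%N -> D w != 0 ->
    (forall j : 'I_N, (j < k)%N -> w j = nu j) -> w k <= nu k.
  have [nu [h1 h2]] := H N; exists nu; split=> // w k; exact: h2.
elim: n => [|n [nu [h1 h2]]]; first by exists nu0.
have [nN|Nn] := ltnP n N; last first.
  by exists nu; split=> // w k kn; apply: h2; apply: leq_trans Nn.
pose kn := Ordinal nN.
pose P x := exists w, [/\ D w != 0, forall j : 'I_N, (j < n)%N -> w j = nu j & w kn = x].
have psE (w : wt) : (forall j : 'I_N, (j < n)%N -> w j = nu j) -> psum n w = psum n nu.
  by move=> hw; apply: eq_bigr => j jn; apply: hw.
have [|x [w [w1 w2 w3]]|x [w [w1 w2 w3]] hx] := @int_max P (b n.+1 - psum n nu).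
- by exists (nu kn), nu.
- by have := hb w n.+1 w1; rewrite (psum_succ kn) w3 psE //=; lia.
exists w; split=> // w' k; rewrite ltnS leq_eqVlt => /orP[/eqP e|lt] d' hw'.
  have ek : k = kn by apply: val_inj.
  rewrite ek w3; apply: hx; exists w'; split=> // j jn; rewrite -w2 //; apply: hw'.
  by rewrite e.
have jw (j : 'I_N) : (j < k)%N -> w j = nu j by move=> jk; apply: w2; apply: ltn_trans lt.
by rewrite w2 //; apply: h2 => // j jk; rewrite hw' // jw.
Qed.

Lemma waddE (w v : wt) (k : 'I_N) : (w + v) k = w k + v k :> int.
Proof. by rewrite ffunE. Qed.
Lemma wsubE (w v : wt) (k : 'I_N) : (w - v) k = w k - v k :> int.
Proof. by rewrite !ffunE. Qed.
Lemma epsE (i k : 'I_N) : eps i k = (k == i)%:R :> int.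
Proof. by rewrite ffunE. Qed.

Lemma epsMnE (i k : 'I_N) r : (eps i *+ r) k = (k == i)%:R * r%:Z :> int.
Proof. by rewrite ffunMnE ffunE; case: (k == i); rewrite ?mul0r ?mul1r ?mul0rn /= ?natz. Qed.

Section FarAway.
Variables (D : wt -> K) (nu : wt) (B : int).
Hypothesis hmax : forall w (k : 'I_N), D w != 0 -> (forall j : 'I_N, (j < k)%N -> w j = nu j) -> w k <= nu k.
Hypothesis hB : forall k, `|nu k| < B.

(** Values beyond all coordinates of [nu]. The summand [N - k] keeps them distinct, and all are
    positive, so a weight with these coordinates has no two entries at one position. *)
Let Z (k : 'I_N) : int := B + (N - k)%N%:Z.
Let cont (k : 'I_N) (y : int) : int := if par k then - y - 1 else y.
Let mix (k : nat) (w : wt) : wt := [ffun j : 'I_N => if (j < k)%N then Z j else w j].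

Lemma Fop_cont i (f : wt -> K) w : Fop false i f w = \sum_(k | cont k (w k - 1) == i) f (w - eps k).
Proof.
apply: eq_bigl => k; rewrite /Submission.xc /cont; case: (par k) => /=; rewrite ?expr0 ?expr1; apply/eqP/eqP; lia.
Qed.

Lemma mix_sub k (l : 'I_N) w : (k <= l)%N -> mix k w - eps l = mix k (w - eps l).
Proof.
move=> kl; apply/ffunP => j; rewrite !ffunE; case: ifP => // jk.
have -> : (j == l) = false by apply/negbTE; rewrite -val_eqE /=; lia.
by rewrite subr0.
Qed.

(** Coordinate [k] climbs by one per step. Earlier coordinates are already too far out to react, and
    a reaction of a later one would leave coordinate [k] larger than the maximality of [nu]
    permits. *)
Lemma far_block (k : 'I_N) (G : wt -> K) (n : nat) :
  (forall w : wt, (forall j : 'I_N, (j < k)%N -> w j = nu j) -> G (mix k w) = D w) ->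
  nu k + n%:Z <= Z k ->
  forall w : wt, (forall j : 'I_N, (j < k)%N -> w j = nu j) -> nu k + n%:Z <= w k ->
  FI [seq cont k (nu k + l%:Z) | l <- iota 0 n] G (mix k w) =
    if w k == nu k + n%:Z then D (w - eps k *+ n) else 0.
Proof.
move=> hG; elim: n => [|n IH] hn w hw hk.
  rewrite /= hG // addr0 subr0; case: eqP => // ne; apply/eqP/negPn/negP => d.
  by have := hmax d hw; rewrite addr0 in hk; lia.
rewrite -addn1 iotaD map_cat FI_cat /= add0n Fop_cont.
have hn' : nu k + n%:Z <= Z k by lia.
rewrite big_mkcond (bigD1 k) //= big1 ?addr0; last first.
  move=> l lk; case: eqP => // e.
  have [kl|lk'] := ltnP k l; last first.
    have ll : (l < k)%N by move: lk; rewrite -val_eqE /=; lia.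
    exfalso; move: e; have -> : mix k w l = Z l by [rewrite ffunE ll]; rewrite /cont /Z; have := hB k; rewrite /Z in hn.
    by have := ltn_ord k; case: (par l); case: (par k); lia.
  have kl' : (k <= l)%N by apply: ltnW.
  have nkl : (k == l) = false by rewrite eq_sym; apply/negbTE.
  rewrite mix_sub // IH //; last first.
  - by rewrite wsubE epsE nkl subr0; lia.
  - by move=> j jk; rewrite wsubE epsE hw //; have -> : (j == l) = false by [apply/negbTE; rewrite -val_eqE /=; lia]; rewrite subr0.
  by rewrite wsubE epsE nkl subr0; case: eqP => // e'; exfalso; lia.
have -> : mix k w k = w k by rewrite ffunE ltnn.
have -> : (cont k (w k - 1) == cont k (nu k + n%:Z)) = (w k == nu k + (n + 1)%N%:Z).
  by rewrite /cont; case: (par k); apply/eqP/eqP; lia.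
case: eqP => // e; rewrite mix_sub // IH //; last first.
- by rewrite wsubE epsE eqxx; lia.
- by move=> j jk; rewrite wsubE epsE hw //; have -> : (j == k) = false by [apply/negbTE; rewrite -val_eqE /=; lia]; rewrite subr0.
rewrite wsubE epsE eqxx; have -> : (w k - 1 == nu k + n%:Z) by apply/eqP; lia.
by rewrite addn1 mulrS opprD addrA.
Qed.

Lemma far_all n : (n <= N)%N -> exists I, forall w : wt, (forall j : 'I_N, (j < n)%N -> w j = nu j) ->
  FI I D (mix n w) = D w.
Proof.
elim: n => [|n IH] nN.
  by exists [::] => w _ /=; congr D; apply/ffunP => j; rewrite ffunE.
have [I hI] := IH (ltnW nN); pose k := Ordinal nN.
have hZ : nu k <= Z k by rewrite /Z; have := hB k; lia.
exists (I ++ [seq cont k (nu k + l%:Z) | l <- iota 0 `|Z k - nu k|%N]) => w hw.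
have hw' (j : 'I_N) : (j < k)%N -> w j = nu j by move=> jk; apply: hw; apply: ltnW.
set r := `|_|%N; have er : nu k + r%:Z = Z k by rewrite /r; lia.
have -> : mix n.+1 w = mix k (w + eps k *+ r).
  apply/ffunP => j; rewrite ffunE [RHS]ffunE waddE epsMnE /= ltnS leq_eqVlt.
  have [->|jk] := eqVneq j k; first by rewrite eqxx ltnn /= hw // mul1r er.
  by rewrite -[(j == n :> nat)]/(j == k) (negbTE jk) /= mul0r addr0.
have hr : (w + eps k *+ r) k = nu k + r%:Z.
  by rewrite waddE epsMnE eqxx mul1r hw.
rewrite FI_cat (far_block (k := k)) //; last 3 first.
- by rewrite er.
- by move=> j jk; rewrite waddE epsMnE hw' //; have -> : (j == k) = false by [apply/negbTE; rewrite -val_eqE /= neq_ltn jk]; rewrite mul0r addr0.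
- by rewrite hr.
by rewrite hr eqxx addrK.
Qed.
End FarAway.

(** Let [nu] be lexicographically maximal in the part of [D] with the core of [y]. Translations
    carry [nu] to a weight with all entries at distance at least [B], and some highest weight [w] of
    a section has the core of [z] shifted by the same amount. Far out the cores of both results
    agree, so all entries of [w] are far out too; then near the origin both cores vanish, and the
    difference is zero everywhere. *)
Lemma linkage D z y : hwd D z -> D y != 0 -> mc y =1 mc z.
Proof.
move=> hD Dy; pose mu := mc y; suff: mu =1 mc z by [].
have Ry : restr mu D y != 0 by rewrite /restr asboolT.
have [|nu [hnu hmax]] := @lex_max (restr mu D) (fun k => psum k z) y _ Ry.
  by move=> w k; rewrite /restr; case: asboolP => _; [apply: hwd_psum hD|rewrite eqxx].
have numu : mc nu =1 mu by move: hnu; rewrite /restr; case: asboolP => //; rewrite eqxx.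
pose B : int := \sum_k (`|nu k| + `|z k|) + 1.
have hBn k : `|nu k| < B /\ `|z k| < B.
  have : `|nu k| + `|z k| <= \sum_k (`|nu k| + `|z k|).
    by rewrite [leRHS](bigD1 k) //= lerDl sumr_ge0 // => i _; rewrite addr_ge0.
  by rewrite /B; lia.
have [I hI] := far_all hmax (fun k => proj1 (hBn k)) (leqnn N).
have := hI nu (fun _ _ => erefl); set yinf := finfun _ => e.
have : restr (fun t => mu t + shiftc I t) (FI I D) yinf != 0 by rewrite -FI_restr e.
rewrite /restr; case: asboolP => [hinf FIy|_]; last by rewrite eqxx.
have [q' sd] := secd_FI I (hwd_secd hD).
have [w /LI_mc[u <- hw]] := secd_ex sd FIy.
have xinf k : xc k yinf = (-1) ^+ par k * (B + (N - k)%N%:Z) by rewrite /Submission.xc ffunE ltn_ord.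
have diff t : mc z t - mu t = mc w t - mc yinf t by rewrite hw hinf; ring.
have mc_ex v t : mc v t != 0 -> exists l, xc l v = t.
  move=> nz; apply: contrapT => h; case/eqP: nz; rewrite /mc big1 // => k _.
  by case: eqP => [e'|_]; rewrite ?mulr0 //; case: h; exists k.
have far0 (v : wt) t : (forall k, `|v k| < B) -> B <= `|t| -> mc v t = 0.
  move=> hv ht; apply/eqP/negPn/negP => /mc_ex[l el]; have := hv l; move: ht; rewrite -el /Submission.xc.
  by rewrite normrM normrX normrN1 expr1n mul1r; lia.
have B0 : 0 <= B by rewrite /B addr_ge0 // sumr_ge0 // => i _; rewrite addr_ge0.
have absx k : `|xc k yinf| = B + (N - k)%N%:Z.
  by rewrite xinf normrM normrX normrN1 expr1n mul1r ger0_norm // addr_ge0.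
have occ k : exists l, xc l w = xc k yinf.
  apply: mc_ex; have : mc w (xc k yinf) - mc yinf (xc k yinf) = 0.
    by rewrite -diff -numu !far0 ?subrr // ?absx ?lerDl // => j; have [] := hBn j.
  move/eqP; rewrite subr_eq0 => /eqP->; rewrite /mc (bigD1 k) //= eqxx mulr1 big1 ?addr0 ?signr_eq0 //.
  move=> l lk; case: eqP => [e'|_]; last by rewrite mulr0.
  exfalso; have := absx l; rewrite e' absx; have := ltn_ord l; have := ltn_ord k.
  by move: lk; rewrite -val_eqE /=; lia.
pose f k := projT1 (cid (occ k)); have hf k : xc (f k) w = xc k yinf := projT2 (cid (occ k)).
have finj : injective f.
  move=> k l e'; have := hf k; rewrite e' hf => /(congr1 (fun x : int => `|x|)); rewrite !absx => e2.
  by apply: val_inj => /=; have := ltn_ord l; have := ltn_ord k; lia.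
have win l : B <= `|xc l w|.
  have [g gK fK] := injF_bij finj; by rewrite -(fK l) hf absx lerDl.
move=> t; apply/eqP; rewrite eq_sym -subr_eq0 diff; apply/eqP.
have [le|lt] := leP B `|t|; last first.
  have z1 (v : wt) : (forall l, B <= `|xc l v|) -> mc v t = 0.
    by move=> hv; apply/eqP/negPn/negP => /mc_ex[l el]; have := hv l; rewrite el; lia.
  by rewrite !z1 ?subrr // => l; rewrite absx lerDl.
by rewrite -diff -numu !far0 ?subrr // => k; have [] := hBn k.
Qed.

End Linkage.

(** * Alternating sums *)

Section Alternation.
Variables (K : numFieldType) (N : nat) (par : 'I_N -> bool).
Local Notation wt := (wt N).
Local Notation xc := (xc par).
Local Notation Fop := (@Fop K N par).
Implicit Types (y z : wt) (w : 'S_N) (f : wt -> K).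

Definition act w y : wt := [ffun k => y (w k)].
Definition Wg : pred 'S_N := fun w => [forall k, par (w k) == par k].
Definition Alt f y : K := \sum_(w | Wg w) (-1) ^+ w * f (act w y).
Definition asym f := forall w y, Wg w -> f (act w y) = (-1) ^+ w * f y.
Definition reg y := forall i j, par i = par j -> xc i y = xc j y -> i = j.

Lemma actE w y k : act w y k = y (w k) :> int. Proof. by rewrite ffunE. Qed.
Lemma WgP w : reflect (forall k, par (w k) = par k) (Wg w).
Proof. exact: 'forall_eqP. Qed.
Lemma actM w u y : act (w * u)%g y = act w (act u y).
Proof. by apply/ffunP => k; rewrite !ffunE permM. Qed.
Lemma act1 y : act 1%g y = y.
Proof. by apply/ffunP => k; rewrite !ffunE perm1. Qed.
Lemma WgM w u : Wg w -> Wg u -> Wg (w * u)%g.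
Proof. by move=> /WgP hw /WgP hu; apply/WgP => k; rewrite permM hu hw. Qed.
Lemma WgV w : Wg w -> Wg w^-1%g.
Proof. by move=> /WgP hw; apply/WgP => k; rewrite -{2}(permKV w k) hw. Qed.
Lemma Wg1 : Wg 1%g. Proof. by apply/WgP => k; rewrite perm1. Qed.
Lemma Wg_tperm i j : par i = par j -> Wg (tperm i j).
Proof. by move=> pij; apply/WgP => k; case: tpermP => // ->. Qed.
Lemma xc_act w y k : Wg w -> xc k (act w y) = xc (w k) y.
Proof. by move=> /WgP hw; rewrite /Submission.xc actE hw. Qed.

Lemma Alt_act w f y : Wg w -> Alt f (act w y) = (-1) ^+ w * Alt f y.
Proof.
move=> hw; rewrite /Alt mulr_sumr (reindex_inj (mulIg w^-1)%g) /=.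
apply: eq_big => [u|u _]; first by apply/idP/idP => h; [rewrite -(mulgKV w u)|]; apply: WgM => //; apply: WgV.
by rewrite -actM mulgKV odd_permM odd_permV signr_addb [RHS]mulrA [X in _ = X * _]mulrC.
Qed.

Lemma Alt_asym f : asym (Alt f). Proof. by move=> w y; apply: Alt_act. Qed.

Lemma Alt_pre w f y : Wg w -> Alt (fun u => f (act w u)) y = (-1) ^+ w * Alt f y.
Proof.
move=> hw; rewrite /Alt mulr_sumr (reindex_inj (mulgI w^-1)%g) /=.
apply: eq_big => [u|u _]; first by apply/idP/idP => h; [rewrite -(mulKVg w u)|]; apply: WgM => //; apply: WgV.
by rewrite -actM mulKVg odd_permM odd_permV signr_addb mulrA.
Qed.

Lemma asym_reg f y : asym f -> f y != 0 -> reg y.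
Proof.
move=> hf fy i j pij xij; apply/eqP/negPn/negP => ij; case/negP: fy.
have e : act (tperm i j) y = y.
  have yij : y i = y j by move: xij; rewrite /Submission.xc pij => /(mulfI _); apply; rewrite signr_eq0.
  by apply/ffunP => k; rewrite actE; case: tpermP => // ->.
have := hf _ y (Wg_tperm pij); rewrite e odd_tperm ij expr1 mulN1r => /eqP.
by rewrite -subr_eq0 opprK -mulr2n mulrn_eq0.
Qed.

(** An alternating sum vanishes off the regular weights, so a template may be altered there at will.
    This freedom absorbs the discrepancies between thresholds below. *)
Lemma Alt_reg f f' y : (forall u, reg u -> f u = f' u) -> Alt f y = Alt f' y.
Proof.
move=> h; have [hy|hy] := pselect (reg y).
  apply: eq_bigr => w hw; rewrite h // => i j pij; rewrite !xc_act // => /hy e.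
  by apply: (@perm_inj _ w); apply: e; rewrite !(WgP _ hw).
have z0 g : Alt g y = 0 by apply/eqP/negPn/negP => n; apply: hy; exact: asym_reg (Alt_asym g) n.
by rewrite !z0.
Qed.

Lemma AltZ a f y : Alt (fun u => a * f u) y = a * Alt f y.
Proof. by rewrite /Alt mulr_sumr; apply: eq_bigr => w _; rewrite mulrCA. Qed.
Lemma Alt_sum (I : finType) (P : pred I) (F : I -> wt -> K) y :
  Alt (fun u => \sum_(i | P i) F i u) y = \sum_(i | P i) Alt (F i) y.
Proof. by rewrite /Alt exchange_big; apply: eq_bigr => w _; rewrite mulr_sumr. Qed.
Lemma eq_Alt f f' y : (forall u, f u = f' u) -> Alt f y = Alt f' y.
Proof. by move=> h; apply: eq_bigr => w _; rewrite h. Qed.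

Lemma act_se w y s k : Wg w -> act w (y - se s (w k)) = act w y - se s k.
Proof.
move=> hw; apply/ffunP => l; rewrite actE !wsubE actE; congr (_ - _).
by rewrite /se; case: s; rewrite !ffunE (inj_eq perm_inj).
Qed.

Lemma Fop_act w s i f y : Wg w -> Fop s i f (act w y) = Fop s i (fun u => f (act w u)) y.
Proof.
move=> hw; rewrite /Submission.Fop [RHS](reindex_inj (@perm_inj _ w)) /=.
by apply: eq_big => [k|k _]; [rewrite xc_act // (WgP _ hw)|rewrite act_se].
Qed.

Lemma Fop_asym s i f : asym f -> asym (Fop s i f).
Proof.
move=> hf w y hw; rewrite Fop_act // /Submission.Fop mulr_sumr.
by apply: eq_bigr => k _; rewrite hf.
Qed.

Lemma Fop_Alt s i f y : Fop s i (Alt f) y = Alt (Fop s i f) y.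
Proof.
rewrite /Alt /Submission.Fop exchange_big; apply: eq_bigr => w hw /=.
by rewrite -mulr_sumr; congr (_ * _); rewrite -[RHS]/(Fop s i f (act w y)) Fop_act.
Qed.

Lemma mc_act w y t : Wg w -> mc par (act w y) t = mc par y t.
Proof.
move=> hw; rewrite /mc [RHS](reindex_inj (@perm_inj _ w)) /=.
by apply: eq_bigr => k _; rewrite xc_act // (WgP _ hw).
Qed.

(** Since parity is monotone, a transposition inside a block is a product of adjacent transpositions
    inside the same block. *)
Lemma asym_adj f : (forall i j : 'I_N, i < j -> par i -> par j)%N ->
  (forall (i j : 'I_N) y, j = i.+1 :> nat -> par i = par j -> f (act (tperm i j) y) = - f y) -> asym f.
Proof.
move=> pm h.
have ht n : forall (i j : 'I_N) y, j = (i + n).+1 :> nat -> par i = par j -> f (act (tperm i j) y) = - f y.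
  elim: n => [|n IH] i j y ij pij; first by apply: h; rewrite // ij addn0.
  have lj : (i + n.+1 < N)%N by have := ltn_ord j; lia.
  pose l := Ordinal lj.
  have pl : par i = par l.
    have il : (i < l)%N by rewrite /=; lia.
    have llj : (l < j)%N by rewrite ij /=; lia.
    case e : (par i); first by rewrite (pm i l il e).
    by case e' : (par l) => //; move: (pm l j llj e'); rewrite -pij e.
  have hl (y' : wt) : f (act (tperm i l) y') = - f y' by apply: IH => //=; lia.
  have hj (y' : wt) : f (act (tperm l j) y') = - f y' by apply: h; rewrite // -?pl // ij.
  have nil : i != l by rewrite -val_eqE /=; lia.
  have nij : i != j by rewrite -val_eqE /= ij; lia.
  have -> : tperm i j = (tperm l j * tperm i l * tperm l j)%g.
    apply/permP => x; rewrite !permM; have [->|xi] := eqVneq x i.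
      by rewrite tpermL [tperm l j i]tpermD 1?eq_sym // !tpermL.
    have [->|xj] := eqVneq x j; first by rewrite tpermR tpermR tpermR tpermD // eq_sym.
    have [->|xl] := eqVneq x l.
      by have nlj : l != j by [rewrite -val_eqE /= ij; lia]; rewrite tpermL [tperm i l j]tpermD // tpermR tpermD // eq_sym.
    by rewrite !tpermD // eq_sym.
  by rewrite !actM hj hl hj opprK.
have hij i j y : i != j -> par i = par j -> f (act (tperm i j) y) = - f y.
  move=> ij pij; have [lt|lt|e] := ltngtP i j.
  - by apply: (ht (j - i.+1)%N) => //; lia.
  - by rewrite tpermC; apply: (ht (i - j.+1)%N) => //; lia.
  - by case/eqP: ij; apply: val_inj.
move=> w; have [n le] := ubnP #|[set k | w k != k]|; elim: n w le => // n IH w le y hw.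
have [k wk|w1] := pickP [pred k | w k != k]; last first.
  have -> : w = 1%g by apply/permP => k; rewrite perm1; apply/eqP/negPn; rewrite [_ != _]w1.
  by rewrite act1 odd_perm1 mul1r.
set t := tperm k (w k); set w' := (w * t)%g.
have ew : w = (w' * t)%g by rewrite /w' -mulgA tperm2 mulg1.
have pk : par k = par (w k) by rewrite (WgP _ hw).
have hw' : Wg w' by apply: WgM => //; apply: Wg_tperm.
have kw : k != w k by rewrite eq_sym.
have sup : (#|[set x | w' x != x]| < n)%N.
  rewrite ltnS in le; apply: leq_trans le; apply: proper_card; apply/properP; split.
    apply/fintype.subsetP => x; rewrite !inE; apply: contraNN => /eqP wx; rewrite /w' permM wx tpermD //.
      by apply: contraNneq wk => ->; rewrite /= wx.
    by apply: contraNneq wk => e; apply/eqP; apply: (@perm_inj _ w); rewrite e wx.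
  exists k; rewrite inE //= negbK /w' permM tpermR //.
rewrite ew actM IH // hij // odd_permM odd_tperm kw addbT signrN mulrN mulNr.
by [].
Qed.

Definition sgx (x : int) : K := (-1) ^+ odd (absz x).
Lemma sgxS x : sgx (x + 1) = - sgx x.
Proof.
rewrite /sgx; have -> : odd (absz (x + 1)) = ~~ odd (absz x); last by rewrite signrN.
case: x => n; first by rewrite -PoszD addn1.
have -> : Negz n + 1 = - n%:Z by rewrite NegzE; lia.
by rewrite NegzE !abszN /= negbK.
Qed.
Lemma sgx_sq x : sgx x * sgx x = 1. Proof. by rewrite /sgx -signr_addb addbb. Qed.

Section Template.
Variables (pi : 'I_N -> 'I_N) (c : 'I_N -> int) (th : 'I_N -> int -> bool).
(** Template of an exponential divided by a product of factors [1 + e^-beta]. The involution [pi]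
    pairs the two entries of a vee; they move together, with an alternating sign, wherever the
    threshold [th] allows. A pair is charged to its epsilon-entry, hence the factor 1 for the
    delta-entry. *)
Definition PsiF (k : 'I_N) y : K :=
  if pi k == k then (xc k y == c k)%:R
  else if par k then 1 else ((xc k y == xc (pi k) y) && th k (xc k y))%:R * sgx (xc k y).
Definition Psi y : K := \prod_k PsiF k y.
End Template.

Lemma eq_Psi pi c th pi' c' th' y : pi =1 pi' -> (forall k, pi k = k -> c k = c' k) ->
  (forall k t, pi k != k -> th k t = th' k t) -> Psi pi c th y = Psi pi' c' th' y.
Proof.
move=> hp hc ht; apply: eq_bigr => k _; rewrite /PsiF -hp.
case: eqVneq => e; first by rewrite hc.
by rewrite ht.
Qed.

Lemma Psi_act w pi c th y : Wg w -> Psi pi c th (act w y) =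
  Psi (fun k => w (pi (w^-1%g k))) (fun k => c (w^-1%g k)) (fun k => th (w^-1%g k)) y.
Proof.
move=> hw; rewrite /Psi [RHS](reindex_inj (@perm_inj _ w)) /=; apply: eq_bigr => k _.
by rewrite /PsiF permK (inj_eq perm_inj) !xc_act // (WgP _ hw).
Qed.

Section FopTemplate.
Variables (pi : 'I_N -> 'I_N) (c : 'I_N -> int) (th : 'I_N -> int -> bool).
Hypothesis piK : involutive pi.
Hypothesis pi_par : forall k, pi k != k -> par (pi k) = ~~ par k.
Definition upd (c : 'I_N -> int) (k : 'I_N) (t : int) (l : 'I_N) := if l == k then t else c l.
Definition unpair (p k : 'I_N) := if (k == p) || (k == pi p) then k else pi k.

Lemma PsiF_far k l s y : l != k -> pi l != k -> PsiF pi c th l (y - se s k) = PsiF pi c th l y.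
Proof.
move=> lk plk; have xl j : j != k -> xc j (y - se s k) = xc j y.
  by move=> /negbTE jk; rewrite xc_seB jk mul0r subr0.
by rewrite /PsiF !xl.
Qed.

Lemma FPsi_typ s i k y : pi k = k ->
  (xc k y == i + (par k == s : nat)%:Z)%:R * Psi pi c th (y - se s k) =
  (c k == i + (par k != s : nat)%:Z)%:R * Psi pi (upd c k (c k + (-1) ^+ (par k (+) s))) th y.
Proof.
move=> pk; rewrite /Psi (bigD1 k) //= [in RHS](bigD1 k) //= !mulrA; congr (_ * _); last first.
  apply: eq_bigr => l lk; rewrite PsiF_far //.
    by rewrite /PsiF /upd (negbTE lk).
  by apply: contraNneq lk => e; rewrite -[l]piK e pk.
rewrite /PsiF pk eqxx /upd eqxx xc_seB eqxx mul1r -!natrM !mulnb; congr (_%:R); congr nat_of_bool.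
by case: (par k); case: s; rewrite /= ?expr0 ?expr1; apply/andP/andP => -[/eqP h1 /eqP h2]; split; apply/eqP; lia.
Qed.

(** Either entry of the pair may make the step, and the two results carry opposite signs. They
    cancel unless the threshold separates [i] from [i + 1], in which case the pair is split into two
    fixed entries. *)
Lemma FPsi_pair s i p y : pi p != p -> par p = false ->
  (xc p y == i + (par p == s : nat)%:Z)%:R * Psi pi c th (y - se s p) +
  (xc (pi p) y == i + (par (pi p) == s : nat)%:Z)%:R * Psi pi c th (y - se s (pi p)) =
  sgx i * ((th p i)%:R - (th p (i + 1))%:R) *
    Psi (unpair p) (upd (upd c p (i + (~~ s : nat)%:Z)) (pi p) (i + (s : nat)%:Z)) th y.
Proof.
move=> pp parp; have parq : par (pi p) = true by rewrite pi_par // parp.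
set q := pi p in pp parq *; have qK : pi q = p by rewrite /q piK.
have spl (f : 'I_N -> K) : \prod_k f k = f p * f q * \prod_(k | (k != p) && (k != q)) f k :> K.
  by rewrite (bigD1 p) //= (bigD1 q) //= mulrA.
have far k : (k != p) && (k != q) -> (pi k != p) && (pi k != q).
  move=> /andP[kp kq]; apply/andP; split; [apply: contraNneq kq|apply: contraNneq kp] => e.
    by rewrite -[k]piK e.
  by rewrite -[k]piK e qK.
rewrite /Psi !spl.
rewrite [X in _ * (_ * _ * X) + _](_ : _ = \prod_(k | (k != p) && (k != q)) PsiF pi c th k y); last first.
  by apply: eq_bigr => k hk; have /andP[h1 h2] := far k hk; have /andP[h3 h4] := hk; rewrite PsiF_far.
rewrite [X in _ + _ * (_ * _ * X)](_ : _ = \prod_(k | (k != p) && (k != q)) PsiF pi c th k y); last first.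
  by apply: eq_bigr => k hk; have /andP[h1 h2] := far k hk; have /andP[h3 h4] := hk; rewrite PsiF_far.
rewrite [X in _ = _ * (_ * _ * X)](_ : _ = \prod_(k | (k != p) && (k != q)) PsiF pi c th k y); last first.
  by apply: eq_bigr => k /andP[/negbTE h3 /negbTE h4]; rewrite /PsiF /unpair /upd -/q h3 h4.
move: (\prod_(k | _) _) => R; rewrite !mulrA -mulrDl; congr (_ * R).
have pq : (p == q) = false by rewrite eq_sym; apply/negbTE.
have qp : (q == p) = false by apply/negbTE.
rewrite /PsiF /unpair /upd -/q qK !eqxx pq qp orbT parp parq !mulr1.
have h1 := sgxS i; move: h1; rewrite !xc_seB !eqxx pq qp !mul1r mul0r subr0 parp parq.
case: s => /=; rewrite ?expr0 ?expr1 ?addr0 ?opprK -?[Posz 1]/(1 : int); move: (xc p y) (xc q y) => u v h1.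
  have [->|ui] := eqVneq u i; last first.
    rewrite !mul0r mulr0 mul0r add0r; case: eqP => [->|_]; last by rewrite mul0r.
    by rewrite addrK (negbTE ui) !mul0r mulr0.
  rewrite mul1r eq_sym; case: (eqVneq v (i + 1)) => [->|_]; last by rewrite !mul0r mulr0 addr0.
  by rewrite addrK eqxx h1 /= !mulr1 mul1r; case: (th p i); case: (th p _); rewrite /=; ring.
have [->|ui] := eqVneq u (i + 1); last first.
  rewrite !mul0r mulr0 mul0r add0r; case: eqP => [->|_]; last by rewrite mul0r.
  by rewrite (negbTE ui) !mul0r mulr0.
rewrite addrK mul1r eq_sym; case: (eqVneq v i) => [->|_]; last by rewrite !mul0r mulr0 addr0.
by rewrite eqxx h1 /= !mulr1 mul1r; case: (th p i); case: (th p _); rewrite /=; ring.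
Qed.

Lemma FPsi s i y : Fop s i (Psi pi c th) y =
  \sum_(k | (pi k == k) && (c k == i + (par k != s : nat)%:Z)) Psi pi (upd c k (c k + (-1) ^+ (par k (+) s))) th y
  + \sum_(p | (pi p != p) && ~~ par p) sgx i * ((th p i)%:R - (th p (i + 1))%:R) *
    Psi (unpair p) (upd (upd c p (i + (~~ s : nat)%:Z)) (pi p) (i + (s : nat)%:Z)) th y.
Proof.
pose F k := (xc k y == i + (par k == s : nat)%:Z)%:R * Psi pi c th (y - se s k).
have -> : Fop s i (Psi pi c th) y = \sum_k F k.
  by rewrite /Submission.Fop big_mkcond; apply: eq_bigr => k _; rewrite /F; case: ifP; rewrite ?mul1r ?mul0r.
rewrite (bigID (fun k => pi k == k)) /=; congr (_ + _).
  rewrite [RHS]big_mkcondr; apply: eq_bigr => k /eqP pk; rewrite /F FPsi_typ //.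
  by case: ifP; rewrite ?mul1r ?mul0r.
rewrite (bigID par) /= addrC.
have -> : \sum_(k | (pi k != k) && par k) F k = \sum_(p | (pi p != p) && ~~ par p) F (pi p).
  rewrite (reindex_onto pi pi) => [|k _]; last exact: piK.
  apply: eq_bigl => k; rewrite piK eqxx andbT eq_sym.
  by case: eqVneq => //= e; rewrite pi_par.
rewrite -big_split; apply: eq_bigr => p /andP[pp /negbTE parp] /=.
exact: FPsi_pair.
Qed.
End FopTemplate.
End Alternation.

(** * Weight diagrams and the character formula *)

Section Diagram.
Variables (K : numFieldType) (N : nat) (par : 'I_N -> bool).
Local Notation wt := (wt N).
Local Notation xc := (xc par).
Local Notation Fop := (@Fop K N par).
Local Notation Wg := (Wg par).
Local Notation Alt := (@Alt K N par).
Local Notation Psi := (@Psi K N par).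
Local Notation reg := (reg par).
Local Notation asym := (@asym K N par).
Local Notation sgx := (@sgx K).
Implicit Types (y z : wt) (k l p q : 'I_N) (w : 'S_N) (t i : int).

Definition typ z k := ~~ [exists l, (par l != par k) && (xc l z == xc k z)].
Definition ppi z k := odflt k [pick l | (par l != par k) && (xc l z == xc k z)].
(* For regular [z], [gl z] increases by one at each wedge and is constant elsewhere. *)
Definition gl z t : int := t - \sum_k ((xc k z <= t) && (~~ par k || typ z k) : nat)%:Z.
(** For regular [z] this says that [t] lies left of the first wedge beyond entry [k]. Stopping at
    the wedge instead of the last vee of the component suits translations, and [template_eq]
    reconciles the two. *)
Definition thz z k t : bool := gl z t <= gl z (xc k z).
Definition atE z p := ~~ par p && ~~ typ z p.
(** The ranks of the vees in a component are [1, ..., t_i], so [tz] is [t_lambda], in a form from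
    which a single vee can be removed. *)
Definition rk z p := #|[pred k | [&& atE z k, gl z (xc k z) == gl z (xc p z) & xc k z <= xc p z]]|.
Definition tz z : K := \prod_(p | atE z p) (rk z p)%:R.
Definition sgz z : K := \prod_(p | atE z p) sgx (xc p z).
Definition PsiZ z := Psi (ppi z) (fun k => xc k z) (thz z).
Definition X z y : K := sgz z / tz z * Alt (PsiZ z) y.
(** Piecewise disconnectedness vee by vee: the rank reaches [t_i] at the last vee of a component,
    and a difference of [gl] counts wedges. *)
Definition pd z := forall p u, atE z p -> atE z u -> gl z (xc p z) < gl z (xc u z) ->
  (rk z p)%:Z <= gl z (xc u z) - gl z (xc p z).

Lemma typP z k l : typ z k -> xc l z = xc k z -> par l = par k.
Proof.
move=> /existsPn/(_ l) h e; rewrite e eqxx andbT negbK in h; exact: (eqP h).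
Qed.

Lemma ntypP z k : ~~ typ z k -> exists l, par l = ~~ par k /\ xc l z = xc k z.
Proof.
rewrite negbK => /existsP[l /andP[h /eqP e]]; exists l; split=> //.
by move: h; case: (par l); case: (par k).
Qed.

Lemma ntypI z k l : par l = ~~ par k -> xc l z = xc k z -> ~~ typ z k.
Proof. by move=> h e; rewrite negbK; apply/existsP; exists l; rewrite h e eqxx andbT; case: (par k). Qed.

Lemma ppi_eq z k : (ppi z k == k) = typ z k.
Proof.
rewrite /ppi; case: pickP => [l /andP[pl xl]|h] /=.
  have -> : typ z k = false by apply/negbTE; rewrite negbK; apply/existsP; exists l; rewrite pl xl.
  by apply: contraNF pl => /eqP->.
by rewrite eqxx; apply/esym/existsPn => l; rewrite h.
Qed.

Lemma ppiP z k : ~~ typ z k -> par (ppi z k) = ~~ par k /\ xc (ppi z k) z = xc k z.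
Proof.
rewrite -ppi_eq /ppi; case: pickP => [l /andP[pl /eqP xl] _|h] /=; last by rewrite eqxx.
by split=> //; move: pl; case: (par l); case: (par k).
Qed.

Lemma ppi_uniq z k l : reg z -> par l = ~~ par k -> xc l z = xc k z -> ppi z k = l.
Proof.
by move=> rz pl xl; have [h1 h2] := ppiP (ntypI pl xl); apply: rz; rewrite ?h1 ?pl // h2 xl.
Qed.

Lemma ppiK z : reg z -> involutive (ppi z).
Proof.
move=> rz k; have [tk|nk] := boolP (typ z k); first by rewrite !(eqP (etrans (ppi_eq _ _) tk)).
by have [h1 h2] := ppiP nk; apply: ppi_uniq; rewrite ?h1 ?negbK.
Qed.

Lemma ppi_par z k : ppi z k != k -> par (ppi z k) = ~~ par k.
Proof. by rewrite ppi_eq => /ppiP[]. Qed.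

Lemma typ_ppi z k : reg z -> typ z (ppi z k) = typ z k.
Proof. by move=> rz; rewrite -!ppi_eq ppiK // eq_sym. Qed.

(** A vee is counted once, through its epsilon-entry, so each occupied position holds exactly one
    counted entry. *)
Lemma glS z t : reg z -> gl z (t + 1) = gl z t + (~~ [exists k, xc k z == t + 1] : nat)%:Z.
Proof.
move=> rz; pose cnt k := ~~ par k || typ z k.
have e : \sum_k ((xc k z <= t + 1) && cnt k : nat)%:Z =
   \sum_k ((xc k z <= t) && cnt k : nat)%:Z + \sum_k ((xc k z == t + 1) && cnt k : nat)%:Z.
  rewrite -big_split; apply: eq_bigr => k _ /=; case: (cnt k); rewrite ?andbF ?andbT //.
  by case: (ltgtP (xc k z) (t + 1)) => h; lia.
rewrite /gl -/cnt e.
suff -> : \sum_k ((xc k z == t + 1) && cnt k : nat)%:Z = ([exists k, xc k z == t + 1] : nat)%:Z.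
  rewrite -[\sum_k ((xc k z <= t) && (~~ par k || typ z k) : nat)%:Z]/(\sum_k ((xc k z <= t) && cnt k : nat)%:Z).
  by move: (\sum_k _) => S0; case: ([exists _, _]) => /=; lia.
case: existsP => [[k0 /eqP hk]|h]; last first.
  by rewrite big1 // => k _; case: eqP => // e'; case: h; exists k; apply/eqP.
have [k [xk ck]] : exists k, xc k z = t + 1 /\ cnt k.
  have [c0|] := boolP (cnt k0); first by exists k0.
  rewrite negb_or negbK => /andP[p0 /ntypP[l [pl xl]]]; exists l; split; first by rewrite xl.
  by rewrite /cnt pl p0.
rewrite (bigD1 k) //= xk eqxx ck /= big1 ?addr0 // => l lk; case: eqP => //= xl.
case cl : (cnt l) => //; case/eqP: lk; apply: rz; last by rewrite xl xk.
move: cl ck; rewrite /cnt; case pl : (par l); case pk : (par k) => //= h1 h2.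
  by have := typP h1 (etrans xk (esym xl)); rewrite pl pk.
by have := typP h2 (etrans xl (esym xk)); rewrite pl pk.
Qed.

Lemma gl_mono z t t' : reg z -> t <= t' -> gl z t <= gl z t'.
Proof.
move=> rz h; have -> : t' = t + (absz (t' - t))%:Z by lia.
elim: (absz _) => [|n IH]; first by rewrite addr0.
by apply: le_trans IH _; rewrite -addn1 PoszD addrA (glS _ rz) lerDl.
Qed.

Lemma gl_ge z t : t - N%:Z <= gl z t.
Proof.
rewrite /gl lerD2l lerN2; apply: le_trans (_ : \sum_(k < N) 1%:Z <= _); last by rewrite sumr_const card_ord natz.
by apply: ler_sum => k _; case: (_ && _).
Qed.

Section Action.
Variables (w : 'S_N) (z : wt).
Hypothesis hw : Wg w.
Lemma reg_act : reg z -> reg (act w z).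
Proof.
move=> rz k l pkl; rewrite !xc_act // => /rz e; apply: (@perm_inj _ w); apply: e.
by rewrite !(WgP _ _ hw).
Qed.
Lemma typ_act k : typ (act w z) k = typ z (w k).
Proof.
congr (~~ _); apply/existsP/existsP => -[l /andP[h1 h2]].
  by exists (w l); rewrite !(WgP _ _ hw) h1 -!(xc_act _ _ hw).
exists (w^-1%g l); rewrite !xc_act // permKV h2 andbT -(WgP _ _ hw k).
by rewrite -(WgP _ _ hw (w^-1%g l)) permKV.
Qed.
Lemma gl_act t : gl (act w z) t = gl z t.
Proof.
rewrite /gl; congr (_ - _); rewrite [RHS](reindex_inj (@perm_inj _ w)) /=.
by apply: eq_bigr => k _; rewrite xc_act // typ_act (WgP _ _ hw).
Qed.
Lemma atE_act k : atE (act w z) k = atE z (w k).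
Proof. by rewrite /atE typ_act (WgP _ _ hw). Qed.
Lemma rk_act p : rk (act w z) p = rk z (w p).
Proof.
rewrite /rk -!sum1_card [RHS](reindex_inj (@perm_inj _ w)) /=.
by apply: eq_bigl => k; rewrite !inE atE_act !xc_act // !gl_act.
Qed.
Lemma tz_act : tz (act w z) = tz z.
Proof.
rewrite /tz [RHS](reindex_inj (@perm_inj _ w)) /=.
by apply: eq_big => k; rewrite ?atE_act // rk_act.
Qed.
Lemma sgz_act : sgz (act w z) = sgz z.
Proof.
rewrite /sgz [RHS](reindex_inj (@perm_inj _ w)) /=.
by apply: eq_big => k; rewrite ?atE_act // xc_act.
Qed.
Lemma pd_act : pd z -> pd (act w z).
Proof. by move=> h p u; rewrite !atE_act rk_act !gl_act !xc_act //; apply: h. Qed.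
Lemma ppi_act k : reg z -> ppi (act w z) k = w^-1%g (ppi z (w k)).
Proof.
move=> rz; have [tk|nk] := boolP (typ z (w k)).
  have /eqP-> : ppi z (w k) == w k by rewrite ppi_eq.
  by rewrite permK; apply/eqP; rewrite ppi_eq typ_act.
have [h1 h2] := ppiP nk; apply: ppi_uniq; first exact: reg_act.
  by rewrite -(WgP _ _ hw) permKV h1 (WgP _ _ hw).
by rewrite !xc_act // permKV h2.
Qed.
(** Renaming the entries permutes the template and costs a sign in the alternation. This gives
    meaning to [X] at non-dominant labels, which occur when an entry passes a vee. *)
Lemma X_act y : reg z -> X (act w z) y = (-1) ^+ w * X z y.
Proof.
move=> rz; rewrite /X sgz_act tz_act mulrCA; congr (_ * _).
have hv := WgV hw; rewrite -[in RHS]odd_permV -Alt_pre //; apply: eq_Alt => u.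
rewrite /PsiZ Psi_act // invgK; apply: eq_Psi => [k|k _|k t _].
- exact: ppi_act.
- by rewrite xc_act.
- by rewrite /thz !gl_act xc_act.
Qed.
End Action.

Lemma X_asym z : asym (X z).
Proof. by move=> w y hw; rewrite /X Alt_act // mulrCA. Qed.

Definition hts y : int := \sum_(k | ~~ par k) xc k y.

Lemma hts_act w y : Wg w -> hts (act w y) = hts y.
Proof.
move=> hw; rewrite /hts [RHS](reindex_inj (@perm_inj _ w)) /=.
by apply: eq_big => k; rewrite ?(WgP _ _ hw) // xc_act.
Qed.

Lemma mc_pairs z v t : reg z -> (forall p, atE z p -> xc p v = xc (ppi z p) v) ->
  mc par v t = \sum_(k | typ z k) (-1) ^+ par k * (xc k v == t)%:R.
Proof.
move=> rz hv; rewrite /mc (bigID (typ z)) /= [X in _ + X](_ : _ = 0) ?addr0 //.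
rewrite (bigID par) /= (reindex_onto (ppi z) (ppi z)) /=; last by move=> k _; apply: ppiK.
rewrite [X in X + _](_ : _ = - \sum_(k | ~~ typ z k && ~~ par k) (-1) ^+ par k * (xc k v == t)%:R); first by rewrite addNr.
rewrite -sumrN; apply: eq_big => [k|k].
  rewrite ppiK // eqxx andbT typ_ppi //; case nk : (typ z k) => //=.
  by rewrite ppi_par // ppi_eq nk.
rewrite ppiK // eqxx andbT typ_ppi // => /andP[nk]; rewrite ppi_par ?ppi_eq // => pk.
by rewrite -hv /atE ?pk ?nk // (negbTE pk) /= expr0 expr1 mulN1r mul1r.
Qed.

Lemma Psi_supp z u : PsiZ z u != 0 -> (forall k, typ z k -> xc k u = xc k z) /\
  (forall p, atE z p -> xc p u = xc (ppi z p) u /\ gl z (xc p u) <= gl z (xc p z)).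
Proof.
move=> /prodf_neq0 h; split=> [k tk|p /andP[pp np]].
  have := h k isT; by rewrite /PsiF ppi_eq tk; case: (xc k u =P xc k z) => // _; rewrite eqxx.
have := h p isT; rewrite /PsiF ppi_eq (negbTE np) (negbTE pp).
by case: andP => [[/eqP h1 h2] _|]; rewrite ?mul0r ?eqxx.
Qed.

Lemma X_supp z y : reg z -> X z y != 0 -> mc par y =1 mc par z /\
  hts y <= \sum_k (`|xc k z| + `|gl z (xc k z)| + N%:Z).
Proof.
move=> rz; rewrite /X mulf_eq0 negb_or => /andP[_].
have [w /andP[hw h]|h] := pickP [pred w | Wg w && (PsiZ z (act w y) != 0)]; last first.
  rewrite /Submission.Alt big1 ?eqxx // => w hw; have := h w; rewrite /= hw /= => /negbFE/eqP->.
  by rewrite mulr0.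
move=> _; have [h1 h2] := Psi_supp h; set u := act w y in h h1 h2.
split=> [t|].
  rewrite -(mc_act y t hw) -/u (@mc_pairs z u) //; last by move=> p /h2[].
  rewrite (@mc_pairs z z) //; last by move=> p /andP[_ /ppiP[]].
  by apply: eq_bigr => k tk; rewrite h1.
rewrite -(hts_act y hw) -/u /hts.
apply: le_trans (_ : \sum_(k | ~~ par k) (`|xc k z| + `|gl z (xc k z)| + N%:Z) <= _).
  apply: ler_sum => k pk; have [tk|nk] := boolP (typ z k); first by rewrite h1 //; lia.
  have [|_ hg] := h2 k; first by rewrite /atE pk.
  by have := gl_ge z (xc k u); lia.
rewrite [leRHS](bigID par) /= lerDr; apply: sumr_ge0 => k _; lia.
Qed.

Lemma tz_neq0 z : tz z != 0.
Proof.
apply/prodf_neq0 => p hp; rewrite pnatr_eq0 -lt0n; apply/card_gt0P; exists p.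
by rewrite !inE hp eqxx lexx.
Qed.

Lemma X_core z : reg z -> (forall k, typ z k) -> X z z = 1.
Proof.
move=> rz ht; have no p : atE z p = false by rewrite /atE ht andbF.
rewrite /X /sgz /tz !big_pred0 // divr1 mul1r /Submission.Alt (bigD1 1%g) /=; last exact: Wg1.
rewrite act1 odd_perm1 mul1r [X in _ + X]big1 ?addr0.
  by apply: big1 => k _; rewrite /PsiF ppi_eq ht eqxx.
move=> w /andP[hw w1]; apply/eqP; rewrite mulf_eq0; apply/orP; right; apply/negPn/negP => /Psi_supp[h _].
case/eqP: w1; apply/permP => k; rewrite perm1; apply: rz; first exact: (WgP _ _ hw).
by rewrite -xc_act // h.
Qed.

Lemma FopZ s i a (f : wt -> K) y : Fop s i (fun u => a * f u) y = a * Fop s i f y.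
Proof. by rewrite /Submission.Fop mulr_sumr. Qed.
Lemma eq_Fop s i (f g : wt -> K) y : (forall u, f u = g u) -> Fop s i f y = Fop s i g y.
Proof. by move=> h; apply: eq_bigr => k _; rewrite h. Qed.

(** * A typical entry exchanging its position with a neighbouring wedge or vee *)

Section CoreShift.
Variables (z z2 : wt) (k : 'I_N) (i : int).
Hypotheses (rz : reg z) (tk : typ z k) (xk : xc k z = i).
Hypothesis nc : forall l, xc l z = i + 1 -> ~~ typ z l.
Let phi t := if t == i then i + 1 else if t == i + 1 then i else t.
Hypothesis hz2 : forall l, xc l z2 = phi (xc l z).

Lemma phi_inj : injective phi.
Proof. by move=> a b; rewrite /phi; do ![case: eqP => ?]; lia. Qed.

Lemma shift_typ l : typ z2 l = typ z l.
Proof.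
congr (~~ _); apply/existsP/existsP => -[m /andP[h1 h2]]; exists m; rewrite h1 /=.
  by move: h2; rewrite !hz2 (inj_eq phi_inj).
by rewrite !hz2 (inj_eq phi_inj).
Qed.

Lemma shift_reg : reg z2.
Proof. by move=> a b pab; rewrite !hz2 => /phi_inj; apply: rz. Qed.

Lemma shift_ppi l : ppi z2 l = ppi z l.
Proof.
have [tl|nl] := boolP (typ z l).
  by transitivity l; [|apply/esym]; apply/eqP; rewrite ppi_eq ?shift_typ.
have [h1 h2] := ppiP nl; apply: ppi_uniq => //; first exact: shift_reg.
by rewrite !hz2 h2.
Qed.

Lemma shift_atE l : atE z2 l = atE z l. Proof. by rewrite /atE shift_typ. Qed.

Lemma only_k l : xc l z = i -> l = k.
Proof. by move=> xl; apply: rz; rewrite ?xl ?xk //; apply: (typP tk); rewrite xl xk. Qed.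

Lemma shift_gl t : gl z2 t = if t == i then gl z (i + 1) else gl z t.
Proof.
have [->|ti] := eqVneq t i; last first.
  rewrite /gl; congr (_ - _); apply: eq_bigr => l _; rewrite hz2 shift_typ; congr (nat_of_bool (_ && _))%:Z.
  by rewrite /phi; case: eqP => [->|_]; [|case: eqP => [->|_]]; apply/idP/idP; lia.
rewrite /gl -addrA; congr (_ + _); rewrite (bigD1 k) //= [in RHS](bigD1 k) //= hz2 xk /phi eqxx shift_typ tk orbT !andbT.
have -> : (i + 1 <= i) = false by lia.
have -> : (i <= i + 1) by lia.
rewrite add0r opprD addrA subrr add0r; congr (- _); apply: eq_bigr => l lk.
rewrite hz2 shift_typ; congr (nat_of_bool (_ && _))%:Z; rewrite /phi.
have xl : xc l z != i by apply: contraNneq lk => /only_k->.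
by rewrite (negbTE xl); case: eqP => [->|h]; apply/idP/idP; lia.
Qed.

Lemma nt_phi l : ~~ typ z l -> xc l z != i.
Proof. by apply: contraNneq => /only_k->. Qed.

Lemma shift_gam l : ~~ typ z l -> gl z2 (xc l z2) = gl z (xc l z).
Proof.
move=> /nt_phi h; rewrite shift_gl hz2 /phi (negbTE h).
by case: (eqVneq (xc l z) (i + 1)) => [->|h2]; rewrite ?eqxx ?(negbTE h).
Qed.

Lemma shift_th l t : ~~ typ z l -> thz z2 l t = thz z l (if t == i then i + 1 else t).
Proof. by move=> nl; rewrite /thz shift_gam // shift_gl; case: ifP. Qed.

Lemma shift_rk p : atE z p -> rk z2 p = rk z p.
Proof.
move=> hp; apply: eq_card => l; rewrite !inE shift_atE; case hl : (atE z l) => //=.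
have /andP[_ nl] := hl; have /andP[_ np] := hp.
rewrite !shift_gam //; congr (_ && _); rewrite !hz2 /phi.
have := nt_phi nl; have := nt_phi np; move=> /negbTE-> /negbTE h; rewrite h.
by move/negbT: h => h; do ![case: eqP => ?]; apply/idP/idP; move: (nt_phi np); lia.
Qed.

Lemma shift_tz : tz z2 = tz z.
Proof. by apply: eq_big => p; rewrite shift_atE // => hp; rewrite shift_rk. Qed.

Lemma shift_pd : pd z -> pd z2.
Proof.
move=> h p u; rewrite !shift_atE => hp hu; have /andP[_ np] := hp; have /andP[_ nu] := hu.
by rewrite shift_rk // !shift_gam //; apply: h.
Qed.

(** The template requires entry [k] at [i], and then regularity keeps every pair away from [i]. So
    the threshold may be replaced by [tha], which does not separate [i] from [i + 1]; no pair is
    split and only [k] moves. *)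
Lemma core_shift y : Fop (par k) i (X z) y = sgz z / tz z * Alt (PsiZ z2) y.
Proof.
rewrite /X FopZ; congr (_ * _).
pose tha l t := thz z l (if t == i then i + 1 else t).
have eA u : Alt (PsiZ z) u = Alt (Psi (ppi z) (fun l => xc l z) tha) u.
  apply: Alt_reg => v rv; have [xkv|xkv] := eqVneq (xc k v) i; last first.
    rewrite /PsiZ /Submission.Psi (bigD1 k) //= [RHS](bigD1 k) //= /PsiF ppi_eq tk xk (negbTE xkv).
    by rewrite !mul0r.
  apply: eq_bigr => l _; rewrite /PsiF ppi_eq; case: ifP => // /negbT nl; case: ifP => // pl.
  case: (xc l v =P xc (ppi z l) v) => //= e.
  suff xl : xc l v != i by rewrite /tha (negbTE xl).
  apply: contraNneq (nl) => xl; have [h1 h2] := ppiP nl.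
  have [epk|epk] := eqVneq (par k) (par l).
    by rewrite -(rv k l epk) ?xl ?xkv.
  have epk' : par k = par (ppi z l) by move: epk; rewrite h1; case: (par k); case: (par l).
  by rewrite -(typ_ppi l rz) -(rv _ _ epk') // xkv -e xl.
rewrite (eq_Fop _ _ _ eA) Fop_Alt; apply: eq_Alt => u.
rewrite FPsi; [|exact: ppiK|exact: ppi_par].
rewrite [X in _ + X]big1 ?addr0; last first.
  move=> p _; have -> : tha p i = tha p (i + 1).
    by rewrite /tha eqxx; have -> : (i + 1 == i) = false by lia.
  by rewrite subrr mulr0 mul0r.
rewrite (bigD1 k) /=; last by rewrite ppi_eq tk xk eqxx addr0 eqxx.
rewrite big1 ?addr0; last first.
  move=> l /andP[/andP[pl /eqP xl] lk]; exfalso; move: xl; rewrite ppi_eq in pl.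
  have [e|e] := eqVneq (par l) (par k); rewrite /= ?addr0 => xl.
    by case/eqP: lk; apply: only_k.
  by move: (nc xl); rewrite pl.
apply: eq_Psi => [l|l pl|l t nl]; first by rewrite shift_ppi.
  rewrite /upd; have [->|lk] := eqVneq l k; first by rewrite addbb expr0 xk hz2 xk /phi eqxx.
  have tl : typ z l by rewrite -ppi_eq pl.
  rewrite hz2 /phi; have -> : (xc l z == i) = false by apply: contraNF lk => /eqP/only_k->.
  by case: eqP => // /nc; rewrite tl.
by rewrite shift_th // -ppi_eq.
Qed.

Lemma shift_sgz0 : (forall l, xc l z != i + 1) -> sgz z2 = sgz z.
Proof.
move=> h; apply: eq_big => p; rewrite shift_atE // => /andP[_ np].
by rewrite hz2 /phi (negbTE (nt_phi np)) (negbTE (h p)).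
Qed.

(** The vee pushed from [i + 1] to [i] flips one factor of [sgz]; in [D_core] this sign meets that
    of a transposition. *)
Lemma shift_sgz1 p : xc p z = i + 1 -> par p = false -> sgz z2 = - sgz z.
Proof.
move=> xp pp; have ap : atE z p by rewrite /atE pp nc.
rewrite /sgz (bigD1 p) ?shift_atE //= [in RHS](bigD1 p) //= hz2 xp /phi eqxx.
have -> : (i + 1 == i) = false by lia.
rewrite sgxS mulNr opprK; congr (_ * _); apply: eq_big => l; rewrite shift_atE //.
move=> /andP[/andP[pl nl] lp]; rewrite hz2 /phi (negbTE (nt_phi nl)); case: eqP => // xl.
by case/eqP: lp; apply: rz; rewrite ?xl ?xp // pp (negbTE pl).
Qed.
End CoreShift.
End Diagram.

Ltac ilia := repeat match goal with
  | H : is_true (@Order.le _ _ _ _) |- _ => revert H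
  | H : is_true (@Order.lt _ _ _ _) |- _ => revert H
  | H : is_true (leq _ _) |- _ => revert H
  | H : is_true (~~ (@eq_op ?T _ _)) |- _ => unify (Equality.sort T) int; revert H
  | H : @eq ?T _ _ |- _ => unify T int; revert H
  end; clear; lia.

(** * Splitting a vee whose right neighbour is a wedge *)

Section Main.
Variables (K : numFieldType) (N : nat) (par : 'I_N -> bool).
Local Notation wt := (wt N).
Local Notation xc := (xc par).
Local Notation Fop := (@Fop K N par).
Local Notation Wg := (Wg par).
Local Notation Alt := (@Alt K N par).
Local Notation Psi := (@Psi K N par).
Local Notation reg := (reg par).
Local Notation asym := (@asym K N par).
Local Notation sgx := (@sgx K).
Local Notation typ := (typ par).
Local Notation ppi := (ppi par).
Local Notation gl := (gl par).
Local Notation thz := (thz par).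
Local Notation atE := (atE par).
Local Notation rk := (rk par).
Local Notation tz := (@tz K N par).
Local Notation sgz := (@sgz K N par).
Local Notation PsiZ := (@PsiZ K N par).
Local Notation X := (@X K N par).
Local Notation pd := (pd par).
Local Notation hts := (hts par).
Local Notation mc := (mc par).
Local Notation hwd := (@hwd K N par).
Implicit Types (y z : wt) (k l p q m : 'I_N) (w : 'S_N) (t i : int).

Section VeeSplit.
Variables (z : wt) (p : 'I_N) (i : int).
Hypotheses (rz : reg z) (ap : atE z p) (xp : xc p z = i).
Hypothesis wedge : forall l, xc l z != i + 1.
Let q := ppi z p.
Let z' := z + se false p.

Let pp : par p = false. Proof. by case/andP: ap => /negbTE. Qed.
Let np : ~~ typ z p. Proof. by case/andP: ap. Qed.
Let parq : par q = true. Proof. by have [-> _] := ppiP np; rewrite pp. Qed.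
Let xq : xc q z = i. Proof. by have [_ ->] := ppiP np. Qed.
Let pq : (p == q) = false. Proof. by apply/negbTE; apply: contraFneq pp => ->; rewrite parq. Qed.
Let qp : (q == p) = false. Proof. by rewrite eq_sym pq. Qed.
Let qK : ppi z q = p. Proof. exact: ppiK. Qed.

Lemma split_xc l : xc l z' = xc l z + (l == p)%:R.
Proof. by rewrite /z' xc_se pp addFb expr0 mulr1. Qed.

Lemma split_atp l : par l = false -> xc l z = i -> l = p.
Proof. by move=> pl xl; apply: rz; rewrite ?pl ?pp ?xl ?xp. Qed.

Lemma split_typ l : typ z' l = [|| typ z l, l == p | l == q].
Proof.
have [->|lp] := eqVneq l p.
  rewrite orbT; apply/existsPn => m; apply/negP => /andP[pm]; rewrite !split_xc eqxx xp.
  by have [e|mp] := eqVneq m p; [rewrite e eqxx in pm|rewrite addr0 (negbTE (wedge m))].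
have [->|lq] := eqVneq l q.
  rewrite !orbT; apply/existsPn => m; apply/negP => /andP[pm]; rewrite !split_xc qp xq addr0.
  have [->|mp] := eqVneq m p; first by rewrite xp => /eqP; ilia.
  rewrite addr0 => /eqP xm; case/eqP: mp; apply: split_atp => //.
  by move: pm; rewrite parq; case: (par m).
rewrite !orbF; have [tl|nl] := boolP (typ z l).
  apply/existsPn => m; apply/negP => /andP[pm]; rewrite !split_xc (negbTE lp) addr0.
  have [->|mp] := eqVneq m p; first by rewrite xp eq_sym (negbTE (wedge l)).
  by rewrite addr0 => /eqP xm; rewrite (typP tl xm) eqxx in pm.
apply/negbTE; have [h1 h2] := ppiP nl; apply: (@ntypI N par z' l (ppi z l)) => //.
rewrite !split_xc (negbTE lp) addr0 h2.
have -> : (ppi z l == p) = false by apply: contraNF lq => /eqP e; rewrite /q -e ppiK.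
by rewrite addr0.
Qed.

Lemma split_reg : reg z'.
Proof.
move=> a b pab; rewrite !split_xc.
have [->|ha] := eqVneq a p; have [->|hb] := eqVneq b p => //; rewrite ?addr0.
- by rewrite xp => e; have := wedge b; rewrite -e eqxx.
- by rewrite xp => e; have := wedge a; rewrite e eqxx.
exact: rz.
Qed.

Lemma split_ppi l : ppi z' l = unpair (ppi z) p l.
Proof.
rewrite /unpair -/q; have [/orP h|h] := boolP ((l == p) || (l == q)).
  by apply/eqP; rewrite ppi_eq split_typ; case: h => ->; rewrite ?orbT.
have [tl|nl] := boolP (typ z l).
  transitivity l; [|apply/esym]; apply/eqP; rewrite ppi_eq ?split_typ tl //.
have [h1 h2] := ppiP nl; apply: ppi_uniq => //; first exact: split_reg.
move: h; rewrite negb_or => /andP[lp lq]; rewrite !split_xc (negbTE lp) addr0 h2.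
have -> : (ppi z l == p) = false by apply: contraNF lq => /eqP e; rewrite /q -e ppiK.
by rewrite addr0.
Qed.

Lemma split_atE l : atE z' l = atE z l && (l != p).
Proof.
rewrite /Submission.atE split_typ !negb_or; case pl : (par l) => //=.
have -> : (l == q) = false by apply: contraFF pl => /eqP->.
by rewrite andbT.
Qed.

Lemma split_gl t : gl z' t = gl z t - (nat_of_bool (i + 1 <= t))%:Z.
Proof.
rewrite /Submission.gl -addrA -opprD; congr (_ - _).
rewrite (bigD1 p) // (bigD1 q) ?qp //= [in RHS](bigD1 p) // [in RHS](bigD1 q) ?qp //=.
rewrite !split_xc !split_typ !eqxx qp xp xq pp parq !orbT !andbT addr0 /=.
have -> : typ z q = false by rewrite typ_ppi // (negbTE np).
rewrite andbF add0r [RHS]addrC; congr (_ + (_ + _)); apply: eq_bigr => l /andP[lp lq].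
by rewrite split_xc split_typ (negbTE lp) (negbTE lq) !orbF addr0.
Qed.

Lemma gl_i1 : gl z (i + 1) = gl z i + 1.
Proof.
rewrite glS //; have -> : [exists k, xc k z == i + 1] = false by apply/existsP => -[k]; rewrite (negbTE (wedge k)).
by [].
Qed.

Lemma gl_lo t : t <= i -> gl z t <= gl z i. Proof. exact: gl_mono. Qed.
Lemma gl_hi t : i + 1 <= t -> gl z i + 1 <= gl z t.
Proof. by rewrite -gl_i1; apply: gl_mono. Qed.

Lemma split_side l : atE z' l -> atE z l /\ (xc l z < i \/ i + 1 < xc l z).
Proof.
rewrite split_atE => /andP[al lp]; split=> //.
have /andP[/negbTE pl _] := al.
have h1 : xc l z != i by apply: contraNneq lp => /(split_atp pl)->.
by have := wedge l; move: h1; ilia.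
Qed.

Lemma split_side_xc l : atE z' l -> xc l z' = xc l z.
Proof. by rewrite split_atE split_xc => /andP[_ /negbTE->]; rewrite addr0. Qed.

Hypothesis hpd : pd z.

(** Filling the wedge at [i + 1] merges the levels [gl z i] and [gl z i + 1]. If [p] shares its
    component with a vee further left, its rank is at least 2 and [pd] leaves no vee on the next
    level. *)
Lemma pdgap l m : atE z l -> l != p -> xc l z < i -> gl z (xc l z) = gl z i ->
  atE z m -> gl z (xc m z) = gl z i + 1 -> False.
Proof.
move=> al lp xl gl_l am gm; have := hpd ap am; rewrite xp gm => /(_ _).
have : (2 <= rk z p)%N.
  rewrite /Submission.rk; apply: leq_trans (_ : #|pred2 l p| <= _)%N; first by rewrite card2 lp.
  apply: subset_leq_card; apply/fintype.subsetP => x; rewrite !inE => /orP[] /eqP->.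
    by rewrite al xp gl_l eqxx ltW.
  by rewrite ap eqxx lexx.
move=> h2 h; have := h _; ilia.
Qed.

Lemma split_rk l : atE z' l -> rk z' l = rk z l.
Proof.
move=> hl; have [al sl] := split_side hl; apply: eq_card => k; rewrite !inE.
case hk : (atE z' k); last first.
  move: hk; rewrite split_atE => /negbT; rewrite negb_and negbK => /orP[/negbTE->//|/eqP->].
  rewrite ap xp /=; apply/esym/negP => /andP[/eqP g1 h1].
  by case: sl => [|h]; [ilia|have := gl_hi (ltW h); ilia].
have [ak sk] := split_side hk; rewrite ak !split_side_xc // !split_gl /=.
have kp : k != p by move: hk; rewrite split_atE => /andP[].
have lp : l != p by move: hl; rewrite split_atE => /andP[].
case: sk => hk'; case: sl => hl'.
- have -> : (i + 1 <= xc k z) = false by ilia.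
  have -> : (i + 1 <= xc l z) = false by ilia.
  by rewrite (inj_eq (addIr _)).
- have -> : (i + 1 <= xc k z) = false by ilia.
  have -> : (i + 1 <= xc l z) by ilia.
  have g1 := gl_lo (ltW hk'); have g2 := gl_hi (ltW hl').
  have -> : (gl z (xc k z) == gl z (xc l z)) = false by ilia.
  have -> // : (gl z (xc k z) - false%:Z == gl z (xc l z) - true%:Z) = false.
  apply/negP => /eqP e; apply: (pdgap ak kp hk' _ al); ilia.
- have -> : (xc k z <= xc l z) = false by ilia.
  by rewrite !andbF.
- have -> : (i + 1 <= xc k z) by ilia.
  have -> : (i + 1 <= xc l z) by ilia.
  by rewrite (inj_eq (addIr _)).
Qed.

Lemma split_tz : tz z = (rk z p)%:R * tz z'.
Proof.
rewrite /Submission.tz (bigD1 p) //=; congr (_ * _); apply: eq_big => l; first by rewrite split_atE.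
by rewrite -split_atE => /split_rk->.
Qed.

Lemma split_sgz : sgz z = sgx i * sgz z'.
Proof.
rewrite /Submission.sgz (bigD1 p) //= xp; congr (_ * _); apply: eq_big => l; first by rewrite split_atE.
by rewrite -split_atE => /split_side_xc->.
Qed.

Lemma split_pd : pd z'.
Proof.
move=> a u ha hu; have [aa sa] := split_side ha; have [au su] := split_side hu.
rewrite split_rk // !split_side_xc // !split_gl; case: sa => xa; case: su => xu.
- have -> : (i + 1 <= xc a z) = false by ilia.
  have -> : (i + 1 <= xc u z) = false by ilia.
  by rewrite !subr0; apply: hpd.
- have -> : (i + 1 <= xc a z) = false by ilia.
  have -> : (i + 1 <= xc u z) by ilia.
  rewrite subr0 => _; have g1 := gl_lo (ltW xa); have g2 := gl_hi (ltW xu).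
  have [e|ne] := eqVneq (gl z (xc a z)) (gl z i); last first.
    have := hpd aa ap; rewrite xp => h; have : (rk z a)%:Z <= gl z i - gl z (xc a z) by apply: h; ilia.
    by rewrite /=; ilia.
  have := hpd ap au; rewrite xp => h; have {}h : (rk z p)%:Z <= gl z (xc u z) - gl z i by apply: h; ilia.
  suff : (rk z a < rk z p)%N by rewrite e /=; ilia.
  apply: proper_card; apply/fintype.properP; split.
    apply/fintype.subsetP => x; rewrite !inE => /and3P[-> /eqP-> h3] /=.
    by rewrite e xp eqxx /=; ilia.
  by exists p; rewrite !inE ap xp ?eqxx ?lexx //= e eqxx /=; ilia.
- have -> : (i + 1 <= xc a z) by ilia.
  have -> : (i + 1 <= xc u z) = false by ilia.
  rewrite subr0; have g1 := gl_lo (ltW xu); have g2 := gl_hi (ltW xa).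
  by rewrite /=; ilia.
- have -> : (i + 1 <= xc a z) by ilia.
  have -> : (i + 1 <= xc u z) by ilia.
  move=> h; have := hpd aa au; move: h; rewrite /= => h h'.
  by have := h' _; ilia.
Qed.

Let c2 p' := upd (upd (fun l => xc l z) p' (i + 1)) (ppi z p') i.

(** Exchanging the pairs of [p] and [p'] takes two transpositions, an even permutation, and both
    pairs have the same threshold. So all vees of the component contribute alike. *)
Lemma split_relabel p' y : atE z p' -> gl z (xc p' z) = gl z i ->
  Alt (Psi (unpair (ppi z) p') (c2 p') (thz z)) y = Alt (Psi (unpair (ppi z) p) (c2 p) (thz z)) y.
Proof.
move=> ap' gp'; have [->//|p'p] := eqVneq p' p.
set q' := ppi z p'; have /andP[/negbTE pp' np'] := ap'.
have [parq' xq'] := ppiP np'; rewrite -/q' pp' /= in parq' xq'.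
have q'K : ppi z q' = p' by rewrite /q' ppiK.
have q'q : q' != q by apply: contraNneq p'p => e; rewrite -q'K e qK.
have d1 : p' != q by apply: contraFneq pp' => ->.
have d2 : p' != q' by apply: contraFneq pp' => ->.
have d3 : p != q' by apply: contraFneq pp => ->.
pose w := (tperm p p' * tperm q q')%g.
have wp : w p = p' by rewrite permM tpermL tpermD // eq_sym.
have wp' : w p' = p by rewrite permM tpermR tpermD // eq_sym // pq.
have wq : w q = q' by rewrite permM [tperm p p' q]tpermD ?tpermL // ?pq // eq_sym.
have wq' : w q' = q by rewrite permM [tperm p p' q']tpermD ?tpermR // eq_sym.
have wo j : j != p -> j != p' -> j != q -> j != q' -> w j = j.
  by move=> h1 h2 h3 h4; rewrite permM !tpermD // eq_sym.
have hw : Wg w by apply: WgM; apply: Wg_tperm; rewrite ?pp ?pp' ?parq ?parq'.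
have ow : w = false :> bool by rewrite odd_permM !odd_tperm [p == p']eq_sym p'p [q == q']eq_sym q'q.
have := Alt_pre (Psi (unpair (ppi z) p) (c2 p) (thz z)) y hw; rewrite ow expr0 mul1r => <-.
apply: eq_Alt => u; rewrite Psi_act //; apply/esym.
have upE j : w (unpair (ppi z) p j) = unpair (ppi z) p' (w j).
  rewrite /unpair -/q -/q'.
  have [->|jp] := eqVneq j p; first by rewrite wp eqxx.
  have [->|jq] := eqVneq j q; first by rewrite wq eqxx orbT.
  have [->|jp'] := eqVneq j p'.
    by rewrite wp' /= -/q' wq' eq_sym (negbTE p'p) (negbTE d3) /=.
  have [->|jq'] := eqVneq j q'.
    by rewrite wq' q'K wp' [q == p']eq_sym (negbTE d1) [q == q']eq_sym (negbTE q'q) /= qK.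
  rewrite (wo j jp jp' jq jq') (negbTE jp') (negbTE jq') /= wo //.
  - by apply: contraNneq jq => e; rewrite /q -e ppiK.
  - by apply: contraNneq jq' => e; rewrite /q' -e ppiK.
  - by apply: contraNneq jp => e; rewrite -qK -e ppiK.
  - by apply: contraNneq jp' => e; rewrite -q'K -e ppiK.
apply: eq_Psi => [k|k|k t].
- by rewrite upE permKV.
- rewrite upE permKV -{1 2 4}(permKV w k); move: (w^-1%g k) => j hj.
  rewrite /c2 /upd -/q -/q'; move: hj; rewrite /unpair -/q -/q'.
  have [->|jp] := eqVneq j p; first by rewrite wp eqxx (negbTE d2) pq.
  have [->|jq] := eqVneq j q; first by rewrite wq eqxx.
  have [->|jp'] := eqVneq j p'.
    by rewrite wp' [p == p']eq_sym (negbTE p'p) (negbTE d3) /= -/q => e; case/eqP: (negbT qp).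
  have [->|jq'] := eqVneq j q'.
    by rewrite wq' [q == p']eq_sym (negbTE d1) [q == q']eq_sym (negbTE q'q) /= qK => e; case/eqP: (negbT pq).
  by rewrite wo // (negbTE jp') (negbTE jq').
- rewrite upE permKV => _; rewrite -{2}(permKV w k); move: (w^-1%g k) => j.
  rewrite /Submission.thz; congr (_ <= _).
  have [->|jp] := eqVneq j p; first by rewrite wp gp' xp.
  have [->|jq] := eqVneq j q; first by rewrite wq xq' gp' xq.
  have [->|jp'] := eqVneq j p'; first by rewrite wp' gp' xp.
  have [->|jq'] := eqVneq j q'; first by rewrite wq' xq' gp' xq.
  by rewrite wo.
Qed.

(** For a vee left of [i] on the level of [p], the two thresholds disagree at positions beyond the
    filled wedge of level [gl z i + 1]. There a pair at a regular weight would have to sit on a vee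
    of [z], which [pdgap] excludes. *)
Lemma split_PsiZ y : Alt (Psi (unpair (ppi z) p) (c2 p) (thz z)) y = Alt (PsiZ z') y.
Proof.
apply: Alt_reg => u ru.
have up l : (unpair (ppi z) p l == l) = typ z' l by rewrite -ppi_eq split_ppi.
have ct l : typ z' l -> c2 p l = xc l z'.
  rewrite split_typ /c2 /upd -/q split_xc; have [->|lp] := eqVneq l p; first by rewrite pq xp.
  by have [->|lq] := eqVneq l q; rewrite addr0 ?xq.
have [hu|hu] := pselect (forall l, typ z' l -> xc l u = xc l z'); last first.
  have [l [tl xl]] : exists l, typ z' l /\ xc l u != xc l z'.
    apply: contrapT => h; apply: hu => l tl; apply/eqP/negPn/negP => xl; apply: h; by exists l.
  rewrite /Submission.PsiZ /Submission.Psi (bigD1 l) //= [RHS](bigD1 l) //= /PsiF up ppi_eq tl ct // (negbTE xl).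
  by rewrite !mul0r.
have ty m : typ z m -> xc m u = xc m z.
  move=> tm; rewrite hu ?split_typ ?tm // split_xc; have [e|_] := eqVneq m p; last by rewrite addr0.
  by case/negP: (np); rewrite -e.
apply: eq_bigr => l _; rewrite /PsiF up ppi_eq; case: ifP => [tl|/negbT nl]; first by rewrite ct.
case: ifP => // pl; rewrite split_ppi; case: (xc l u =P _) => //= e.
suff -> : thz z l (xc l u) = thz z' l (xc l u) by [].
have hl : atE z' l by rewrite /Submission.atE pl nl.
have [al sl] := split_side hl; have lp : l != p by move: hl; rewrite split_atE => /andP[].
set l2 := unpair _ _ _ in e; have pl2 : par l2 = true.
  by have [+ _] := ppiP nl; rewrite split_ppi -/l2 pl.
set t := xc l u in e *.
have tyc m : typ z' m -> t != xc m z'.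
  move=> tm; rewrite -hu //; apply/eqP => e2; case pm : (par m).
    have l2m : l2 = m by apply: ru; rewrite ?pl2 ?pm // -e.
    by case/negP: nl; rewrite -(typ_ppi l split_reg) split_ppi -/l2 l2m.
  by move: nl; rewrite (ru l m _ e2) ?tm // pl pm.
have ti : t != i by have := tyc q; rewrite split_typ eqxx !orbT split_xc qp xq addr0; apply.
have ti1 : t != i + 1 by have := tyc p; rewrite split_typ eqxx !orbT split_xc eqxx xp; apply.
rewrite /Submission.thz split_side_xc // !split_gl; case: sl => xl.
  have -> : (i + 1 <= xc l z) = false by ilia.
  rewrite subr0; case: (leP (i + 1) t) => ht; last by rewrite subr0.
  have g1 := gl_lo (ltW xl); have g2 := gl_hi ht.
  apply/idP/idP => [|h]; first ilia.
  exfalso; have gt : gl z t = gl z i + 1 by rewrite /= in h; ilia.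
  have gl_l : gl z (xc l z) = gl z i by rewrite /= in h; ilia.
  have [/existsP[m /eqP xm]|/existsPn noat] := boolP [exists m, xc m z == t].
    have [tm|nm] := boolP (typ z m).
      have := tyc m; rewrite split_typ tm split_xc; have [e3|_] := eqVneq m p; first by case/negP: (np); rewrite -e3.
      by rewrite addr0 xm eqxx => /(_ isT).
    case pm : (par m).
      have [h1 h2] := ppiP nm.
      apply: (@pdgap l (ppi z m)) => //; last by rewrite h2 xm.
      by rewrite /Submission.atE h1 pm typ_ppi.
    by apply: (@pdgap l m) => //; [rewrite /Submission.atE pm|rewrite xm].
  have := glS (t - 1) rz; rewrite subrK.
  have -> : [exists k, xc k z == t] = false by apply/existsP => -[k]; rewrite (negbTE (noat k)).
  have := @gl_hi (t - 1); have : i + 1 <= t - 1 by ilia.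
  by move=> h1 h2; have := h2 h1; rewrite gt /=; ilia.
have -> : (i + 1 <= xc l z) by ilia.
have g2 := gl_hi (ltW xl).
case: (leP (i + 1) t) => ht; first by rewrite lerD2r.
have g1 : gl z t <= gl z i by apply: gl_lo; ilia.
by rewrite subr0 /=; apply/idP/idP => _; ilia.
Qed.

(** Exactly the vees of the component of [p] have their threshold between [i] and [i + 1]. There are
    [rk z p] of them with equal contributions, and [tz] drops by the same factor. *)
Lemma vee_split y : Fop false i (X z) y = X z' y.
Proof.
rewrite {1}/Submission.X FopZ Fop_Alt.
rewrite (@eq_Alt _ _ _ _ (fun u => \sum_(p' | (ppi z p' != p') && ~~ par p')
    (sgx i * ((thz z p' i)%:R - (thz z p' (i + 1))%:R)) * Psi (unpair (ppi z) p') (c2 p') (thz z) u)); last first.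
  move=> u; rewrite FPsi; [|exact: ppiK|exact: ppi_par].
  rewrite big_pred0 ?add0r.
    by apply: eq_bigr => p' _; rewrite addr0.
  move=> l; apply/negP => /andP[tl /eqP]; rewrite ppi_eq in tl; case pl : (par l) => /= xl.
    by have := wedge l; rewrite xl eqxx.
  by move: np; rewrite -(split_atp pl) ?tl // xl addr0.
rewrite Alt_sum (eq_bigr (fun p' => (gl z (xc p' z) == gl z i)%:R * (sgx i * Alt (PsiZ z') y))); last first.
  move=> p' /andP[np' pp']; rewrite AltZ; rewrite ppi_eq in np'.
  have -> : (thz z p' i)%:R - (thz z p' (i + 1))%:R = (gl z (xc p' z) == gl z i)%:R :> K.
    rewrite /Submission.thz gl_i1; case: eqP => [->|h].
      rewrite lexx; have -> : (gl z i + 1 <= gl z i) = false by ilia.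
      by rewrite mulr0n subr0.
    have -> : (gl z i + 1 <= gl z (xc p' z)) = (gl z i <= gl z (xc p' z)) by apply/idP/idP; move: h; clear; lia.
    by rewrite subrr.
  case: eqP => h; last by rewrite mulr0 !mul0r.
  by rewrite mulr1 mul1r split_relabel ?split_PsiZ // /Submission.atE pp'.
rewrite -mulr_suml.
have -> : \sum_(p' | (ppi z p' != p') && ~~ par p') (gl z (xc p' z) == gl z i)%:R = (rk z p)%:R :> K.
  rewrite /Submission.rk -sum1_card natr_sum big_mkcond [RHS]big_mkcond; apply: eq_bigr => l _.
  rewrite inE ppi_eq /Submission.atE xp [~~ typ z l && _]andbC; case pl : (par l) => //=; case tl : (typ z l) => //=.
  case: eqP => //= g; suff -> : xc l z <= i by [].
  by rewrite leNgt; apply/negP => h; have := @gl_hi (xc l z); rewrite g => h'; have := h' _; ilia.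
rewrite /Submission.X split_sgz split_tz.
have h1 := tz_neq0 K par z'; have h2 := tz_neq0 K par z; rewrite split_tz in h2.
have h3 : (rk z p)%:R != 0 :> K by apply: contraNneq h2 => ->; rewrite mul0r.
have hs := @sgx_sq K i; move: (Alt _ _) (sgx i) (sgz z') (tz z') (rk z p)%:R hs h1 h3 => A s S T r hs h1 h3.
by rewrite -[RHS]mul1r -hs; field; rewrite h1 h3.
Qed.
End VeeSplit.
End Main.

(** * Comparison of both sides by induction on the number of vees *)

Section Main.
Variables (K : numFieldType) (N : nat) (par : 'I_N -> bool) (mm : nat).
Hypothesis hpar : forall k : 'I_N, par k = (mm <= k)%N.
Local Notation wt := (wt N).
Local Notation xc := (xc par).
Local Notation Fop := (@Fop K N par).
Local Notation Wg := (Wg par).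
Local Notation Alt := (@Alt K N par).
Local Notation reg := (reg par).
Local Notation asym := (@asym K N par).
Local Notation typ := (typ par).
Local Notation ppi := (ppi par).
Local Notation gl := (gl par).
Local Notation thz := (thz par).
Local Notation atE := (atE par).
Local Notation X := (@X K N par).
Local Notation PsiZ := (@PsiZ K N par).
Local Notation pd := (pd par).
Local Notation hts := (hts par).
Local Notation mc := (mc par).
Local Notation hwd := (@hwd K N par).
Implicit Types (y z : wt) (k l p q m : 'I_N) (w : 'S_N) (t i : int) (D : wt -> K).

Lemma par_lt p q : par p = false -> par q = true -> (p < q)%N.
Proof. by rewrite !hpar => /negbT; rewrite -ltnNge; exact: leq_trans. Qed.

Lemma dom_lt z (i j : 'I_N) : dominant par z -> (i < j)%N -> par i = par j -> z j < z i.
Proof.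
move=> dz; have H n : forall i j : 'I_N, j = (i + n).+1 :> nat -> par i = par j -> z j < z i.
  elim: n => [|n IH] {}i {}j ij pij; first by apply: dz; rewrite // ij addn0.
  have lj : (i + n.+1 < N)%N by have := ltn_ord j; rewrite ij; move=> h; apply: leq_trans h; rewrite ltnW.
  pose l := Ordinal lj.
  have pl : par i = par l.
    by move: pij; rewrite !hpar ij /= => e; apply/idP/idP => h; move: e; lia.
  have h1 : z j < z l by apply: dz; [rewrite ij|rewrite -pl].
  by apply: lt_trans h1 (IH i l _ pl); rewrite /= addnS.
move=> ij pij; apply: (H (j - i.+1)%N) => //; lia.
Qed.

Lemma dom_reg z : dominant par z -> reg z.
Proof.
move=> dz i j pij xij; have zij : z i = z j.
  by move: xij; rewrite /Submission.xc pij => /(mulfI _); apply; rewrite signr_eq0.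
have [lt|lt|e] := ltngtP i j; last exact: val_inj.
- by have := dom_lt dz lt pij; rewrite zij ltxx.
- by have := dom_lt dz lt (esym pij); rewrite zij ltxx.
Qed.

Lemma mc_typ z k : reg z -> typ z k -> mc z (xc k z) = (-1) ^+ par k.
Proof.
move=> rz tk; rewrite /Submission.mc (bigD1 k) //= eqxx mulr1 big1 ?addr0 // => l lk.
case: eqP => [e|]; last by rewrite mulr0.
by case/eqP: lk; apply: rz => //; apply: (typP tk).
Qed.

Lemma mc_ex z t : mc z t != 0 -> exists k, xc k z = t.
Proof.
move=> nz; apply: contrapT => h; case/eqP: nz; rewrite /Submission.mc big1 // => k _.
by case: eqP => [e'|_]; rewrite ?mulr0 //; case: h; exists k.
Qed.

Lemma mc0_nt z k : reg z -> mc z (xc k z) = 0 -> ~~ typ z k.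
Proof. by move=> rz h; apply/negP => tk; have := mc_typ rz tk; rewrite h => /esym/eqP; rewrite signr_eq0. Qed.

Lemma mc_nt z k : reg z -> ~~ typ z k -> mc z (xc k z) = 0.
Proof.
move=> rz nk; have [h1 h2] := ppiP nk; have kp : ppi z k != k by rewrite ppi_eq.
rewrite /Submission.mc (bigD1 k) //= (bigD1 (ppi z k)) //= h2 eqxx !mulr1 h1 big1 ?addr0.
  by case: (par k) => /=; rewrite ?expr0 ?expr1 ?subrr ?addNr.
move=> l /andP[lk lp]; case: eqP => [e|]; last by rewrite mulr0.
have [pl|pl] := eqVneq (par l) (par k); first by case/eqP: lk; apply: rz.
case/eqP: lp; apply: rz; rewrite ?h1 ?h2 //.
by move: pl; case: (par l); case: (par k).
Qed.

Lemma mc_n0_typ z k : reg z -> mc z (xc k z) != 0 -> typ z k.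
Proof. by move=> rz; apply: contraNT => /(mc_nt rz)->. Qed.

Definition nv z := #|[pred p | atE z p]|.

Lemma hwd_reg D z : hwd D z -> reg z.
Proof. by move=> /hwd_dominant; apply: dom_reg. Qed.

Lemma mc_linv z2 z (phi : int -> int) t : involutive phi -> (forall l, xc l z2 = phi (xc l z)) ->
  mc z2 t = mc z (phi t).
Proof.
move=> pK h; apply: eq_bigr => l _; rewrite h; congr (_ * _); congr (nat_of_bool _)%:R.
by rewrite -(inj_eq (can_inj pK)) pK.
Qed.

Definition swp i t := if t == i then i + 1 else if t == i + 1 then i else t.
Lemma swpK i : involutive (swp i).
Proof.
move=> t; rewrite /swp; case: (t =P i) => [->|h].
  have -> : (i + 1 == i) = false by lia.
  by rewrite eqxx.
by case: (t =P i + 1) => [->|h2]; [rewrite eqxx|rewrite (introF eqP h) (introF eqP h2)].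
Qed.

(** If [i + 1] is empty, entry [k] moves there. If it carries a vee, the member of the vee with
    parity opposite to [k] moves to [i] instead; the result is the exchange of the two positions up
    to a transposition, whose sign matches the change of [sgz]. *)
Lemma D_core D z k i : hwd D z -> asym D -> typ z k -> xc k z = i ->
  (forall l, xc l z = i + 1 -> ~~ typ z l) ->
  exists z', [/\ hwd (Fop (par k) i D) z', forall y, Fop (par k) i (X z) y = X z' y,
    pd z -> pd z', nv z' = nv z & forall t, mc z' t = mc z (swp i t)].
Proof.
move=> hD aD tk xk nc; have rz := hwd_reg hD; set s := par k.
have ok l : xc l z = i -> l = k by apply: only_k.
have [[l0 xl0]|no] := pselect (exists l, xc l z = i + 1); last first.
  have no' l : xc l z != i + 1 by apply/eqP => e; apply: no; exists l.
  pose z' := z + se s k.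
  have hz l : xc l z' = swp i (xc l z).
    rewrite /z' xc_se addbb expr0 mulr1 /swp (negbTE (no' l)).
    have [->|lk] := eqVneq l k; first by rewrite xk eqxx.
    by rewrite addr0; case: eqP => // /ok e; rewrite e eqxx in lk.
  have rz' := shift_reg rz tk xk hz.
  exists z'; split.
  - apply: (hwd_step hD) => [m mk|].
      left; rewrite /matching; apply/negP => /eqP; case: (eqVneq (par m) s) => /= e.
        by rewrite addr0 => /ok h; rewrite h eqxx in mk.
      by move=> h; have := no' m; rewrite h eqxx.
    exists z'; rewrite /Submission.Fop (big_pred1 k); first by rewrite /z' addrK (hwd_top hD) oner_neq0.
    move=> m; rewrite /= ; case: (eqVneq (par m) s) => /= e; last first.
      have -> : (m == k) = false by apply: contraNF e => /eqP->.
      rewrite addr0 hz /swp; apply/negP => /eqP; case: eqP => [_|h1]; first lia.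
      by case: eqP => // h2; have := no' m; rewrite h2 eqxx.
    apply/eqP/eqP => [h|->]; last by rewrite hz xk /swp eqxx.
    by apply: rz' => //; rewrite h hz xk /swp eqxx.
  - move=> y; rewrite (core_shift K rz tk xk nc hz) /Submission.X.
    by rewrite (shift_sgz0 K rz tk xk hz no') (shift_tz K rz tk xk hz).
  - exact: shift_pd rz tk xk hz.
  - by apply: eq_card => l; rewrite !inE (shift_atE tk xk hz).
  - by move=> t; apply: mc_linv => //; apply: swpK.
have nl0 := nc _ xl0; have [h1 h2] := ppiP nl0.
have [p [q [pp pq xp xq]]] : exists p q, [/\ par p = s, par q = ~~ s, xc p z = i + 1 & xc q z = i + 1].
  have [e|e] := eqVneq (par l0) s.
    by exists l0, (ppi z l0); split=> //; [rewrite h1 e|rewrite h2].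
  exists (ppi z l0), l0; split=> //; [rewrite h1| |rewrite h2 //]; by move: e; case: (par l0); case: (s).
have pk : p != k by apply/eqP => e; move: xp; rewrite e xk; lia.
have qk : q != k by apply/eqP => e; move: xq; rewrite e xk; lia.
have qp : q != p by apply/eqP => e; move: pq; rewrite e pp; case: (s).
have at1 l : xc l z = i + 1 -> l = p \/ l = q.
  move=> xl; have [e|e] := eqVneq (par l) s; [left|right]; apply: rz; rewrite ?xl ?xp ?xq ?pp ?pq //.
  by move: e; case: (par l); case: (s).
pose z' := z + se s q; pose w := tperm k p; pose z2 := act w z'.
have hw : Wg w by apply: Wg_tperm; rewrite pp.
have xz' l : xc l z' = xc l z - (l == q)%:R.
  by rewrite /z' xc_se pq addNb addbb /= expr1 mulrN1.
have hz l : xc l z2 = swp i (xc l z).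
  rewrite xc_act // xz' /w; case: tpermP => [->|->|lk lp].
  - by rewrite eq_sym (negbTE qp) subr0 xp xk /swp eqxx.
  - rewrite eq_sym (negbTE qk) subr0 xk xp /swp eqxx.
    by have -> : (i + 1 == i) = false by lia.
  have [->|lq] := eqVneq l q.
    rewrite xq /swp eqxx addrK; by have -> : (i + 1 == i) = false by lia.
  rewrite subr0 /swp; case: eqP => [/ok//|_]; case: eqP => // /at1[//|e].
  by rewrite e eqxx in lq.
have hD' : hwd (Fop s i D) z'.
  apply: (hwd_step hD) => [m mq|].
    rewrite /matching; case: (eqVneq (par m) s) => /= e.
      have [->|mk] := eqVneq m k; last by left; rewrite addr0; apply/negP => /eqP/ok h; rewrite h eqxx in mk.
      right=> /dom_reg r2; case/eqP: (pk); apply: r2 => //.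
      by rewrite !xc_se eqxx (negbTE pk) mul0r addr0 xp xk addbb expr0 mulr1.
    left; apply/negP => /eqP/at1[h|h]; last by rewrite h eqxx in mq.
    by rewrite h pp eqxx in e.
  exists z'; rewrite /Submission.Fop (bigD1 q) /=; last first.
    by rewrite xz' xq eqxx pq; case: (s); rewrite /= addr0 addrK.
  (* The other terms evaluate [D] at weights with two equal entries of one parity, where
     antisymmetry makes it vanish; the coefficient at [z'] is therefore 1. *)
  rewrite /z' addrK (hwd_top hD) big1 ?addr0 ?oner_neq0 // => m /andP[/eqP hm mq].
  apply/eqP/negPn/negP => /(asym_reg aD) r2.
  move: hm; rewrite -/z' xz' (negbTE mq) subr0; case: (eqVneq (par m) s) => /= e.
    move=> /at1[h|h]; last by rewrite h eqxx in mq.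
    have := r2 k p; rewrite pp => /(_ erefl); rewrite !xc_seB -/z' !xz' h eqxx ![_ == q]eq_sym (negbTE qp) (negbTE qk) !subr0.
    rewrite [k == p]eq_sym (negbTE pk) mul0r subr0 xk xp pp addbb expr0 mulr1 addrK => /(_ erefl) e2.
    by rewrite e2 eqxx in pk.
  by rewrite addr0 => /ok h; rewrite h eqxx in e.
have rz' := hwd_reg hD'.
exists z'; split=> //.
- move=> y; rewrite (core_shift K rz tk xk nc hz).
  have e2 : X z2 y = - X z' y.
    by rewrite X_act // odd_tperm eq_sym pk expr1 mulN1r.
  have es : sgz K par z2 = - sgz K par z.
    case ps : s; [apply: (shift_sgz1 K rz tk xk nc hz xq)|apply: (shift_sgz1 K rz tk xk nc hz xp)].
      by rewrite pq ps.
    by rewrite pp ps.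
  have := e2; rewrite {1}/Submission.X es (shift_tz K rz tk xk hz) !mulNr => /eqP; rewrite eqr_opp => /eqP.
  by [].
- move=> hp; have := pd_act (WgV hw) (shift_pd rz tk xk hz hp).
  by rewrite /z2 -actM mulVg act1.
- rewrite /nv -(_ : nv z2 = #|[pred p | atE z p]|); last by apply: eq_card => l; rewrite !inE (shift_atE tk xk hz).
  rewrite /nv -!sum1_card [LHS](reindex_inj (@perm_inj _ w)) /=.
  by apply: eq_bigl => l; rewrite !inE atE_act.
- by move=> t; rewrite -(mc_act z' t hw); apply: mc_linv => //; apply: swpK.
Qed.

Lemma D_vee D z p i : hwd D z -> pd z -> atE z p -> xc p z = i -> (forall l, xc l z != i + 1) ->
  exists z', [/\ hwd (Fop false i D) z', forall y, Fop false i (X z) y = X z' y, pd z' & (nv z' < nv z)%N].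
Proof.
move=> hD hpd ap xp wedge; have rz := hwd_reg hD.
have /andP[/negbTE pp np] := ap; have [pq xq] := ppiP np; set q := ppi z p in pq xq.
rewrite pp /= in pq.
exists (z + se false p); split.
- apply: (hwd_step hD) => [m mp|].
    left; rewrite /matching; apply/negP => /eqP; case pm : (par m) => /= h.
      by have := wedge m; rewrite h eqxx.
    by rewrite (split_atp rz ap xp pm) ?eqxx // in mp; rewrite h addr0.
  exists (z + se false p); rewrite /Submission.Fop (bigD1 p) /=; last by rewrite (split_xc ap) eqxx xp pp.
  rewrite addrK (hwd_top hD) big1 ?addr0 ?oner_neq0 // => m /andP[/eqP hm mp].
  move: hm; rewrite (split_xc ap) (negbTE mp) addr0; case pm : (par m) => /= hm; last first.
    by have := wedge m; rewrite hm eqxx.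
  have em : m = q by apply: rz; rewrite ?pm ?pq // xq xp hm addr0.
  (* The competing term, in which the delta-entry of the vee moves back, lies above [z], because
     epsilon-indices precede delta-indices. *)
  apply/eqP/negPn/negP => nz; have := hwd_psum p.+1 hD nz.
  have pltq : (p < q)%N by apply: par_lt.
  rewrite em -addrA -[se false p - se false q]/(root p q) psumD psum_root // ltnSn pltq /=.
  by move: (psum _ _) => t; clear; lia.
- by move=> y; apply: vee_split.
- exact: (split_pd rz ap xp wedge hpd).
- apply: proper_card; apply/fintype.properP; split.
    by apply/fintype.subsetP => l; rewrite !inE (split_atE rz ap xp wedge) => /andP[].
  by exists p; rewrite !inE ?ap // (split_atE rz ap xp wedge) eqxx andbF.
Qed.

(** Two wedges: nothing can move. Two vees: every move collides with an entry of the same parity. A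
    vee to the right of a wedge: [hwd_nested]. On the side of [X], no threshold separates [i] from
    [i + 1] in any of these cases. *)
Lemma F_zero D z i : hwd D z -> (forall l, xc l z = i \/ xc l z = i + 1 -> ~~ typ z l) ->
  ~ ((exists l, xc l z = i) /\ (forall l, xc l z != i + 1)) ->
  forall y, Fop false i D y = 0 /\ Fop false i (X z) y = 0.
Proof.
move=> hD nc hn y; have rz := hwd_reg hD.
have both l t : (t = i \/ t = i + 1) -> xc l z = t -> exists p q, [/\ par p = false, par q = true, xc p z = t & xc q z = t].
  move=> ht xl; have nl : ~~ typ z l by apply: nc; rewrite xl.
  have [h1 h2] := ppiP nl; case pl : (par l).
    by exists (ppi z l), l; rewrite h1 h2 pl.
  by exists l, (ppi z l); rewrite h1 h2 pl.
split.
  have [[l xl]|no1] := pselect (exists l, xc l z = i + 1); last first.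
    have no0 l : xc l z <> i.
      by move=> xl; apply: hn; split; [exists l|move=> l'; apply/eqP => e; apply: no1; exists l'].
    apply: (hwd_zero hD) => k; left; rewrite /matching; apply/negP => /eqP; case: (par k) => /= h.
      by apply: no1; exists k.
    by apply: (no0 k); rewrite h addr0.
  have [p [q [pp pq xp xq]]] := both l _ (or_intror erefl) xl.
  have [[l' xl']|no0] := pselect (exists l, xc l z = i).
    have [p' [q' [pp' pq' xp' xq']]] := both l' _ (or_introl erefl) xl'.
    apply: (hwd_zero hD) => k; rewrite /matching; have [h|h] := boolP (xc k z == _); [right|by left].
    move=> /dom_reg r2; move/eqP: h; case pk : (par k) => /= h.
      have kq : q' = k; last by move: xq'; rewrite kq h; lia.
      apply: r2; rewrite ?pq' ?pk // !xc_se eqxx pk; have [e|_] := eqVneq q' k.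
        by move: xq'; rewrite e h; lia.
      by rewrite mul0r addr0 xq' h /=; lia.
    have kp : p = k; last by move: xp; rewrite kp h; lia.
    apply: r2; rewrite ?pp ?pk // !xc_se eqxx pk; have [e|_] := eqVneq p k.
      by move: xp; rewrite e h; lia.
    by rewrite mul0r addr0 xp h /=; lia.
  apply: (hwd_nested hD (par_lt pp pq) pp pq xp xq) => k kq; rewrite /matching; apply/negP => /eqP.
  case pk : (par k) => /= h.
    by case/eqP: kq; apply: rz; rewrite ?pk ?pq // h xq.
  by apply: no0; exists k; rewrite h addr0.
rewrite /Submission.X FopZ Fop_Alt (@eq_Alt _ _ _ _ (fun=> 0)) => [|u].
  by rewrite /Submission.Alt big1 ?mulr0 // => w _; rewrite mulr0.
rewrite FPsi; [|exact: ppiK|exact: ppi_par].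
rewrite big_pred0 => [|l]; last first.
  apply/negP => /andP[tl /eqP]; rewrite ppi_eq in tl; case pl : (par l) => /= xl.
    by case/negP: (nc l (or_intror xl)).
  by case/negP: (nc l (or_introl (etrans xl (addr0 _)))).
rewrite add0r big1 // => p /andP[np pp]; rewrite ppi_eq in np.
suff -> : thz z p i = thz z p (i + 1) by rewrite subrr mulr0 mul0r.
rewrite /Submission.thz; have e1 := glS i rz; case: existsP e1 => [_|no] /= e1; first by rewrite e1 addr0.
have no1 l : xc l z != i + 1 by apply/negP => h; apply: no; exists l.
have no0 l : xc l z != i by apply/eqP => xl; apply: hn; split=> //; exists l.
have e0 := glS (i - 1) rz; rewrite subrK in e0.
case: existsP e0 => [[l hl]|_] /= e0; first by move: hl; rewrite (negbTE (no0 l)).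
have [h|h] := leP (xc p z) (i - 1).
  have := gl_mono rz h; move: e0 e1; clear; move=> *; apply/idP/idP; lia.
have h' : i + 1 <= xc p z by have := no0 p; have := no1 p; move: h; clear; lia.
have := gl_mono rz h'; move: e0 e1; clear; move=> *; apply/idP/idP; lia.
Qed.

Section Induction.
Variable r : nat.
Hypothesis IHr : forall D z, (nv z < r)%N -> hwd D z -> asym D -> pd z -> forall y, D y = X z y.

Lemma hts_se nu s k : hts (nu + se s k) = hts nu + (if par k then 0 else (-1) ^+ s).
Proof.
rewrite /Submission.hts; have e l : xc l (nu + se s k) = xc l nu + (l == k)%:R * (-1) ^+ (par k (+) s) by apply: xc_se.
under eq_bigr => l _ do rewrite e; rewrite big_split /=; congr (_ + _).
case pk : (par k).
  by apply: big1 => l pl; have -> : (l == k) = false by [apply: contraNF pl => /eqP->]; rewrite mul0r.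
rewrite (bigD1 k) ?pk //= eqxx mul1r big1 ?addr0 // => l /andP[_ /negbTE->].
by rewrite mul0r.
Qed.

Lemma hts_seB nu s k : hts (nu - se s k) = hts nu - (if par k then 0 else (-1) ^+ s).
Proof. by rewrite -{2}(subrK (se s k) nu) hts_se addrK. Qed.

(** [l] counts the typical positions directly right of the vee of [nu] at [t]. The last of them is
    pushed one step to the right by a translation that [D] and [X z] obey alike, which lowers [l].
    For [l = 0] the translation at [t] is known on both sides, and at [nu + eps p] every term other
    than that of [nu] has larger [hts], hence vanishes. *)
Lemma claim (l : nat) : forall D z nu p q t, (nv z <= r)%N -> hwd D z -> asym D -> pd z -> reg nu -> mc nu =1 mc z ->
  par p = false -> par q = true -> xc p nu = t -> xc q nu = t ->
  (forall j, (j < l)%N -> mc z (t + 1 + j%:Z) != 0) -> mc z (t + 1 + l%:Z) = 0 ->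
  (forall k, xc k nu != t + 1 + l%:Z) ->
  (forall nu', hts nu < hts nu' -> X z nu' - D nu' = 0) -> X z nu - D nu = 0.
Proof.
elim: l => [|l IH] D z nu p q t nvz hD aD hpd rnu mnu pp pq xp xq hcore hnc hno hmax; have rz := hwd_reg hD.
  rewrite addr0 in hnc hno.
  have npq : ~~ typ nu p by apply: (@ntypI _ _ nu p q); rewrite ?pp ?pq ?xp ?xq.
  have mt : mc z t = 0 by rewrite -mnu -xp mc_nt.
  have nc k : xc k z = t \/ xc k z = t + 1 -> ~~ typ z k by case=> e; apply: mc0_nt => //; rewrite e.
  have F0 y : Fop false t (X z) y - Fop false t D y = 0.
    have [[[k xk] wedge]|h] := pselect ((exists k, xc k z = t) /\ (forall k, xc k z != t + 1)).
      have nk : ~~ typ z k by apply: nc; left.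
      have [p' [ap' xp']] : exists p', atE z p' /\ xc p' z = t.
        have [h1 h2] := ppiP nk; case pk : (par k).
          by exists (ppi z k); rewrite /Submission.atE h1 pk typ_ppi // h2.
        by exists k; rewrite /Submission.atE pk.
      have [z' [g1 g2 g3 g4]] := D_vee hD hpd ap' xp' wedge.
      rewrite g2 (IHr _ g1) ?subrr //; last exact: Fop_asym.
      exact: leq_trans g4 nvz.
    by have [-> ->] := F_zero hD nc h y; rewrite subrr.
  have := F0 (nu + se false p); rewrite /Submission.Fop -sumrB (bigD1 p) /=; last first.
    by rewrite -[eps p]/(se false p) xc_se eqxx pp xp /= mul1r expr0.
  rewrite -[eps p]/(se false p) addrK big1 ?addr0 // => k /andP[/eqP hk kp]; apply: hmax.
  rewrite -[eps k]/(se false k) hts_seB hts_se pp; have -> : par k = true; last by rewrite expr0 subr0; clear; lia.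
  apply/negPn/negP => /negbTE pk; move: hk; rewrite xc_se (negbTE kp) mul0r addr0 pk /= => hk.
  by have := hno k; rewrite hk eqxx.
pose s := t + 1 + l%:Z.
have es : s + 1 = t + 1 + l.+1%:Z by rewrite /s; lia.
have ms : mc z s != 0 by apply: hcore.
have [k xk] := mc_ex ms.
have tk : typ z k by apply: mc_n0_typ; rewrite ?xk.
have nc m : xc m z = s + 1 -> ~~ typ z m by move=> e; apply: mc0_nt => //; rewrite e es.
have [z' [g1 g2 g3 g4 g5]] := D_core hD aD tk xk nc.
have [k' xk'] : exists k', xc k' nu = s by apply: mc_ex; rewrite mnu.
have tk' : typ nu k' by apply: mc_n0_typ; rewrite ?xk' ?mnu.
have pk' : par k' = par k.
  have := mc_typ rnu tk'; rewrite xk' mnu -xk mc_typ //; case: (par k); case: (par k') => //= /eqP; rewrite ?expr0 ?expr1 ?eqr_oppLR //=.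
pose nu' := nu + se (par k) k'.
have hnu l' : xc l' nu' = swp s (xc l' nu).
  rewrite /nu' xc_se pk' addbb expr0 mulr1 /swp; have := hno l'; rewrite -es => /negbTE->.
  have [->|lk] := eqVneq l' k'; first by rewrite xk' eqxx.
  rewrite addr0; case: eqP => // e; case/eqP: lk; apply: rnu; last by rewrite e xk'.
  by apply: (typP tk'); rewrite e xk'.
have rnu' : reg nu'.
  by move=> a b pab; rewrite !hnu => /(can_inj (swpK s)); apply: rnu.
have hs k'' : xc k'' nu' != s.
  rewrite hnu /swp; case: (xc k'' nu =P s) => [_|h]; first by apply/eqP; clear; lia.
  by case: (xc k'' nu =P s + 1) => [e|h2]; [have := hno k''; rewrite e es eqxx|apply/eqP].
have swp_id u : u < s -> swp s u = u by rewrite /swp => h; case: eqP => [?|_]; [lia|case: eqP => [?|_]; lia].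
have ts : t < s by rewrite /s; lia.
have key : X z' nu' - Fop (par k) s D nu' = 0.
  apply: (IH _ z' nu' p q t) => //.
  - by rewrite g4.
  - exact: Fop_asym.
  - exact: g3.
  - by move=> u; rewrite g5 (mc_linv u (swpK s) hnu) mnu.
  - by rewrite hnu xp swp_id.
  - by rewrite hnu xq swp_id.
  - by move=> j jl; rewrite g5 swp_id ?hcore //; [apply: ltnW|rewrite /s; lia].
  - by rewrite g5 -/s /swp eqxx es.
  move=> nu2 h; rewrite -g2 /Submission.Fop -sumrB big1 // => m _; apply: hmax.
  move: h; rewrite hts_seB /nu' hts_se pk'; case: (par k); case: (par m); rewrite ?expr0 ?expr1 => *; lia.
move: key; rewrite -g2 /Submission.Fop -sumrB (big_pred1 k') => [|m]; first by rewrite /nu' addrK.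
rewrite /=; case: (eqVneq (par m) (par k)) => /= e; last first.
  by rewrite addr0 (negbTE (hs m)); apply/esym/negbTE; apply: contraNneq e => ->; rewrite pk'.
apply/eqP/eqP => [h|->]; last by rewrite hnu xk' /swp eqxx.
by apply: rnu'; rewrite ?e ?pk' // h hnu xk' /swp eqxx.
Qed.
End Induction.

Lemma hts_psum y : hts y = psum mm y.
Proof.
apply: eq_big => k; first by rewrite hpar -ltnNge.
by move=> /negbTE pk; rewrite /Submission.xc pk expr0 mul1r.
Qed.

Theorem hwd_X D z : hwd D z -> asym D -> pd z -> forall y, D y = X z y.
Proof.
have [r le] := ubnP (nv z); elim: r D z le => // r IH D z le hD aD hpd y.
have rz := hwd_reg hD.
pose c u := X z u - D u; suff: c y = 0 by move/eqP; rewrite subr_eq0 => /eqP.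
have cas : asym c by move=> w u hw; rewrite /c X_asym // aD // mulrBr.
apply/eqP/negPn/negP => cy.
pose P x := exists2 u, c u != 0 & hts u = x.
have sup u : c u != 0 -> X z u != 0 \/ D u != 0.
  by move=> cu; have [e|] := eqVneq (X z u) 0; [right; apply: contraNneq cu => d; rewrite /c e d subrr|left].
pose B := Num.max (\sum_k (`|xc k z| + `|gl z (xc k z)| + N%:Z)) (psum mm z).
have [||x [nu cnu hnu] hmax] := @int_max P B.
- by exists (hts y), y.
- move=> x [u /sup[h|h] <-]; rewrite /B le_max.
    by have [_ ->] := X_supp rz h.
  by rewrite hts_psum (hwd_psum mm hD h) orbT.
have rnu := asym_reg cas cnu.
have mnu : mc nu =1 mc z by case: (sup _ cnu) => h; [have [] := X_supp rz h|apply: linkage hD h].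
have hmax' nu' : hts nu < hts nu' -> c nu' = 0.
  move=> h; apply/eqP/negPn/negP => n; have := hmax (hts nu'); rewrite -hnu => h2.
  by have := h2 (ex_intro2 _ _ nu' n erefl); lia.
have [[p0 ap0]|no] := pselect (exists p, atE nu p).
  (* To the right of the rightmost vee, a position with vanishing core is empty in [nu], as [claim]
     demands. *)
  case: (@arg_maxP _ _ _ p0 (atE nu) (xc^~ nu) ap0) => p ap pmax.
  have /andP[/negbTE pp np] := ap; have [pq xq] := ppiP np; rewrite pp /= in pq.
  pose t := xc p nu.
  have ex : exists l : nat, mc z (t + 1 + l%:Z) == 0.
    pose S := \sum_k `|xc k z|; exists (absz (S + `|t|)).
    apply/negPn/negP => /mc_ex[k hk].
    have : `|xc k z| <= S by rewrite /S (bigD1 k) //= lerDl sumr_ge0.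
    have S0 : 0 <= S by apply: sumr_ge0.
    move: hk S0; clear; lia.
  case: (ex_minnP ex) => l /eqP hl lmin.
  have : c nu = 0; last by move/eqP; rewrite (negbTE cnu).
  apply: (@claim r _ l D z nu p (ppi nu p) t) => //.
  - by move=> j jl; apply/negP => /lmin; rewrite leqNgt jl.
  move=> k; apply/eqP => xk; have nk : ~~ typ nu k by apply: mc0_nt => //; rewrite xk mnu.
  have [h1 h2] := ppiP nk.
  have [p' [ap' xp']] : exists p', atE nu p' /\ xc p' nu = xc k nu.
    case pk : (par k); last by exists k; rewrite /Submission.atE pk.
    by exists (ppi nu k); rewrite /Submission.atE h1 pk typ_ppi.
  have := pmax _ ap'; rewrite xp' xk -/t; clear; lia.
have tnu k : typ nu k.
  case tk : (typ nu k) => //; have nk := negbT tk; have [h1 h2] := ppiP nk; case: no; case pk : (par k); last by exists k; rewrite /Submission.atE pk.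
  by exists (ppi nu k); rewrite /Submission.atE h1 pk typ_ppi.
(* When [nu] has no vee, its core forces [z] to have the same entries. Then [nu] is in the orbit of
   the typical weight [z], where both sides have coefficient 1 up to the common sign. *)
have ex k : exists m, par m = par k /\ xc m z = xc k nu.
  apply: contrapT => h; have := mc_typ rnu (tnu k); rewrite mnu => e.
  have : (-1) ^+ par k * mc z (xc k nu) <= 0.
    rewrite /Submission.mc mulr_sumr; apply: sumr_le0 => m _; case: eqP => [xm|_]; last by rewrite !mulr0.
    have pm : par m = ~~ par k.
      by case pm : (par m); case pk : (par k) => //; case: h; exists m; rewrite pm pk.
    by rewrite pm mulr1; case: (par k).
  by rewrite e -signr_addb addbb.
pose f k := projT1 (cid (ex k)); have hf k : par (f k) = par k /\ xc (f k) z = xc k nu := projT2 (cid (ex k)).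
have finj : injective f.
  by move=> a b e; apply: rnu; rewrite -?(proj1 (hf a)) -?(proj2 (hf a)) e; [rewrite (proj1 (hf b))|rewrite (proj2 (hf b))].
pose w := perm finj.
have hw : Wg w by apply/WgP => k; rewrite permE; have [] := hf k.
have enu : nu = act w z.
  apply/ffunP => k; rewrite actE permE; have [h1 h2] := hf k.
  by move: h2; rewrite /Submission.xc h1 => /(mulfI _); rewrite signr_eq0 => /(_ isT).
have tz k : typ z k.
  by have := tnu (w^-1%g k); rewrite enu typ_act // permKV.
by move: cnu; rewrite enu cas // /c X_core // (hwd_top hD) subrr mulr0 eqxx.
Qed.
End Main.

(** * From abstract simple modules to matrices *)

Section HighestWeightModule.
Variables (K : numFieldType) (N : nat) (par : 'I_N -> bool) (mm : nat).
Hypothesis hpar : forall k : 'I_N, par k = (mm <= k)%N.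
Local Notation wt := (wt N).
Variables (V : lmodType K) (T : 'I_N -> 'I_N -> V -> V) (ga : V -> V).
Hypothesis TL : forall i j a x y, T i j (a *: x + y) = a *: T i j x + T i j y.
Hypothesis TR : forall i j k l u, T k l (T i j u) = sgn4 K par i j k l *: T i j (T k l u) +
  ((j == k)%:R *: T i l u - sgn4 K par i j k l *: ((i == l)%:R *: T k j u)).
Hypothesis gaL : forall a x y, ga (a *: x + y) = a *: ga x + ga y.
Hypothesis gaK : forall x, ga (ga x) = x.
Hypothesis gaT : forall i j x, ga (T i j x) = (-1) ^+ (par i (+) par j) *: T i j (ga x).
Definition lin (P : V -> Prop) := P 0 /\ forall a x y, P x -> P y -> P (a *: x + y).
(** Stability under the parity involution [ga] expresses that a subspace is graded. *)
Hypothesis simp : forall P, lin P -> (forall i j x, P x -> P (T i j x)) -> (forall x, P x -> P (ga x)) ->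
  (exists2 x, P x & x != 0) -> forall u, P u.

Definition wv (y : wt) u := forall i, T i i u = ((y i)%:~R - rr K par i) *: u.
Definition sing u := forall i j : 'I_N, (j < i)%N -> T i j u = 0.

Lemma T0 i j : T i j 0 = 0.
Proof. by have := TL i j (-1) 0 0; rewrite scaler0 addr0 scaleN1r addNr. Qed.
Lemma TZ i j a x : T i j (a *: x) = a *: T i j x.
Proof. by rewrite -[a *: x]addr0 TL T0 addr0. Qed.
Lemma TD i j x y : T i j (x + y) = T i j x + T i j y.
Proof. by rewrite -{1}[x]scale1r TL scale1r. Qed.
Lemma ga0 : ga 0 = 0.
Proof. by have := gaL (-1) 0 0; rewrite scaler0 addr0 scaleN1r addNr. Qed.
Lemma gaZ a x : ga (a *: x) = a *: ga x.
Proof. by rewrite -[a *: x]addr0 gaL ga0 addr0. Qed.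

Section Lin.
Variables (P : V -> Prop) (hP : lin P).
Lemma linD x y : P x -> P y -> P (x + y).
Proof. by move=> hx hy; rewrite -[x]scale1r; apply: (proj2 hP). Qed.
Lemma linZ a x : P x -> P (a *: x).
Proof. by move=> hx; rewrite -[_ *: _]addr0; apply: (proj2 hP) => //; apply: (proj1 hP). Qed.
Lemma linB x y : P x -> P y -> P (x - y).
Proof. by move=> hx hy; rewrite -scaleN1r addrC; apply: (proj2 hP). Qed.
End Lin.

Lemma wv_T y u i j : wv y u -> wv (y + (eps j - eps i)) (T i j u).
Proof.
move=> hu k; have := TR i j k k u; have -> : sgn4 K par i j k k = 1 by rewrite /sgn4 addbb andbF.
rewrite !scale1r => ->; rewrite hu TZ.
have -> : (j == k)%:R *: T i k u = (j == k)%:R *: T i j u by case: eqP => [->|]; rewrite ?scale0r.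
have -> : (i == k)%:R *: T k j u = (i == k)%:R *: T i j u by case: eqP => [->|]; rewrite ?scale0r.
rewrite -scalerBl -scalerDl; congr (_ *: _); rewrite waddE wsubE !epsE !(rmorphD, rmorphB) /= !rmorph_nat.
by rewrite [k == j]eq_sym [k == i]eq_sym; ring.
Qed.

Lemma wvZ y a u : wv y u -> wv y (a *: u).
Proof. by move=> hu i; rewrite TZ hu !scalerA mulrC. Qed.
Lemma wv_lin y : lin (wv y).
Proof.
split=> [i|a u w hu hw i]; first by rewrite T0 scaler0.
by rewrite TL hu hw scalerDr !scalerA mulrC.
Qed.

(** Take a coordinate [k] separating the first weight from [y] and apply [T k k] minus its value on
    the first term: the list becomes shorter. *)
Lemma wv_indep (s : seq (wt * V)) y :
  (forall p, p \in map fst s -> p != y) -> (forall i, (i < size s)%N -> wv (nth (y, 0) s i).1 (nth (y, 0) s i).2) ->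
  wv y (\sum_(p <- s) p.2) -> \sum_(p <- s) p.2 = 0.
Proof.
have [n le] := ubnP (size s); elim: n s le => // n IHn [|[y1 u1] s] /= le hne hwv hs; first by rewrite big_nil.
rewrite big_cons /= in hs *; set u := u1 + _ in hs *.
have y1y : y1 != y by apply: hne; rewrite inE eqxx.
have [k hk] : exists k, y1 k != y k.
  apply: contrapT => h; case/eqP: y1y; apply/ffunP => k; apply/eqP/negPn/negP => hk; apply: h; by exists k.
pose c1 : K := (y1 k)%:~R - rr K par k.
pose g (p : wt * V) := (p.1, ((p.1 k)%:~R - rr K par k - c1) *: p.2).
have hu1 : wv y1 u1 by apply: (hwv 0%N).
have sumT (l : seq (wt * V)) : (forall i, (i < size l)%N -> wv (nth (y, 0) l i).1 (nth (y, 0) l i).2) ->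
   T k k (\sum_(p <- l) p.2) - c1 *: \sum_(p <- l) p.2 = \sum_(p <- map g l) p.2.
  elim: l => [|[y2 u2] l IHl] hl; first by rewrite !big_nil T0 scaler0 subrr.
  rewrite /= !big_cons /= TD scalerDr opprD addrACA IHl; last by move=> i hi; apply: (hl i.+1).
  by congr (_ + _); rewrite (hl 0%N (ltn0Sn _)) -scalerBl.
have e : ((y k)%:~R - (y1 k)%:~R) *: u = \sum_(p <- map g s) p.2.
  rewrite -sumT; last by move=> i hi; apply: (hwv i.+1).
  have := hs k; rewrite /u TD hu1 -/c1 => h.
  have -> : T k k (\sum_(p <- s) p.2) = ((y k)%:~R - rr K par k) *: (u1 + \sum_(p <- s) p.2) - c1 *: u1.
    by rewrite -h addrAC subrr add0r.
  rewrite -addrA -opprD -scalerDr -scalerBl; congr (_ *: _); rewrite /c1; ring.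
have z0 : \sum_(p <- map g s) p.2 = 0.
  apply: IHn => [|p|i|].
  - by rewrite size_map.
  - by rewrite -map_comp /= => hp; apply: hne; rewrite inE hp orbT.
  - rewrite size_map => hi; rewrite (nth_map (y, 0)) //=; apply: wvZ; exact: (hwv i.+1).
  - by rewrite -e; apply: wvZ.
move: e; rewrite z0 => /eqP; rewrite scaler_eq0 -rmorphB intr_eq0 subr_eq0 eq_sym (negbTE hk) /=.
by move/eqP.
Qed.

(** Weights are controlled by checking [Q] on generators only; [sums_wt] transfers it back to an
    arbitrary nonzero weight vector. *)
Definition sums (Q : wt -> V -> Prop) u := exists s : seq (wt * V),
  (forall i, (i < size s)%N -> wv (nth (0, 0) s i).1 (nth (0, 0) s i).2 /\ Q (nth (0, 0) s i).1 (nth (0, 0) s i).2)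
  /\ u = \sum_(p <- s) p.2.

Lemma sums1 Q y u : wv y u -> Q y u -> sums Q u.
Proof. by move=> h1 h2; exists [:: (y, u)]; split; [case|rewrite big_seq1]. Qed.

Lemma sums_lin Q : (forall y a u, Q y u -> Q y (a *: u)) -> lin (sums Q).
Proof.
move=> hQ; split=> [|a x y [s [h1 ->]] [t [h2 ->]]]; first by exists [::]; rewrite big_nil.
exists (map (fun p => (p.1, a *: p.2)) s ++ t); split=> [i|]; last first.
  by rewrite big_cat /= big_map scaler_sumr.
rewrite size_cat size_map nth_cat size_map => hi; have [li|gi] := ltnP i (size s).
  by rewrite (nth_map (0, 0)) //=; have [a1 a2] := h1 i li; split; [apply: wvZ|apply: hQ].
by apply: h2; rewrite ltn_subLR.
Qed.

Lemma sums_T Q i j : (forall y u, wv y u -> Q y u -> Q (y + (eps j - eps i)) (T i j u)) ->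
  forall u, sums Q u -> sums Q (T i j u).
Proof.
move=> hQ u [s [h ->]]; exists (map (fun p => (p.1 + (eps j - eps i), T i j p.2)) s); split=> [l|].
  by rewrite size_map => hl; rewrite (nth_map (0, 0)) //=; have [a1 a2] := h l hl; split; [apply: wv_T|apply: hQ].
by rewrite big_map /=; elim: (s) => [|p t IH]; rewrite ?big_nil ?T0 // !big_cons TD IH.
Qed.

Lemma sums_wt Q u y : sums Q u -> wv y u -> u != 0 -> exists w, Q y w.
Proof.
move=> [s [h ->]] hu nz; apply: contrapT => hn; case/eqP: nz; apply: (@wv_indep s y) => //.
  move=> p /(nthP 0)[i]; rewrite size_map => hi; rewrite (nth_map (0, 0)) // => <-; apply/eqP => e.
  by have [_ h2] := h i hi; apply: hn; exists (nth (0, 0) s i).2; rewrite -e.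
by move=> i hi; rewrite (set_nth_default (0, 0)) //; have [] := h i hi.
Qed.

Lemma sums_nz Q u : sums Q u -> sums (fun y w => Q y w /\ w != 0) u.
Proof.
move=> [s [h ->]]; exists [seq p <- s | p.2 != 0]; split=> [i hi|].
  have := mem_nth (0, 0) hi; rewrite mem_filter => /andP[h1 /(nthP (0, 0))[j hj ej]]; rewrite -ej in h1 *.
  by have [a1 a2] := h j hj.
by rewrite big_filter [LHS](bigID (fun p : wt * V => p.2 != 0)) /= [X in _ + X]big1 ?addr0 // => p /negPn/eqP.
Qed.

(** The span of all lowering words applied to [x], as an intersection of stable subspaces. *)
Definition Low x u := forall P, lin P -> P x -> (forall (i j : 'I_N) y, (i < j)%N -> P y -> P (T i j y)) -> P u.

Lemma Low_lin x : lin (Low x).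
Proof. by split=> [P hP|a u w hu hw P hP h1 h2]; [case: hP|apply: (proj2 hP); [apply: hu|apply: hw]]. Qed.
Lemma Low_T x (i j : 'I_N) u : (i < j)%N -> Low x u -> Low x (T i j u).
Proof. by move=> ij hu P hP h1 h2; apply: (h2) => //; apply: hu. Qed.
Lemma Low_x x : Low x x. Proof. by move=> P. Qed.

Lemma Low_stable x y : wv y x -> sing x -> forall u, Low x u -> forall i j, Low x (T i j u).
Proof.
move=> hx sx u hu; have hL := Low_lin x.
apply: (proj2 (hu (fun u => Low x u /\ forall i j, Low x (T i j u)) _ _ _)).
- split=> [|a p q [p1 p2] [q1 q2]]; first by split=> [|i j]; rewrite ?T0; apply: (proj1 hL).
  by split=> [|i j]; rewrite ?TL; apply: (proj2 hL).
- split=> [|i j]; first exact: Low_x.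
  case: (ltngtP i j) => [ij|ji|/val_inj->].
  + by apply: Low_T => //; apply: Low_x.
  + by rewrite sx //; apply: (proj1 hL).
  + by rewrite hx; apply: (linZ hL); apply: Low_x.
- move=> a b p ab [p1 p2]; split=> [|i j]; first exact: Low_T.
  rewrite TR; apply: (linD hL); first by apply: (linZ hL); apply: Low_T.
  by apply: (linB hL); [apply: (linZ hL)|apply: (linZ hL); apply: (linZ hL)].
Qed.

(** [Low_stable] makes this span a submodule, and the homogeneity of [x] makes it graded, so
    simplicity applies. *)
Lemma Low_all x y : wv y x -> sing x -> (ga x = x \/ ga x = - x) -> x != 0 -> forall u, Low x u.
Proof.
move=> hx sx gx nz; apply: simp => [||u hu|]; first exact: Low_lin.
- by move=> i j u hu; apply: Low_stable hu i j.
- have hL := Low_lin x; apply: (hu (fun u => Low x (ga u))).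
  + by split=> [|a p q hp hq]; rewrite ?ga0 ?gaL; [apply: (proj1 hL)|apply: (proj2 hL)].
  + by case: gx => ->; [|rewrite -scaleN1r; apply: (linZ hL)]; apply: Low_x.
  + by move=> i j p ij hp; rewrite gaT; apply: (linZ hL); apply: Low_T.
- by exists x => //; apply: Low_x.
Qed.

Lemma Low_psum x y u w k : wv y x -> Low x u -> wv w u -> u != 0 -> psum k w <= psum k y.
Proof.
move=> hx hu hw nz; have hs : sums (fun w _ => psum k w <= psum k y) u.
  apply: hu; first exact: sums_lin.
    exact: sums1 hx (lexx _).
  move=> i j p ij; apply: sums_T => w' p' _; rewrite -[eps j - eps i]opprB -/(root i j) psumD psumN psum_root //.
  by case: (_ <= _)%N => /=; lia.
by have [_] := sums_wt hs hw nz.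
Qed.

Lemma psum_inj (y w : wt) : (forall k, psum k y = psum k w) -> y = w.
Proof. by move=> h; apply/ffunP => k; have := h k.+1; rewrite !psum_succ h => /addrI. Qed.

Variables (v : V) (z : wt).
Hypotheses (v0 : v != 0) (vg : ga v = v \/ ga v = - v) (vs : sing v) (vz : wv z v) (dz : dominant par z).

Lemma Vlow u : Low v u. Proof. exact: (Low_all vz vs vg v0). Qed.
Lemma wt_psum y u k : wv y u -> u != 0 -> psum k y <= psum k z.
Proof. exact: Low_psum vz (Vlow u). Qed.

Lemma wv_top u : wv z u -> exists c, u = c *: v.
Proof.
pose Q (y : wt) (_ : V) := y != z /\ forall k, psum k y <= psum k z.
have [c hc] : exists c, sums Q (u - c *: v).
  refine (Vlow u (P := fun u => exists c, sums Q (u - c *: v)) _ _ _).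
  - split=> [|a x y [c hc] [d hd]]; first by exists 0; rewrite scale0r subr0; apply: (proj1 (sums_lin _)).
    exists (a * c + d); have := proj2 (@sums_lin Q (fun _ _ _ h => h)) a _ _ hc hd.
    by rewrite scalerBr scalerA addrACA -opprD -scalerDl.
  - by exists 1; rewrite scale1r subrr; apply: (proj1 (sums_lin _)).
  - move=> i j y ij [c hc]; exists 0; rewrite scale0r subr0.
    have low (w : wt) : (forall k, psum k w <= psum k z) -> w + (eps j - eps i) != z /\ forall k, psum k (w + (eps j - eps i)) <= psum k z.
      move=> hw; have e k : psum k (w + (eps j - eps i)) = psum k w - (i < k <= j)%N%:R.
        by rewrite -[eps j - eps i]opprB -/(root i j) psumD psumN psum_root.
      split=> [|k]; last by rewrite e; have := hw k; case: (_ <= _)%N => /=; lia.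
      apply/eqP => ez; have := hw i.+1; have := e i.+1; rewrite ez ltnSn ij /=; lia.
    rewrite -[y](subrK (c *: v)) TD; apply: (@linD (sums Q)); first exact: sums_lin.
      by apply: (@sums_T Q) hc => w p _ [_ h]; exact: low.
    rewrite TZ; apply: (@linZ (sums Q)); first exact: sums_lin.
    by apply: sums1 (wv_T i j vz) _; apply: low.
move=> hu; exists c; apply/eqP; rewrite -subr_eq0; apply/negPn/negP => nz.
have [_ [] ] := sums_wt hc (@linB (wv z) (wv_lin z) _ _ hu (wvZ c vz)) nz.
by rewrite eqxx.
Qed.

(** A singular vector need not be homogeneous, but [u + ga u] and [u - ga u] are; when nonzero, each
    generates [V], so its weight and [z] dominate each other. *)
Lemma sing_top y u : wv y u -> sing u -> exists c, u = c *: v.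
Proof.
move=> hu su; have one w : wv y w -> sing w -> (ga w = w \/ ga w = - w) -> exists c, w = c *: v.
  move=> hw sw gw; have [->|nz] := eqVneq w 0; first by exists 0; rewrite scale0r.
  have ey : y = z.
    apply: psum_inj => k; apply/eqP; rewrite eq_le (wt_psum k hw nz) /=.
    exact: Low_psum hw (Low_all hw sw gw nz v) vz v0.
  by apply: wv_top; rewrite -ey.
have hg : wv y (ga u) by move=> i; have := congr1 ga (hu i); rewrite gaT addbb expr0 scale1r gaZ.
have sg : sing (ga u).
  move=> i j ji; have := congr1 ga (su i j ji); rewrite gaT ga0 => /eqP.
  by rewrite scaler_eq0 signr_eq0 => /eqP.
have singL a x w : sing x -> sing w -> sing (a *: x + w).
  by move=> hx hw i j ji; rewrite TL hx // hw // scaler0 addr0.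
have [c1 e1] : exists c, u + ga u = c *: v.
  apply: one; [exact: (@linD (wv y) (wv_lin y) _ _ hu hg)| |left].
    by have := singL 1 u (ga u) su sg; rewrite scale1r.
  by have := gaL 1 u (ga u); rewrite !scale1r gaK [ga u + u]addrC.
have [c2 e2] : exists c, u - ga u = c *: v.
  apply: one; [exact: (@linB (wv y) (wv_lin y) _ _ hu hg)| |right].
    by have := singL (-1) (ga u) u sg su; rewrite scaleN1r addrC.
  by have h := gaL (-1) (ga u) u; rewrite !scaleN1r gaK in h; rewrite addrC h opprD opprK addrC.
exists ((c1 + c2) / 2); rewrite mulrC -scalerA scalerDl -e1 -e2 addrACA subrr addr0 -mulr2n -scaler_nat scalerA mulVf ?scale1r //.
by rewrite pnatr_eq0.
Qed.

(** * The sl_2 of an even root *)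

Section SL2.
Variables (i j : 'I_N).
Hypotheses (nij : i != j) (pij : par i = par j).
Let f := T i j.
Let e := T j i.

Lemma it0 (g : V -> V) n : g 0 = 0 -> iter n g 0 = 0.
Proof. by move=> g0; elim: n => //= n ->. Qed.

Lemma wv_iter y u n : wv y u -> wv (y + (eps j - eps i) *+ n) (iter n f u).
Proof.
move=> hu; elim: n => [|n IH] /=; first by rewrite addr0.
by rewrite mulrSr addrA; apply: wv_T.
Qed.

Definition hwt (y : wt) : K := ((y i)%:~R - rr K par i) - ((y j)%:~R - rr K par j).

Lemma ef y w : wv y w -> e (f w) = f (e w) + hwt y *: w.
Proof.
move=> hw; rewrite /e /f TR; have -> : sgn4 K par i j j i = 1 by rewrite /sgn4 pij addbb.
by rewrite !eqxx !scale1r !hw -scalerBl.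
Qed.

Lemma hwt_iter y n : hwt (y + (eps j - eps i) *+ n) = hwt y - (n%:R) *+ 2.
Proof.
have nji : (j == i) = false by rewrite eq_sym (negbTE nij).
rewrite /hwt !waddE; have e1 k : ((eps j - eps i) *+ n) k = ((k == j)%:R - (k == i)%:R) * n%:Z :> int.
  by rewrite mulrnBl wsubE !epsMnE mulrBl.
rewrite !e1 !eqxx (negbTE nij) nji !rmorphD /= !rmorphM /= !rmorphB /= !rmorph_nat mulr2n.
by rewrite -[(n%:Z)%:~R]/(n%:R : K); move: (n%:R : K) => t; ring.
Qed.

Lemma ef_iter y u n : wv y u -> e (iter n.+1 f u) = iter n.+1 f (e u) + (n.+1%:R * (hwt y - n%:R)) *: iter n f u.
Proof.
move=> hu; elim: n => [|n IH]; first by rewrite /= (ef hu) mul1r subr0.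
rewrite [iter n.+2 f u]iterS (ef (wv_iter n.+1 hu)) IH /f TD TZ -/f -[f (iter n f u)]/(iter n.+1 f u).
rewrite -[f (iter n.+1 f (e u))]/(iter n.+2 f (e u)) -addrA -scalerDl hwt_iter; congr (_ + _ *: _).
by rewrite -[n.+2]addn1 -[n.+1]addn1 !natrD mulr2n; ring.
Qed.

Lemma iter_lin n a x w : iter n f (a *: x + w) = a *: iter n f x + iter n f w.
Proof. by elim: n => //= n ->; rewrite /f TL. Qed.

(** First [e u = 0], by induction on the power of [e] killing [u], since [e u] has weight [k + 2].
    Then [u] is primitive, and the coefficients [(l + 1) (k - l)] with [l < k] are nonzero, so
    vanishing descends from [f^k u] to [u]. *)
Lemma sl2_inj n y u k : iter n e u = 0 -> wv y u -> hwt y = k%:R -> iter k f u = 0 -> u = 0.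
Proof.
have f0 : f 0 = 0 by apply: T0.
have e0 : e 0 = 0 by apply: T0.
elim: n y u k => [|n IH] y u k hn hu hk fk //.
have eu : e u = 0.
  apply: (IH (y + (eps i - eps j)) (e u) k.+2).
  - by rewrite -iterSr.
  - exact: wv_T.
  - have nji : (j == i) = false by rewrite eq_sym (negbTE nij).
    rewrite -[k.+2]addn2 natrD -hk /hwt !(waddE y) !(wsubE (eps i)) !epsE !eqxx (negbTE nij) nji.
    by rewrite !(rmorphD, rmorphB) /= ; ring.
  have := ef_iter k hu; rewrite iterS fk f0 e0 hk subrr mulr0 scale0r addr0 => h.
  by rewrite iterS -h f0.
have down m : (m <= k)%N -> iter (k - m) f u = 0.
  elim: m => [|m IHm] mk; first by rewrite subn0.
  have es : (k - m = (k - m.+1).+1)%N by lia.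
  have := IHm (ltnW mk); rewrite es => h.
  have := ef_iter (k - m.+1) hu; rewrite h e0 eu it0 // add0r => /esym/eqP.
  rewrite scaler_eq0 mulf_eq0 pnatr_eq0 /= hk -natrB ?pnatr_eq0; last by lia.
  by case/orP => [/eqP h2|/eqP//]; lia.
by have := down k (leqnn k); rewrite subnn.
Qed.
End SL2.

Lemma rr1 (i j : 'I_N) : j = i.+1 :> nat -> par i = par j -> rr K par i = rr K par j + 1.
Proof. by move=> ij pij; rewrite -(rr_adj K ij pij) addrC subrK. Qed.

Lemma hwtE (i j : 'I_N) (y : wt) : j = i.+1 :> nat -> par i = par j -> hwt i j y = (y i - y j - 1)%:~R.
Proof. by move=> ij pij; rewrite /hwt (rr1 ij pij) !rmorphB /=; ring. Qed.

Lemma nil_e (i j : 'I_N) y u : j = i.+1 :> nat -> wv y u -> exists n, iter n (T j i) u = 0.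
Proof.
move=> ij hu; pose n := absz (psum j z - psum j y).
exists n.+1; apply/eqP/negPn/negP => nz.
have := wt_psum j (wv_iter j i n.+1 hu) nz; have ijl : (i < j)%N by rewrite ij.
by rewrite -/(root i j) psumD psumMn psum_root // ijl leqnn /= -mulr_natr mul1r natz /n; lia.
Qed.

(** If [k] is the sl_2 weight of [v], then [f^(k+1) v] is singular. Were it nonzero, it would
    generate [V], although [v] has a strictly higher weight. *)
Lemma fv_zero (i j : 'I_N) : j = i.+1 :> nat -> par i = par j -> exists n, iter n (T i j) v = 0.
Proof.
move=> ij pij; have ijl : (i < j)%N by rewrite ij.
have nij : i != j by rewrite -val_eqE /= ij; lia.
have dk := dz ij pij; pose k := absz (z i - z j - 1)%R; exists k.+1.
have hk : hwt i j z = k%:R.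
  by rewrite hwtE //; have -> : z i - z j - 1 = k%:Z by rewrite /k; lia.
set x := iter _ _ v; apply/eqP/negPn/negP => nz.
have hx := wv_iter i j k.+1 vz; rewrite -/x in hx.
have sx : sing x.
  (* Past [f], a raising operator other than [T j i] produces only raising operators other than
     [T j i], because [i] and [j] are adjacent. *)
  have oth n (a b : 'I_N) : (b < a)%N -> ~~ ((a == j) && (b == i)) -> T a b (iter n (T i j) v) = 0.
    elim: n a b => [|n IH] a b ba nab; first exact: vs.
    rewrite iterS TR IH // T0 scaler0 add0r.
    have [e1|_] := eqVneq j a.
      have bi : b != i by move: nab; rewrite -e1 eqxx.
      have bi' : (b < i)%N by move: ba bi; rewrite -e1 ij ltnS -val_eqE /=; lia.
      rewrite [T i b _]IH //; last by rewrite (negbTE nij).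
      by rewrite eq_sym (negbTE bi) scale0r !scaler0 subrr.
    rewrite scale0r sub0r; have [e2|_] := eqVneq i b; last by rewrite scale0r scaler0 oppr0.
    rewrite [T a j _]IH ?scaler0 ?oppr0 //; last by rewrite [j == i]eq_sym (negbTE nij) andbF.
    have aj : a != j by move: nab; rewrite e2 eqxx andbT.
    by move: ba aj; rewrite -e2 -val_eqE /= ij; lia.
  move=> a b ba; have [/andP[/eqP-> /eqP->]|nab] := boolP ((a == j) && (b == i)); last exact: oth.
  by rewrite /x (ef_iter nij pij k vz) vs // it0 ?T0 // add0r hk subrr mulr0 scale0r.
have gx : ga x = x \/ ga x = - x.
  have gi n : ga (iter n (T i j) v) = iter n (T i j) (ga v).
    by elim: n => //= n IH; rewrite gaT pij addbb expr0 scale1r IH.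
  rewrite /x gi; case: vg => ->; [by left|right].
  rewrite -scaleN1r -[_ *: v]addr0 iter_lin it0 ?T0 // addr0 scaleN1r.
  by [].
have := Low_psum j hx (Low_all hx sx gx nz v) vz v0.
rewrite -[eps j - eps i]opprB -/(root i j) psumD mulNrn psumN psumMn psum_root // ijl leqnn /=.
by rewrite -mulr_natr mul1r natz; lia.
Qed.

(** The commutator [A] of [f] with a lowering operator commutes with [f], so local nilpotency
    spreads from [v] to everything it generates. *)
Lemma nil_f (i j : 'I_N) u : j = i.+1 :> nat -> par i = par j -> exists n, iter n (T i j) u = 0.
Proof.
move=> ij pij; have nij : i != j by rewrite -val_eqE /= ij; lia.
have f0 := T0 i j.
have mono n m' w : (n <= m')%N -> iter n (T i j) w = 0 -> iter m' (T i j) w = 0.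
  by move=> nm h; rewrite -(subnK nm) iterD h it0.
refine (Vlow u (P := fun u => exists n, iter n (T i j) u = 0) _ _ _).
- split=> [|a x y [n hn] [m' hm]]; first by exists 0%N.
  exists (maxn n m'); rewrite iter_lin (mono _ _ _ (leq_maxl n m') hn) (mono _ _ _ (leq_maxr n m') hm).
  by rewrite scaler0 addr0.
- exact: fv_zero.
move=> a b y ab [n hn]; exists n.+1.
pose A w := (b == i)%:R *: T a j w - (a == j)%:R *: T i b w.
have s1 c d : sgn4 K par c d i j = 1 by rewrite /sgn4 pij addbb andbF.
have fT w : T i j (T a b w) = T a b (T i j w) + A w.
  by rewrite TR s1 !scale1r.
have nab : ~~ ((b == i) && (a == j)) by apply/negP => /andP[/eqP e1 /eqP e2]; move: ab; rewrite e1 e2 ij; lia.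
have AL c x w : A (c *: x + w) = c *: A x + A w.
  rewrite /A !TL !scalerDr scalerN !scalerA (mulrC c (b == i)%:R) (mulrC c (a == j)%:R).
  by rewrite opprD addrACA.
have A0 : A 0 = 0 by rewrite /A !T0 !scaler0 subrr.
have fA w : T i j (A w) = A (T i j w).
  have ni : (i == j) = false by apply/negbTE.
  have nj : (j == i) = false by rewrite eq_sym.
  have TN x : T i j (- x) = - T i j x by rewrite -scaleN1r TZ scaleN1r.
  rewrite /A TD TN !TZ (TR a j i j w) (TR i b i j w) !s1 !scale1r ni nj !scale0r sub0r subr0.
  move: nab; case: eqP => _; case: eqP => _ //= _; rewrite ?scale0r ?scale1r ?oppr0 ?addr0 ?add0r //.
have itA q w : iter q (T i j) (A w) = A (iter q (T i j) w) by elim: q => //= q ->; rewrite fA.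
have itD q x w : iter q (T i j) (x + w) = iter q (T i j) x + iter q (T i j) w.
  by rewrite -[x]scale1r iter_lin !scale1r.
elim: n y hn => [|n IH] y hn; first by move: hn => /= ->; rewrite T0 T0.
rewrite iterSr fT itD itA hn A0 addr0; apply: IH.
by rewrite -iterSr.
Qed.

Lemma wt_swap (i j : 'I_N) y u : j = i.+1 :> nat -> par i = par j -> wv y u -> u != 0 ->
  exists y' u', [/\ wv y' u', u' != 0, y' i = y j + 1, y' j = y i - 1 & forall k, k != i -> k != j -> y' k = y k].
Proof.
move=> ij pij hu nz; have nij : i != j by rewrite -val_eqE /= ij; lia.
have nji : (j == i) = false by rewrite eq_sym (negbTE nij).
have ev (a b : 'I_N) n k : (y + (eps b - eps a) *+ n) k = y k + ((k == b)%:R - (k == a)%:R) * n%:Z :> int.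
  by rewrite waddE mulrnBl wsubE !epsMnE mulrBl.
have [h|h] := leP 0 (y i - y j - 1).
  pose n := absz (y i - y j - 1)%R; exists (y + (eps j - eps i) *+ n), (iter n (T i j) u).
  split; rewrite ?ev ?eqxx ?(negbTE nij) ?nji; [exact: wv_iter| |rewrite /n; lia|rewrite /n; lia|].
    apply: contraNneq nz => e0; have [l hl] := nil_e ij hu.
    by apply/eqP; apply: (sl2_inj nij pij hl hu _ e0); rewrite hwtE //; have -> : y i - y j - 1 = n%:Z by rewrite /n; lia.
  by move=> k /negbTE ki /negbTE kj; rewrite ev ki kj subrr mul0r addr0.
pose n := absz (y j - y i + 1)%R; exists (y + (eps i - eps j) *+ n), (iter n (T j i) u).
split; rewrite ?ev ?eqxx ?(negbTE nij) ?nji; [exact: wv_iter| |rewrite /n; lia|rewrite /n; lia|].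
  apply: contraNneq nz => e0; have [l hl] := nil_f u ij pij.
  apply/eqP; apply: (sl2_inj _ (esym pij) hl hu _ e0); first by rewrite eq_sym.
  have -> : hwt j i y = - hwt i j y by rewrite /hwt [RHS]opprB.
  by rewrite hwtE // -rmorphN /=; have -> : - (y i - y j - 1) = n%:Z by rewrite /n; lia.
by move=> k /negbTE ki /negbTE kj; rewrite ev ki kj subrr mul0r addr0.
Qed.

End HighestWeightModule.

Section LinearFamilies.
Variables (K : fieldType) (V : lmodType K).

Lemma indep_le d d' (e : 'I_d -> V) (f : 'I_d' -> V) :
  (forall k, exists c : 'rV[K]_d, f k = \sum_b c 0 b *: e b) ->
  (forall c : 'rV[K]_d', \sum_k c 0 k *: f k = 0 -> c = 0) -> (d' <= d)%N.
Proof.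
move=> hs hi; pose A : 'M[K]_(d', d) := \matrix_(k, b) projT1 (cid (hs k)) 0 b.
have hA k : f k = \sum_b A k b *: e b.
  by rewrite {1}(projT2 (cid (hs k))); apply: eq_bigr => b _; rewrite mxE.
rewrite leqNgt; apply/negP => lt.
have kz : kermx A = 0.
  apply/row_matrixP => r; rewrite row0; apply: hi.
  under eq_bigr => k _ do rewrite hA scaler_sumr.
  rewrite exchange_big big1 // => b _ /=; under eq_bigr => k _ do rewrite scalerA.
  rewrite -scaler_suml; have := mulmx_ker A => /matrixP/(_ r b); rewrite !mxE => h.
  by rewrite -[X in X *: _](_ : 0 = _) ?scale0r // -[LHS]h; apply: eq_bigr => k _; rewrite !mxE.
have := mxrank_ker A; rewrite kz mxrank0 => h; have := rank_leq_col A; lia.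
Qed.
End LinearFamilies.

(** * Finite dimensionality and passage to matrices *)

Section Coordinates.
Variables (K : numFieldType) (N : nat) (par : 'I_N -> bool) (mm : nat).
Hypothesis hpar : forall k : 'I_N, par k = (mm <= k)%N.
Local Notation wt := (wt N).
Variables (V : lmodType K) (T : 'I_N -> 'I_N -> V -> V) (ga : V -> V).
Hypothesis TL : forall i j a x y, T i j (a *: x + y) = a *: T i j x + T i j y.
Hypothesis TR : forall i j k l u, T k l (T i j u) = sgn4 K par i j k l *: T i j (T k l u) +
  ((j == k)%:R *: T i l u - sgn4 K par i j k l *: ((i == l)%:R *: T k j u)).
Hypothesis gaL : forall a x y, ga (a *: x + y) = a *: ga x + ga y.
Hypothesis gaK : forall x, ga (ga x) = x.
Hypothesis gaT : forall i j x, ga (T i j x) = (-1) ^+ (par i (+) par j) *: T i j (ga x).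
Hypothesis simp : forall P : V -> Prop, lin P -> (forall i j x, P x -> P (T i j x)) -> (forall x, P x -> P (ga x)) ->
  (exists2 x, P x & x != 0) -> forall u, P u.
Variables (v : V) (z : wt).
Hypotheses (v0 : v != 0) (vg : ga v = v \/ ga v = - v) (vs : sing T v) (vz : wv par T z v) (dz : dominant par z).
Local Notation wv := (wv par T).
Local Notation sums := (sums par T).

Let Vl u (P : V -> Prop) := @Vlow K N par V T ga TL TR gaL gaT simp v z v0 vg vs vz u P.

(** The span of the products of [r] odd lowering operators applied to arbitrary vectors. *)
Fixpoint O r (u : V) : Prop := if r is r'.+1 then forall P : V -> Prop, lin P ->
  (forall p q w, ~~ par p -> par q -> O r' w -> P (T p q w)) -> P u else True.

Lemma O_lin r : lin (O r).
Proof.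
case: r => [|r]; first by split.
split=> [P hP _|a x y hx hy P hP h]; first by case: hP.
by apply: (proj2 hP); [apply: hx|apply: hy].
Qed.

Lemma O_odd r p q w : ~~ par p -> par q -> O r w -> O r.+1 (T p q w).
Proof. by move=> hp hq hw P hP; apply. Qed.

Lemma O_even r k l u : par k = par l -> O r u -> O r (T k l u).
Proof.
move=> kl; elim: r u => [//|r IH] u hu.
refine (hu (fun u => O r.+1 (T k l u)) _ _).
  have hl := O_lin r.+1; split=> [|a x y hx hy]; first by rewrite (T0 TL); apply: (proj1 hl).
  by rewrite TL; apply: (proj2 hl).
move=> p q w hp hq hw; have hl := O_lin r.+1.
have s1 : sgn4 K par p q k l = 1 by rewrite /sgn4 kl addbb andbF.
rewrite TR s1 !scale1r; apply: (linD hl); first by apply: O_odd => //; apply: IH.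
apply: (linB hl).
  have [e|_] := eqVneq q k; last by rewrite scale0r; apply: (proj1 hl).
  by rewrite scale1r; apply: O_odd => //; rewrite -kl -e.
have [e|_] := eqVneq p l; last by rewrite scale0r; apply: (proj1 hl).
by rewrite scale1r; apply: O_odd => //; rewrite kl -e.
Qed.

Definition run (s : seq ('I_N * 'I_N)) (w : V) : V := foldr (fun p x => T p.1 p.2 x) w s.
Definition oddp (p : 'I_N * 'I_N) := ~~ par p.1 && par p.2.

Lemma O_run r u : O r u -> forall P : V -> Prop, lin P -> (forall s w, size s = r -> all oddp s -> P (run s w)) -> P u.
Proof.
elim: r u => [|r IH] u hu P hP h; first exact: (h [::] u).
apply: hu => // p q w hp hq hw.
apply: (IH w hw (fun w => P (T p q w))).
  split=> [|a x y hx hy]; first by rewrite (T0 TL); apply: (proj1 hP).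
  by rewrite TL; apply: (proj2 hP).
by move=> s w' hs ha; apply: (h ((p, q) :: s)); rewrite /= ?hs // /oddp /= hp hq.
Qed.

Lemma anti a b w : oddp a -> oddp b -> T a.1 a.2 (T b.1 b.2 w) = - T b.1 b.2 (T a.1 a.2 w).
Proof.
case: a b => [p q] [p' q'] /andP[/= hp hq] /andP[/= hp' hq'].
have ne x y : ~~ par x -> par y -> (x == y) = false by move=> hx hy; apply: contraNF hx => /eqP->.
rewrite TR /sgn4 (negbTE hp) (negbTE hp') hq hq' /= [q' == p]eq_sym !ne // !scale0r !scaler0 subrr addr0 expr1.
by rewrite scaleN1r.
Qed.

Lemma run_in a s w : oddp a -> all oddp s -> a \in s -> T a.1 a.2 (run s w) = 0.
Proof.
move=> ha; elim: s => //= b s IH /andP[hb hs]; rewrite inE => h; have := anti (run s w) ha hb.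
move: h; have [<- _ h|_ /= h ->] := eqVneq a b; last by rewrite IH // (T0 TL) oppr0.
have : T a.1 a.2 (T a.1 a.2 (run s w)) *+ 2 = 0 by rewrite mulr2n {1}h addNr.
by rewrite -scaler_nat => /eqP; rewrite scaler_eq0 pnatr_eq0 /= => /eqP.
Qed.

Lemma run_nuniq s w : all oddp s -> ~~ uniq s -> run s w = 0.
Proof.
elim: s => //= a s IH /andP[ha hs]; rewrite negb_and negbK => /orP[h|h]; first exact: run_in.
by rewrite IH // (T0 TL).
Qed.

(** Odd lowering operators anticommute and square to zero, so a word with a repeated letter
    vanishes, and there are at most [N * N] letters. *)
Lemma O_bound r u : (N * N < r)%N -> O r u -> u = 0.
Proof.
move=> hr hu; apply: (O_run hu (P := fun u => u = 0)).
  by split=> // a x y -> ->; rewrite scaler0 addr0.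
move=> s w hs ha; apply: run_nuniq => //; apply/negP => us.
have := max_card (mem s); rewrite (card_uniqP us) card_prod !card_ord hs; move: hr; clear; lia.
Qed.

Lemma psum_move k y (i j : 'I_N) : (i < j)%N -> psum k (y + (eps j - eps i)) = psum k y - (nat_of_bool (i < k <= j)%N)%:Z.
Proof.
move=> ij; rewrite -[eps j - eps i]opprB -/(root i j) psumD psumN psum_root //.
by case: (i < k <= j)%N.
Qed.

(** Among the lowering operators only odd ones change [psum mm], by one each, and [O_bound] limits
    their number. *)
Lemma wt_low y u : wv y u -> u != 0 ->
  psum N y = psum N z /\ psum mm z - (N * N)%N%:Z <= psum mm y.
Proof.
move=> hu nz; pose Q (y : wt) u := psum N y = psum N z /\
  (u = 0 \/ exists r, [/\ (r <= N * N)%N, O r u & psum mm z - r%:Z <= psum mm y]).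
have hs : sums Q u.
  apply: (Vl u (P := sums Q)).
  - apply: (sums_lin par TL) => w a x [h1 h2]; split=> //; case: h2 => [->|[r [r1 r2 r3]]]; first by left; rewrite scaler0.
    by right; exists r; split=> //; apply: (linZ (O_lin r)).
  - by apply: sums1 vz _; split=> //; right; exists 0%N; split=> //; rewrite subr0.
  move=> i j w ij; apply: (sums_T TL TR) => y' u' hw [h1 h2]; split.
    rewrite psum_move // h1; have := ltn_ord j; case h: (i < N <= j)%N => /= jN; last by rewrite subr0.
    by move: h jN; clear; lia.
  case: h2 => [->|[r [r1 r2 r3]]]; first by left; rewrite (T0 TL).
  rewrite psum_move //; have [pij|pij] := eqVneq (par i) (par j).
    right; exists r; split=> //; first exact: O_even.
    have -> : (i < mm <= j)%N = false by move: pij; rewrite !hpar; lia.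
    by rewrite subr0.
  have hi : ~~ par i by move: pij; rewrite !hpar; lia.
  have hj : par j by move: pij; rewrite !hpar; lia.
  have [le|gt] := leqP r.+1 (N * N); last by left; apply: (O_bound gt); apply: O_odd.
  right; exists r.+1; split=> //; first exact: O_odd.
  by case: (_ <= _)%N => /=; move: r3; clear; lia.
have [w [[h1 h2] wnz]] := sums_wt TL (sums_nz hs) hu nz; split=> //.
by case: h2 => [e|[r [r1 _ r3]]]; [rewrite e eqxx in wnz|move: r1 r3; clear; lia].
Qed.

Lemma sum_le_const (P : pred 'I_N) (F : 'I_N -> int) c : 0 <= c -> (forall i, P i -> F i <= c) ->
  \sum_(i | P i) F i <= c *+ N.
Proof.
move=> c0 h; rewrite -[X in _ <= _ *+ X](card_ord N) -sumr_const big_mkcond; apply: ler_sum => i _.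
by case: ifP => // /h.
Qed.

(** The first coordinate is at most [psum 1 z], and reflections spread this bound over the
    epsilon-coordinates; dually, the last coordinate bounds the delta-coordinates from below. The
    opposite bounds come from the two block sums, controlled by [wt_low]. *)
Lemma wt_bound : exists B : nat, forall y u, wv y u -> u != 0 -> forall k, `|y k| <= B%:Z.
Proof.
have ps0 (y : wt) : psum 0 y = 0 by rewrite /psum big_pred0.
have wp y u k : wv y u -> u != 0 -> psum k y <= psum k z by apply: (wt_psum TL TR gaL gaT simp v0 vg vs vz).
have hE n : forall y u (k : 'I_N), wv y u -> u != 0 -> k = n :> nat -> ~~ par k -> y k <= psum 1 z.
  elim: n => [|n IH] y u k hu nz kn pk.
    by have := psum_succ k y; rewrite kn ps0 add0r => <-; apply: wp hu nz.
  have ln : (n < N)%N by have := ltn_ord k; lia.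
  have pi : ~~ par (Ordinal ln) by move: pk; rewrite !hpar kn /=; lia.
  have [y' [u' [h1 h2 h3 _ _]]] := wt_swap TL TR gaL gaT simp v0 vg vs vz dz (i := Ordinal ln) (j := k) kn
    (etrans (negbTE pi) (esym (negbTE pk))) hu nz.
  by have := IH y' u' (Ordinal ln) h1 h2 erefl pi; rewrite h3; lia.
have hD n : forall y u (k : 'I_N), wv y u -> u != 0 -> (k + n).+1 = N -> par k -> psum N z - psum N.-1 z <= y k.
  elim: n => [|n IH] y u k hu nz kn pk.
    have kN : k.+1 = N by move: kn; clear; lia.
    have := psum_succ k y; rewrite kN (proj1 (wt_low hu nz)) => e; have := wp y u k hu nz.
    have -> : psum N.-1 z = psum k z by congr psum; lia.
    by move: e; lia.
  have ln : (k.+1 < N)%N by lia.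
  have pj : par (Ordinal ln) by move: pk; rewrite !hpar /=; lia.
  have [y' [u' [h1 h2 _ h3 _]]] := wt_swap TL TR gaL gaT simp v0 vg vs vz dz (i := k) (j := Ordinal ln) erefl
    (etrans pk (esym pj)) hu nz.
  have kn' : ((Ordinal ln : nat) + n).+1 = N by rewrite /=; lia.
  by have := IH y' u' (Ordinal ln) h1 h2 kn' pj; rewrite h3; lia.
pose c := `|psum 1 z|; pose d := `|psum N z - psum N.-1 z|; pose t := c *+ N; pose t' := d *+ N.
exists (absz c + absz d + absz t + absz t' + absz (psum mm z) + absz (psum N z) + N * N)%N => y u hu nz k.
have [e1 e2] := wt_low hu nz.
have hE' i : ~~ par i -> y i <= c by move=> hi; have := hE i y u i hu nz erefl hi; rewrite /c; lia.
have hD' i : par i -> - y i <= d.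
  move=> hi; have := hD (N - i.+1)%N y u i hu nz _ hi; have := ltn_ord i; rewrite /d => lt h.
  by have := h ltac:(lia); lia.
have c0 : 0 <= c by []. have d0 : 0 <= d by [].
have sm : psum mm y = \sum_(i | ~~ par i) y i.
  by apply: eq_bigl => i; rewrite hpar ltnNge.
have sN : psum N y = psum mm y + \sum_(i | par i) y i.
  rewrite sm /psum [LHS](bigID par) /= addrC; congr (_ + _); apply: eq_bigl => i; rewrite ltn_ord //.
have [pk|pk] := boolP (par k).
  have := hD' k pk; have : - \sum_(i | par i && (i != k)) y i <= t'.
    by rewrite -sumrN; apply: sum_le_const => // i /andP[hi _]; apply: hD'.
  have : \sum_(i | par i) y i = y k + \sum_(i | par i && (i != k)) y i by rewrite (bigD1 k).
  by move: e1 e2 sN; clear; lia.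
have := hE' k pk; have : \sum_(i | ~~ par i && (i != k)) y i <= t.
  by apply: sum_le_const => // i /andP[hi _]; apply: hE'.
have : \sum_(i | ~~ par i) y i = y k + \sum_(i | ~~ par i && (i != k)) y i by rewrite (bigD1 k).
by move: e1 e2 sm; clear; lia.
Qed.

Definition ht (y : wt) : int := \sum_(k < N) psum k.+1 y.

Lemma ht_move y (i j : 'I_N) : (i < j)%N -> ht (y + (eps j - eps i)) <= ht y - 1.
Proof.
move=> ij; rewrite /ht (bigD1 i) //= [X in _ <= X - _](bigD1 i) //= psum_move // ltnSn ij /=.
have : \sum_(k < N | k != i) psum k.+1 (y + (eps j - eps i)) <= \sum_(k < N | k != i) psum k.+1 y.
  by apply: ler_sum => k _; rewrite psum_move //; case: (i < k.+1 <= j)%N => /=; lia.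
by move=> h; rewrite [X in _ <= X]addrAC; apply: lerD.
Qed.

(** The lowering words of length [n] applied to [v], with their weights. Each letter lowers [ht] by
    at least one. *)
Fixpoint lev n : seq (wt * V) := if n is n'.+1 then
  [seq (p.1 + (eps q.2 - eps q.1), T q.1 q.2 p.2) | p <- lev n', q <- [seq q : 'I_N * 'I_N <- enum {: 'I_N * 'I_N} | (q.1 < q.2)%N]]
  else [:: (z, v)].

Lemma levP n p : p \in lev n -> wv p.1 p.2 /\ ht p.1 <= ht z - n%:Z.
Proof.
elim: n p => [|n IH] p /=; first by rewrite inE => /eqP->; rewrite subr0.
case/allpairsP=> [[r q]] /= [hr hq ->] /=; have [h1 h2] := IH r hr; split; first exact: (wv_T TL TR).
by move: hq; rewrite mem_filter => /andP[lt _]; apply: le_trans (ht_move r.1 lt) _; move: h2; clear; lia.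
Qed.

Lemma lin_sum (P : V -> Prop) I (r : seq I) (F : I -> V) : lin P -> (forall i, P (F i)) -> P (\sum_(i <- r) F i).
Proof. by move=> hP h; elim/big_rec: _ => [|i x _ hx]; [case: hP|apply: (linD hP)]. Qed.

Lemma T_sum i j I (r : seq I) (F : I -> V) : T i j (\sum_(k <- r) F k) = \sum_(k <- r) T i j (F k).
Proof. by elim: r => [|k r IH]; rewrite ?big_nil ?(T0 TL) // !big_cons (TD TL) IH. Qed.

Definition spans d (lb : 'I_d -> wt) (e : 'I_d -> V) := (forall b, wv (lb b) (e b)) /\
  forall u, exists c : 'rV[K]_d, u = \sum_b c 0 b *: e b.

Lemma fin_span : exists d (lb : 'I_d -> wt) (e : 'I_d -> V), spans lb e.
Proof.
have [B hB] := wt_bound.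
(* No weight has [ht] below [- N * N * B], so every word of length at least [H] gives zero. *)
pose H := (absz (ht z) + N * N * B + 1)%N; pose L := flatten [seq lev n | n <- iota 0 H].
have htB y u : wv y u -> u != 0 -> - (N * N * B)%N%:Z <= ht y.
  move=> hu nz; have pb k : - psum k y <= B%:Z *+ N.
    rewrite /psum -sumrN; apply: sum_le_const => // i _; have := hB y u hu nz i; lia.
  have : - ht y <= (B%:Z *+ N) *+ N.
    by rewrite /ht -sumrN; apply: sum_le_const => [|i _]; [apply: mulrn_wge0|apply: pb].
  rewrite -mulrnA -mulr_natr natz; lia.
have Lw p : p \in L -> wv p.1 p.2 by case/flatten_mapP => n _ /levP[].
pose e (b : 'I_(size L)) := (nth (0, 0) L b).2.
exists (size L), (fun b => (nth (0, 0) L b).1), e; split=> [b|u]; first exact: Lw (mem_nth _ (ltn_ord b)).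
pose Sp w := exists c : 'rV[K]_(size L), w = \sum_b c 0 b *: e b.
have hl : lin Sp.
  split=> [|a x y [c ->] [c' ->]]; first by exists 0; rewrite big1 // => b _; rewrite mxE scale0r.
  exists (a *: c + c'); rewrite scaler_sumr -big_split; apply: eq_bigr => b _.
  by rewrite !mxE scalerDl scalerA.
have Lin p : p \in L -> Sp p.2.
  move=> /(nthP (0, 0))[k hk <-]; exists (delta_mx 0 (Ordinal hk)).
  rewrite (bigD1 (Ordinal hk)) //= mxE !eqxx scale1r big1 ?addr0 // => b /negbTE nb.
  by rewrite mxE nb andbF scale0r.
apply: (Vl u (P := Sp) hl); first by apply: (Lin (z, v)); apply/flatten_mapP; exists 0%N; [rewrite mem_iota /H; clear; lia|rewrite inE].
move=> i j y ij [c ->]; rewrite T_sum; apply: lin_sum => // b; rewrite (TZ TL); apply: (linZ hl).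
have /flatten_mapP[n] := mem_nth (0, 0) (ltn_ord b); rewrite mem_iota => /andP[_ hn] hb.
have hb' : (nth (0, 0) L b).1 + (eps j - eps i) = ((nth (0, 0) L b).1 + (eps j - eps i)) by [].
have inl : ((nth (0, 0) L b).1 + (eps j - eps i), T i j (e b)) \in lev n.+1.
  apply/allpairsP; exists (nth (0, 0) L b, (i, j)); split=> //=.
  by rewrite mem_filter ij mem_enum.
have [lt|ge] := ltnP n.+1 H.
  by apply: (Lin ((nth (0, 0) L b).1 + (eps j - eps i), T i j (e b))); apply/flatten_mapP; exists n.+1 => //; rewrite mem_iota.
have [h1 h2] := levP inl; have [->|nz] := eqVneq (T i j (e b)) 0; first by case: hl.
have := htB _ _ h1 nz; move: h2 ge; rewrite /H /=; lia.
Qed.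

Lemma fin_basis : exists d (lb : 'I_d -> wt) (e : 'I_d -> V), spans lb e /\
  forall c : 'rV[K]_d, \sum_b c 0 b *: e b = 0 -> c = 0.
Proof.
have [d0 hd0] := fin_span.
have ex : exists d, `[< exists (lb : 'I_d -> wt) (e : 'I_d -> V), spans lb e >] by exists d0; apply/asboolP.
case: (ex_minnP ex) => d /asboolP[lb [e hs]] hmin; exists d, lb, e; split=> // c hc.
apply/rowP => k; rewrite mxE; apply/eqP/negPn/negP => ck.
case: d lb e hs hmin c hc k ck => [|d] lb e [hw hs] hmin c hc k ck; first by case: k {ck}.
suff : (d.+1 <= d)%N by rewrite ltnn.
apply: hmin; apply/asboolP; exists (fun b => lb (lift k b)), (fun b => e (lift k b)); split=> [b|u]; first exact: hw.
have [c' ->] := hs u; exists (\row_b (c' 0 (lift k b) - c' 0 k / c 0 k * c 0 (lift k b))).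
move: hc; rewrite (bigD1_ord k) //= => hc.
under [RHS]eq_bigr => b _ do rewrite mxE scalerBl -scalerA.
rewrite sumrB -scaler_sumr [LHS](bigD1_ord k) //= addrC; congr (_ + _).
have -> : \sum_(i < d) c 0 (lift k i) *: e (lift k i) = - (c 0 k *: e k) by apply/eqP; rewrite -addr_eq0 addrC hc.
by rewrite scalerN opprK scalerA divfK.
Qed.

Section Basis.
Variables (d : nat) (lb : 'I_d -> wt) (e : 'I_d -> V).
Hypothesis hs : spans lb e.
Hypothesis hi : forall c : 'rV[K]_d, \sum_b c 0 b *: e b = 0 -> c = 0.

Definition vec (x : 'rV[K]_d) : V := \sum_b x 0 b *: e b.
Definition co (u : V) : 'rV[K]_d := projT1 (cid (proj2 hs u)).

Lemma vec_lin a x y : vec (a *: x + y) = a *: vec x + vec y.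
Proof.
rewrite /vec scaler_sumr -big_split; apply: eq_bigr => b _.
by rewrite !mxE scalerDl scalerA.
Qed.
Lemma vecZ a x : vec (a *: x) = a *: vec x.
Proof.
by rewrite /vec scaler_sumr; apply: eq_bigr => b _; rewrite !mxE scalerA.
Qed.
Lemma vecD x y : vec (x + y) = vec x + vec y.
Proof. by rewrite -[x]scale1r vec_lin !scale1r. Qed.
Lemma vecB x y : vec (x - y) = vec x - vec y.
Proof. by rewrite vecD -[- y]scaleN1r vecZ scaleN1r. Qed.
Lemma vec_inj : injective vec.
Proof. by move=> x y h; apply/eqP; rewrite -subr_eq0; apply/eqP/hi; rewrite -/(vec _) vecB h subrr. Qed.
Lemma coK : cancel co vec.
Proof. by move=> u; rewrite /vec -(projT2 (cid (proj2 hs u))). Qed.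
Lemma vecK : cancel vec co.
Proof. by move=> x; apply: vec_inj; rewrite coK. Qed.
Lemma co_lin a x y : co (a *: x + y) = a *: co x + co y.
Proof. by apply: vec_inj; rewrite vec_lin !coK. Qed.

Definition Tm i j : 'M[K]_d := \matrix_(b, c) co (T i j (e b)) 0 c.

Lemma vec_Tm i j x : vec (x *m Tm i j) = T i j (vec x).
Proof.
rewrite {1}/vec /vec T_sum; under [RHS]eq_bigr => b _ do rewrite (TZ TL) -[T i j (e b)]coK /vec scaler_sumr.
rewrite exchange_big; apply: eq_bigr => c _; rewrite mxE scaler_suml; apply: eq_bigr => b _.
by rewrite mxE scalerA.
Qed.

Lemma mx_vec (A B : 'M[K]_d) : (forall x, vec (x *m A) = vec (x *m B)) -> A = B.
Proof. by move=> h; apply/row_matrixP => b; rewrite !rowE; apply: vec_inj. Qed.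

Lemma Tm_rel : bracket_rel par Tm.
Proof.
move=> i j k l; apply: mx_vec => x; rewrite mulmxDr mulmxBr -!scalemxAr !mulmxA vecD vecB !vecZ !vec_Tm TR.
by [].
Qed.

Lemma Tm_diag i : Tm i i = diag_mx (\row_b ((lb b i)%:~R - rr K par i)).
Proof.
apply: mx_vec => x; rewrite vec_Tm /vec T_sum; apply: eq_bigr => b _.
by rewrite (TZ TL) (proj1 hs b) mul_mx_diag !mxE scalerA.
Qed.

Definition Mrep : srep K par := SRep Tm_rel Tm_diag.

Lemma co_supp y u b : wv y u -> co u 0 b != 0 -> lb b = y.
Proof.
move=> hu nz; apply/ffunP => i; have := hu i; rewrite -{1}[u]coK -vec_Tm -{2}[u]coK -vecZ => /vec_inj.
rewrite Tm_diag => /rowP/(_ b); rewrite mul_mx_diag !mxE mulrC => /(mulIf nz)/addIr.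
by move/intr_inj.
Qed.

Lemma wv_vec y (x : 'rV[K]_d) : (forall b, x 0 b != 0 -> lb b = y) -> wv y (vec x).
Proof.
move=> h i; rewrite -vec_Tm -vecZ; congr vec; apply/rowP => b; rewrite Tm_diag mul_mx_diag !mxE mulrC.
by have [->|/h->//] := eqVneq (x 0 b) 0; rewrite !mulr0.
Qed.

Lemma hwm_one : @hwm K N par Mrep 1%:M (co v) z.
Proof.
split; rewrite ?mulmx1 //.
- by move=> i j; rewrite mul1mx mulmx1.
- by apply: contraNneq v0 => h; rewrite -[v]coK h /vec big1 // => b _; rewrite mxE scale0r.
- apply/rowP => b; rewrite mulPm mxE; have [->|nz] := eqVneq (co v 0 b) 0; first by rewrite mul0r.
  by rewrite [lab b](co_supp vz nz) eqxx mulr1.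
- by move=> i j ji; apply: vec_inj; rewrite vec_Tm coK vs // /vec big1 // => b _; rewrite mxE scale0r.
- move=> x y _ hx hr; have hw : wv y (vec x).
    apply: wv_vec => b; apply: contraNeq => nb.
    by have nb' : (@lab K N par Mrep b == y) = false by [exact: negbTE]; rewrite -hx mulPm mxE nb' mulr0.
  have [|c hc] := sing_top TL TR gaL gaK gaT simp v0 vg vs vz hw.
    by move=> i j ji; rewrite -vec_Tm hr // /vec big1 // => b _; rewrite mxE scale0r.
  by exists c; apply: vec_inj; rewrite vecZ coK.
- move=> P hP hv u; rewrite mulmx1 -[u]vecK; apply: (Vl (vec u) (P := fun w => P (co w))) => //.
    split=> [|a x y hx hy]; last by rewrite co_lin; apply: (submodL hP).
    have -> : co 0 = 0 by apply: vec_inj; rewrite coK /vec big1 // => b _; rewrite mxE scale0r.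
    exact: submod0 hP.
  move=> i j y _ hy; have -> : co (T i j y) = co y *m Tm i j by apply: vec_inj; rewrite coK vec_Tm coK.
  exact: (submodY hP).
Qed.

Lemma eig_wt (x : 'I_N -> K) u : u != 0 -> (forall i, T i i u = x i *: u) ->
  exists y : wt, forall i, x i = (y i)%:~R - rr K par i.
Proof.
move=> nz hx; have [b nb] : exists b, co u 0 b != 0.
  apply: contrapT => h; case/eqP: nz; rewrite -[u]coK /vec big1 // => b _.
  by have [->|hb] := eqVneq (co u 0 b) 0; [rewrite scale0r|case: h; exists b].
exists (lb b) => i; have := hx i; rewrite -{1}[u]coK -vec_Tm -{2}[u]coK -vecZ => /vec_inj.
by rewrite Tm_diag => /rowP/(_ b); rewrite mul_mx_diag !mxE mulrC => /(mulIf nb)->.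
Qed.

Definition nd y := #|[pred b | lb b == y]|.
Definition eb y (k : 'I_(nd y)) : V := e (enum_val k).

Lemma eb_wv y k : wv y (@eb y k).
Proof. by move: (enum_valP k); rewrite inE => /eqP h; have := proj1 hs (enum_val k); rewrite h. Qed.

Lemma eb_sum y (x : 'rV[K]_d) : (forall b, x 0 b != 0 -> lb b = y) ->
  vec x = \sum_k x 0 (enum_val k) *: @eb y k.
Proof.
move=> h; rewrite /vec (bigID (fun b => lb b == y)) /= [X in _ + X]big1 ?addr0; last first.
  by move=> b /eqP nb; have [->|/h//] := eqVneq (x 0 b) 0; rewrite scale0r.
by rewrite (big_enum_val (A := [pred b | lb b == y]) (fun b => x 0 b *: e b)).
Qed.

Lemma eb_span y u : wv y u -> exists c : 'rV[K]_(nd y), u = \sum_k c 0 k *: @eb y k.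
Proof.
move=> hu; exists (\row_k co u 0 (enum_val k)); rewrite -{1}[u]coK (eb_sum (y := y)); last first.
  by move=> b; apply: co_supp hu.
by apply: eq_bigr => k _; rewrite mxE.
Qed.

Lemma eb_indep y (c : 'rV[K]_(nd y)) : \sum_k c 0 k *: @eb y k = 0 -> c = 0.
Proof.
move=> hc; pose x : 'rV[K]_d := \row_b \sum_(k | enum_val k == b :> 'I_d) c 0 k.
have xe k : x 0 (enum_val k) = c 0 k.
  by rewrite mxE (bigD1 k) //= big1 ?addr0 // => l /andP[/eqP/enum_val_inj->]; rewrite eqxx.
have x0 : x = 0.
  apply: hi; rewrite -/(vec x) (eb_sum (y := y)).
    by rewrite -[RHS]hc; apply: eq_bigr => k _; rewrite xe.
  move=> b; rewrite mxE; apply: contraNeq => nb; rewrite big_pred0 // => k; apply/negbTE.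
  by apply: contraNneq nb => <-; have := enum_valP k; rewrite inE.
by apply/rowP => k; rewrite -xe x0 !mxE.
Qed.

Lemma nd_le (g : V -> V) (y w : wt) : (forall a x u, g (a *: x + u) = a *: g x + g u) ->
  (forall u, wv y u -> wv w (g u)) -> (forall u, wv y u -> g u = 0 -> u = 0) -> (nd y <= nd w)%N.
Proof.
move=> gL gw gi; have g0 : g 0 = 0 by have := gL (-1) 0 0; rewrite scaler0 addr0 scaleN1r addNr.
apply: (@indep_le K V _ _ (@eb w) (fun k => g (@eb y k))) => [k|c hc]; first exact: eb_span (gw _ (@eb_wv y k)).
apply: eb_indep; apply: gi.
  by apply: (@lin_sum (wv y) _ _ _ (wv_lin par TL y)) => k; apply: (wvZ TL); apply: eb_wv.
rewrite -[RHS]hc; elim: (index_enum _) => [|k r IH]; first by rewrite !big_nil.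
by rewrite !big_cons gL IH.
Qed.

(** A power of [f] or [e] embeds a weight space into the reflected one. Reflection acts on
    rho-shifted labels here, hence the [+ 1] and [- 1]. *)
Lemma nd_swap (i j : 'I_N) (y w : wt) : j = i.+1 :> nat -> par i = par j ->
  w i = y j + 1 -> w j = y i - 1 -> (forall k, k != i -> k != j -> w k = y k) -> (nd y <= nd w)%N.
Proof.
move=> ij pij h1 h2 h3; have nij : i != j by rewrite -val_eqE /= ij; lia.
have nji : (j == i) = false by rewrite eq_sym (negbTE nij).
have ev (a b : 'I_N) n k : (y + (eps b - eps a) *+ n) k = y k + ((k == b)%:R - (k == a)%:R) * n%:Z :> int.
  by rewrite waddE mulrnBl wsubE !epsMnE mulrBl.
have [h|h] := leP 0 (y i - y j - 1).
  pose n := absz (y i - y j - 1)%R.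
  have ew : w = y + (eps j - eps i) *+ n.
    apply/ffunP => k; rewrite ev; have [->|ki] := eqVneq k i; first by rewrite h1 (negbTE nij) /n; lia.
    by have [->|kj] := eqVneq k j; [rewrite h2 /n; lia|rewrite h3 // subrr mul0r addr0].
  apply: (@nd_le (iter n (T i j))) => [a x u|u hu|u hu hn]; first exact: (iter_lin TL).
    by rewrite ew; apply: (wv_iter TL TR).
  have [l hl] := nil_e TL TR gaL gaT simp v0 vg vs vz ij hu.
  apply: (sl2_inj TL TR v0 nij pij hl hu _ hn); rewrite hwtE //.
  by have -> : y i - y j - 1 = n%:Z by rewrite /n; lia.
pose n := absz (y j - y i + 1)%R.
have ew : w = y + (eps i - eps j) *+ n.
  apply/ffunP => k; rewrite ev; have [->|ki] := eqVneq k i; first by rewrite h1 (negbTE nij) /n; lia.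
  by have [->|kj] := eqVneq k j; [rewrite h2 /n; lia|rewrite h3 // subrr mul0r addr0].
apply: (@nd_le (iter n (T j i))) => [a x u|u hu|u hu hn]; first exact: (iter_lin TL).
  by rewrite ew; apply: (wv_iter TL TR).
have [l hl] := nil_f TL TR gaL gaT simp v0 vg vs vz dz u ij pij.
have nij' : j != i by rewrite nji.
apply: (sl2_inj TL TR v0 nij' (esym pij) hl hu _ hn).
have -> : hwt K par j i y = - hwt K par i j y by rewrite /hwt [RHS]opprB.
by rewrite hwtE // -rmorphN /=; have -> : - (y i - y j - 1) = n%:Z by rewrite /n; lia.
Qed.

Lemma chi_nd y : @chi K N par Mrep 1%:M y = (nd y)%:R.
Proof.
rewrite chiE mul1mx /mxtrace /nd -sum1_card natr_sum [RHS]big_mkcond /=; apply: eq_bigr => b _.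
by rewrite /Pm !mxE eqxx mulr1n inE /=; case: (lb b == y).
Qed.

Lemma Dser_asym : asym par (fun y => @Dser K N par Mrep 1%:M y).
Proof.
apply: asym_adj => [i j ij pi|i j y ij pij]; first by move: pi; rewrite !hpar; lia.
have nij : (j == i) = false by apply/eqP => ji; move: ij; rewrite ji; lia.
rewrite -[act _ y]/(swap i j y); apply: opR_antisym => // {}y; rewrite !chi_nd; congr (_%:R).
have sE k : swap i j y k = y (tperm i j k) by rewrite ffunE.
have rE k : (y + root i j) k = y k + (k == i)%:R - (k == j)%:R :> int by rewrite waddE wsubE !epsE addrA.
have nji : (i == j) = false by rewrite eq_sym.
apply/eqP; rewrite eqn_leq; apply/andP; split; apply: (nd_swap ij pij) => [||k ki kj].
- by rewrite rE sE tpermR eqxx nji subr0.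
- by rewrite rE sE tpermL eqxx nij addr0.
- by rewrite rE sE (negbTE ki) (negbTE kj) subr0 addr0 tpermD // eq_sym.
- by rewrite rE sE tpermL eqxx nij addr0 subrK.
- by rewrite rE sE tpermR eqxx nji subr0 addrK.
- by rewrite rE sE (negbTE ki) (negbTE kj) subr0 addr0 tpermD // eq_sym.
Qed.
End Basis.

Theorem highest_weight_character : exists f : bser K N,
  [/\ @hwd K N par (fun y : wt => opR K par f y) z, @asym K N par (fun y : wt => opR K par f y),
   forall y : wt, exists d (e : 'I_d -> V), [/\ f y = d%:R, forall k, wv y (e k),
     forall u, wv y u -> exists c : 'rV[K]_d, u = \sum_k c 0 k *: e k
     & forall c : 'rV[K]_d, \sum_k c 0 k *: e k = 0 -> c = 0],
   forall (x : 'I_N -> K) u, u != 0 -> (forall i, T i i u = x i *: u) ->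
     exists y : wt, forall i, x i = (y i)%:~R - rr K par i
   & exists s : seq wt, forall y : wt, f y != 0 -> y \in s].
Proof.
have [d [lb [e [hs hi]]]] := fin_basis.
exists (@chi K N par (Mrep hs hi) 1%:M); split.
- by exists (Mrep hs hi), 1%:M, (co hs v); split=> //; apply: hwm_one.
- exact: Dser_asym.
- move=> y; exists (nd lb y), (@eb d lb e y); split; [exact: chi_nd|exact: eb_wv|exact: eb_span|exact: eb_indep].
- exact: eig_wt hs hi.
exists (codom lb) => y; rewrite chi_nd pnatr_eq0 -lt0n => /card_gt0P[b]; rewrite inE => /eqP <-.
exact: codom_f.
Qed.

End Coordinates.

From mathcomp Require Import cardinality fsbigop.
From mathcomp Require Import finmap reals complex.
Local Open Scope classical_set_scope.
Local Open Scope ring_scope.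

(** * Comparison with the formal series of the statement *)

Section Embedding.
Variables (R : realType) (m n : nat).
Local Notation C := R[i].
Local Notation N := (m + n)%N.
Local Notation wt := (Submission.wt N).

Definition oddpar (k : 'I_N) : bool := (m <= k)%N.
Definition iw (y : wt) : 'rV[C]_N := \row_k (y k)%:~R.
Definition wtab (a : 'I_m -> int) (b : 'I_n -> int) : wt :=
  [ffun k : 'I_N => match fintype.split k with inl p => a p | inr q => - b q end].

Lemma iw_inj : injective iw.
Proof. by move=> x y /rowP h; apply/ffunP => k; have := h k; rewrite !mxE => /intr_inj. Qed.
Lemma iwD x y : iw (x + y) = iw x + iw y.
Proof. by apply/rowP => k; rewrite !mxE ffunE rmorphD. Qed.
Lemma iwN x : iw (- x) = - iw x.
Proof. by apply/rowP => k; rewrite !mxE ffunE rmorphN. Qed.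
Lemma iwB x y : iw (x - y) = iw x - iw y. Proof. by rewrite iwD iwN. Qed.
Lemma iwMn x k : iw (x *+ k) = iw x *+ k.
Proof. by elim: k => [|k IH]; [apply/rowP => l; rewrite !mxE !ffunE|rewrite !mulrS iwD IH]. Qed.
Lemma iw_eps k : iw (Submission.eps k) = delta_mx 0 k.
Proof. by apply/rowP => l; rewrite !mxE ffunE eqxx; case: eqP. Qed.

Lemma wtab_l a b p : wtab a b (lshift n p) = a p :> int.
Proof. by rewrite ffunE (fintype.unsplitK (inl p)). Qed.
Lemma wtab_r a b q : wtab a b (rshift m q) = - b q :> int.
Proof. by rewrite ffunE (fintype.unsplitK (inr q)). Qed.

Lemma par_l p : oddpar (lshift n p) = false. Proof. by rewrite /oddpar /= leqNgt ltn_ord. Qed.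
Lemma par_r q : oddpar (rshift m q) = true. Proof. by rewrite /oddpar /= leq_addr. Qed.

Lemma weight_ofE a b : weight_of R a b = iw (wtab a b).
Proof.
apply/rowP => k; rewrite /weight_of !mxE !summxE -(fintype.splitK k); case: (fintype.split k) => x /=.
  rewrite wtab_l (bigD1 x) //= big1 => [|i /negbTE ix]; last first.
    by rewrite !mxE /= (inj_eq (@lshift_inj m n)) eq_sym ix mulr0.
  rewrite big1 ?subr0 ?addr0 => [|j _]; last by rewrite !mxE /= eq_lrshift mulr0.
  by rewrite !mxE !eqxx mulr1.
rewrite wtab_r big1 => [|i _]; last by rewrite !mxE /= eq_rlshift mulr0.
rewrite (bigD1 x) //= big1 => [|i /negbTE ix]; last first.
  by rewrite !mxE /= (inj_eq (@rshift_inj m n)) eq_sym ix mulr0.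
by rewrite !mxE !eqxx mulr1 addr0 sub0r rmorphN.
Qed.

Lemma sum_pairs d (x : 'I_d) :
  \sum_(p : 'I_d * 'I_d | (p.1 < p.2)%N) ((x == p.1)%:R - (x == p.2)%:R) =
  (\sum_(j < d | (x < j)%N) 1) - \sum_(j < d | (j < x)%N) 1 :> C.
Proof.
rewrite -(pair_big_dep xpredT (fun i j : 'I_d => (i < j)%N) (fun i j => (x == i)%:R - (x == j)%:R)) /=.
under eq_bigr => i _ do rewrite sumrB.
rewrite sumrB; congr (_ - _).
  rewrite (bigD1 x) //= [X in _ + X]big1 ?addr0 => [|i /negbTE xi]; last by rewrite big1 // => j _; rewrite eq_sym xi.
  by apply: eq_bigr => j _; rewrite eqxx.
rewrite (exchange_big_dep xpredT) //= (bigD1 x) //= [X in _ + X]big1 ?addr0 => [|i /negbTE xi].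
  by apply: eq_bigr => j _; rewrite eqxx.
by rewrite big1 // => j _; rewrite eq_sym xi.
Qed.

Lemma rhoE k : rho R m n 0 k = rr C oddpar k.
Proof.
have ev : (\sum_(al <- even_pos_roots R m n) al) 0 k =
  \sum_(p : 'I_m * 'I_m | (p.1 < p.2)%N) ((k == lshift n p.1)%:R - (k == lshift n p.2)%:R) +
  \sum_(p : 'I_n * 'I_n | (p.1 < p.2)%N) ((k == rshift m p.1)%:R - (k == rshift m p.2)%:R).
  rewrite /even_pos_roots big_cat /= !big_map !big_filter !big_enum_cond mxE !summxE.
  by congr (_ + _); apply: eq_bigr => p _; rewrite !mxE /=.
have od : (\sum_(al <- odd_pos_roots R m n) al) 0 k =
  \sum_(p < m) \sum_(q < n) ((k == lshift n p)%:R - (k == rshift m q)%:R).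
  rewrite /odd_pos_roots big_map big_enum summxE pair_big /=.
  by apply: eq_bigr => p _; rewrite !mxE /=.
have c1 (t : nat) : (\sum_(j < t) 1 : C) = t%:R by rewrite sumr_const card_ord.
rewrite /rho !mxE ev od /rr !big_split_ord /= -(fintype.splitK k); case: (fintype.split k) => x /=.
  under eq_bigr => p _ do rewrite !(inj_eq (@lshift_inj m n)).
  rewrite sum_pairs [X in _ * (_ + X)]big1 => [|p _]; last by rewrite !eq_lrshift subrr.
  have -> : \sum_(p < m) \sum_(q < n) ((lshift n x == lshift n p)%:R - (lshift n x == rshift m q)%:R) = n%:R :> C.
    rewrite (bigD1 x) //= [X in _ + X]big1 ?addr0 => [|i /negbTE xi].
      by rewrite -[RHS]c1; apply: eq_bigr => j _; rewrite eqxx eq_lrshift subr0.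
    by rewrite big1 // => j _; rewrite (inj_eq (@lshift_inj m n)) eq_sym xi eq_lrshift subr0.
  have s1 (P : pred 'I_m) : \sum_(j < m | P j) (-1) ^+ oddpar (lshift n j) = \sum_(j < m | P j) 1 :> C.
    by apply: eq_bigr => j _; rewrite par_l.
  rewrite !s1 par_l expr0 mul1r.
  have -> : \sum_(j < n | (x < m + j)%N) (-1) ^+ oddpar (rshift m j) = - n%:R :> C.
    rewrite -[in RHS]c1 -sumrN; apply: eq_big => j; first by rewrite ltn_addr.
    by rewrite par_r.
  rewrite [X in _ - (_ + X)]big_pred0 => [|j]; last by apply/negbTE; rewrite -leqNgt ltnW // ltn_addr.
  by field.
rewrite big1 => [|p _]; last by rewrite !eq_rlshift subrr.
under eq_bigr => p _ do rewrite !(inj_eq (@rshift_inj m n)).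
rewrite sum_pairs.
have -> : \sum_(p < m) \sum_(q < n) ((rshift m x == lshift n p)%:R - (rshift m x == rshift m q)%:R) = - m%:R :> C.
  rewrite -[in RHS]c1 -sumrN; apply: eq_bigr => p _; rewrite (bigD1 x) //= big1 ?addr0 => [|i /negbTE xi].
    by rewrite eqxx eq_rlshift sub0r.
  by rewrite (inj_eq (@rshift_inj m n)) [x == i]eq_sym xi eq_rlshift subr0.
have s1 (P : pred 'I_n) : \sum_(j < n | P j) (-1) ^+ oddpar (rshift m j) = - \sum_(j < n | P j) 1 :> C.
  by rewrite -sumrN; apply: eq_bigr => j _; rewrite par_r.
rewrite !s1 par_r expr1 big_pred0 => [|j]; last by apply/negbTE; rewrite -leqNgt ltnW // ltn_addr.
have -> : \sum_(j < m | (j < m + x)%N) (-1) ^+ oddpar (lshift n j) = m%:R :> C.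
  by rewrite -[in RHS]c1; apply: eq_big => j; [rewrite ltn_addr|rewrite par_l].
under [in RHS]eq_bigl => j do rewrite ltn_add2l.
under [X in _ - (_ - X)]eq_bigl => j do rewrite ltn_add2l.
by field.
Qed.

Lemma iw_rho y i : (iw y - rho R m n) 0 i = (y i)%:~R - rr C oddpar i.
Proof. by rewrite -rhoE; move: (rho R m n) => r; rewrite !mxE. Qed.

Lemma iw_rhoP y mu : (mu = iw y - rho R m n) <-> (forall i, mu 0 i = (y i)%:~R - rr C oddpar i).
Proof.
split=> [-> i|h]; first exact: iw_rho.
by apply/rowP => i; rewrite iw_rho h.
Qed.
End Embedding.

(** * The given supermodule as a family of operators with a parity involution *)

Section ConcreteModule.
Variables (R : realType) (m n : nat).
Local Notation C := R[i].
Local Notation N := (m + n)%N.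
Local Notation wt := (Submission.wt N).
Local Notation par := (@oddpar m n).
Variables (V : lmodType C) (Vp : bool -> set V) (act : 'M[C]_N -> V -> V).
Hypothesis hsm : is_supermodule Vp act.

Let aL := sm_act_linear_l hsm.
Let aR := sm_act_linear_r hsm.

Lemma act_X0 v : act 0 v = 0.
Proof. by have := aL (-1) 0 0 v; rewrite scaler0 addr0 scaleN1r addNr. Qed.
Lemma act_XZ c X v : act (c *: X) v = c *: act X v.
Proof. by rewrite -[c *: X]addr0 aL act_X0 addr0. Qed.
Lemma act_XD X Y v : act (X + Y) v = act X v + act Y v.
Proof. by rewrite -{1}[X]scale1r aL scale1r. Qed.
Lemma act_Xsum I (r : seq I) (F : I -> 'M[C]_N) v : act (\sum_(i <- r) F i) v = \sum_(i <- r) act (F i) v.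
Proof. by elim: r => [|i r IH]; rewrite ?big_nil ?act_X0 // !big_cons act_XD IH. Qed.

(** The indices are transposed to match the row vector convention of [Ym]. *)
Definition unit_act (i j : 'I_N) : V -> V := act (delta_mx j i).

Lemma delta_homog i j : gl_homogeneous (par i (+) par j) (delta_mx i j : 'M[C]_N).
Proof. by move=> k l; rewrite mxE; case: (k =P i) => [->|_]; case: (l =P j) => [->|_] //=; rewrite eqxx. Qed.

Lemma unit_act_rel i j k l u : unit_act k l (unit_act i j u) =
  sgn4 C par i j k l *: unit_act i j (unit_act k l u) +
  ((j == k)%:R *: unit_act i l u - sgn4 C par i j k l *: ((i == l)%:R *: unit_act k j u)).
Proof.
have := sm_act_bracket hsm u (@delta_homog l k) (@delta_homog j i).
have -> : (par l (+) par k) && (par j (+) par i) = (par i (+) par j) && (par k (+) par l).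
  by rewrite andbC [par j (+) _]addbC [par l (+) _]addbC.
rewrite -/(sgn4 C par i j k l) /gl_bracket !mul_delta_mx_cond.
have -> : (-1) ^+ ((par l (+) par k) && (par j (+) par i)) = sgn4 C par i j k l.
  by rewrite /sgn4 andbC [par j (+) _]addbC [par l (+) _]addbC.
have nE (c : bool) (X : 'M[C]_N) : X *+ c = c%:R *: X by case: c; rewrite ?scale1r ?scale0r.
rewrite !nE -scaleNr act_XD !act_XZ => h.
rewrite -[LHS](subrK (sgn4 C par i j k l *: act (delta_mx j i) (act (delta_mx l k) u))) -h addrC.
by rewrite scaleNr [k == j]eq_sym.
Qed.

(** The even and odd parts are extracted by choice; [gradingE] shows that the result does not depend
    on it. *)
Definition grading (u : V) : V :=
  projT1 (cid (sm_part_span hsm u)) - projT1 (cid (projT2 (cid (sm_part_span hsm u)))).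

Lemma gradingE x y : Vp false x -> Vp true y -> grading (x + y) = x - y.
Proof.
move=> hx hy; rewrite /grading; case: cid => u0 /= h; case: cid => u1 /= [h0 h1 e].
have sub p (c : C) u v : Vp p u -> Vp p v -> Vp p (c *: u + v) by apply: (proj2 (sm_part_subspace hsm p)).
have d0 : u0 - x = 0.
  apply: (sm_part_disjoint hsm); first by rewrite addrC -scaleN1r; apply: sub.
  have -> : u0 - x = -1 *: u1 + y; last exact: sub.
  by apply/eqP; rewrite scaleN1r subr_eq -addrA [y + x]addrC e addrC addrK.
have e0 : u0 = x by apply/eqP; rewrite -subr_eq0 d0.
by move: e; rewrite e0 => /addrI ->.
Qed.

Lemma part_dec u : exists x y, [/\ Vp false x, Vp true y, u = x + y & grading u = x - y].
Proof.
have [x [y [hx hy ->]]] := sm_part_span hsm u; exists x, y; split=> //; exact: gradingE.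
Qed.

Lemma part_sub p (c : C) u v : Vp p u -> Vp p v -> Vp p (c *: u + v).
Proof. exact: (proj2 (sm_part_subspace hsm p)). Qed.

Lemma grading_lin c x y : grading (c *: x + y) = c *: grading x + grading y.
Proof.
have [x0 [x1 [h0 h1 -> ->]]] := part_dec x; have [y0 [y1 [k0 k1 -> ->]]] := part_dec y.
rewrite scalerDr addrACA gradingE; [|exact: part_sub|exact: part_sub].
by rewrite scalerBr opprD addrACA.
Qed.

Lemma gradingK x : grading (grading x) = x.
Proof.
have [x0 [x1 [h0 h1 -> ->]]] := part_dec x; rewrite gradingE //; first by rewrite opprK.
by rewrite -[- x1]addr0 -scaleN1r; apply: part_sub => //; apply: (proj1 (sm_part_subspace hsm true)).
Qed.

Lemma unitD i j x y : unit_act i j (x + y) = unit_act i j x + unit_act i j y.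
Proof. by rewrite -[x]scale1r /unit_act aR !scale1r. Qed.
Lemma unitB i j x y : unit_act i j (x - y) = unit_act i j x - unit_act i j y.
Proof. by rewrite addrC -scaleN1r /unit_act aR scaleN1r addrC. Qed.

Lemma grading_act i j x : grading (unit_act i j x) = (-1) ^+ (par i (+) par j) *: unit_act i j (grading x).
Proof.
have [x0 [x1 [h0 h1 -> ->]]] := part_dec x.
have a0 := sm_act_parity hsm (@delta_homog j i) h0; have a1 := sm_act_parity hsm (@delta_homog j i) h1.
rewrite -/(unit_act i j) in a0 a1; rewrite [par j (+) _]addbC in a0 a1.
rewrite unitD unitB; case e : (par i (+) par j); rewrite e in a0 a1.
  by rewrite addrC gradingE // expr1 scaleN1r opprB.
by rewrite gradingE // expr0 scale1r.
Qed.

Lemma simple_stable : is_simple Vp act -> forall P : V -> Prop, lin P ->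
  (forall i j x, P x -> P (unit_act i j x)) -> (forall x, P x -> P (grading x)) ->
  (exists2 x, P x & x != 0) -> forall u, P u.
Proof.
move=> [_ hs] P hP hT hg [x px nz] u.
have hsub : is_subsupermodule Vp act (P : set V).
  split=> [|X w pw|u0 u1 h0 h1 pu]; first by case: hP.
    rewrite [X]matrix_sum_delta act_Xsum; apply: lin_sum => // i; rewrite act_Xsum; apply: lin_sum => // j.
    by rewrite act_XZ; apply: (linZ hP); apply: (hT j i).
  have pg := hg _ pu; rewrite gradingE // in pg.
  have h2 : (2%:R : C) != 0 by rewrite pnatr_eq0.
  have e0 : u0 = 2%:R^-1 *: ((u0 + u1) + (u0 - u1)).
    by rewrite addrACA subrr addr0 -mulr2n -[u0 *+ 2]scaler_nat scalerA mulVf ?scale1r.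
  have e1 : u1 = 2%:R^-1 *: ((u0 + u1) - (u0 - u1)).
    by rewrite opprB [X in _ *: X]addrC addrA subrK -mulr2n -[u1 *+ 2]scaler_nat scalerA mulVf ?scale1r.
  by split; [rewrite e0; apply: (linZ hP); apply: (linD hP)|rewrite e1; apply: (linZ hP); apply: (linB hP)].
case: (hs _ hsub) => h.
  by have : (P : set V) x by []; rewrite h /= => x0; rewrite x0 eqxx in nz.
by have : (P : set V) u by rewrite h.
Qed.

End ConcreteModule.

(** * Weight multiplicities of the simple module *)

Section Character.
Variables (R : realType) (m n : nat).
Local Notation C := R[i].
Local Notation N := (m + n)%N.
Local Notation wt := (Submission.wt N).
Local Notation par := (@oddpar m n).
Variables (lam : 'rV[C]_N) (a : 'I_m -> int) (b : 'I_n -> int).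
Hypothesis hlam : dominant_with_entries lam a b.
Local Notation z := (wtab a b).
Variables (V : lmodType C) (Vp : bool -> set V) (act : 'M[C]_N -> V -> V).
Hypothesis hV : is_L Vp act lam.

(** [dimension] picks some admissible size. Uniqueness of the coordinates of 0 yields linear
    independence, so any two sizes agree. *)
Lemma basis_dim (U : set V) d (e : 'I_d -> V) : is_basis U e -> U 0 -> dimension U = d.
Proof.
move=> hb U0; have ind d' (e' : 'I_d' -> V) : is_basis U e' ->
    (forall c : 'rV[C]_d', \sum_k c 0 k *: e' k = 0 -> c = 0) /\ forall k, U (e' k).
  move=> hb'; have [c0 [h0 hu]] := proj1 (hb' 0) U0.
  have z0 : (0 : V) = \sum_(i < d') (0 : 'rV[C]_d') 0 i *: e' i by rewrite big1 // => i _; rewrite mxE scale0r.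
  have hi (c : 'rV[C]_d') : \sum_k c 0 k *: e' k = 0 -> c = 0.
    by move=> h; rewrite -(hu _ (esym h)) (hu _ z0).
  split=> // k; apply/(hb' (e' k)).
  have dk : e' k = \sum_(i < d') (delta_mx 0 k : 'rV[C]_d') 0 i *: e' i.
    rewrite (bigD1 k) //= mxE !eqxx scale1r big1 ?addr0 // => i /negbTE ik.
    by rewrite mxE ik andbF scale0r.
  exists (delta_mx 0 k); split=> // c hc; apply/eqP; rewrite -subr_eq0; apply/eqP/hi.
  by under eq_bigr => i _ do rewrite mxE [X in _ + X]mxE scalerBl; rewrite sumrB -hc -dk subrr.
have le d1 d2 (e1 : 'I_d1 -> V) (e2 : 'I_d2 -> V) : is_basis U e1 -> is_basis U e2 -> (d1 <= d2)%N.
  move=> h1 h2; apply: (@indep_le C V _ _ e2 e1) => [k|]; last exact: (proj1 (ind _ _ h1)).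
  by have [c [hc _]] := proj1 (h2 (e1 k)) (proj2 (ind _ _ h1) k); exists c.
rewrite /dimension; case: xgetP => [d' _ [e' hb']|h].
  by apply/eqP; rewrite eqn_leq (le _ _ _ _ hb' hb) (le _ _ _ _ hb hb').
by case: (h d); exists e.
Qed.

Lemma dim_neq0 (U : set V) : U 0 -> dimension U != 0%N -> exists2 u, U u & u != 0.
Proof.
move=> U0; rewrite /dimension; case: xgetP => [d _ [e hb] d0|]; last by rewrite eqxx.
apply: contrapT => hn.
have [c0 [h0 hu]] := proj1 (hb 0) U0; case: d e d0 hb c0 h0 hu => // d e _ hb c0 h0 hu.
have Uz u : U u -> u = 0 by move=> Uu; apply/eqP/negPn/negP => nz; apply: hn; exists u.
have z0 : (0 : V) = \sum_(i < d.+1) (0 : 'rV[C]_d.+1) 0 i *: e i by rewrite big1 // => i _; rewrite mxE scale0r.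
have hi (c : 'rV[C]_d.+1) : \sum_k c 0 k *: e k = 0 -> c = 0 by move=> h; rewrite -(hu _ (esym h)) (hu _ z0).
have dk : e ord0 = \sum_(i < d.+1) (delta_mx 0 ord0 : 'rV[C]_d.+1) 0 i *: e i.
  rewrite (bigD1 ord0) //= mxE !eqxx scale1r big1 ?addr0 // => i /negbTE ik.
  by rewrite mxE ik andbF scale0r.
have Ue : U (e ord0).
  apply/(hb (e ord0)); exists (delta_mx 0 ord0); split=> // c hc; apply/eqP; rewrite -subr_eq0; apply/eqP/hi.
  by under eq_bigr => i _ do rewrite mxE [X in _ + X]mxE scalerBl; rewrite sumrB -hc -dk subrr.
have /rowP/(_ ord0) : (delta_mx 0 ord0 : 'rV[C]_d.+1) = 0 by apply: hi; rewrite -dk; apply: Uz.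
by rewrite !mxE eqxx => /eqP; rewrite oner_eq0.
Qed.

Lemma z_dom : dominant par z.
Proof.
case: hlam => _ ha hb i j ij pij; move: ij pij; rewrite -(fintype.splitK i) -(fintype.splitK j).
case: (fintype.split i) => p; case: (fintype.split j) => q /=; rewrite ?par_l ?par_r ?wtab_l ?wtab_r // => ij _.
  by apply: ha; rewrite ij.
by rewrite ltrN2; apply: hb; lia.
Qed.

Theorem simple_module_data : exists f : bser C N,
  [/\ @hwd C N par (fun y : wt => opR C par f y) z, @asym C N par (fun y : wt => opR C par f y),
   forall y : wt, f y = ratr (character act (iw R y - rho R m n)),
   forall mu, character act mu != 0 -> exists y : wt, mu = iw R y - rho R m n
   & exists s : seq wt, forall y : wt, f y != 0 -> y \in s].
Proof.
have [hsm hs [v [v0 [p vp] vw vsing]]] := hV.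
have lamE i : lam 0 i = (z i)%:~R - rr C par i.
  case: hlam => h _ _; rewrite weight_ofE in h.
  by have -> : lam = iw R z - rho R m n; [rewrite -h addrK|rewrite iw_rho].
have vg : grading hsm v = v \/ grading hsm v = - v.
  case: p vp => vp; [right|left].
    by rewrite -{1}[v]add0r gradingE ?sub0r //; apply: (proj1 (sm_part_subspace hsm false)).
  by rewrite -{1}[v]addr0 gradingE ?subr0 //; apply: (proj1 (sm_part_subspace hsm true)).
have vz : wv par (unit_act act) z v by move=> i; rewrite /unit_act vw lamE.
have vs : sing (unit_act act) v by move=> i j ji; apply: vsing.
have hp k : par k = (m <= k)%N by [].
have [f [h1 h2 h3 h4 h5]] := @highest_weight_character C N par m hp V (unit_act act) (grading hsm)
  (fun i j => sm_act_linear_r hsm (delta_mx j i)) (unit_act_rel hsm) (grading_lin hsm) (gradingK hsm)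
  (grading_act hsm) (simple_stable hs) v z v0 vg vs vz z_dom.
have ws0 mu : weight_space act mu 0.
  by move=> i; have := sm_act_linear_r hsm (delta_mx i i) (-1) 0 0; rewrite !scaler0 addr0 scaleN1r addNr.
exists f; split=> // [y|mu].
  have [d [e [-> he hspan hind]]] := h3 y; rewrite /character ratr_nat; congr (_%:R).
  apply/esym; apply: (@basis_dim _ _ e) => // u; split=> [hu|[c [-> _]] i].
    have hw : wv par (unit_act act) y u by move=> i; rewrite /unit_act hu iw_rho.
    have [c hc] := hspan u hw; exists c; split=> // c' hc'; apply/eqP; rewrite -subr_eq0; apply/eqP/hind.
    by under eq_bigr => i _ do rewrite mxE [X in _ + X]mxE scalerBl; rewrite sumrB -hc -hc' subrr.
  have hw : wv par (unit_act act) y (\sum_k c 0 k *: e k).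
    apply: (@lin_sum C V (wv par (unit_act act) y)) => [|k]; first by apply: wv_lin => i' j'; apply: sm_act_linear_r hsm _.
    by apply: wvZ => // i' j'; apply: sm_act_linear_r hsm _.
  by rewrite -[act _ _]/(unit_act act i i _) hw iw_rho.
rewrite /character pnatr_eq0 => /(dim_neq0 (ws0 mu))[u hu nz].
have [y hy] := h4 (fun i => mu 0 i) u nz (fun i => hu i).
by exists y; apply/iw_rhoP.
Qed.
End Character.

Lemma opR_shift_scale (K : numFieldType) (N : nat) (par : 'I_N -> bool) (c : K) a (g : bser K N) y :
  opR K par (bscale N c (opS K a g)) y = c * opR K par g (y + a).
Proof. by rewrite opR_scale opR_shift. Qed.

(** * Formal series over complex weights as bounded series over integral ones *)

Section SeriesBridge.
Variables (R : realType) (m n : nat).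
Local Notation C := R[i].
Local Notation N := (m + n)%N.
Local Notation wt := (Submission.wt N).
Local Notation par := (@oddpar m n).
Local Notation ser := (series R m n).
Local Notation iw := (@iw R m n).
Local Notation bser := (bser C N).

(** A finitely supported left factor makes the sum in [conv] finite for every [X]. The list may
    repeat weights, hence the [undup] in the proof. *)
Lemma conv_list (c : seq ('rV[C]_N * rat)) (F X : ser) :
  (forall mu, F mu = \sum_(p <- c) p.2 * fexp p.1 mu) ->
  forall mu, conv F X mu = \sum_(p <- c) p.2 * X (mu - p.1).
Proof.
move=> hF mu; rewrite /conv (fsbigE (undup (map fst c))) ?undup_uniq //; last first.
  move=> nu _; rewrite mem_undup => nin; rewrite hF big1_seq ?mul0r // => p /andP[_ hp].
  rewrite /fexp; case: eqP => [e|_]; last by rewrite mulr0.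
  by case/negP: nin; rewrite e; apply: map_f.
rewrite (eq_bigl xpredT) => [|nu]; last by rewrite in_setT.
under eq_bigr => nu _ do rewrite hF mulr_suml.
rewrite exchange_big /=; apply: eq_big_seq => p hp.
rewrite (bigD1_seq p.1) ?undup_uniq ?mem_undup ?map_f //= big1 ?addr0; first by rewrite /fexp eqxx mulr1.
by move=> nu /negbTE ne; rewrite /fexp ne mulr0 mul0r.
Qed.

Lemma conv_fexp nu (X : ser) mu : conv (fexp nu) X mu = X (mu - nu).
Proof.
rewrite (@conv_list [:: (nu, 1)]) => [|w]; first by rewrite big_seq1 mul1r.
by rewrite big_seq1 mul1r.
Qed.

Lemma conv_fin (s : seq 'rV[C]_N) (F h : ser) mu : uniq s -> (forall k, h k != 0 -> k \in s) ->
  conv F h mu = \sum_(k <- s) F (mu - k) * h k.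
Proof.
move=> us hs; rewrite /conv (fsbigE (map (fun k => mu - k) s)) //; last first.
- move=> nu _ nin; have [->|nz] := eqVneq (h (mu - nu)) 0; first by rewrite mulr0.
  by case/negP: nin; apply/mapP; exists (mu - nu); rewrite ?hs // subKr.
- by rewrite map_inj_uniq // => x y /addrI/oppr_inj.
rewrite (eq_bigl xpredT) => [|nu]; last by rewrite in_setT.
by rewrite big_map; apply: eq_bigr => k _; rewrite subKr.
Qed.

Lemma mulrn_vec_inj (be : 'rV[C]_N) k l : be != 0 -> be *+ k = be *+ l -> k = l.
Proof.
move=> nz /eqP; rewrite -subr_eq0 -[be *+ k]scaler_nat -[be *+ l]scaler_nat -scalerBl scaler_eq0 (negbTE nz) orbF.
by rewrite subr_eq0 eqr_nat => /eqP.
Qed.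

Lemma inv_one_plusE (be : 'rV[C]_N) k : be != 0 -> inv_one_plus be (- (be *+ k)) = (-1) ^+ k.
Proof.
move=> nz; rewrite /inv_one_plus (fsbigE [:: k]) //; last first.
  move=> l _; rewrite inE => lk; rewrite /fexp eqr_opp; case: eqP => [/(mulrn_vec_inj nz) e|_]; last by rewrite mulr0.
  by rewrite e eqxx in lk.
by rewrite big_mkcond big_seq1 in_setT /fexp eqxx mulr1.
Qed.

Lemma inv_one_plus0 (be nu : 'rV[C]_N) : (forall k, nu <> - (be *+ k)) -> inv_one_plus be nu = 0.
Proof.
move=> h; rewrite /inv_one_plus (fsbigE [::]) //; first by rewrite big_nil.
by move=> k _ _; rewrite /fexp; case: eqP => [/h//|_]; rewrite mulr0.
Qed.

(** The sum in [conv] is finite because [X] vanishes far up along [be], and [be != 0] keeps the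
    exponents [- k be] distinct. *)
Lemma conv_inv (be : 'rV[C]_N) (X : ser) mu M : be != 0 -> (forall k, (M <= k)%N -> X (mu + be *+ k) = 0) ->
  conv (inv_one_plus be) X mu = \sum_(k < M) (-1) ^+ k * X (mu + be *+ k).
Proof.
move=> nz h; rewrite /conv (fsbigE (map (fun k => - (be *+ k)) (iota 0 M))) //; last first.
- move=> nu _ nin; have [[k e]|hn] := pselect (exists k, nu = - (be *+ k)); last first.
    by rewrite inv_one_plus0 ?mul0r // => k e; apply: hn; exists k.
  have [lt|ge] := ltnP k M; last by rewrite e opprK h // mulr0.
  by case/negP: nin; rewrite e; apply/mapP; exists k; rewrite // mem_iota.
- by rewrite map_inj_uniq ?iota_uniq // => x y /oppr_inj; apply: mulrn_vec_inj.
rewrite (eq_bigl xpredT) => [|nu]; last by rewrite in_setT.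
rewrite big_map -(big_mkord xpredT (fun k => (-1) ^+ k * X (mu + be *+ k))) /index_iota subn0.
by apply: eq_bigr => k _; rewrite inv_one_plusE // opprK.
Qed.

(** Rational coefficients are compared through [ratr]; the second clause confines the support, a
    priori among complex weights, to integral ones. *)
Definition represents (X : ser) (g : bser) :=
  (forall x : wt, ratr (X (iw x)) = g x :> C) /\ forall nu, X nu != 0 -> exists x : wt, nu = iw x.

Lemma iw_root_neq0 (i j : 'I_N) : i != j -> iw (root i j) != 0.
Proof.
move=> ij; apply/eqP => /rowP/(_ i); rewrite !mxE wsubE !epsE eqxx (negbTE ij) subr0 => /eqP.
by rewrite oner_eq0.
Qed.

Lemma represents_inv (i j : 'I_N) X g : (i < j)%N -> par i != par j -> represents X g ->
  represents (conv (inv_one_plus (iw (root i j))) X) (opinv C par i j g).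
Proof.
move=> ij pij [h1 h2]; have nz : iw (root i j) != 0 by apply: iw_root_neq0; rewrite -val_eqE /=; lia.
split=> [x|nu hnu].
  have [M hM] := bser_vanish ij g x.
  have XM k : (M <= k)%N -> X (iw x + iw (root i j) *+ k) = 0.
    by move=> hk; have /eqP := h1 (x + root i j *+ k); rewrite hM // iwD iwMn fmorph_eq0 => /eqP.
  rewrite (conv_inv nz XM) (opinvE _ _ ij) /= (@binvE C N _ _ ij _ g x M hM) rmorph_sum; apply: eq_bigr => k _.
  by rewrite rmorphM rmorphXn rmorphN1 /= -iwMn -iwD h1 -negb_eqb pij.
apply: contrapT => hn; case/eqP: hnu; rewrite (@conv_inv _ _ _ 0) ?big_ord0 // => k _.
apply/eqP/negPn/negP => /h2[x e]; apply: hn; exists (x - root i j *+ k).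
by rewrite iwB iwMn -e addrK.
Qed.

Definition even_prod (l : seq ('I_N * 'I_N)) : ser :=
  \big[@conv R m n/fexp 0]_(p <- l) (fun mu => fexp 0 mu - fexp (- iw (root p.1 p.2)) mu).

Lemma even_prod_list l : exists c, forall mu, even_prod l mu = \sum_(p <- c) p.2 * fexp p.1 mu.
Proof.
elim: l => [|q l [c IH]]; first by exists [:: (0, 1)] => mu; rewrite /even_prod big_nil big_seq1 mul1r.
exists (c ++ map (fun p => (p.1 - iw (root q.1 q.2), - p.2)) c) => mu.
rewrite /even_prod big_cons -/(even_prod l) (@conv_list [:: (0, 1); (- iw (root q.1 q.2), -1)]); last first.
  by move=> w; rewrite !big_cons big_nil /= mul1r mulN1r addr0.
rewrite !big_cons big_nil /= mul1r mulN1r addr0 subr0 opprK !IH big_cat big_map /=; congr (_ + _).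
rewrite -sumrN; apply: eq_bigr => p _; rewrite mulNr; congr (- (_ * _)); rewrite /fexp.
by rewrite [in RHS]eq_sym subr_eq eq_sym.
Qed.

(** The instance of associativity of [conv] that is needed, obtained by writing the even product as
    a finite combination of exponentials. *)
Lemma conv_even_cons q l (X : ser) mu :
  conv (even_prod (q :: l)) X mu = conv (even_prod l) X mu - conv (even_prod l) X (mu + iw (root q.1 q.2)).
Proof.
have [c hc] := even_prod_list l.
rewrite (@conv_list (c ++ map (fun p => (p.1 - iw (root q.1 q.2), - p.2)) c)); last first.
  move=> w; rewrite /even_prod big_cons -/(even_prod l) (@conv_list [:: (0, 1); (- iw (root q.1 q.2), -1)]); last first.
    by move=> w'; rewrite !big_cons big_nil /= mul1r mulN1r addr0.
  rewrite !big_cons big_nil /= mul1r mulN1r addr0 subr0 opprK !hc big_cat big_map /=; congr (_ + _).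
  rewrite -sumrN; apply: eq_bigr => p _; rewrite mulNr; congr (- (_ * _)); rewrite /fexp.
  by rewrite [in RHS]eq_sym subr_eq eq_sym.
rewrite !(conv_list X hc) big_cat big_map /=; congr (_ + _).
by rewrite -sumrN; apply: eq_bigr => p _; rewrite mulNr opprB addrA addrAC.
Qed.

Lemma represents_even (l : seq ('I_N * 'I_N)) X g : (forall p, p \in l -> par p.1 = par p.2) -> represents X g ->
  represents (conv (even_prod l) X) ((\prod_(p <- l) opn C par p.1 p.2) g).
Proof.
move=> hl hX; elim: l hl => [|q l IH] hl.
  rewrite big_nil /even_prod big_nil; split=> [x|nu]; rewrite conv_fexp subr0; [exact: (proj1 hX)|exact: (proj2 hX)].
have [h1 h2] := IH (fun p hp => hl p (mem_behead (s := q :: l) hp)).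
rewrite big_cons; split=> [x|nu].
  rewrite conv_even_cons rmorphB /= -iwD !h1 -[RHS]/(opn C par q.1 q.2 _ x) opnE.
  by rewrite (hl q (mem_head _ _)) addbb expr0 mul1r.
rewrite conv_even_cons; have [->|/h2//] := eqVneq (conv (even_prod l) X nu) 0.
rewrite sub0r oppr_eq0 => /h2[x e]; exists (x - root q.1 q.2).
by rewrite iwB -e addrK.
Qed.

Definition odd_prod (l : seq ('I_N * 'I_N)) : ser :=
  \big[@conv R m n/fexp 0]_(p <- l) inv_one_plus (iw (root p.1 p.2)).

Lemma delta0_bounded : bounded (fun y : wt => (y == 0)%:R : C).
Proof.
exists 0 => y; case: (y =P 0) => [->|_]; last by rewrite eqxx.
by move=> _ k; rewrite /psum big1 // => i _; rewrite ffunE.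
Qed.
Definition delta0 : bser := Bser delta0_bounded.

Lemma iw0 : iw 0 = 0. Proof. by apply/rowP => k; rewrite !mxE ffunE. Qed.

Lemma represents_delta0 : represents (fexp 0) delta0.
Proof.
split=> [x|nu]; rewrite /fexp.
  by rewrite -[X in _ == X]iw0 (inj_eq (@iw_inj R m n)) /= rmorph_nat.
by case: (nu =P 0) => [-> _|_]; [exists 0; rewrite iw0|rewrite eqxx].
Qed.

Lemma represents_odd (l : seq ('I_N * 'I_N)) : (forall p, p \in l -> (p.1 < p.2)%N && (par p.1 != par p.2)) ->
  represents (odd_prod l) ((\prod_(p <- l) opinv C par p.1 p.2) delta0).
Proof.
elim: l => [|q l IH] hl; first by rewrite /odd_prod !big_nil; apply: represents_delta0.
rewrite /odd_prod !big_cons -/(odd_prod l); have /andP[q1 q2] := hl q (mem_head _ _).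
by apply: (represents_inv q1 q2); apply: IH => p hp; apply: hl; rewrite inE hp orbT.
Qed.

Definition even_list : seq ('I_N * 'I_N) :=
  [seq (lshift n p.1, lshift n p.2) | p : 'I_m * 'I_m <- enum {: 'I_m * 'I_m} & (p.1 < p.2)%N] ++
  [seq (rshift m p.1, rshift m p.2) | p : 'I_n * 'I_n <- enum {: 'I_n * 'I_n} & (p.1 < p.2)%N].
Definition odd_list : seq ('I_N * 'I_N) :=
  [seq (lshift n p.1, rshift m p.2) | p : 'I_m * 'I_n <- enum {: 'I_m * 'I_n}].

Lemma odd_rootE p : odd_root R p = iw (root (lshift n p.1) (rshift m p.2)).
Proof. by rewrite /root iwB !iw_eps. Qed.

Lemma represents_superdenominator : represents (superdenominator R m n) (opR C par delta0).
Proof.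
have -> : superdenominator R m n = conv (even_prod even_list) (odd_prod odd_list).
  rewrite /superdenominator; congr conv.
    have -> : even_pos_roots R m n = map (fun p => iw (root p.1 p.2)) even_list.
      rewrite /even_list map_cat -!map_comp; congr (_ ++ _); apply: eq_map => p /=; by rewrite /root iwB !iw_eps.
    by rewrite big_map.
  have -> : odd_pos_roots R m n = map (fun p => iw (root p.1 p.2)) odd_list.
    by rewrite -map_comp; apply: eq_map => p /=; apply: odd_rootE.
  by rewrite big_map.
have he p : p \in even_list -> (p.1 < p.2)%N && (par p.1 == par p.2).
  rewrite mem_cat => /orP[] /mapP[q]; rewrite mem_filter => /andP[lt _] -> /=; rewrite ?par_l ?par_r ?ltn_add2l ?lt //.
have ho p : p \in odd_list -> (p.1 < p.2)%N && (par p.1 != par p.2).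
  by move=> /mapP[q _ ->]; rewrite par_l par_r /= ltn_addr.
have hperm : perm_eq (pospairs N) (even_list ++ odd_list).
  apply: uniq_perm.
  - by rewrite filter_uniq // enum_uniq.
  - rewrite cat_uniq; apply/and3P; split.
    + rewrite cat_uniq; apply/and3P; split.
      * rewrite map_inj_uniq; first by [apply: filter_uniq; apply: enum_uniq|apply: enum_uniq].
        move=> x y /= e; rewrite [x]surjective_pairing [y]surjective_pairing;
          congr (_, _); apply: (@lshift_inj m n); [exact: (congr1 fst e)|exact: (congr1 snd e)].
      * apply/hasPn => p /mapP[q _ ->]; apply/negP => /mapP[r _ /(congr1 fst)/eqP].
        by rewrite /= eq_rlshift.
      * rewrite map_inj_uniq; first by [apply: filter_uniq; apply: enum_uniq|apply: enum_uniq].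
        move=> x y /= e; rewrite [x]surjective_pairing [y]surjective_pairing;
          congr (_, _); apply: (@rshift_inj m n); [exact: (congr1 fst e)|exact: (congr1 snd e)].
    + apply/hasPn => p /mapP[q _ ->]; apply/negP; rewrite mem_cat => /orP[] /mapP[r _].
        by move=> /(congr1 snd)/eqP; rewrite /= eq_rlshift.
      by move=> /(congr1 fst)/eqP; rewrite /= eq_lrshift.
    + rewrite map_inj_uniq; first exact: enum_uniq.
      move=> x y /= e; rewrite [x]surjective_pairing [y]surjective_pairing;
        congr (_, _); [apply: (@lshift_inj m n); exact: (congr1 fst e)|apply: (@rshift_inj m n); exact: (congr1 snd e)].
  move=> [i j]; rewrite mem_pospairs /=; apply/idP/idP; last first.
    by rewrite mem_cat => /orP[/he/andP[]|/ho/andP[]].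
  rewrite !mem_cat -(fintype.splitK i) -(fintype.splitK j); case: (fintype.split i) => p; case: (fintype.split j) => q /= lt.
  - by apply/orP; left; apply/orP; left; apply/mapP; exists (p, q); rewrite // mem_filter lt mem_enum.
  - by apply/orP; right; apply/mapP; exists (p, q); rewrite // mem_enum.
  - by have := ltn_ord q; lia.
  - by apply/orP; left; apply/orP; right; apply/mapP; exists (p, q); rewrite // mem_filter mem_enum /= andbT -(ltn_add2l m).
have -> : opR C par = (\prod_(p <- even_list) opn C par p.1 p.2) * (\prod_(p <- odd_list) opinv C par p.1 p.2).
  rewrite /opR (comm_perm _ hperm) => [|p q hp hq]; last by apply: Ffac_comm; rewrite -mem_pospairs.
  rewrite big_cat /=; congr (_ * _); apply: eq_big_seq => p hp.
    by have /andP[_ /eqP->] := he p hp; rewrite addbb.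
  by have /andP[_ pp] := ho p hp; rewrite -negb_eqb pp.
apply: represents_even; first by move=> p /he/andP[_ /eqP].
exact: represents_odd.
Qed.

(** The character has finite support, so the left hand side is a finite combination of translates of
    the superdenominator, and [opR] commutes with translations. *)
Lemma lhs_bridge (f : bser) (ch : ser) (s : seq wt) :
  (forall y : wt, f y = ratr (ch (iw y - rho R m n))) ->
  (forall mu, ch mu != 0 -> exists y : wt, mu = iw y - rho R m n) ->
  (forall y : wt, f y != 0 -> y \in s) ->
  (forall y, ratr (conv (conv (fexp (rho R m n)) (superdenominator R m n)) ch (iw y)) = opR C par f y) /\
  forall mu, (forall y, mu <> iw y) -> conv (conv (fexp (rho R m n)) (superdenominator R m n)) ch mu = 0.
Proof.
move=> hf hch hs; have [d1 d2] := represents_superdenominator.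
pose t := undup s.
have E mu : conv (conv (fexp (rho R m n)) (superdenominator R m n)) ch mu =
    \sum_(y <- t) superdenominator R m n (mu - iw y) * ch (iw y - rho R m n).
  rewrite (@conv_fin (map (fun y => iw y - rho R m n) t)).
  - by rewrite big_map; apply: eq_bigr => y _; rewrite conv_fexp opprB addrA addrAC addrK.
  - by rewrite map_inj_uniq ?undup_uniq // => x y /addIr/iw_inj.
  - move=> k hk; have [y e] := hch k hk; rewrite e; apply: map_f; rewrite mem_undup; apply: hs.
    by rewrite hf -e fmorph_eq0.
split=> [y|mu hmu]; rewrite E; last first.
  rewrite big1 // => y _; have [->|/d2[x e]] := eqVneq (superdenominator R m n (mu - iw y)) 0; first by rewrite mul0r.
  by case: (hmu (x + y)); rewrite iwD -e subrK.
have -> : f = \sum_(u <- t) bscale N (f u) (opS C (- u) delta0).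
  apply: bserE => w; rewrite bser_sumE; have [wt'|nw] := boolP (w \in t).
    rewrite (bigD1_seq w) ?undup_uniq //= subrr eqxx mulr1 big1 ?addr0 // => u uw.
    by rewrite subr_eq0 eq_sym (negbTE uw) mulr0.
  rewrite big1_seq => [|u /andP[_ hu]].
    by apply/eqP/negPn/negP => /hs; rewrite -mem_undup (negbTE nw).
  by rewrite /= subr_eq0; case: eqP => [e|_]; [rewrite e hu in nw|rewrite mulr0].
rewrite endo_sum bser_sumE rmorph_sum; apply: eq_bigr => u _.
rewrite rmorphM /= -iwB d1 -hf mulrC; apply/esym.
exact: (@opR_shift_scale C N par (f u) (- u) delta0 y).
Qed.

(* Coefficients of [prod_(i, j) in l 1 / (1 + e^-(eps_i - eps_j))] for disjoint pairs. *)
Definition pts (l : seq ('I_N * 'I_N)) := map fst l ++ map snd l.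
Definition pair_coef (s t : int) : C := ((s <= 0) && (t == - s))%:R * sgx C s.
Definition odd_coef (l : seq ('I_N * 'I_N)) (x : wt) : C :=
  (\prod_(k : 'I_N | k \notin pts l) (x k == 0)%:R) * \prod_(p <- l) pair_coef (x p.1) (x p.2).

(** As the pairs are disjoint, each geometric series touches its own two coordinates, and the value
    [x i] selects the single term that contributes. *)
Lemma odd_prodE (l : seq ('I_N * 'I_N)) : uniq (pts l) -> (forall p, p \in l -> (p.1 < p.2)%N && (par p.1 != par p.2)) ->
  forall x, (\prod_(p <- l) opinv C par p.1 p.2) delta0 x = odd_coef l x.
Proof.
elim: l => [|[i j] l IH] ul hl x.
  rewrite big_nil /odd_coef big_nil mulr1 /=; have [->|nz] := eqVneq x 0.
    by rewrite big1 // => k _; rewrite ffunE eqxx.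
  have [k hk] : exists k, x k != 0.
    by apply: contrapT => h; case/eqP: nz; apply/ffunP => k; rewrite ffunE; apply/eqP/negPn/negP => hk; apply: h; exists k.
  by rewrite (bigD1 k) //= (negbTE hk) mul0r.
have /andP[/= ij pij] := hl (i, j) (mem_head _ _).
have hl' p : p \in l -> (p.1 < p.2)%N && (par p.1 != par p.2) by move=> hp; apply: hl; rewrite inE hp orbT.
have nij : i != j by rewrite -val_eqE /=; move: ij; clear; lia.
have pp k : (k \in pts ((i, j) :: l)) = [|| k == i, k == j | k \in pts l].
  by rewrite /pts /= !inE !mem_cat inE; case: (k == i); case: (k == j); rewrite ?orbT.
move: ul; rewrite /pts /= mem_cat inE cat_uniq /= => /andP[]; rewrite !negb_or => /and3P[i1 _ i2].
move=> /and4P[u1 /andP[j1 u2] j2 u3].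
have ul' : uniq (pts l) by rewrite /pts cat_uniq u1 u2 u3.
have il : i \notin pts l by rewrite /pts mem_cat negb_or i1 i2.
have jl : j \notin pts l by rewrite /pts mem_cat negb_or j1 j2.
rewrite big_cons; pose g : bser := (\prod_(p <- l) opinv C par p.1 p.2) delta0; rewrite -[LHS]/(opinv C par i j g x).
pose AB : C := (\prod_(q : 'I_N | q \notin pts ((i, j) :: l)) (x q == 0)%:R) * \prod_(p <- l) pair_coef (x p.1) (x p.2).
have gE k : g (x + root i j *+ k) = ((x i == - k%:Z) && (x j == k%:Z))%:R * AB.
  have xe q : (x + root i j *+ k) q = x q + ((q == i)%:R - (q == j)%:R) * k%:Z :> int.
    by rewrite waddE mulrnBl wsubE !epsMnE mulrBl.
  rewrite /g IH // /odd_coef /AB (bigD1 i) //= (bigD1 j) /=; last by rewrite jl eq_sym.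
  rewrite !xe !eqxx (negbTE nij) [j == i]eq_sym (negbTE nij) subr0 sub0r mul1r mulN1r.
  have -> : (x i + k%:Z == 0) = (x i == - k%:Z) by rewrite addr_eq0.
  rewrite subr_eq0 !mulrA -natrM mulnb -!mulrA; congr (_ * (_ * _)).
    apply: eq_big => q; first by rewrite pp !negb_or; case: (q == i); case: (q == j); rewrite ?andbF ?andbT.
    by move=> /andP[/andP[_ /negbTE qi] /negbTE qj]; rewrite xe qi qj subrr mul0r addr0.
  apply: eq_big_seq => p hp; have nin q : q \in pts l -> x q + ((q == i)%:R - (q == j)%:R) * k%:Z = x q.
    move=> hq; have -> : (q == i) = false by apply: contraNF il => /eqP<-.
    have -> : (q == j) = false by apply: contraNF jl => /eqP<-.
    by rewrite subrr mul0r addr0.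
  by rewrite !xe !nin // /pts mem_cat map_f ?orbT.
have [M hM] := bser_vanish ij g x.
(* The cut-off must exceed both the vanishing bound [M] and the only index that can contribute, the
   absolute value of [x i]. *)
rewrite (opinvE _ _ ij) /= (@binvE C N _ _ ij _ g x (M + absz (x i)).+1); last first.
  by move=> k hk; apply: hM; move: hk; clear; lia.
under eq_bigr => k _ do rewrite gE -negb_eqb pij mulrA.
rewrite -mulr_suml /odd_coef big_cons /= [RHS]mulrCA; congr (_ * _).
rewrite /pair_coef; have [le|gt] /= := leP (x i) 0; last first.
  by rewrite mul0r big1 // => k _; have -> : (x i == - k%:Z) = false by [apply/eqP; move: gt; clear; lia]; rewrite mulr0.
have lt : (absz (x i) < (M + absz (x i)).+1)%N by rewrite ltnS leq_addl.
rewrite (bigD1 (Ordinal lt)) //= big1 ?addr0; last first.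
  move=> k nk; have -> : (x i == - k%:Z) = false; last by rewrite mulr0.
  by apply: contraNF nk => /eqP e; apply/eqP/val_inj => /=; move: e le; clear; lia.
have -> : (x i == - (absz (x i))%:Z) by apply/eqP; move: le; clear; lia.
have -> : (absz (x i))%:Z = - x i by move: le; clear; lia.
by rewrite mulrC /sgx signr_odd.
Qed.

End SeriesBridge.

(** * The Weyl group as the parity preserving permutations of all indices *)

Lemma adj_ind d (B : 'S_d -> Prop) : B 1%g -> (forall u w, B u -> B w -> B (u * w)%g) ->
  (forall i j : 'I_d, j = i.+1 :> nat -> B (tperm i j)) -> forall w, B w.
Proof.
move=> B1 BM Ba.
have ht n : forall (i j : 'I_d), j = (i + n).+1 :> nat -> B (tperm i j).
  elim: n => [|n IH] i j ij; first by apply: Ba; rewrite // ij addn0.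
  have lj : (i + n.+1 < d)%N by have := ltn_ord j; lia.
  pose l := Ordinal lj.
  have hl : B (tperm i l) by apply: IH => //=; lia.
  have hj : B (tperm l j) by apply: Ba; rewrite // ij.
  have nil : i != l by rewrite -val_eqE /=; lia.
  have nij : i != j by rewrite -val_eqE /= ij; lia.
  have -> : tperm i j = (tperm l j * tperm i l * tperm l j)%g; last exact: (BM _ _ (BM _ _ hj hl) hj).
  apply/permP => x; rewrite !permM; have [->|xi] := eqVneq x i.
    by rewrite tpermL [tperm l j i]tpermD 1?eq_sym // !tpermL.
  have [->|xj] := eqVneq x j; first by rewrite tpermR tpermR tpermR tpermD // eq_sym.
  have [->|xl] := eqVneq x l.
    by have nlj : l != j by [rewrite -val_eqE /= ij; lia]; rewrite tpermL [tperm i l j]tpermD // tpermR tpermD // eq_sym.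
  by rewrite !tpermD // eq_sym.
have hij i j : B (tperm i j).
  have [lt|lt|e] := ltngtP i j.
  - by apply: (ht (j - i.+1)%N) => //; lia.
  - by rewrite tpermC; apply: (ht (i - j.+1)%N) => //; lia.
  - by rewrite (val_inj e) tperm1.
move=> w; have [ts -> _] := prod_tpermP w.
by elim: ts => [|t ts IH]; rewrite ?big_nil // big_cons; apply: BM.
Qed.

Section WeylGroupEmbedding.
Variables (m n : nat).
Local Notation N := (m + n)%N.
Local Notation W := ('S_m * 'S_n)%type.
Local Notation wt := (Submission.wt N).
Local Notation par := (@oddpar m n).

Definition blockfun (w : W) (k : 'I_N) : 'I_N :=
  match fintype.split k with inl p => lshift n (w.1 p) | inr q => rshift m (w.2 q) end.

Lemma blockfun_inj w : injective (blockfun w).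
Proof.
move=> k l; rewrite -(fintype.splitK k) -(fintype.splitK l) /blockfun !fintype.unsplitK.
case: (fintype.split k) => p; case: (fintype.split l) => q /= h.
- by move/lshift_inj: h => /perm_inj->.
- by move/eqP: h; rewrite eq_lrshift.
- by move/eqP: h; rewrite eq_rlshift.
- by move/rshift_inj: h => /perm_inj->.
Qed.
Definition blockperm w : 'S_N := perm (@blockfun_inj w).

Lemma blockpermL w p : blockperm w (lshift n p) = lshift n (w.1 p).
Proof. by rewrite permE /blockfun (fintype.unsplitK (inl p)). Qed.
Lemma blockpermR w q : blockperm w (rshift m q) = rshift m (w.2 q).
Proof. by rewrite permE /blockfun (fintype.unsplitK (inr q)). Qed.

Lemma blockpermM w u : blockperm (w * u)%g = (blockperm w * blockperm u)%g.
Proof.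
apply/permP => k; rewrite -(fintype.splitK k) permM; case: (fintype.split k) => p /=.
  by rewrite !blockpermL permM.
by rewrite !blockpermR permM.
Qed.

Lemma blockperm1 : blockperm 1%g = 1%g.
Proof. by apply/permP => k; rewrite -(fintype.splitK k); case: (fintype.split k) => p /=; rewrite ?blockpermL ?blockpermR !perm1. Qed.

Lemma blockperm_inj : injective blockperm.
Proof.
move=> w u h; rewrite [w]surjective_pairing [u]surjective_pairing; congr (_, _); apply/permP => p.
  by apply: (@lshift_inj m n); rewrite -!blockpermL h.
by apply: (@rshift_inj m n); rewrite -!blockpermR h.
Qed.

Lemma blockperm_Wg w : Wg par (blockperm w).
Proof.
apply/WgP => k; rewrite -(fintype.splitK k); case: (fintype.split k) => p /=; first by rewrite blockpermL !par_l.
by rewrite blockpermR !par_r.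
Qed.

Lemma Wg_blockperm u : Wg par u -> exists w, blockperm w = u.
Proof.
move=> /WgP hu.
have h1 p : exists p', u (lshift n p) = lshift n p'.
  have := hu (lshift n p); rewrite par_l -(fintype.splitK (u _)); case: (fintype.split _) => q /=; last by rewrite par_r.
  by exists q.
have h2 p : exists p', u (rshift m p) = rshift m p'.
  have := hu (rshift m p); rewrite par_r -(fintype.splitK (u _)); case: (fintype.split _) => q /=; first by rewrite par_l.
  by exists q.
pose f1 p := projT1 (cid (h1 p)); pose f2 p := projT1 (cid (h2 p)).
have e1 p : u (lshift n p) = lshift n (f1 p) := projT2 (cid (h1 p)).
have e2 p : u (rshift m p) = rshift m (f2 p) := projT2 (cid (h2 p)).
have i1 : injective f1.
  by move=> p q h; apply: (@lshift_inj m n); apply: (@perm_inj _ u); rewrite !e1 h.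
have i2 : injective f2.
  by move=> p q h; apply: (@rshift_inj m n); apply: (@perm_inj _ u); rewrite !e2 h.
exists (perm i1, perm i2); apply/permP => k; rewrite -(fintype.splitK k); case: (fintype.split k) => p /=.
  by rewrite blockpermL /= permE -e1.
by rewrite blockpermR /= permE -e2.
Qed.

Local Notation expr w k := (exists s : seq W, [/\ size s = k, all (@simple_reflection m n) s & (\prod_(x <- s) x)%g = w]).

Lemma expr_exists w : exists k, expr w k.
Proof.
have emul u v : (exists k, expr u k) -> (exists k, expr v k) -> exists k, expr (u * v)%g k.
  move=> [k [s [h1 h2 h3]]] [l [t [k1 k2 k3]]]; exists (size (s ++ t)), (s ++ t); split=> //.
    by rewrite all_cat h2 k2.
  by rewrite big_cat /= h3 k3.
have one : exists k, expr 1%g k by exists 0%N, [::]; rewrite big_nil.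
have -> : w = ((w.1, 1) * (1, w.2))%g.
  by rewrite [LHS]surjective_pairing; congr (_, _); rewrite /= ?mulg1 ?mul1g.
have gen s : simple_reflection s -> exists k, expr s k by move=> h; exists 1%N, [:: s]; rewrite big_seq1 /= h.
apply: (emul).
  apply: (adj_ind (B := fun u => exists k, expr ((u, 1) : W)%g k)) => // [u v hu hv|i j ij].
    have -> : ((u * v, 1) : W)%g = ((u, 1) * (v, 1))%g by congr (_, _); rewrite /= mulg1.
    exact: (emul).
  by apply: gen; apply/orP; left; apply/existsP; exists i; apply/existsP; exists j; rewrite ij !eqxx.
apply: (adj_ind (B := fun u => exists k, expr ((1, u) : W)%g k)) => // [u v hu hv|i j ij].
  have -> : ((1, u * v) : W)%g = ((1, u) * (1, v))%g by congr (_, _); rewrite /= mulg1.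
  exact: (emul).
by apply: gen; apply/orP; right; apply/existsP; exists i; apply/existsP; exists j; rewrite ij !eqxx.
Qed.

(** The [k + 1] prefix products of a shortest expression are distinct, since a segment between two
    equal ones could be cut out. Hence [k] is less than the order of the group, and the bounded
    search succeeds. *)
Lemma weyl_length_expr w : expr w (weyl_length w).
Proof.
have ex : exists k, `[< expr w k >] by have [k h] := expr_exists w; exists k; apply/asboolP.
case: (ex_minnP ex) => k /asboolP[s [sk sa sw]] kmin.
pose pre (j : 'I_k.+1) := (\prod_(x <- take j s) x)%g.
have pinj : injective pre.
  have aux (i j : 'I_k.+1) : (i < j)%N -> pre i <> pre j.
    move=> ij h; have jk : (j <= k)%N by rewrite -ltnS.
    have : (k <= i + (k - j))%N.
      apply: kmin; apply/asboolP; exists (take i s ++ drop j s); split.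
      - by rewrite size_cat size_take_min size_drop sk; lia.
      - by rewrite all_cat; apply/andP; split; apply/allP => x hx; apply: (allP sa);
          first [exact: (mem_take hx)|exact: (mem_drop hx)].
      - by rewrite big_cat /= -[(\prod_(x <- take i s) x)%g]/(pre i) h /pre -big_cat cat_take_drop.
    by lia.
  move=> i j h; have [lt|lt|/val_inj//] := ltngtP i j; first by case: (aux _ _ lt).
  by case: (aux _ _ lt).
have kW : (k < #|{: W}|)%N by have := leq_card pre pinj; rewrite card_ord.
pose p := fun k => [exists s : k.-tuple W, all (@simple_reflection m n) s && ((\prod_(x <- s) x)%g == w)].
have hp : has p (iota 0 #|{: W}|).
  apply/hasP; exists k; first by rewrite mem_iota.
  have st : size s == k by apply/eqP.
  by apply/existsP; exists (Tuple st); rewrite /= sa sw eqxx.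
have := nth_find 0%N hp; rewrite nth_iota ?add0n; last by rewrite -[X in (_ < X)%N](size_iota 0) -has_find.
move/existsP=> [t /andP[ta /eqP tw]]; exists t; split=> //; exact: size_tuple.
Qed.

Lemma weyl_length_sign (K : pzRingType) w : (-1) ^+ weyl_length w = (-1) ^+ odd_perm (blockperm w) :> K.
Proof.
have [s [<- sa <-]] := weyl_length_expr w; rewrite -[in LHS]signr_odd; congr (_ ^+ (nat_of_bool _)).
elim: s sa => [_|x s IH /= /andP[hx hs]]; first by rewrite big_nil blockperm1 odd_perm1.
rewrite big_cons blockpermM odd_permM -IH //; suff -> : odd_perm (blockperm x) = true by [].
case/orP: hx => /existsP[i /existsP[j /andP[/eqP ij /eqP->]]].
  have -> : blockperm (tperm i j, 1%g) = tperm (lshift n i) (lshift n j).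
    apply/permP => k; rewrite -(fintype.splitK k); case: (fintype.split k) => p /=.
      rewrite blockpermL /=; case: (tpermP i j p) => [->|->|/eqP pi /eqP pj]; rewrite ?tpermL ?tpermR //.
      by rewrite tpermD // (inj_eq (@lshift_inj m n)) eq_sym.
    by rewrite blockpermR /= perm1 tpermD // eq_lrshift.
  by rewrite odd_tperm (inj_eq (@lshift_inj m n)) -val_eqE /= ij; lia.
have -> : blockperm (1%g, tperm i j) = tperm (rshift m i) (rshift m j).
  apply/permP => k; rewrite -(fintype.splitK k); case: (fintype.split k) => p /=.
    by rewrite blockpermL /= perm1 tpermD // eq_rlshift.
  rewrite blockpermR /=; case: (tpermP i j p) => [->|->|/eqP pi /eqP pj]; rewrite ?tpermL ?tpermR //.
  by rewrite tpermD // (inj_eq (@rshift_inj m n)) eq_sym.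
by rewrite odd_tperm (inj_eq (@rshift_inj m n)) -val_eqE /= ij; lia.
Qed.

Lemma weyl_sum (K : numFieldType) (g : wt -> K) y :
  \sum_(w : W) (-1) ^+ weyl_length w * g (act (blockperm w) y) = @Alt K N par g y.
Proof.
rewrite /Alt.
have hI u : exists w, Wg par u -> blockperm w = u.
  by have [/Wg_blockperm[w hw]|h] := boolP (Wg par u); [exists w|exists 1%g].
pose wi u := projT1 (cid (hI u)).
have wiK u : Wg par u -> blockperm (wi u) = u := projT2 (cid (hI u)).
rewrite [RHS](reindex_onto blockperm wi) => [|u hu]; last exact: wiK.
apply: eq_big => [w|w _]; last by rewrite weyl_length_sign.
by rewrite blockperm_Wg /=; apply/esym/eqP/blockperm_inj; rewrite wiK // blockperm_Wg.
Qed.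

Lemma weyl_actE (R : realType) (w : W) (mu : 'rV[R[i]]_N) :
  weyl_act w^-1%g mu = \row_k mu 0 (blockperm w k).
Proof.
apply/rowP => k; rewrite /weyl_act !mxE !summxE -(fintype.splitK k); case: (fintype.split k) => x /=.
  rewrite blockpermL (bigD1 (w.1 x)) //= [X in _ + X + _]big1 => [|i ix]; last first.
    rewrite !mxE /= (inj_eq (@lshift_inj m n)) (_ : (x == _) = false) ?mulr0 //.
    by apply: contraNF ix => /eqP->; rewrite permKV.
  rewrite big1 => [|j _]; last by rewrite !mxE /= eq_lrshift mulr0.
  by rewrite !mxE /= permK !eqxx mulr1 !addr0.
rewrite blockpermR big1 => [|j _]; last by rewrite !mxE /= eq_rlshift mulr0.
rewrite (bigD1 (w.2 x)) //= big1 => [|i ix]; last first.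
  rewrite !mxE /= (inj_eq (@rshift_inj m n)) (_ : (x == _) = false) ?mulr0 //.
  by apply: contraNF ix => /eqP->; rewrite permKV.
by rewrite !mxE /= permK !eqxx mulr1 addr0 add0r.
Qed.

Lemma weyl_act_iw (R : realType) (w : W) y : weyl_act w^-1%g (iw R y) = iw R (act (blockperm w) y).
Proof. by rewrite weyl_actE; apply/rowP => k; rewrite !mxE ffunE. Qed.
End WeylGroupEmbedding.

Lemma sgxD (K : numFieldType) x y : sgx K (x + y) = sgx K x * sgx K y.
Proof.
have nat_ x' n : sgx K (x' + n%:Z) = sgx K x' * sgx K n%:Z.
  elim: n => [|n IH]; first by rewrite addr0 /sgx /= mulr1.
  by rewrite -addn1 PoszD addrA !sgxS IH mulrN.
case: (intP y) => [|n|n]; first exact: (nat_ x 0%N); first exact: nat_.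
have sN : sgx K (- n.+1%:Z) = sgx K n.+1%:Z by rewrite /sgx abszN.
by rewrite sN -{2}[x](subrK n.+1%:Z) nat_ -mulrA sgx_sq mulr1.
Qed.

Lemma sgxN (K : numFieldType) x : sgx K (- x) = sgx K x.
Proof. by rewrite /sgx abszN. Qed.

Lemma exprz_sgx (K : numFieldType) (x : int) : (-1) ^ x = sgx K x :> K.
Proof.
case: x => n; first by rewrite -exprnP /sgx signr_odd.
rewrite -[LHS]/(((-1) ^+ n.+1)^-1) /sgx NegzE abszN -[X in X^-1]signr_odd /=.
by case: (odd n); rewrite /= ?expr0 ?invr1 ?expr1 ?invrN1.
Qed.

(** Remove the element with the largest value: its rank is the cardinality, and the other ranks do
    not change. *)
Lemma prod_ranks (I : finType) (x : I -> int) (E : {set I}) : {in E &, injective x} ->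
  (\prod_(k in E) #|[set l in E | (x l <= x k)%R]| = (#|E|)`!)%N.
Proof.
have [c le] := ubnP #|E|; elim: c E le => // c IH E le xi.
have [->|[k0 k0E]] := set_0Vmem E; first by rewrite big_set0 cards0.
pose k1 := [arg max_(k > k0 in E) x k]%O.
have [k1E mx] : k1 \in E /\ forall k, k \in E -> x k <= x k1.
  by rewrite /k1; case: Order.TotalTheory.arg_maxP => // k hk h; split.
rewrite (big_setD1 k1) //= (cardsD1 k1 E) k1E add1n factS; congr (_ * _)%N.
  have -> : [set l in E | x l <= x k1] = E by apply/setP => l; rewrite !inE; case lE : (l \in E) => //=; apply: mx.
  by rewrite [LHS](cardsD1 k1 E) k1E.
have xi' : {in E :\ k1 &, injective x} by move=> k l /setD1P[_ hk] /setD1P[_ hl]; apply: xi.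
rewrite -(IH _ _ xi'); last by rewrite (cardsD1 k1 E) k1E in le.
apply: eq_bigr => k /setD1P[kk1 kE]; apply: eq_card => l; rewrite !inE.
have [->|//] := eqVneq l k1; rewrite k1E /=; apply/negbTE; apply: contra kk1 => h.
by apply/eqP/xi => //; apply/le_anti; rewrite h mx.
Qed.

(** * Atypical components in terms of wedge counts *)

Section Diagram2.
Variables (R : realType) (m n : nat).
Local Notation C := R[i].
Local Notation N := (m + n)%N.
Local Notation wt := (Submission.wt N).
Local Notation par := (@oddpar m n).
Local Notation xc := (xc par).
Local Notation gl := (gl par).
Local Notation atE := (atE par).
Local Notation typ := (typ par).
Local Notation rk := (rk par).
Variables (a : 'I_m -> int) (b : 'I_n -> int).
Hypothesis ainj : injective a.
Hypothesis binj : injective b.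
Local Notation z := (wtab a b).
Hypothesis rz : reg par z.
Local Notation vee := (is_vee a b).
Local Notation wedge := (is_wedge a b).

Lemma xc_l (y : wt) p : xc (lshift n p) y = y (lshift n p).
Proof. by rewrite /Submission.xc par_l expr0 mul1r. Qed.
Lemma xc_r (y : wt) q : xc (rshift m q) y = - y (rshift m q).
Proof. by rewrite /Submission.xc par_r expr1 mulN1r. Qed.
Lemma xcz_l p : xc (lshift n p) z = a p. Proof. by rewrite xc_l wtab_l. Qed.
Lemma xcz_r q : xc (rshift m q) z = b q. Proof. by rewrite xc_r wtab_r opprK. Qed.

Lemma occ_wedge t : [exists k, xc k z == t] = ~~ wedge t.
Proof.
rewrite /is_wedge negb_and !negbK; apply/existsP/orP => [[k]|[] /existsP[p h]].
- rewrite -(fintype.splitK k); case: (fintype.split k) => p /=; rewrite ?xcz_l ?xcz_r => h; [left|right];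
    by apply/existsP; exists p.
- by exists (lshift n p); rewrite xcz_l.
- by exists (rshift m p); rewrite xcz_r.
Qed.

Lemma typ_l p : typ z (lshift n p) = ~~ vee (a p).
Proof.
rewrite /Submission.typ; congr (~~ _); rewrite /is_vee (_ : [exists i, a i == a p] = true) /=; last by apply/existsP; exists p.
apply/existsP/existsP => [[k]|[q h]]; last by exists (rshift m q); rewrite par_l par_r xcz_l xcz_r h.
rewrite -(fintype.splitK k); case: (fintype.split k) => q /=; rewrite par_l ?par_l ?par_r ?xcz_l ?xcz_r //= => h.
by exists q.
Qed.
Lemma atE_l p : atE z (lshift n p) = vee (a p).
Proof. by rewrite /Submission.atE par_l typ_l negbK. Qed.
Lemma atE_r q : atE z (rshift m q) = false.
Proof. by rewrite /Submission.atE par_r. Qed.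

Lemma vee_atE t : vee t -> exists k, atE z k /\ xc k z = t.
Proof.
move=> h; have /andP[/existsP[p /eqP e] _] := h; exists (lshift n p).
by rewrite atE_l xcz_l e.
Qed.
Lemma atE_vee k : atE z k -> vee (xc k z).
Proof. by rewrite -(fintype.splitK k); case: (fintype.split k) => p /=; rewrite ?atE_l ?xcz_l // atE_r. Qed.
Lemma vee_wedge t : vee t -> ~~ wedge t.
Proof. by move=> /vee_atE[k [_ e]]; rewrite -occ_wedge; apply/existsP; exists k; rewrite e. Qed.
Lemma atE_inj k l : atE z k -> atE z l -> xc k z = xc l z -> k = l.
Proof. by move=> /andP[/negbTE pk _] /andP[/negbTE pl _]; apply: rz; rewrite pk pl. Qed.

Lemma gl_wedge t : gl z (t + 1) = gl z t + (nat_of_bool (wedge (t + 1)))%:Z.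
Proof. by rewrite glS // occ_wedge negbK. Qed.

Lemma gl_lt s t : s < t -> wedge t -> gl z s < gl z t.
Proof.
move=> st wt'; have := gl_wedge (t - 1); rewrite subrK wt' => e.
by have := gl_mono (t' := t - 1) rz (t := s); move/(_ ltac:(lia)); rewrite e /=; lia.
Qed.

Lemma gl_eqP s t : s <= t -> (gl z s = gl z t <-> forall x, s < x <= t -> ~~ wedge x).
Proof.
move=> st; split=> [e x /andP[sx xt]|].
  apply/negP => wx; have := gl_lt sx wx; have := gl_mono rz xt; rewrite e; lia.
have [k ->] : exists k : nat, t = s + k%:Z by exists (absz (t - s)); lia.
elim: k => [|k IH] h; first by rewrite addr0.
have e1 : s + k.+1%:Z = s + k%:Z + 1 by lia.
rewrite e1 gl_wedge IH => [|x hx]; last by apply: h; lia.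
by rewrite -e1 (negbTE (h _ _)) /= ?addr0 //; lia.
Qed.

(** The positions reachable from [s] without meeting a wedge, which for a vee [s] is its atypical
    component. *)
Definition comp (s : int) : set int := [set x | forall y, (s <= y <= x) || (x <= y <= s) -> ~~ wedge y].

Lemma comp_block s : vee s -> vee_block a b (comp s).
Proof.
move=> vs; split.
- move=> x y w hx hw /andP[xy yw] t ht; have [ts|st] := leP t s.
    by apply: hx; lia.
  by apply: hw; lia.
- by exists s => // y hy; have -> : y = s by [lia]; apply: vee_wedge.
by move=> t ht; apply: ht; lia.
Qed.

Lemma block_comp s A : vee_block a b A -> A s -> A `<=` comp s.
Proof. by move=> [h1 _ h3] As x Ax y hy; apply: h3; case/orP: hy => h; [apply: (h1 s y x)|apply: (h1 x y s)]. Qed.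

Lemma comp_self s : vee s -> comp s s.
Proof. by move=> vs y hy; have -> : y = s by [lia]; apply: vee_wedge. Qed.

Lemma comp_component s : vee s -> atypical_component a b (comp s).
Proof.
move=> vs; split=> [|T' hT' hs]; first exact: comp_block.
by apply/seteqP; split=> //; apply: block_comp => //; apply: hs; apply: comp_self.
Qed.

Lemma componentE s A : atypical_component a b A -> A s -> vee s -> A = comp s.
Proof. by move=> [hA mx] As vs; apply/esym/mx; [apply: comp_block|apply: block_comp]. Qed.

Lemma comp_gl s t : vee s -> vee t -> (comp s t <-> gl z s = gl z t).
Proof.
move=> vs vt; have [st|ts] := leP s t.
  rewrite gl_eqP //; split=> h x hx; first by apply: h; lia.
  by have [->|xs] := eqVneq x s; [apply: vee_wedge|apply: h; lia].
have ts' := ltW ts; split=> [h|/esym/(gl_eqP ts') h x hx].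
  by apply/esym/(gl_eqP ts') => x hx; apply: h; lia.
by have [->|xs] := eqVneq x t; [apply: vee_wedge|apply: h; lia].
Qed.

Lemma same_componentP s t : vee s -> vee t -> (same_component a b s t <-> gl z s = gl z t).
Proof.
move=> vs vt; rewrite -comp_gl //; split=> [[A [hA As At]]|h].
  by rewrite -(componentE hA As vs).
by exists (comp s); split=> //; [apply: comp_component|apply: comp_self].
Qed.

Lemma max_atypicalP p : vee (a p) -> exists p', [/\ vee (a p'), gl z (a p') = gl z (a p),
  max_atypical a b (a p) = a p' & forall r, vee (a r) -> gl z (a r) = gl z (a p) -> a r <= a p'].
Proof.
move=> vp; pose M := max_atypical a b (a p); rewrite -/M.
have [p' [h1 h2 h3]] : exists p', [/\ vee (a p'), gl z (a p') = gl z (a p) & M = a p'].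
  rewrite /M /max_atypical; elim/big_rec: _ => [|i x /andP[vi /asboolP/same_componentP si] [p' [h1 h2 ->]]]; first by exists p.
  have [le|gt] := leP (a i) (a p'); first by exists p'.
  by exists i; split=> //; rewrite -si.
exists p'; split=> // r vr er; rewrite -h3; apply: (le_bigmax_cond (a p)).
by rewrite vr; apply/asboolP/same_componentP.
Qed.

Section Components.
Variable T : seq (set int).
Hypothesis hT : components_enumeration a b T.

Lemma comp_index k : atE z k -> exists2 i, (i < size T)%N & nth set0 T i = comp (xc k z).
Proof. by move=> /atE_vee vk; apply/(proj1 hT); apply: comp_component. Qed.

Lemma nth_component i : (i < size T)%N -> atypical_component a b (nth set0 T i).
Proof. by move=> hi; apply/(proj1 hT); exists i. Qed.

Lemma nth_comp i k : (i < size T)%N -> atE z k -> nth set0 T i (xc k z) -> nth set0 T i = comp (xc k z).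
Proof. by move=> hi hk h; apply: componentE => //; [apply: nth_component|apply: atE_vee]. Qed.

Lemma index_uniq i j x : (i < size T)%N -> (j < size T)%N -> nth set0 T i x -> nth set0 T j x -> i = j.
Proof.
move=> hi hj h1 h2; have [lt|lt|//] := ltngtP i j.
  by have := proj2 hT i j lt hj x x h1 h2; rewrite ltxx.
by have := proj2 hT j i lt hi x x h2 h1; rewrite ltxx.
Qed.

Definition inA (A : set int) : {set 'I_N} := [set k | atE z k && `[< A (xc k z) >]].

Lemma num_veesE A : num_vees a b A = #|inA A|.
Proof.
rewrite /num_vees; pose s := [seq xc k z | k <- enum (inA A)].
have -> : [set t | A t /\ vee t] = [set` seq_fset tt s].
  have mE t : (t \in seq_fset tt s) = (t \in s) := seq_fsetE tt s t.
  apply/seteqP; split=> [t [At vt]|t ht].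
    change (is_true (t \in seq_fset tt s)); rewrite mE; have [k [hk e]] := vee_atE vt; apply/mapP; exists k; rewrite ?e // mem_enum inE hk e.
    exact/asboolP.
  have {ht} : t \in seq_fset tt s := ht; rewrite mE => /mapP[k]; rewrite mem_enum inE => /andP[hk /asboolP hA] ->.
  by split=> //; apply: atE_vee.
rewrite set_fsetK size_seq_fset undup_id ?size_map -?cardE //.
rewrite map_inj_in_uniq ?enum_uniq // => k l; rewrite !mem_enum !inE => /andP[hk _] /andP[hl _].
exact: atE_inj.
Qed.

Lemma rk_inA i k : (i < size T)%N -> k \in inA (nth set0 T i) ->
  rk z k = #|[set l in inA (nth set0 T i) | xc l z <= xc k z]|.
Proof.
move=> hi; rewrite inE => /andP[hk /asboolP hA]; rewrite /Submission.rk; apply: eq_card => l; rewrite !inE.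
rewrite (nth_comp hi hk hA); case hl : (atE z l) => //=; congr andb.
by apply/eqP/asboolP => [e|/comp_gl->//]; [apply/comp_gl => //; apply: atE_vee|apply: atE_vee|apply: atE_vee].
Qed.

(** Each vee lies in exactly one listed component, and inside a component the ranks multiply to the
    factorial by [prod_ranks]. *)
Lemma t_factorialE : ((t_factorial a b T)%:R = tz C par z :> C).
Proof.
rewrite /t_factorial /tz -natr_prod (big_nth set0) big_mkord; congr (_%:R).
transitivity (\prod_(k | atE z k) \prod_(i < size T | k \in inA (nth set0 T i)) rk z k)%N; last first.
  apply: eq_bigr => k hk; have [i hi e] := comp_index hk.
  have hin : k \in inA (nth set0 T i) by rewrite inE hk e; apply/asboolP/comp_self/atE_vee.
  rewrite (big_pred1 (Ordinal hi)) // => j; apply/idP/eqP => [|-> //].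
  move: hin; rewrite !inE hk /= => /asboolP h1 /asboolP h2; apply/val_inj; exact: index_uniq h2 h1.
rewrite (exchange_big_dep xpredT) //=; apply: eq_bigr => i _.
rewrite num_veesE -(@prod_ranks _ (fun k => xc k z)).
  apply: eq_big => [k|k hk]; last by rewrite (rk_inA (ltn_ord i)).
  by rewrite !inE; case: (atE z k).
by move=> k l; rewrite !inE => /andP[hk _] /andP[hl _]; apply: atE_inj.
Qed.

(** On these wedges [gl z] is injective, with values above [gl z s] and at most [gl z t]. *)
Lemma wedges_bound A B s t : A s -> (exists2 s', B s' & s' <= t) -> gl z s <= gl z t ->
  (num_wedges_between a b A B)%:Z <= gl z t - gl z s.
Proof.
move=> As [s' Bs' s't] gst; rewrite /num_wedges_between; set D := [set _ | _].
(* [fset_set] sends an infinite set to the empty one, which makes that case trivial. *)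
have [fin|inf] := pselect (finite_set D); last first.
  by rewrite (_ : #|` _| = 0%N) ?subr_ge0 // /fset_set; case: pselect.
pose F := fset_set D; have hF x : x \in F -> [/\ wedge x, s < x & x < t].
  rewrite in_fset_set // => /set_mem[h1 h2 h3]; split=> //; first exact: h2.
  exact: lt_le_trans (h3 _ Bs') s't.
pose f (x : int) := absz (gl z x - gl z s - 1)%R.
have fi : {in F &, injective f}.
  move=> x y /hF[wx sx xt] /hF[wy sy yt]; have := gl_lt sx wx; have := gl_lt sy wy; rewrite /f.
  by have [lt|lt|//] := ltgtP x y; [have := gl_lt lt wy|have := gl_lt lt wx]; lia.
have us : uniq [seq f x | x <- F] by rewrite map_inj_in_uniq ?fset_uniq.
have sub : {subset [seq f x | x <- F] <= iota 0 (absz (gl z t - gl z s)%R)}.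
  move=> c /mapP[x /hF[wx sx xt] ->]; rewrite mem_iota /f; have := gl_lt sx wx.
  have := gl_mono rz (ltW xt); lia.
have h := uniq_leq_size us sub; rewrite size_map size_iota in h.
have {h} : (#|` fset_set D| <= absz (gl z t - gl z s)%R)%N := h.
by move: gst; move: #|` fset_set D| (gl z t) (gl z s) => c g1 g2; clear; lia.
Qed.

(** The hypothesis compares neighbouring components; for a component further right, the increase of
    [gl] includes the wedges before the next component. *)
Lemma pdE : piecewise_disconnected a b T -> pd par z.
Proof.
move=> hpd k u hk hu lt; have [i hi ei] := comp_index hk; have [j hj ej] := comp_index hu.
have ki : nth set0 T i (xc k z) by rewrite ei; apply/comp_self/atE_vee.
have uj : nth set0 T j (xc u z) by rewrite ej; apply/comp_self/atE_vee.
have vk := atE_vee hk; have vu := atE_vee hu.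
have ij : (i < j)%N.
  have [//|lt'|e] := ltngtP i j.
    have := proj2 hT j i lt' hi _ _ uj ki => /ltW/(gl_mono rz); lia.
  by move: uj; rewrite -e ei => /comp_gl e'; move: lt; rewrite e' // ltxx.
have hi1 : (i.+1 < size T)%N by apply: leq_ltn_trans hj.
have rle : (rk z k <= num_vees a b (nth set0 T i))%N.
  have hin : k \in inA (nth set0 T i) by rewrite inE hk; apply/asboolP.
  rewrite (rk_inA hi hin) num_veesE; apply: subset_leq_card; apply/fintype.subsetP => l.
  by rewrite inE => /andP[].
have hb := hpd i hi1.
have ex : exists2 s', nth set0 T i.+1 s' & s' <= xc u z.
  have [e|ne] := eqVneq i.+1 j; first by exists (xc u z); rewrite ?e.
  have [[_ [s' hs' _] _] _] := nth_component hi1; exists s' => //; apply: ltW.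
  by apply: (proj2 hT i.+1 j _ hj) => //; rewrite ltn_neqAle ne.
have := wedges_bound ki ex (ltW lt); lia.
Qed.
End Components.
End Diagram2.

(** * Matching the right hand side of the formula with the alternating template *)

Section Final.
Variables (R : realType) (m n : nat).
Local Notation C := R[i].
Local Notation N := (m + n)%N.
Local Notation wt := (Submission.wt N).
Local Notation par := (@oddpar m n).
Local Notation xc := (xc par).
Local Notation gl := (gl par).
Local Notation iw := (@iw R m n).
Variables (lam : 'rV[C]_N) (a : 'I_m -> int) (b : 'I_n -> int).
Hypothesis hlam : dominant_with_entries lam a b.
Local Notation z := (wtab a b).
Local Notation S := (isotropic_set lam).
Local Notation mx := (max_atypical a b).

Lemma lamE : lam + rho R m n = iw z.
Proof. by case: hlam => -> _ _; rewrite weight_ofE. Qed.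

Lemma a_inj : injective a.
Proof.
case: hlam => _ ha _ i k e; have [lt|lt|/val_inj//] := ltngtP i k.
  by have := ha _ _ lt; rewrite e ltxx.
by have := ha _ _ lt; rewrite e ltxx.
Qed.
Lemma b_inj : injective b.
Proof.
case: hlam => _ _ hb i k e; have [lt|lt|/val_inj//] := ltngtP i k.
  by have := hb _ _ lt; rewrite e ltxx.
by have := hb _ _ lt; rewrite e ltxx.
Qed.
Lemma z_reg : reg par z. Proof. exact: dom_reg (z_dom hlam). Qed.

Lemma mem_S p q : ((p, q) \in S) = (a p == b q).
Proof.
rewrite inE lamE /Defs.form odd_rootE (bigD1 p) //= big1 => [|i /negbTE ip]; last first.
  by rewrite !mxE wsubE !epsE eq_lrshift (inj_eq (@lshift_inj m n)) ip subr0 mulr0.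
rewrite (bigD1 q) //= big1 => [|j /negbTE jq]; last first.
  by rewrite !mxE wsubE !epsE eq_rlshift (inj_eq (@rshift_inj m n)) jq subr0 mulr0.
rewrite !mxE !wsubE !epsE !eqxx eq_lrshift eq_rlshift wtab_l wtab_r subr0 sub0r !addr0 mulr1 mulrN1z mulrN1 opprK.
by rewrite rmorphN subr_eq0 eqr_int.
Qed.

Lemma S_vee p q : (p, q) \in S -> is_vee a b (a p).
Proof.
rewrite mem_S => /eqP e; apply/andP; split; apply/existsP; first by exists p.
by exists q; rewrite e.
Qed.

Definition zup : wt := wtab (fun p => if [exists q, (p, q) \in S] then mx (a p) else a p)
  (fun q => if [exists p, (p, q) \in S] then mx (b q) else b q).
Lemma uparrowE : uparrow lam a b = iw zup. Proof. exact: weight_ofE. Qed.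

Lemma zup_l p q : (p, q) \in S -> zup (lshift n p) = mx (a p).
Proof. by move=> h; rewrite wtab_l; case: ifP => // /existsP[]; exists q. Qed.
Lemma zup_r p q : (p, q) \in S -> zup (rshift m q) = - mx (a p).
Proof.
move=> h; rewrite wtab_r; case: ifP => [_|/existsP[]]; last by exists p.
by move: h; rewrite mem_S => /eqP->.
Qed.

Lemma typ_zup k : typ par z k -> zup k = z k.
Proof.
rewrite -(fintype.splitK k); case: (fintype.split k) => p /= tk; rewrite ?wtab_l ?wtab_r; case: ifP => // /existsP[q].
  by move=> /S_vee vp; move: tk; rewrite typ_l vp.
rewrite mem_S => /eqP e; have := @typP _ par z (rshift m p) (lshift n q) tk.
by rewrite xcz_l xcz_r e par_l par_r => /(_ erefl).
Qed.

Definition Spairs : seq ('I_N * 'I_N) := [seq (lshift n p.1, rshift m p.2) | p <- enum S].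

Lemma pts_typ k : (k \in pts Spairs) = ~~ typ par z k.
Proof.
rewrite /pts /Spairs -!map_comp mem_cat; apply/orP/idP.
  case=> /mapP[[p q]]; rewrite mem_enum => h -> /=; first by rewrite typ_l negbK; apply: S_vee h.
  by apply: (@ntypI _ _ _ _ (lshift n p)); rewrite ?par_l ?par_r // xcz_l xcz_r; move: h; rewrite mem_S => /eqP.
move=> nt; have [l [pl xl]] := ntypP nt; move: pl xl; rewrite -(fintype.splitK k) -(fintype.splitK l).
case: (fintype.split k) => p; case: (fintype.split l) => q /=; rewrite ?par_l ?par_r ?xcz_l ?xcz_r // => _ e.
  by left; apply/mapP; exists (p, q); rewrite // mem_enum mem_S e.
by right; apply/mapP; exists (q, p); rewrite // mem_enum mem_S e.
Qed.

Lemma pts_uniq : uniq (pts Spairs).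
Proof.
rewrite /pts /Spairs -!map_comp cat_uniq; apply/and3P; split.
- rewrite map_inj_in_uniq ?enum_uniq // => [[p q] [p' q']]; rewrite !mem_enum !mem_S /= => /eqP e /eqP e' /lshift_inj h.
  by move: e e'; rewrite -h => -> /b_inj ->.
- by apply/hasPn => k /mapP[p _ ->] /=; apply/negP => /mapP[q _ /eqP] /=; rewrite eq_rlshift.
rewrite map_inj_in_uniq ?enum_uniq // => [[p q] [p' q']]; rewrite !mem_enum !mem_S /= => /eqP e /eqP e' /rshift_inj h.
by move: e; rewrite h -e' => /a_inj ->.
Qed.

Definition sgn_up : C := \prod_(p <- enum S) sgx C (mx (a p.1) - a p.1).

(** The coefficients in [S_norm] come from a choice with a default value. They exist, as [k0] shows,
    and on [S] they are determined because the epsilon-coordinate of a root of [S] occurs in no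
    other root of [S]. *)
Lemma S_normE : (-1) ^ S_norm S (uparrow lam a b - (lam + rho R m n)) = sgn_up :> C.
Proof.
rewrite uparrowE lamE -iwB /S_norm; set P := [set k | _].
have cf (k : 'I_m * 'I_n -> int) p : p \in S ->
    (\sum_(q in S) (k q)%:~R *: odd_root R q) 0 (lshift n p.1) = (k p)%:~R.
  move=> pS; rewrite summxE (bigD1 p) //= big1 ?addr0 => [|q /andP[qS qp]].
    by rewrite odd_rootE !mxE wsubE !epsE eqxx eq_lrshift subr0 mulr1.
  rewrite odd_rootE !mxE wsubE !epsE eq_lrshift (inj_eq (@lshift_inj m n)) subr0 (_ : (p.1 == q.1) = false) ?mulr0 //.
  apply: contraNF qp => /eqP e; case: p q pS qS e => [p p'] [q q'] /=; rewrite !mem_S => /eqP h1 /eqP h2 e.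
  by move: h1; rewrite e h2 => /b_inj ->.
have Pex : exists k, P k.
  pose k0 := [ffun q : 'I_m * 'I_n => mx (a q.1) - a q.1].
  have k0E q : k0 q = mx (a q.1) - a q.1 by rewrite ffunE.
  exists k0; rewrite /P /=; apply/rowP => k; rewrite mxE.
  have [tk|nt] := boolP (typ par z k).
    rewrite wsubE typ_zup // subrr summxE big1 // => [[p q]] h; rewrite odd_rootE !mxE wsubE !epsE.
    have ki : (k == lshift n p) = false by apply/eqP => e; move: tk; rewrite e typ_l (S_vee h).
    have kj : (k == rshift m q) = false.
      apply/eqP => e; have : k \in pts Spairs; last by rewrite pts_typ tk.
      by rewrite e mem_cat; apply/orP; right; rewrite -map_comp; apply/mapP; exists (p, q); rewrite ?mem_enum.
    by rewrite ki kj subrr mulr0.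
  have : k \in pts Spairs by rewrite pts_typ.
  rewrite mem_cat -!map_comp => /orP[] /mapP[[p q]]; rewrite mem_enum => h -> /=.
    by rewrite (cf k0 (p, q) h) k0E /= wsubE (zup_l h) wtab_l.
  rewrite summxE (bigD1 (p, q)) //= big1 ?addr0 => [|[p' q'] /andP[h' ne]].
    rewrite wsubE (zup_r h) wtab_r k0E odd_rootE !mxE wsubE !epsE eqxx eq_rlshift sub0r /= mulrN1z mulrN1.
    by rewrite -rmorphN; congr (_%:~R); move: h; rewrite mem_S => /eqP ->; clear; lia.
  rewrite odd_rootE !mxE wsubE !epsE eq_rlshift (inj_eq (@rshift_inj m n)) sub0r (_ : (q == q') = false) ?mulr0 ?oppr0 ?mulr0 //.
  apply: contraNF ne => /eqP e; move: h h'; rewrite !mem_S e => /eqP <- /eqP/a_inj->.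
  by rewrite eqxx.
have hk := xgetPex [ffun=> 0] Pex; move: (xget _ _) hk => k hk.
rewrite exprz_sgx /sgn_up big_enum /=.
have -> : \sum_(p in S) k p = \sum_(p in S) (mx (a p.1) - a p.1).
  apply: eq_bigr => [[p q]] h; have := cf k (p, q) h; rewrite -hk mxE wsubE /= (zup_l h) wtab_l.
  by move/intr_inj.
by elim/big_rec2: _ => [|p x y _ <-]; [rewrite /sgx|rewrite sgxD].
Qed.

(** The expansion starts at the last vee of a component, whereas the template is cut at the
    following wedge. At a regular weight agreeing with [z] on typical entries no pair sits strictly
    between them, since those positions are taken by typical entries. *)
Lemma template_eq u : reg par u ->
  sgn_up * odd_coef R Spairs (u - zup) = sgz C par z * PsiZ C par z u.
Proof.
move=> ru; rewrite /odd_coef.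
have [ht|nt] := pselect (forall k, typ par z k -> xc k u = xc k z); last first.
  have [k [tk xk]] : exists k, typ par z k /\ xc k u != xc k z.
    apply: contrapT => h; apply: nt => k tk; apply/eqP/negPn/negP => hk; apply: h; by exists k.
  rewrite (bigD1 k) ?pts_typ ?negbK //= (_ : ((u - zup) k == 0) = false); last first.
    rewrite wsubE (typ_zup tk) subr_eq0; apply: contraNF xk => /eqP e; by rewrite /Submission.xc e.
  rewrite mul0r mul0r mulr0 /PsiZ /Psi (bigD1 k) //= /PsiF ppi_eq tk (negbTE xk).
  by rewrite mul0r mulr0.
have -> : \prod_(k | k \notin pts Spairs) ((u - zup) k == 0)%:R = 1 :> C.
  rewrite big1 // => k; rewrite pts_typ negbK => tk; rewrite wsubE (typ_zup tk).
  have := ht k tk; rewrite /Submission.xc => /(mulfI _) ->; rewrite ?subrr ?eqxx //; by rewrite signr_eq0.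
rewrite mul1r /PsiZ /Psi (bigID (fun k => k \in pts Spairs)) /=.
rewrite [X in _ = _ * (_ * X)]big1 ?mulr1 => [|k]; last first.
  by rewrite pts_typ negbK => tk; rewrite /PsiF ppi_eq tk (ht k tk) eqxx.
rewrite -(big_uniq _ pts_uniq) /pts big_cat /= /Spairs !big_map.
rewrite [X in _ = _ * (_ * X)]big1_seq ?mulr1 => [|[p q]]; last first.
  rewrite mem_enum => /andP[_ h]; rewrite /PsiF par_r ppi_eq.
  have : rshift m q \in pts Spairs by rewrite mem_cat -!map_comp; apply/orP; right; apply/mapP; exists (p, q); rewrite ?mem_enum.
  by rewrite pts_typ => /negbTE->.
have -> : sgz C par z = \prod_(p <- enum S) sgx C (a p.1).
  rewrite /sgz (eq_bigl (fun k => k \in [seq lshift n p.1 | p <- enum S])) => [|k].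
    have us : uniq [seq lshift n p.1 | p <- enum S].
      by have := pts_uniq; rewrite /pts cat_uniq -!map_comp => /and3P[].
    rewrite -(big_uniq _ us) big_map; apply: eq_bigr => p _; by rewrite xcz_l.
  have := pts_typ k; rewrite /pts -!map_comp mem_cat /Submission.atE -(fintype.splitK k).
  case: (fintype.split k) => p /= <-; rewrite ?par_l ?par_r /=.
    rewrite [X in _ || X](_ : _ = false) ?orbF //; apply/negbTE/negP => /mapP[q _ /eqP] /=; by rewrite eq_lrshift.
  by apply/esym/negbTE/negP => /mapP[q _ /eqP]; rewrite eq_rlshift.
rewrite /sgn_up -!big_split; apply: eq_big_seq => [[p q]] /=; rewrite mem_enum => h.
have vp := S_vee h; have tl : typ par z (lshift n p) = false by rewrite typ_l vp.
have ab : a p = b q by move: h; rewrite mem_S => /eqP.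
have pe : ppi par z (lshift n p) = rshift m q.
  by apply: (ppi_uniq z_reg); rewrite ?par_l ?par_r // xcz_l xcz_r ab.
have [p' [vp' gp' mp' hmax]] := max_atypicalP z_reg vp.
rewrite /PsiF ppi_eq tl par_l pe /thz xcz_l !xc_l xc_r /pair_coef !wsubE (zup_l h) (zup_r h) mp'.
set t := u (lshift n p); set t' := u (rshift m q).
have -> : (t - a p' <= 0) && (t' - - a p' == - (t - a p')) = (t == - t') && (gl z t <= gl z (a p)).
  have -> : (t' - - a p' == - (t - a p')) = (t == - t') by apply/eqP/eqP; lia.
  rewrite andbC; case: eqP => //= e; rewrite subr_le0 -gp'; apply/idP/idP; first exact: gl_mono z_reg.
  move=> le; rewrite leNgt; apply/negP => lt.
  have ge : gl z t = gl z (a p') by apply/eqP; rewrite eq_le le gl_mono // ?ltW //; apply: z_reg.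
  have : ~~ is_wedge a b t by apply: (proj1 (gl_eqP z_reg (ltW lt)) (esym ge)); rewrite lt lexx.
  rewrite -occ_wedge => /existsP[k /eqP xk]; have [tk|ntk] := boolP (typ par z k).
    have xu := ht k tk; rewrite xk in xu; case pk : (par k).
      have kq : k = rshift m q by apply: ru; rewrite ?par_r // xu xc_r -/t' -e.
      move: tk; rewrite kq => tk'; have := @typP _ par z (rshift m q) (lshift n p) tk'.
      by rewrite xcz_l xcz_r ab par_l par_r => /(_ erefl).
    have kp : k = lshift n p by apply: ru; rewrite ?par_l // xu xc_l.
    by rewrite kp tl in tk.
  have [r [hr xr]] : exists r, is_vee a b (a r) /\ a r = t.
    have [l [pl xl]] := ntypP ntk; move: ntk pl xl xk; rewrite -(fintype.splitK k) -(fintype.splitK l).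
    case: (fintype.split k) => c; case: (fintype.split l) => d /=; rewrite ?par_l ?par_r ?xcz_l ?xcz_r // => nt _ e1 e2.
      by exists c; split=> //; move: nt; rewrite typ_l negbK.
    exists d; rewrite e1; split=> //; apply/andP; split; apply/existsP; [by exists d; rewrite e1|by exists c].
  by have := hmax r hr; rewrite xr ge gp' => /(_ erefl); rewrite leNgt lt.
rewrite mulrCA [RHS]mulrCA; congr (_ * _); rewrite -{2}[t](subrK (a p')) sgxD.
by rewrite !sgxD !sgxN; ring.
Qed.

End Final.

Lemma Alt_scale (K : numFieldType) N (par : 'I_N -> bool) (c : K) f y :
  @Alt K N par (fun u => c * f u) y = c * @Alt K N par f y.
Proof. by rewrite /Alt mulr_sumr; apply: eq_bigr => w _; rewrite mulrCA. Qed.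

Theorem theorem30 (R : realType) (m n : nat)
    (lam : 'rV[R[i]]_(m + n)) (a : 'I_m -> int) (b : 'I_n -> int)
    (hlam : dominant_with_entries lam a b)
    (T : seq (set int)) (hT : components_enumeration a b T)
    (hpd : piecewise_disconnected a b T)
    (V : lmodType R[i]) (Vp : bool -> set V) (act : 'M[R[i]]_(m + n) -> V -> V)
    (hV : is_L Vp act lam) :
  forall mu : 'rV[R[i]]_(m + n),
    conv (conv (fexp (rho R m n)) (superdenominator R m n)) (character act) mu
    = (-1) ^ S_norm (isotropic_set lam) (uparrow lam a b - (lam + rho R m n))
      / (t_factorial a b T)%:R
      * \sum_(w : 'S_m * 'S_n)
          (-1) ^+ weyl_length w
          * weyl_act_series w
              (conv (fexp (uparrow lam a b))
                 (\big[@conv R m n/fexp 0]_(p in isotropic_set lam)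
                    inv_one_plus (odd_root R p))) mu.
Proof.
move=> mu; have [f [f1 f2 f3 f4 [s f5]]] := simple_module_data hlam hV.
have rz := z_reg hlam.
have pz : pd (@oddpar m n) (wtab a b).
  apply: pdE hpd; by [exact: a_inj hlam|exact: b_inj hlam|exact: rz|exact: hT].
have tE : ((t_factorial a b T)%:R = tz R[i] (@oddpar m n) (wtab a b) :> R[i]).
  apply: t_factorialE; by [exact: a_inj hlam|exact: b_inj hlam|exact: rz|exact: hT].
have hX y : opR R[i] (@oddpar m n) f y = X R[i] (@oddpar m n) (wtab a b) y.
  by apply: (@hwd_X R[i] (m + n) (@oddpar m n) m).
have [L1 L2] := lhs_bridge f3 f4 f5.
have hl p : p \in Spairs lam -> (p.1 < p.2)%N && (oddpar p.1 != oddpar p.2).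
  by move=> /mapP[q _ ->]; rewrite par_l par_r /= ltn_addr.
have -> : \big[@conv R m n/fexp 0]_(p in isotropic_set lam) inv_one_plus (odd_root R p) = @odd_prod R m n (Spairs lam).
  have e : enum (isotropic_set lam) = [seq p <- index_enum _ | p \in isotropic_set lam].
    by rewrite [index_enum _]unlock.
  by rewrite /odd_prod /Spairs big_map e big_filter; apply: eq_bigr => p _; rewrite odd_rootE.
have [Y1 Y2] := @represents_odd R m n _ hl.
have YE x : ratr (@odd_prod R m n (Spairs lam) (iw R x)) = odd_coef R (Spairs lam) x :> R[i].
  by rewrite Y1 odd_prodE //; apply: pts_uniq hlam.
have wE w nu : weyl_act_series w (conv (fexp (uparrow lam a b)) (@odd_prod R m n (Spairs lam))) nu =
    @odd_prod R m n (Spairs lam) (weyl_act w^-1%g nu - iw R (zup lam a b)).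
  by rewrite /weyl_act_series conv_fexp uparrowE.
(* Off the image of the integral weights both sides vanish; on it, coefficients are compared after
   the injective map [ratr]. *)
have [[y ->]|hmu] := pselect (exists y, mu = iw R y); last first.
  rewrite L2 => [|y e]; last by apply: hmu; exists y.
  rewrite big1 ?mulr0 // => w _; rewrite wE.
  have [->|/Y2[x e]] := eqVneq (@odd_prod R m n (Spairs lam) (weyl_act w^-1%g mu - iw R (zup lam a b))) 0.
    by rewrite mulr0.
  case: hmu; exists (Submission.act (blockperm w)^-1%g (x + zup lam a b)); apply/rowP => k; rewrite !mxE actE.
  have /rowP/(_ ((blockperm w)^-1%g k)) : weyl_act w^-1%g mu = iw R (x + zup lam a b) by rewrite iwD -e subrK.
  by rewrite weyl_actE !mxE permKV.
have inj : injective (@ratr R[i]) by apply: fmorph_inj.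
apply: inj; rewrite L1 hX rmorphM /= rmorph_sum /=.
have -> : \sum_w ratr ((-1) ^+ weyl_length w *
      weyl_act_series w (conv (fexp (uparrow lam a b)) (@odd_prod R m n (Spairs lam))) (iw R y)) =
    @Alt R[i] (m + n) (@oddpar m n) (fun u => odd_coef R (Spairs lam) (u - zup lam a b)) y.
  rewrite -weyl_sum; apply: eq_bigr => w _.
  by rewrite rmorphM rmorphXn rmorphN1 /= wE weyl_act_iw -iwB YE.
have -> : ratr ((-1) ^ S_norm (isotropic_set lam) (uparrow lam a b - (lam + rho R m n)) / (t_factorial a b T)%:R) =
    sgn_up lam a b / tz R[i] (@oddpar m n) (wtab a b) :> R[i].
  rewrite fmorph_div /= ratr_nat tE; congr (_ / _); rewrite -(S_normE hlam) !exprz_sgx /sgx rmorphXn.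
  by rewrite rmorphN1.
rewrite /X -[LHS]mulrAC -[RHS]mulrAC; congr (_ / _).
rewrite -!Alt_scale; apply: Alt_reg => u ru; apply/esym; exact: template_eq.
Qed.
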